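(* Let $\alpha>-1$ and $p\geqslant 1$. Suppose $\psi\in (H^\infty)^{-1}$ and $\varphi$ is an elliptic automorphism of $D$ of order $\infty$. Then, for the weighted composition operator $C_{\psi,\varphi}$ on $A_\alpha^p$, one has $$\sigma(C_{\psi,\varphi})=\sigma_e(C_{\psi,\varphi})=\{\lambda\in\mathbb{C} : \rho_{\frac{1}{\psi},\varphi}^{-1}\leqslant|\lambda|\leqslant \rho_{\psi,\varphi}\}.$$
   Context: $D$ is the open unit disk in $\mathbb{C}$; $H^\infty$ is the Banach algebra of bounded analytic functions on $D$ with the supremum norm $\|\cdot\|_\infty$; $(H^\infty)^{-1}=\{f: f\in H^\infty,\ 1/f\in H^\infty\}$. For $\alpha>-1$, $p\geqslant 1$, the weighted Bergman space $A_\alpha^p$ is the Banach space of analytic functions $f$ on $D$ with $\|f\|^p=\int_D|f|^p\,dA_\alpha<\infty$, where $dA_\alpha(z)=\frac{1+\alpha}{\pi}(1-|z|^2)^\alpha dA(z)$ and $dA$ is area Lebesgue measure. An elliptic automorphism is a biholomorphic map $\varphi:D\to D$ with a unique fixed point in $D$. Write $\varphi_n$ for the $n$-th iterate of $\varphi$ ($\varphi_0$ the identity). The order of $\varphi$ is the smallest positive integer $n$ such that $\varphi_n$ is the identity on $D$; if there is no such $n$, $\varphi$ is of order $\infty$. For $\psi\in H^\infty$, the weighted composition operator is $C_{\psi,\varphi}f=\psi\cdot (f\circ\varphi)$; it is bounded on $A_\alpha^p$. $\sigma(C_{\psi,\varphi})$ is its spectrum on $A_\alpha^p$ and $\sigma_e(C_{\psi,\varphi})=\{\lambda\in\mathbb{C}: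 C_{\psi,\varphi}-\lambda\text{ is not Fredholm on }A_\alpha^p\}$ its essential spectrum. For $\psi\in H^\infty$ set $\psi_{(n)}=\prod_{j=0}^{n-1}\psi\circ\varphi_j$, $\psi_{(0)}=1$, and $\rho_{\psi,\varphi}=\lim_{n\to\infty}\|\psi_{(n)}\|_\infty^{1/n}$. The number $\rho_{1/\psi,\varphi}$ is defined by the same formula with $1/\psi$ in place of $\psi$, and $\rho_{1/\psi,\varphi}^{-1}$ is its reciprocal. *)

(* Defs.v *)
From HB Require Import structures.
From mathcomp Require Import all_boot all_order all_algebra.
From mathcomp Require Import all_classical all_reals all_analysis.
From mathcomp.real_closed Require Import complex.
From mathcomp Require Import measurable_realfun lra.

Set Implicit Arguments.
Unset Strict Implicit.
Unset Printing Implicit Defensive.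
Import Order.TTheory GRing.Theory Num.Theory.
Import ComplexField.Normc.
Import numFieldNormedType.Exports.

Local Open Scope classical_set_scope.
Local Open Scope ring_scope.
Local Open Scope complex_scope.

(* The library equips [K^o] with its normed-module structure over [K]; the
   concrete field [R[i]] has to be given it explicitly.  The norm of
   [normedModType R[i]] is the usual modulus, seen as an element of [R[i]];
   [normc] is the same modulus as an element of [R]. *)
HB.instance Definition _ (R : rcfType) := PseudoPointedMetric.copy R[i] R[i]^o.
HB.instance Definition _ (R : rcfType) := Vector.copy R[i] R[i]^o.
HB.instance Definition _ (R : rcfType) := NormedModule.copy R[i] R[i]^o.

Section operators.
Context {K : numFieldType} {V : normedModType K}.
Implicit Types (T S : V -> V) (E : set V).

Definition bounded_operator T := linear T /\ continuous T.

Definition invertible_operator T :=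
  bounded_operator T /\
  exists S, [/\ bounded_operator S, cancel T S & cancel S T].

Definition spectrum T : set K :=
  [set l | ~ invertible_operator (fun x => T x - l *: x)].

Definition lspan (s : seq V) : set V :=
  [set x | exists c : nat -> K, x = \sum_(i < size s) c i *: s`_i].

Definition finite_dim E := exists s, E `<=` lspan s.

Definition finite_codim E :=
  exists s, forall x, exists2 y, E y & lspan s (x - y).

Definition fredholm T :=
  [/\ bounded_operator T, finite_dim [set x | T x = 0],
      closed (range T) & finite_codim (range T)].

Definition essential_spectrum T : set K :=
  [set l | ~ fredholm (fun x => T x - l *: x)].

End operators.

Section disk.
Context {R : realType}.
Implicit Types (f g psi phi : R[i] -> R[i]) (D : set R[i]).

Definition disk : set R[i] := [set z | normc z < 1].

Definition holomorphic_on D f := forall z, D z -> derivable f z 1.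

Definition Hinfty f :=
  holomorphic_on disk f /\ exists M : R, forall z, disk z -> normc (f z) <= M.

(* The nonvanishing condition is needed because [0^-1 = 0]. *)
Definition Hinfty_unit f :=
  [/\ Hinfty f, forall z, disk z -> f z != 0 & Hinfty (fun z => (f z)^-1)].

Definition supnorm f : R := sup [set normc (f z) | z in disk].

Definition disk_automorphism phi :=
  [/\ holomorphic_on disk phi, {homo phi : z / disk z} &
    exists phi', [/\ holomorphic_on disk phi', {homo phi' : z / disk z},
      forall z, disk z -> phi' (phi z) = z &
      forall z, disk z -> phi (phi' z) = z]].

Definition elliptic_automorphism phi :=
  disk_automorphism phi /\ exists! z, disk z /\ phi z = z.

Definition infinite_order phi :=
  forall n, (0 < n)%N -> ~ (forall z, disk z -> iter n phi z = z).

Definition iter_weight psi phi (n : nat) : R[i] -> R[i] :=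
  fun z => \prod_(j < n) psi (iter j phi z).

(* The term of index [0] is [1], since [0^-1 = 0]. *)
Definition rho psi phi : R :=
  limn (fun n => supnorm (iter_weight psi phi n) `^ n%:R^-1).

Definition cplx (w : R * R) : R[i] := w.1 +i* w.2.

Definition bergman_density (alpha : R) (w : R * R) : R :=
  (1 + alpha) / pi * (1 - (w.1 ^+ 2 + w.2 ^+ 2)) `^ alpha.

Definition area : {measure set (measurableTypeR R * measurableTypeR R) -> \bar R} :=
  (lebesgue_measure \x lebesgue_measure)%E.

End disk.

(* Locked because unification otherwise unfolds it down to the definition of
   the Lebesgue integral. *)
HB.lock Definition bergman_integral {R : realType} (alpha p : R)
    (f : R[i] -> R[i]) : \bar R :=
  \int[area]_(w in cplx @^-1` disk)
    (normc (f (cplx w)) `^ p * bergman_density alpha w)%:E.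

Section measurability.
Context {R : realType}.
Local Notation T := (measurableTypeR R * measurableTypeR R)%type.
Implicit Types (f : R[i] -> R[i]) (z : R[i]).

Lemma normrC z : `|z| = (normc z)%:C.
Proof. by []. Qed.

Lemma normc_ge0 z : 0 <= normc z.
Proof. by case: z => a b; rewrite /= sqrtr_ge0. Qed.

Lemma normc_cplx_le (w : R * R) : normc (cplx w) <= `|w.1| + `|w.2|.
Proof.
case: w => a b /=.
rewrite -[leRHS]ger0_norm ?addr_ge0// -sqrtr_sqr ler_sqrt ?sqr_ge0//.
rewrite sqrrD !real_normK ?num_real// lerD2r lerDl mulrn_wge0// mulr_ge0//.
Qed.

Lemma nbhs_cplx (w : R * R) (A : set R[i]) : nbhs (cplx w) A ->
  exists2 e : R, 0 < e & forall v : R * R,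
    `|w.1 - v.1| < e -> `|w.2 - v.2| < e -> A (cplx v).
Proof.
move=> /nbhs_ballP[d /= d0 dA].
have de : d = (complex.Re d)%:C by rewrite RRe_real// gtr0_real.
move: d0; rewrite de ltcR => d0.
exists (complex.Re d / 2); first by rewrite divr_gt0.
move=> v v1 v2; apply: dA; rewrite -ball_normE /= de normrC ltcR.
have -> : cplx w - cplx v = cplx (w.1 - v.1, w.2 - v.2) by [].
by rewrite (le_lt_trans (normc_cplx_le _))//= [ltRHS]splitr ltrD.
Qed.

Lemma measurable_plane_open (A : set T) :
  (forall w, A w -> exists2 e : R, 0 < e & forall v : R * R,
    `|w.1 - v.1| < e -> `|w.2 - v.2| < e -> A v) ->
  measurable A.
Proof.
move=> oA.
pose rect (q : (rat * rat) * (rat * rat)) : set T :=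
  [set` `]ratr q.1.1, ratr q.1.2[] `*` [set` `]ratr q.2.1, ratr q.2.2[].
pose G q := if `[< rect q `<=` A >] then rect q else set0.
have -> : A = \bigcup_q G q.
  apply/seteqP; split => [[x y] Axy|w [q _]]; last first.
    by rewrite /G; case: asboolP => // qA; exact: qA.
  have [e e0 eA] := oA _ Axy.
  have xe : x - e < x by rewrite ltrBlDr ltrDl.
  have xe' : x < x + e by rewrite ltrDl.
  have ye : y - e < y by rewrite ltrBlDr ltrDl.
  have ye' : y < y + e by rewrite ltrDl.
  have [a1] := rat_in_itvoo xe; have [a2] := rat_in_itvoo xe'.
  have [b1] := rat_in_itvoo ye; have [b2] := rat_in_itvoo ye'.
  rewrite !in_itv /= => /andP[yb2 b2e] /andP[eb1 b1y] /andP[xa2 a2e]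
    /andP[ea1 a1x].
  exists ((a1, a2), (b1, b2)) => //; rewrite /G; case: asboolP.
    by move=> _; split; rewrite /= in_itv /= ?a1x ?b1y ?xa2 ?yb2.
  case; move=> [u v] [] /=; rewrite !in_itv /= => /andP[u1 u2] /andP[v1 v2].
  by apply: eA => /=; rewrite ltr_norml; apply/andP; split; lra.
apply: countable_bigcupT_measurable => // q.
rewrite /G; case: ifP => // _; apply: measurableX; exact: measurable_itv.
Qed.

End measurability.

Section bergman_norm.
Context {R : realType}.
Local Notation T := (measurableTypeR R * measurableTypeR R)%type.
Local Notation D := (@cplx R @^-1` disk).
Implicit Types (f : R[i] -> R[i]) (z : R[i]) (alpha p : R).

Lemma ler_normcD (x y : R[i]) : normc (x + y) <= normc x + normc y.
Proof. by rewrite -lecR rmorphD /= -!normrC ler_normD. Qed.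

Lemma ler_dist_normc (x y : R[i]) : `|normc x - normc y| <= normc (x - y).
Proof.
have h1 := ler_normcD (x - y) y; have h2 := ler_normcD (y - x) x.
rewrite !subrK in h1 h2; rewrite -opprB normcN in h2.
by rewrite ler_norml; apply/andP; split; lra.
Qed.

Lemma nbhs_disk z : disk z -> nbhs z disk.
Proof.
move=> dz; apply/nbhs_ballP; exists ((1 - normc z)%:C).
  by rewrite /= ltcR subr_gt0.
move=> y; rewrite -ball_normE /= normrC ltcR => zy; rewrite /disk /=.
have := ler_dist_normc z y; rewrite ler_norml => /andP[h _]; lra.
Qed.

Lemma nbhs_normc f z (a b : R) : derivable f z 1 -> a < normc (f z) < b ->
  nbhs z [set y | a < normc (f y) < b].
Proof.
move=> /derivable1_diffP/differentiable_continuous fz /andP[af fb].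
pose e := Num.min (normc (f z) - a) (b - normc (f z)).
have e0 : 0 < e by rewrite lt_min !subr_gt0 af fb.
have e0' : 0 < e%:C :> R[i] by rewrite ltcR.
move/cvgrPdist_lt : fz => /(_ _ e0').
apply: filterS => y; rewrite /= normrC ltcR.
move=> /(le_lt_trans (ler_dist_normc _ _)); rewrite lt_min !ltr_norml.
by move=> /andP[/andP[h1 h2] /andP[h3 h4]]; apply/andP; split; lra.
Qed.

Lemma measurable_disk : measurable (D : set T).
Proof.
by apply: measurable_plane_open => w /nbhs_disk/nbhs_cplx.
Qed.

Lemma measurable_normc f : holomorphic_on disk f ->
  measurable_fun (D : set T) (fun w => normc (f (cplx w))).
Proof.
move=> hf; apply: (measurability _ (RGenOpens.measurableE R)).
move=> _ [_ [a [b ->] <-]]; apply: measurable_plane_open => w [Dw].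
rewrite /= in_itv /= => fab.
have /nbhs_cplx[e e0 eA] : nbhs (cplx w) (disk `&` [set y | a < normc (f y) < b]).
  by apply: filterI; [exact: nbhs_disk|exact: (nbhs_normc (hf _ Dw))].
by exists e.
Qed.

Lemma sqr_normc_cplx (w : R * R) : normc (cplx w) ^+ 2 = w.1 ^+ 2 + w.2 ^+ 2.
Proof. by case: w => a b /=; rewrite sqr_sqrtr// addr_ge0 ?sqr_ge0. Qed.

Lemma bergman_density_ge0 alpha w : -1 < alpha -> 0 <= bergman_density alpha w.
Proof.
by move=> a1; rewrite mulr_ge0 ?powR_ge0// divr_ge0 ?pi_ge0//; lra.
Qed.

Lemma bergman_density_gt0 alpha w : -1 < alpha -> D w ->
  0 < bergman_density alpha w.
Proof.
move=> a1 Dw; rewrite mulr_gt0//; first by rewrite divr_gt0 ?pi_gt0//; lra.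
by rewrite powR_gt0// subr_gt0 -sqr_normc_cplx expr_lt1// normc_ge0.
Qed.

Lemma measurable_bergman_density alpha :
  measurable_fun [set: T] (bergman_density alpha : T -> R).
Proof.
apply: measurable_funM => //.
apply: (measurableT_comp (measurable_powR _)).
apply: measurable_funB => //.
by apply: measurable_funD; apply: measurable_funX;
  [exact: measurable_fst|exact: measurable_snd].
Qed.

(* The [L^p] norm of this function for [area] is the Bergman norm of [f],
   which reduces the triangle inequality to [minkowski_EFin]. *)
Definition bergman_root alpha p f : T -> R :=
  (fun w => normc (f (cplx w)) * bergman_density alpha w `^ p^-1) \_ D.

Lemma bergman_root_ge0 alpha p f w : 0 <= bergman_root alpha p f w.
Proof.
by rewrite /bergman_root patchE; case: ifP => // _;
  rewrite mulr_ge0 ?normc_ge0 ?powR_ge0.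
Qed.

Lemma measurable_bergman_root alpha p f : holomorphic_on disk f ->
  measurable_fun [set: T] (bergman_root alpha p f).
Proof.
move=> hf; rewrite /bergman_root.
apply: (iffLR (measurable_restrictT _ measurable_disk)).
apply: measurable_funM; first exact: measurable_normc.
apply: (measurable_funS measurableT (@subsetT _ _)).
exact: (measurableT_comp (measurable_powR _) (measurable_bergman_density _)).
Qed.

Lemma bergman_integralE alpha p f : -1 < alpha -> 1 <= p ->
  bergman_integral alpha p f =
  (\int[area]_w (bergman_root alpha p f w `^ p)%:E)%E.
Proof.
move=> a1 p1; rewrite bergman_integral.unlock integral_mkcond.
apply: eq_integral => w _; rewrite /bergman_root !patchE; case: ifP => _.
  rewrite powRM ?normc_ge0 ?powR_ge0// -powRrM mulVf ?powRr1//; last lra.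
  exact: bergman_density_ge0.
by rewrite powR0//; lra.
Qed.

Lemma bergman_integral_ge0 alpha p f : -1 < alpha -> 1 <= p ->
  (0 <= bergman_integral alpha p f)%E.
Proof.
move=> a1 p1; rewrite bergman_integralE//; apply: integral_ge0 => w _.
by rewrite lee_fin powR_ge0.
Qed.

Lemma Lnorm_bergman_root alpha p f : -1 < alpha -> 1 <= p ->
  'N[area]_p%:E[EFin \o bergman_root alpha p f]%E =
  (bergman_integral alpha p f `^ p^-1)%E.
Proof.
move=> a1 p1; rewrite (bergman_integralE f a1 p1) Lnorm.unlock.
apply: (congr1 (fun x => x `^ p^-1)%E).
apply: eq_integral => w _ /=.
by rewrite ger0_norm// bergman_root_ge0.
Qed.

Lemma bergman_integralD alpha p f g : -1 < alpha -> 1 <= p ->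
  holomorphic_on disk f -> holomorphic_on disk g ->
  (bergman_integral alpha p (f + g)%R `^ p^-1 <=
   bergman_integral alpha p f `^ p^-1 + bergman_integral alpha p g `^ p^-1)%E.
Proof.
move=> a1 p1 hf hg.
have : ('N[area]_p%:E[EFin \o bergman_root alpha p (f + g)%R] <=
    'N[area]_p%:E[EFin \o bergman_root alpha p f] +
    'N[area]_p%:E[EFin \o bergman_root alpha p g])%E; last first.
  by rewrite !Lnorm_bergman_root.
have mf := measurable_bergman_root alpha p hf.
have mg := measurable_bergman_root alpha p hg.
apply: (le_trans _ (minkowski_EFin area mf mg p1)).
have p0 : 0 < p by lra.
rewrite Lnorm.unlock; apply: gt0_ler_poweR.
- by rewrite invr_ge0 ltW.
- by rewrite in_itv /= leey andbT integral_ge0// => w _; rewrite poweR_ge0.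
- by rewrite in_itv /= leey andbT integral_ge0// => w _; rewrite poweR_ge0.
have hfg : holomorphic_on disk (f + g).
  by move=> z dz; apply: derivableD; [exact: hf|exact: hg].
have mfg := measurable_bergman_root alpha p hfg.
have mP (h : T -> R) : measurable_fun [set: T] h ->
    measurable_fun [set: T] (fun w => (`|(EFin \o h) w| `^ p)%E).
  move=> mh; apply/measurable_EFinP => /=.
  by apply: (measurableT_comp (measurable_powR _)); exact: measurableT_comp.
apply: ge0_le_integral => //.
- by move=> w _; rewrite poweR_ge0.
- exact: (mP _ mfg).
- exact: (mP _ (measurable_funD mf mg)).
move=> w _ /=; rewrite lee_fin ge0_ler_powR ?nnegrE ?normr_ge0 ?(ltW p0)//.
rewrite !ger0_norm ?addr_ge0 ?bergman_root_ge0// /bergman_root !patchE.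
case: ifP => _; last first.
  by rewrite (_ : point = 0 :> R) // addr0.
by rewrite -mulrDl ler_wpM2r ?powR_ge0// ler_normcD.
Qed.

Lemma bergman_integralZ alpha p (c : R[i]) f : -1 < alpha -> 1 <= p ->
  holomorphic_on disk f ->
  bergman_integral alpha p (c *: f)%R =
  ((normc c `^ p)%:E * bergman_integral alpha p f)%E.
Proof.
move=> a1 p1 hf; rewrite !bergman_integralE//.
have mf := measurable_bergman_root alpha p hf.
rewrite -ge0_integralZl_EFin ?powR_ge0//.
- apply: eq_integral => w _; rewrite -EFinM -powRM ?normc_ge0 ?bergman_root_ge0//.
  by rewrite /bergman_root !patchE; case: ifP => _; rewrite ?mulr0// normcM mulrA.
- by move=> w _; rewrite lee_fin powR_ge0.
- by apply/measurable_EFinP; exact: (measurableT_comp (measurable_powR _)).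
Qed.

Lemma bergman_integral_eq0 alpha p f : -1 < alpha -> 1 <= p ->
  holomorphic_on disk f -> bergman_integral alpha p f = 0%E ->
  forall z, disk z -> f z = 0.
Proof.
move=> a1 p1 hf If0 z0 dz0; apply/eqP; apply: contrapT => /negP fz0.
have p0 : p != 0 by rewrite gt_eqF//; lra.
have : (\int[area]_w `|(bergman_root alpha p f w `^ p)%:E| = 0)%E.
  rewrite -[RHS]If0 bergman_integralE//; apply: eq_integral => w _.
  by rewrite /= ger0_norm ?powR_ge0.
have mf := measurable_bergman_root alpha p hf.
move/(ae_eq_integral_abs _ measurableT) => /(_ _)[].
  by apply/measurable_EFinP; exact: (measurableT_comp (measurable_powR _)).
move=> N [mN N0 subN].
have fz0' : 0 < normc (f z0) < normc (f z0) + 1.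
  by rewrite ltrDl ltr01 andbT lt_neqAle normc_ge0 andbT eq_sym;
     apply: contra fz0 => /eqP/eq0_normc ->.
have zE : z0 = cplx (complex.Re z0, complex.Im z0) by case: (z0).
have /nbhs_cplx[] : nbhs (cplx (complex.Re z0, complex.Im z0))
    (disk `&` [set y | 0 < normc (f y) < normc (f z0) + 1]).
  rewrite -zE; apply: filterI; first exact: nbhs_disk.
  exact: (nbhs_normc (hf _ dz0)).
move=> e e0 /= eA.
set x := complex.Re z0; set y := complex.Im z0.
pose Q : set T := [set` `]x - e, x + e[] `*` [set` `]y - e, y + e[].
have QN : Q `<=` N.
  move=> [u v] [] /=; rewrite !in_itv /= => /andP[u1 u2] /andP[v1 v2].
  apply: subN => /= /(_ Logic.I) /=.
  have [||/= duv /andP[fuv _]] := eA (u, v).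
  - by rewrite /= ltr_norml -/x; apply/andP; split; lra.
  - by rewrite /= ltr_norml -/y; apply/andP; split; lra.
  move=> [] /powR_eq0_eq0; rewrite /bergman_root patchE mem_set//.
  move/eqP; rewrite mulf_eq0 gt_eqF//= gt_eqF// powR_gt0//.
  exact: bergman_density_gt0.
have : (area Q <= 0)%E.
  rewrite -N0; apply: le_measure => //; rewrite inE//.
  by apply: measurableX; exact: measurable_itv.
rewrite /area /= product_measure1E; [|exact: measurable_itv..].
have len (t : R) : lebesgue_measure [set` `]t - e, t + e[] = (e + e)%:E.
  rewrite lebesgue_measure_itv /= lte_fin ifT; last by lra.
  by rewrite -EFinB; congr EFin; lra.
have := (len x, len y); rewrite /= => -[-> ->].
by rewrite -EFinM lee_fin leNgt mulr_gt0// addr_gt0.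
Qed.

End bergman_norm.

(* An element of the Bergman space is a function on the disk, represented by
   its extension by [0] to the whole plane. *)
Definition bergman_pred {R : realType} {alpha p : R}
    (alpha_gtN1 : -1 < alpha) (p_ge1 : 1 <= p) : {pred R[i] -> R[i]} :=
  [pred f | `[< [/\ holomorphic_on disk f, forall z, ~ disk z -> f z = 0 &
                    (bergman_integral alpha p f < +oo)%E] >]].

Section bergman_space.
Context {R : realType} {alpha p : R} (alpha_gtN1 : -1 < alpha) (p_ge1 : 1 <= p).
Local Notation bergman_pred := (bergman_pred alpha_gtN1 p_ge1).

Lemma bergman_pred_submod : submod_closed bergman_pred.
Proof.
have p0 : 0 < p by apply: lt_le_trans p_ge1.
have finP f : (bergman_integral alpha p f `^ p^-1 < +oo)%E ->
    (bergman_integral alpha p f < +oo)%E.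
  move=> h; rewrite ltey; apply/eqP => If; move: h.
  by rewrite If poweRyr// invr_eq0 gt_eqF.
split => [|a f g].
  apply/asboolP; split => //.
  rewrite bergman_integralE// integral0_eq// => w _.
  by rewrite /bergman_root patchE; case: ifP => _;
    rewrite ?normc0 ?mul0r powR0 ?gt_eqF.
move=> /asboolP[hf f0 If] /asboolP[hg g0 Ig]; apply/asboolP.
have haf : holomorphic_on disk (a *: f).
  by move=> z dz; apply: derivableZ; exact: hf.
split.
- by move=> z dz; apply: derivableD; [exact: haf|exact: hg].
- by move=> z dz; rewrite -[LHS]/(a * f z + g z) f0// g0// mulr0 addr0.
- apply: finP; apply: (le_lt_trans (bergman_integralD _ _ haf hg)) => //.
  rewrite bergman_integralZ//; apply: lte_add_pinfty; apply: poweR_lty.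
    by apply: lte_mul_pinfty If; rewrite ?lee_fin ?powR_ge0.
  exact: Ig.
Qed.

HB.instance Definition _ :=
  GRing.isSubmodClosed.Build R[i] (R[i] -> R[i]) bergman_pred
    bergman_pred_submod.

Record bergman := Bergman {
  bergman_fun :> R[i] -> R[i] ;
  _ : bergman_fun \in bergman_pred }.

HB.instance Definition _ := [isSub for bergman_fun].
HB.instance Definition _ := [Choice of bergman by <:].
HB.instance Definition _ := [SubChoice_isSubLmodule of bergman by <:].

Definition bergman_norm (f : bergman) : R :=
  fine (bergman_integral alpha p f) `^ p^-1.

Lemma bergmanP (f : bergman) :
  [/\ holomorphic_on disk f, forall z, ~ disk z -> f z = 0 &
      bergman_integral alpha p f \is a fin_num].
Proof.
have /asboolP[hf f0 If] := valP f; split => //.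
by rewrite ge0_fin_numE// bergman_integral_ge0.
Qed.

Lemma bergman_normE (f : bergman) :
  (bergman_norm f)%:E = (bergman_integral alpha p f `^ p^-1)%E.
Proof. by have [_ _ /fineK <-] := bergmanP f. Qed.

Let bergman_normD (f g : bergman) :
  (bergman_norm (f + g))%:C <= (bergman_norm f)%:C + (bergman_norm g)%:C.
Proof.
have [hf _ _] := bergmanP f; have [hg _ _] := bergmanP g.
suff : ((bergman_norm (f + g))%:E <=
    (bergman_norm f)%:E + (bergman_norm g)%:E)%E.
  by rewrite -EFinD lee_fin -lecR rmorphD.
rewrite (bergman_normE f) (bergman_normE g) (bergman_normE (f + g)).
have -> : bergman_fun (f + g) = bergman_fun f + bergman_fun g by [].
exact: (bergman_integralD alpha_gtN1 p_ge1 hf hg).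
Qed.

Let bergman_normZ (a : R[i]) (f : bergman) :
  (bergman_norm (a *: f))%:C = `|a| * (bergman_norm f)%:C.
Proof.
have [hf _ If] := bergmanP f.
suff -> : bergman_norm (a *: f) = normc a * bergman_norm f by rewrite rmorphM.
rewrite /bergman_norm.
have -> : bergman_fun (a *: f) = a *: bergman_fun f by [].
rewrite (bergman_integralZ a alpha_gtN1 p_ge1 hf).
rewrite fineM// powRM ?powR_ge0 ?fine_ge0 ?bergman_integral_ge0//.
rewrite -powRrM mulfV ?powRr1 ?normc_ge0//.
by rewrite gt_eqF// (lt_le_trans _ p_ge1).
Qed.

Let bergman_norm0_eq0 (f : bergman) : (bergman_norm f)%:C = 0 -> f = 0.
Proof.
have [hf f0 If] := bergmanP f.
move=> /complexI/powR_eq0_eq0 n0; apply/val_inj/funext => z /=.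
have [dz|dz] := pselect (disk z); last exact: f0.
apply: (bergman_integral_eq0 alpha_gtN1 p_ge1 hf) => //.
by rewrite -[LHS]fineK// n0.
Qed.

HB.instance Definition _ := Lmodule_isNormed.Build R[i] bergman
  bergman_normD bergman_normZ bergman_norm0_eq0.

(* The value is [0] in case [psi * (f \o phi)] lies outside the Bergman space;
   this does not happen for [psi] in [Hinfty] and [phi] an automorphism. *)
Definition weighted_composition (psi phi : R[i] -> R[i]) (f : bergman) :
    bergman :=
  insubd 0 (patch (fun=> 0) disk (fun z => psi z * f (phi z))).

End bergman_space.

Arguments weighted_composition {R alpha p} alpha_gtN1 p_ge1 psi phi f.

(* Main.v *)
(* In the chart of the disk that moves the fixed point of [phi] to 0, [phi] is an
   irrational rotation [z |-> mu z] and the operator is [C f (z) = w z * f (mu z)],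
   its powers having the weights [w_n z = \prod_(j < n) w (mu^j z)].  If
   [|w_n| = O(r^n)] with [r < |l|], the Neumann series inverts [C - l]; applied to
   [C] and to [C^-1], this puts the spectrum inside the annulus.

   Conversely, let the range of [C - l] have finite codimension, with
   [|w 0| <= |l|] (otherwise pass to [C^-1]).  Comparing Taylor coefficients,
   [C - l'] is injective unless [l'] is one of the numbers [w 0 * mu^k]; multiplying
   [l] by a power of [mu] keeps the codimension finite and avoids these values.  By
   the open mapping theorem [C - l] is bounded below, and since the powers of [mu]
   are dense in the circle, so is [C - l'], uniformly for [|l'|] close to [|l|].
   For [|l'| > |w 0|] the formal resolvent is a holomorphic function whose Taylor
   polynomials show that the range of [C - l'] is dense, hence everything.
   Averaging [(C - l')^-1] over a circle bounds [C^n], so that [|w_n| = O(r^n)] for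
   some [r < |l|], and therefore [rho <= r < |l|]. *)
Require Import Defs.
From HB Require Import structures.
From mathcomp Require Import all_boot all_order all_algebra.
From mathcomp Require Import all_classical all_reals all_analysis.
From mathcomp.real_closed Require Import complex.
From mathcomp Require Import measurable_realfun zify ring lra.

Set Implicit Arguments.
Unset Strict Implicit.
Unset Printing Implicit Defensive.
Import Order.TTheory GRing.Theory Num.Theory.
Import ComplexField.Normc.
Import numFieldNormedType.Exports.

Local Open Scope classical_set_scope.
Local Open Scope ring_scope.
Local Open Scope complex_scope.

(** * Complex derivatives *)

(** Complex analysis is rebuilt from the maximum principle. Goursat's theorem serves once, to bound
    a central value; two substitutes take the place of Cauchy's formula. A bound on second divided
    differences follows from the maximum principle, survives uniform limits and implies
    differentiability. Integrals over a circle become averages over orbits of the irrational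
    rotation, whose unwanted terms are geometric sums bounded independently of their length.

    Read in the chart, the norm need not be rotation invariant; hence [rotation_space] asks for
    domination, Fatou, bounded evaluations and a bound for rotations that is uniform in [mu].

    The tension in the main argument lies in the powers of [z]. Multiplying by [z ^+ k] rotates the
    spectral parameter without raising the norm and makes a given vector small, but undoing it costs
    [s^-1 ^+ k]. The density argument gains a factor 1/2 per block of powers and must do so faster
    than this loss accumulates, which forces [s] close to 1.

    Areas are compared through Lipschitz bounds and superlevel sets, without Jacobians. *)

HB.lock Definition cnorm {R : realType} (z : R[i]) : R := normc z.

Definition ccont {R : realType} (f : R[i] -> R[i]) z := forall e : R, 0 < e ->
  exists2 d : R, 0 < d & forall w, cnorm (w - z) < d -> cnorm (f w - f z) <= e.

(* Epsilon-delta form of the complex derivative; [holoP] relates it to [derivable]. *)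
Definition cderiv {R : realType} (f : R[i] -> R[i]) z l := forall e : R, 0 < e ->
  exists2 d : R, 0 < d & forall w, cnorm (w - z) < d ->
    cnorm (f w - f z - l * (w - z)) <= e * cnorm (w - z).

Definition holo {R : realType} (f : R[i] -> R[i]) z := exists l, cderiv f z l.

Section complex_modulus.
Context {R : realType}.
Implicit Types (x y z w l : R[i]) (f g : R[i] -> R[i]).

Lemma cnormE z : cnorm z = normc z.
Proof. by rewrite cnorm.unlock. Qed.

Lemma cnorm_ge0 z : 0 <= cnorm z.
Proof. by rewrite cnorm.unlock normc_ge0. Qed.

Lemma cnorm0 : cnorm 0 = 0 :> R.
Proof. by rewrite cnorm.unlock normc0. Qed.

Lemma cnorm1 : cnorm 1 = 1 :> R.
Proof. by rewrite cnorm.unlock normc1. Qed.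

Lemma cnormM x y : cnorm (x * y) = cnorm x * cnorm y.
Proof. by rewrite cnorm.unlock normcM. Qed.

Lemma cnormN x : cnorm (- x) = cnorm x.
Proof. by rewrite cnorm.unlock (normcN (x : Rcomplex R)). Qed.

Lemma cnormV x : cnorm x^-1 = (cnorm x)^-1.
Proof. by rewrite cnorm.unlock normcV. Qed.

Lemma cnormX x n : cnorm (x ^+ n) = cnorm x ^+ n.
Proof. by elim: n => [|n IH]; rewrite ?expr0 ?cnorm1// !exprS cnormM IH. Qed.

Lemma cnorm_eq0 x : (cnorm x == 0) = (x == 0).
Proof.
by apply/eqP/eqP => [|->]; [rewrite cnorm.unlock => /eq0_normc|rewrite cnorm0].
Qed.

Lemma cnorm_gt0 x : (0 < cnorm x) = (x != 0).
Proof. by rewrite lt_neqAle cnorm_ge0 andbT eq_sym cnorm_eq0. Qed.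

Lemma cnormD x y : cnorm (x + y) <= cnorm x + cnorm y.
Proof. by rewrite cnorm.unlock ler_normcD. Qed.

Lemma cdistC x y : cnorm (x - y) = cnorm (y - x).
Proof. by rewrite -opprB cnormN. Qed.

Lemma cnormB x y : cnorm (x - y) <= cnorm x + cnorm y.
Proof. by rewrite -(cnormN y) cnormD. Qed.

Lemma cnormD_ge x y : cnorm x - cnorm y <= cnorm (x + y).
Proof. by rewrite lerBlDr -{1}(addrK y x) (le_trans (cnormB _ _)). Qed.

Lemma cnormB_ge x y : cnorm x - cnorm y <= cnorm (x - y).
Proof. by rewrite -(cnormN y) cnormD_ge. Qed.

Lemma cdist_trans y x z : cnorm (x - z) <= cnorm (x - y) + cnorm (y - z).
Proof. by rewrite (le_trans _ (cnormD _ _))// addrA subrK. Qed.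

Lemma cnorm_sum (I : Type) (r : seq I) (P : pred I) (F : I -> R[i]) :
  cnorm (\sum_(i <- r | P i) F i) <= \sum_(i <- r | P i) cnorm (F i).
Proof.
elim/big_ind2 : _ => [|x u y v xu yv|//]; first by rewrite cnorm0.
by rewrite (le_trans (cnormD _ _))// lerD.
Qed.

Lemma cnorm_prod (I : Type) (r : seq I) (P : pred I) (F : I -> R[i]) :
  cnorm (\prod_(i <- r | P i) F i) = \prod_(i <- r | P i) cnorm (F i).
Proof. by rewrite (big_morph _ cnormM cnorm1). Qed.

Lemma cnorm_real (r : R) : cnorm r%:C = `|r|.
Proof. by rewrite cnorm.unlock /= expr0n /= addr0 sqrtr_sqr. Qed.

Lemma cnorm_nat n : cnorm n%:R = n%:R :> R.
Proof. by rewrite -[n%:R](rmorph_nat (real_complex R)) cnorm_real normr_nat. Qed.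

Lemma cnorm_i : cnorm ('i%C : R[i]) = 1.
Proof. by rewrite cnorm.unlock /= expr0n /= add0r expr1n sqrtr1. Qed.

Lemma cnorm_sqr z : cnorm z ^+ 2 = complex.Re z ^+ 2 + complex.Im z ^+ 2.
Proof.
by case: z => a b; rewrite cnorm.unlock /= sqr_sqrtr// addr_ge0 ?sqr_ge0.
Qed.

Lemma ler_Re_cnorm z : `|complex.Re z| <= cnorm z.
Proof.
rewrite -(@ler_pXn2r _ 2)// ?nnegrE ?cnorm_ge0// cnorm_sqr.
by rewrite real_normK ?num_real// lerDl sqr_ge0.
Qed.

Lemma ler_Im_cnorm z : `|complex.Im z| <= cnorm z.
Proof.
rewrite -(@ler_pXn2r _ 2)// ?nnegrE ?cnorm_ge0// cnorm_sqr.
by rewrite real_normK ?num_real// lerDr sqr_ge0.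
Qed.

Lemma cnorm_le_ReIm z : cnorm z <= `|complex.Re z| + `|complex.Im z|.
Proof. by case: z => a b; rewrite cnormE (normc_cplx_le (a, b)). Qed.

Lemma complexE z : z = (complex.Re z)%:C + 'i%C * (complex.Im z)%:C.
Proof. by case: z => a b; simpc. Qed.

Lemma cnorm_inj_eq z w : (forall e : R, 0 < e -> cnorm (z - w) <= e) -> z = w.
Proof.
move=> h; apply/eqP; rewrite -subr_eq0 -cnorm_eq0 eq_le cnorm_ge0 andbT.
by apply/ler_addgt0Pr => e /h; rewrite add0r.
Qed.

End complex_modulus.

Section complex_derivative.
Context {R : realType}.
Implicit Types (x y z w l : R[i]) (f g : R[i] -> R[i]).

Lemma cderiv_cont f z l : cderiv f z l -> ccont f z.
Proof.
move=> fl e e0; have [d d0 h] := fl 1 ltr01.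
have L0 : 0 < 1 + cnorm l by have := cnorm_ge0 l; lra.
exists (Num.min d (e / (1 + cnorm l))); first by rewrite lt_min d0 divr_gt0.
move=> w; rewrite lt_min => /andP[/h hw wd].
have -> : f w - f z = (f w - f z - l * (w - z)) + l * (w - z) by rewrite subrK.
rewrite (le_trans (cnormD _ _))// cnormM.
rewrite ltr_pdivlMr// in wd; apply: (le_trans (lerD hw (lexx _))).
by rewrite -mulrDl mulrC ltW.
Qed.

Lemma holo_cont f z : holo f z -> ccont f z.
Proof. by move=> [l]; exact: cderiv_cont. Qed.

Lemma ccont_bound f z : ccont f z ->
  exists2 d : R, 0 < d & forall w, cnorm (w - z) < d -> cnorm (f w) <= cnorm (f z) + 1.
Proof.
move=> /(_ 1 ltr01)[d d0 h]; exists d => // w /h fw.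
by rewrite -(subrK (f z) (f w)) (le_trans (cnormD _ _))// addrC lerD2l.
Qed.

Lemma cderiv_eq f g z l (d : R) : 0 < d ->
  (forall w, cnorm (w - z) < d -> f w = g w) -> cderiv f z l -> cderiv g z l.
Proof.
move=> d0 fg fl e e0; have [d' d'0 h] := fl e e0.
exists (Num.min d d'); first by rewrite lt_min d0 d'0.
move=> w; rewrite lt_min => /andP[wd wd'].
by rewrite -fg// -fg ?subrr ?cnorm0//; exact: h.
Qed.

Lemma holo_eq f g z (d : R) : 0 < d ->
  (forall w, cnorm (w - z) < d -> f w = g w) -> holo f z -> holo g z.
Proof. by move=> d0 fg [l fl]; exists l; exact: (cderiv_eq d0 fg). Qed.

Lemma cderiv_cst (c : R[i]) z : cderiv (fun=> c) z 0.
Proof.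
move=> e e0; exists 1 => // w _.
by rewrite subrr mul0r subr0 cnorm0 mulr_ge0 ?cnorm_ge0// ltW.
Qed.

Lemma cderiv_id z : cderiv (fun w => w) z 1.
Proof.
move=> e e0; exists 1 => // w _.
by rewrite mul1r subrr cnorm0 mulr_ge0 ?cnorm_ge0// ltW.
Qed.

Lemma cderivD f g z l m : cderiv f z l -> cderiv g z m ->
  cderiv (fun w => f w + g w) z (l + m).
Proof.
move=> fl gm e e0; have e2 : 0 < e / 2 by rewrite divr_gt0.
have [d d0 h] := fl _ e2; have [d' d'0 h'] := gm _ e2.
exists (Num.min d d'); first by rewrite lt_min d0 d'0.
move=> w; rewrite lt_min => /andP[/h hw /h' hw'].
have -> : f w + g w - (f z + g z) - (l + m) * (w - z) =
  (f w - f z - l * (w - z)) + (g w - g z - m * (w - z)) by ring.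
rewrite (le_trans (cnormD _ _))// (le_trans (lerD hw hw'))//.
by rewrite -mulrDl -splitr.
Qed.

Lemma cderivM f g z l m : cderiv f z l -> cderiv g z m ->
  cderiv (fun w => f w * g w) z (l * g z + f z * m).
Proof.
move=> fl gm e e0.
set A := cnorm (g z) + 1; set B := cnorm (f z) + 1; set L := cnorm l + 1.
have A0 : 0 < A by rewrite /A; have := cnorm_ge0 (g z); lra.
have B0 : 0 < B by rewrite /B; have := cnorm_ge0 (f z); lra.
have L0 : 0 < L by rewrite /L; have := cnorm_ge0 l; lra.
have eA : 0 < e / 3 / A by rewrite !divr_gt0.
have eB : 0 < e / 3 / B by rewrite !divr_gt0.
have eL : 0 < e / 3 / L by rewrite !divr_gt0.
have [d1 d10 h1] := fl _ eA; have [d2 d20 h2] := gm _ eB.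
have [d3 d30 h3] := cderiv_cont gm eL.
have [d4 d40 h4] := ccont_bound (cderiv_cont gm).
exists (Num.min (Num.min d1 d2) (Num.min d3 d4)); first by rewrite !lt_min d10 d20 d30.
move=> w; rewrite !lt_min => /andP[/andP[/h1 w1 /h2 w2] /andP[/h3 w3 /h4 w4]].
have -> : f w * g w - f z * g z - (l * g z + f z * m) * (w - z) =
  (f w - f z - l * (w - z)) * g w + f z * (g w - g z - m * (w - z)) +
  l * (w - z) * (g w - g z) by ring.
have n0 := cnorm_ge0 (w - z).
have k1 : cnorm ((f w - f z - l * (w - z)) * g w) <= e / 3 * cnorm (w - z).
  rewrite cnormM (le_trans (ler_pM (cnorm_ge0 _) (cnorm_ge0 _) w1 w4))//.
  by rewrite -/A (_ : e / 3 / A * _ * A = e / 3 * cnorm (w - z))//; field; rewrite gt_eqF.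
have k2 : cnorm (f z * (g w - g z - m * (w - z))) <= e / 3 * cnorm (w - z).
  rewrite cnormM.
  have fB : cnorm (f z) <= B by rewrite /B lerDl.
  rewrite (le_trans (ler_pM (cnorm_ge0 _) (cnorm_ge0 _) fB w2))//.
  by rewrite (_ : B * _ = e / 3 * cnorm (w - z))//; field; rewrite gt_eqF.
have k3 : cnorm (l * (w - z) * (g w - g z)) <= e / 3 * cnorm (w - z).
  rewrite !cnormM.
  have lL : cnorm l <= L by rewrite /L lerDl.
  have w3' : cnorm (w - z) * cnorm (g w - g z) <= cnorm (w - z) * (e / 3 / L).
    by rewrite ler_wpM2l.
  rewrite -mulrA (le_trans (ler_pM (cnorm_ge0 _) _ lL w3'))//.
    by rewrite mulr_ge0 ?cnorm_ge0.
  by rewrite (_ : L * _ = e / 3 * cnorm (w - z))//; field; rewrite gt_eqF.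
rewrite (le_trans (cnormD _ _))// (le_trans (lerD (cnormD _ _) (lexx _)))//.
lra.
Qed.

Lemma cderiv_comp f g z l m : cderiv g z m -> cderiv f (g z) l ->
  cderiv (fun w => f (g w)) z (l * m).
Proof.
move=> gm fl e e0.
set M := cnorm m + 1; set L := cnorm l + 1.
have M0 : 0 < M by rewrite /M; have := cnorm_ge0 m; lra.
have L0 : 0 < L by rewrite /L; have := cnorm_ge0 l; lra.
have eM : 0 < e / 2 / M by rewrite !divr_gt0.
have eL : 0 < e / 2 / L by rewrite !divr_gt0.
have [d1 d10 h1] := fl _ eM.
have [d2 d20 h2] := gm _ eL; have [d3 d30 h3] := gm _ ltr01.
have dd : 0 < d1 / 2 by rewrite divr_gt0.
have [d4 d40 h4] := cderiv_cont gm dd.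
exists (Num.min d2 (Num.min d3 d4)); first by rewrite !lt_min d20 d30.
move=> w; rewrite !lt_min => /andP[/h2 w2 /andP[/h3 w3 /h4 w4]].
have gw : cnorm (g w - g z) <= M * cnorm (w - z).
  rewrite -(subrK (m * (w - z)) (g w - g z)) (le_trans (cnormD _ _))// cnormM.
  by rewrite (le_trans (lerD w3 (lexx _)))// -mulrDl addrC.
have -> : f (g w) - f (g z) - l * m * (w - z) =
  (f (g w) - f (g z) - l * (g w - g z)) + l * (g w - g z - m * (w - z)) by ring.
have k1 : cnorm (f (g w) - f (g z) - l * (g w - g z)) <= e / 2 * cnorm (w - z).
  have gd : cnorm (g w - g z) < d1 by lra.
  rewrite (le_trans (h1 _ gd))// (le_trans (ler_wpM2l (ltW eM) gw))//.
  by rewrite (_ : _ * (M * _) = e / 2 * cnorm (w - z))//; field; rewrite gt_eqF.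
have k2 : cnorm (l * (g w - g z - m * (w - z))) <= e / 2 * cnorm (w - z).
  have lL : cnorm l <= L by rewrite /L lerDl.
  rewrite cnormM (le_trans (ler_pM (cnorm_ge0 _) (cnorm_ge0 _) lL w2))//.
  by rewrite (_ : L * _ = e / 2 * cnorm (w - z))//; field; rewrite gt_eqF.
rewrite (le_trans (cnormD _ _))// (le_trans (lerD k1 k2))//.
by rewrite -mulrDl -splitr.
Qed.

Lemma cderiv_inv z : z != 0 -> cderiv (fun w => w^-1) z (- z^-2).
Proof.
move=> z0 e e0; have nz : 0 < cnorm z by rewrite cnorm_gt0.
exists (Num.min (cnorm z / 2) (e * cnorm z ^+ 3 / 2)).
  by rewrite lt_min !divr_gt0// mulr_gt0// exprn_gt0.
move=> w; rewrite lt_min => /andP[w1 w2].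
have nw : cnorm z / 2 < cnorm w.
  by have := cnormB_ge z w; rewrite cdistC; lra.
have w0 : w != 0 by rewrite -cnorm_gt0; lra.
have -> : w^-1 - z^-1 - - z^-2 * (w - z) = (w - z) ^+ 2 * (w^-1 * z^-2).
  by field; rewrite w0 z0.
rewrite cnormM cnormX expr2 -mulrA [leRHS]mulrC ler_wpM2l ?cnorm_ge0//.
rewrite cnormM !cnormV cnormX -invfM ler_pdivrMr; last first.
  by rewrite mulr_gt0 ?exprn_gt0//; lra.
have k : cnorm z ^+ 3 / 2 <= cnorm w * cnorm z ^+ 2.
  by rewrite exprS; have := sqr_ge0 (cnorm z); nra.
have := ler_wpM2l (ltW e0) k; lra.
Qed.

Lemma holo_cst (c : R[i]) z : holo (fun=> c) z.
Proof. by exists 0; exact: cderiv_cst. Qed.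

Lemma holo_id z : holo (fun w => w) z.
Proof. by exists 1; exact: cderiv_id. Qed.

Lemma holoD f g z : holo f z -> holo g z -> holo (fun w => f w + g w) z.
Proof. by move=> [l fl] [m gm]; exists (l + m); exact: cderivD. Qed.

Lemma holoM f g z : holo f z -> holo g z -> holo (fun w => f w * g w) z.
Proof. by move=> [l fl] [m gm]; eexists; exact: cderivM fl gm. Qed.

Lemma holoN f z : holo f z -> holo (fun w => - f w) z.
Proof.
move=> hf; apply: (@holo_eq (fun w => -1 * f w) _ _ 1) => //.
  by move=> w _; rewrite mulN1r.
by apply: holoM => //; exact: holo_cst.
Qed.

Lemma holoB f g z : holo f z -> holo g z -> holo (fun w => f w - g w) z.
Proof. by move=> hf hg; apply: holoD => //; exact: holoN. Qed.

Lemma holo_comp f g z : holo g z -> holo f (g z) -> holo (fun w => f (g w)) z.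
Proof. by move=> [m gm] [l fl]; eexists; exact: cderiv_comp gm fl. Qed.

Lemma holoV f z : holo f z -> f z != 0 -> holo (fun w => (f w)^-1) z.
Proof. by move=> hf f0; apply: (holo_comp hf); eexists; exact: cderiv_inv. Qed.

Lemma holo_div f g z : holo f z -> holo g z -> g z != 0 ->
  holo (fun w => f w / g w) z.
Proof. by move=> hf hg g0; apply: holoM => //; exact: holoV. Qed.

Lemma holoX f z n : holo f z -> holo (fun w => f w ^+ n) z.
Proof.
move=> hf; elim: n => [|n IH]; first exact: holo_cst.
apply: (@holo_eq (fun w => f w * f w ^+ n) _ _ 1) => //.
  by move=> w _; rewrite exprS.
exact: holoM.
Qed.

Lemma holo_sum (I : Type) (r : seq I) (F : I -> R[i] -> R[i]) z :
  (forall i, holo (F i) z) -> holo (fun w => \sum_(i <- r) F i w) z.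
Proof.
move=> hF; elim: r => [|i r IH].
  by apply: (@holo_eq (fun=> 0) _ _ 1) => //; [move=> w _; rewrite big_nil|exact: holo_cst].
apply: (@holo_eq (fun w => F i w + \sum_(j <- r) F j w) _ _ 1) => //.
  by move=> w _; rewrite big_cons.
exact: holoD.
Qed.

Lemma holo_prod (I : Type) (r : seq I) (F : I -> R[i] -> R[i]) z :
  (forall i, holo (F i) z) -> holo (fun w => \prod_(i <- r) F i w) z.
Proof.
move=> hF; elim: r => [|i r IH].
  by apply: (@holo_eq (fun=> 1) _ _ 1) => //; [move=> w _; rewrite big_nil|exact: holo_cst].
apply: (@holo_eq (fun w => F i w * \prod_(j <- r) F j w) _ _ 1) => //.
  by move=> w _; rewrite big_cons.
exact: holoM.
Qed.

Lemma cderiv_uniq f z l m : cderiv f z l -> cderiv f z m -> l = m.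
Proof.
move=> fl fm; apply: cnorm_inj_eq => e e0; have e2 : 0 < e / 2 by rewrite divr_gt0.
have [d d0 h] := fl _ e2; have [d' d'0 h'] := fm _ e2.
pose t : R := Num.min d d' / 2.
have t0 : 0 < t by rewrite divr_gt0// lt_min d0.
have nt : cnorm (z + t%:C - z) = t by rewrite addrC addKr cnorm_real gtr0_norm.
have td : t < Num.min d d'.
  have : 0 < Num.min d d' by rewrite lt_min d0.
  rewrite /t; lra.
move: td; rewrite lt_min => /andP[td td'].
have := h (z + t%:C); have := h' (z + t%:C); rewrite nt => /(_ td') k' /(_ td) k.
have : cnorm ((l - m) * (z + t%:C - z)) <= e * t.
  have -> : (l - m) * (z + t%:C - z) = (f (z + t%:C) - f z - m * (z + t%:C - z))
    - (f (z + t%:C) - f z - l * (z + t%:C - z)) by ring.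
  by rewrite (le_trans (cnormB _ _))// (le_trans (lerD k' k))// -mulrDl -splitr.
by rewrite cnormM nt ler_pM2r.
Qed.

End complex_derivative.

(** * Goursat's theorem *)

Definition rcont {R : realType} (F : R -> R[i]) t := forall e : R, 0 < e ->
  exists2 d : R, 0 < d & forall s, `|s - t| < d -> cnorm (F s - F t) <= e.

HB.lock Definition cint {R : realType} (F : R -> R[i]) (a b : R) : R[i] :=
  (\int[lebesgue_measure]_(t in `[a, b]) complex.Re (F t))%:C +
  'i%C * (\int[lebesgue_measure]_(t in `[a, b]) complex.Im (F t))%:C.

Section complex_integral.
Context {R : realType}.
Implicit Types (F G : R -> R[i]) (a b : R) (c : R[i]).
Local Notation mu := (@lebesgue_measure R).

Definition rcont_on F a b := forall t, a <= t <= b -> rcont F t.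

Lemma rcontB F G t : rcont F t -> rcont G t -> rcont (fun s => F s - G s) t.
Proof.
move=> fF fG e e0; have e2 : 0 < e / 2 by rewrite divr_gt0.
have [d d0 h] := fF _ e2; have [d' d'0 h'] := fG _ e2.
exists (Num.min d d'); first by rewrite lt_min d0.
move=> s; rewrite lt_min => /andP[/h hs /h' hs'].
have -> : F s - G s - (F t - G t) = (F s - F t) - (G s - G t) by ring.
by rewrite (le_trans (cnormB _ _))//; lra.
Qed.

Lemma rcont_onB F G a b : rcont_on F a b -> rcont_on G a b ->
  rcont_on (fun s => F s - G s) a b.
Proof. by move=> hF hG t tab; apply: rcontB; [exact: hF|exact: hG]. Qed.

Lemma integrable_part (p : R[i] -> R) F a b :
  (forall z w, `|p z - p w| <= cnorm (z - w)) ->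
  rcont_on F a b -> mu.-integrable `[a, b] (EFin \o (fun t => p (F t))).
Proof.
move=> pl hF; apply: continuous_compact_integrable; first exact: segment_compact.
apply: continuous_in_subspaceT => t; rewrite inE /= in_itv /= => tab.
apply/cvgrPdist_le => e e0; have [d d0 h] := hF _ tab _ e0.
near=> s; rewrite (le_trans (pl _ _))// cdistC; apply: h.
by rewrite distrC; near: s; exists d.
Unshelve. all: by end_near.
Qed.

Lemma Re_dist z (w : R[i]) : `|complex.Re z - complex.Re w| <= cnorm (z - w).
Proof. by have := ler_Re_cnorm (z - w); case: z; case: w. Qed.

Lemma Im_dist z (w : R[i]) : `|complex.Im z - complex.Im w| <= cnorm (z - w).
Proof. by have := ler_Im_cnorm (z - w); case: z; case: w. Qed.

Lemma cintB F G a b : rcont_on F a b -> rcont_on G a b ->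
  cint (fun t => F t - G t) a b = cint F a b - cint G a b.
Proof.
move=> hF hG; rewrite !cint.unlock.
have -> : (fun t => complex.Re (F t - G t)) =
    (fun t => complex.Re (F t) - complex.Re (G t)).
  by apply/funext => t; case: (F t); case: (G t).
have -> : (fun t => complex.Im (F t - G t)) =
    (fun t => complex.Im (F t) - complex.Im (G t)).
  by apply/funext => t; case: (F t); case: (G t).
rewrite !RintegralB//; first by rewrite !rmorphB /=; ring.
- exact: (integrable_part Im_dist hF).
- exact: (integrable_part Im_dist hG).
- exact: (integrable_part Re_dist hF).
- exact: (integrable_part Re_dist hG).
Qed.

Lemma Rint_near (f : R -> R) a b (c e : R) : a <= b ->
  mu.-integrable `[a, b] (EFin \o f) -> (forall t, a <= t <= b -> `|f t - c| <= e) ->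
  `|\int[mu]_(t in `[a, b]) f t - (b - a) * c| <= e * (b - a).
Proof.
move=> ab fi fc.
have icst r : \int[mu]_(t in `[a, b]) (cst r t) = r * (b - a).
  rewrite Rintegral_cst//= lebesgue_measure_itv/= lte_fin.
  by move: ab; rewrite le_eqVlt => /predU1P[->|->]//; rewrite ltxx subrr.
have ic r : mu.-integrable `[a, b] (EFin \o cst r).
  apply: continuous_compact_integrable; first exact: segment_compact.
  by apply: continuous_subspaceT => x; exact: cvg_cst.
rewrite ler_norml; apply/andP; split.
  suff : \int[mu]_(t in `[a, b]) (cst (c - e) t) <= \int[mu]_(t in `[a, b]) f t.
    by rewrite icst; lra.
  apply: le_Rintegral => // t; rewrite /= in_itv /= => /fc.
  by rewrite ler_norml => /andP[]; lra.
suff : \int[mu]_(t in `[a, b]) f t <= \int[mu]_(t in `[a, b]) (cst (c + e) t).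
  by rewrite icst; lra.
apply: le_Rintegral => // t; rewrite /= in_itv /= => /fc.
by rewrite ler_norml => /andP[]; lra.
Qed.

(** The factor 2 is the price of estimating the real and the imaginary part separately. *)
Lemma cint_near F a b c e : a <= b -> rcont_on F a b ->
  (forall t, a <= t <= b -> cnorm (F t - c) <= e) ->
  cnorm (cint F a b - (b - a)%:C * c) <= 2 * e * (b - a).
Proof.
move=> ab hF Fc.
have -> : cint F a b - (b - a)%:C * c =
    (\int[mu]_(t in `[a, b]) complex.Re (F t) - (b - a) * complex.Re c)%:C +
    'i%C * (\int[mu]_(t in `[a, b]) complex.Im (F t) - (b - a) * complex.Im c)%:C.
  have hB (r s : R) : (r - s)%:C = r%:C - s%:C :> R[i] by exact: rmorphB.
  have hM (r s : R) : (r * s)%:C = r%:C * s%:C :> R[i] by exact: rmorphM.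
  rewrite !cint.unlock {1}(complexE c) !(hB, hM). ring.
rewrite (le_trans (cnormD _ _))// cnormM cnorm_i mul1r !cnorm_real.
have h1 := @Rint_near (fun t => complex.Re (F t)) a b (complex.Re c) e ab
  (integrable_part Re_dist hF).
have h2 := @Rint_near (fun t => complex.Im (F t)) a b (complex.Im c) e ab
  (integrable_part Im_dist hF).
rewrite -mulrA mulr_natl mulr2n; apply: lerD.
  by apply: h1 => t /Fc; apply: le_trans; exact: Re_dist.
by apply: h2 => t /Fc; apply: le_trans; exact: Im_dist.
Qed.

Lemma Rint_split (f : R -> R) a m b : a <= m <= b ->
  mu.-integrable `[a, b] (EFin \o f) ->
  \int[mu]_(t in `[a, b]) f t =
  \int[mu]_(t in `[a, m]) f t + \int[mu]_(t in `[m, b]) f t.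
Proof.
move=> /andP[am mb] fi.
have := @Rintegral_itvB R f (BLeft a) (BRight b) m fi.
rewrite !bnd_simp => /(_ am mb); rewrite Rintegral_itv_obnd_cbnd.
  by move=> <-; rewrite addrC subrK.
by apply: integrableS fi => //; apply: subset_itvr; rewrite bnd_simp.
Qed.

Lemma cint_split F a m b : a <= m <= b -> rcont_on F a b ->
  cint F a b = cint F a m + cint F m b.
Proof.
move=> amb hF; rewrite !cint.unlock.
rewrite (Rint_split amb (integrable_part Re_dist hF)).
rewrite (Rint_split amb (integrable_part Im_dist hF)).
by rewrite !rmorphD /=; ring.
Qed.

End complex_integral.

Section goursat.
Context {R : realType}.
Implicit Types (g : R[i] -> R[i]) (x y h k : R).

(** The contour integral along the boundary of a rectangle, counterclockwise, with opposite sides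
    merged into one integrand. For an affine function these differences are constant. *)
Definition rect_int g x y h k : R[i] :=
  cint (fun t => g (t +i* y) - g (t +i* (y + k))) x (x + h) +
  'i%C * cint (fun t => g ((x + h) +i* t) - g (x +i* t)) y (y + k).

Definition holo_rect g x y h k :=
  forall s t, x <= s <= x + h -> y <= t <= y + k -> holo g (s +i* t).

Lemma cnorm_rect_dist (x y x' y' : R) :
  cnorm ((x +i* y) - (x' +i* y')) <= `|x - x'| + `|y - y'|.
Proof. exact: cnorm_le_ReIm. Qed.

Lemma rcont_horizontal g a b y : (forall s, a <= s <= b -> holo g (s +i* y)) ->
  rcont_on (fun t => g (t +i* y)) a b.
Proof.
move=> hg t /hg/holo_cont gt e e0; have [d d0 h] := gt e e0; exists d => // s sd.
by apply: h; rewrite (le_lt_trans (cnorm_rect_dist _ _ _ _))// subrr normr0 addr0.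
Qed.

Lemma rcont_vertical g a b x : (forall s, a <= s <= b -> holo g (x +i* s)) ->
  rcont_on (fun t => g (x +i* t)) a b.
Proof.
move=> hg t /hg/holo_cont gt e e0; have [d d0 h] := gt e e0; exists d => // s sd.
by apply: h; rewrite (le_lt_trans (cnorm_rect_dist _ _ _ _))// subrr normr0 add0r.
Qed.

Lemma rect_int_bisect g x y h k : 0 <= h -> 0 <= k -> holo_rect g x y (h + h) (k + k) ->
  rect_int g x y (h + h) (k + k) = rect_int g x y h k + rect_int g (x + h) y h k +
    rect_int g x (y + k) h k + rect_int g (x + h) (y + k) h k.
Proof.
move=> h0 k0 hg; rewrite /rect_int !addrA.
have H t a b : y <= t <= y + k + k -> x <= a -> b <= x + h + h ->
    rcont_on (fun s => g (s +i* t)) a b.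
  move=> tk xa bx; apply: rcont_horizontal => s /andP[sa sb]; apply: hg.
    by rewrite (le_trans xa)//= (le_trans sb)// addrA.
  by rewrite addrA.
have V s a b : x <= s <= x + h + h -> y <= a -> b <= y + k + k ->
    rcont_on (fun t => g (s +i* t)) a b.
  move=> sh ya by_; apply: rcont_vertical => t /andP[sa sb]; apply: hg.
    by rewrite addrA.
  by rewrite (le_trans ya)//= (le_trans sb)// addrA.
have SH t : y <= t <= y + k + k -> cint (fun s => g (s +i* t)) x (x + h + h) =
    cint (fun s => g (s +i* t)) x (x + h) + cint (fun s => g (s +i* t)) (x + h) (x + h + h).
  by move=> ty; apply: cint_split; [lra|apply: H; lra].
have SV s : x <= s <= x + h + h -> cint (fun t => g (s +i* t)) y (y + k + k) =
    cint (fun t => g (s +i* t)) y (y + k) + cint (fun t => g (s +i* t)) (y + k) (y + k + k).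
  by move=> ty; apply: cint_split; [lra|apply: V; lra].
rewrite !cintB; [|first [apply: H; lra|apply: V; lra] ..].
rewrite (SH y) ?(SH (y + k + k)) ?(SV x) ?(SV (x + h + h)); [idtac|lra ..]. ring.
Qed.

Lemma nested_intervals (u l : nat -> R) (c : R) :
  (forall n, u n <= u n.+1) -> (forall n, u n.+1 + l n.+1 <= u n + l n) ->
  (forall n, 0 <= l n) -> exists x, forall n, u n <= x <= u n + l n.
Proof.
move=> ui vd l0.
have um m n : u m <= u (m + n)%N.
  by elim: n => [|n IH]; rewrite ?addn0// addnS (le_trans IH).
have vm m n : u (m + n)%N + l (m + n)%N <= u m + l m.
  by elim: n => [|n IH]; rewrite ?addn0// addnS (le_trans (vd _)).
have uv m n : u m <= u n + l n.
  rewrite (le_trans (um m n))// (le_trans _ (vm n m))// addnC lerDl.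
  exact: l0.
have ub n : ubound [set u m | m in setT] (u n + l n) by move=> _ [m _ <-].
exists (sup [set u m | m in setT]) => n; apply/andP; split.
  by apply: ub_le_sup; [exists (u 0%N + l 0%N); exact: ub|exists n].
by apply: ge_sup => //; exists (u 0%N), 0%N.
Qed.

(** The affine approximation contributes nothing, since its two contributions [h * (- l * 'i * k)]
    and ['i * (k * (l * h))] cancel. What remains is an error [2 * e] on each pair of opposite
    sides, doubled by [cint_near]. *)
Lemma rect_int_small g x y h k (z l : R[i]) e : 0 <= h -> 0 <= k -> 0 <= e ->
  holo_rect g x y h k ->
  (forall s t, x <= s <= x + h -> y <= t <= y + k ->
    cnorm (g (s +i* t) - g z - l * ((s +i* t) - z)) <= e) ->
  cnorm (rect_int g x y h k) <= 4 * e * (h + k).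
Proof.
move=> h0 k0 e0 hg gl.
have c1 : cnorm (cint (fun t => g (t +i* y) - g (t +i* (y + k))) x (x + h) -
    (x + h - x)%:C * (- l * 'i%C * k%:C)) <= 2 * (2 * e) * (x + h - x).
  apply: cint_near; first lra.
    by apply: rcont_onB; apply: rcont_horizontal => s sx; apply: hg => //; lra.
  move=> t tx; have g1 := gl t y tx; have g2 := gl t (y + k) tx.
  have -> : g (t +i* y) - g (t +i* (y + k)) - - l * 'i%C * k%:C =
    (g (t +i* y) - g z - l * ((t +i* y) - z)) -
    (g (t +i* (y + k)) - g z - l * ((t +i* (y + k)) - z)).
    have -> : t +i* (y + k) = (t +i* y) + 'i%C * k%:C by simpc.
    by ring.
  have {}g1 := g1 ltac:(lra); have {}g2 := g2 ltac:(lra).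
  by rewrite (le_trans (cnormB _ _))//; lra.
have c2 : cnorm (cint (fun t => g ((x + h) +i* t) - g (x +i* t)) y (y + k) -
    (y + k - y)%:C * (l * h%:C)) <= 2 * (2 * e) * (y + k - y).
  apply: cint_near; first lra.
    by apply: rcont_onB; apply: rcont_vertical => s sx; apply: hg => //; lra.
  move=> t tx; have g1 := gl x t; have g2 := gl (x + h) t.
  have -> : g ((x + h) +i* t) - g (x +i* t) - l * h%:C =
    (g ((x + h) +i* t) - g z - l * (((x + h) +i* t) - z)) -
    (g (x +i* t) - g z - l * ((x +i* t) - z)).
    have -> : (x + h) +i* t = (x +i* t) + h%:C by simpc.
    by ring.
  have {}g1 := g1 ltac:(lra) tx; have {}g2 := g2 ltac:(lra) tx.
  by rewrite (le_trans (cnormB _ _))//; lra.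
have e1 (a b : R) : a + b - a = b by ring.
rewrite !e1 in c1 c2.
have -> : rect_int g x y h k =
  (cint (fun t => g (t +i* y) - g (t +i* (y + k))) x (x + h) -
    h%:C * (- l * 'i%C * k%:C)) +
  'i%C * (cint (fun t => g ((x + h) +i* t) - g (x +i* t)) y (y + k) - k%:C * (l * h%:C)).
  by rewrite /rect_int; ring.
rewrite (le_trans (cnormD _ _))// cnormM cnorm_i mul1r; lra.
Qed.

Lemma ler_dist_itv (a l s t : R) : a <= s <= a + l -> a <= t <= a + l -> `|s - t| <= l.
Proof. by move=> ss tt; rewrite ler_norml; apply/andP; split; lra. Qed.

Lemma sub_itv (a l b m s : R) : a <= b -> b + m <= a + l -> b <= s <= b + m ->
  a <= s <= a + l.
Proof. by move=> ab bm ss; apply/andP; split; lra. Qed.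

Lemma goursat g x y h k : 0 <= h -> 0 <= k -> holo_rect g x y h k ->
  rect_int g x y h k = 0.
Proof.
move=> h0 k0 hg.
pose H n : R := h / 2 ^+ n; pose K n : R := k / 2 ^+ n.
have p2 n : 0 < 2 ^+ n :> R by rewrite exprn_gt0.
have HS n : H n = H n.+1 + H n.+1.
  by rewrite /H exprS; field; rewrite gt_eqF.
have KS n : K n = K n.+1 + K n.+1.
  by rewrite /K exprS; field; rewrite gt_eqF.
have H0 n : 0 <= H n by rewrite divr_ge0// ltW.
have K0 n : 0 <= K n by rewrite divr_ge0// ltW.
pose inside n (q : R * R) := [/\ x <= q.1, q.1 + H n <= x + h, y <= q.2 & q.2 + K n <= y + k].
(* Stated for every [q], so that choice can build the sequence before [inside] is known for its
   members. If no quarter kept a fourth of the modulus, the four could not add up to the whole. *)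
have next n (q : R * R) : exists q' : R * R, inside n q ->
   [/\ q.1 <= q'.1, q'.1 + H n.+1 <= q.1 + H n, q.2 <= q'.2, q'.2 + K n.+1 <= q.2 + K n &
      cnorm (rect_int g q.1 q.2 (H n) (K n)) / 4 <=
      cnorm (rect_int g q'.1 q'.2 (H n.+1) (K n.+1))].
  have [iq|niq] := pselect (inside n q); last by exists q.
  case: iq => q1 q2 q3 q4.
  have := H0 n.+1; have := K0 n.+1; have := HS n; have := KS n => Ks Hs Kp Hp.
  have E := @rect_int_bisect g q.1 q.2 (H n.+1) (K n.+1) Hp Kp.
  rewrite -HS -KS in E.
  have hq : holo_rect g q.1 q.2 (H n) (K n) by move=> s t ss tt; apply: hg; lra.
  have {}E := E hq.
  apply: contrapT => no.
  have F q' : q.1 <= q'.1 -> q'.1 + H n.+1 <= q.1 + H n -> q.2 <= q'.2 ->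
      q'.2 + K n.+1 <= q.2 + K n ->
      cnorm (rect_int g q'.1 q'.2 (H n.+1) (K n.+1)) <
      cnorm (rect_int g q.1 q.2 (H n) (K n)) / 4.
    move=> a1 a2 a3 a4; rewrite ltNge; apply/negP => a5.
    by apply: no; exists q'.
  have F1 := F (q.1, q.2) ltac:(simpl; lra) ltac:(simpl; lra) ltac:(simpl; lra) ltac:(simpl; lra).
  have F2 := F (q.1 + H n.+1, q.2) ltac:(simpl; lra) ltac:(simpl; lra) ltac:(simpl; lra) ltac:(simpl; lra).
  have F3 := F (q.1, q.2 + K n.+1) ltac:(simpl; lra) ltac:(simpl; lra) ltac:(simpl; lra) ltac:(simpl; lra).
  have F4 := F (q.1 + H n.+1, q.2 + K n.+1) ltac:(simpl; lra) ltac:(simpl; lra) ltac:(simpl; lra) ltac:(simpl; lra).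
  rewrite /= in F1 F2 F3 F4.
  have := cnormD (rect_int g q.1 q.2 (H n.+1) (K n.+1) + rect_int g (q.1 + H n.+1) q.2 (H n.+1) (K n.+1) + rect_int g q.1 (q.2 + K n.+1) (H n.+1) (K n.+1))
    (rect_int g (q.1 + H n.+1) (q.2 + K n.+1) (H n.+1) (K n.+1)).
  have := cnormD (rect_int g q.1 q.2 (H n.+1) (K n.+1) + rect_int g (q.1 + H n.+1) q.2 (H n.+1) (K n.+1))
    (rect_int g q.1 (q.2 + K n.+1) (H n.+1) (K n.+1)).
  have := cnormD (rect_int g q.1 q.2 (H n.+1) (K n.+1)) (rect_int g (q.1 + H n.+1) q.2 (H n.+1) (K n.+1)).
  rewrite -E; lra.
pose nxt n q := projT1 (cid (next n q)).
have nxtP n q := projT2 (cid (next n q)).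
pose q := fix q n : R * R := if n is m.+1 then nxt m (q m) else (x, y).
have ins n : inside n (q n).
  elim: n => [|n IH]; first by rewrite /inside /H /K /= !expr0 !divr1.
  have [a1 a2 a3 a4 _] := nxtP _ _ IH; have [b1 b2 b3 b4] := IH.
  by split; [exact: le_trans b1 a1|exact: le_trans a2 b2|exact: le_trans b3 a3|
    exact: le_trans a4 b4].
have [X XP] := @nested_intervals (fun n => (q n).1) H 0
  (fun n => let: And5 a _ _ _ _ := nxtP _ _ (ins n) in a)
  (fun n => let: And5 _ a _ _ _ := nxtP _ _ (ins n) in a) H0.
have [Y YP] := @nested_intervals (fun n => (q n).2) K 0
  (fun n => let: And5 _ _ a _ _ := nxtP _ _ (ins n) in a)
  (fun n => let: And5 _ _ _ a _ := nxtP _ _ (ins n) in a) K0.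
have [i1 i2 i3 i4] := ins 0%N.
have XP0 := XP 0%N; have YP0 := YP 0%N; rewrite /H /K /= !expr0 !divr1 in XP0 YP0.
have [l gl] := hg X Y XP0 YP0.
apply: cnorm_inj_eq => e e0; rewrite subr0.
(* Choosing a quarter [n] times loses [4 ^+ n], which the two factors [H n + K n] in the bound for
   the small rectangle regain; it remains to ensure [4 * e' * (h + k) ^+ 2 <= e]. *)
pose e' := e / (4 * (h + k) ^+ 2 + 1).
have D0 : 0 < 4 * (h + k) ^+ 2 + 1 by have := sqr_ge0 (h + k); lra.
have e'0 : 0 < e' by rewrite divr_gt0.
have [d d0 gd] := gl _ e'0.
have [n nd] : exists n, H n + K n < d.
  have [n hn] : exists n, (h + k) / d < 2 ^+ n.
    have hd : 0 <= (h + k) / d by rewrite divr_ge0 ?addr_ge0// ltW.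
    exists (Num.bound ((h + k) / d)); rewrite (lt_trans (archi_boundP hd))//.
    by rewrite -natrX ltr_nat ltn_expl.
  exists n; have -> : H n + K n = (h + k) / 2 ^+ n by rewrite /H /K mulrDl.
  by move: hn; rewrite !ltr_pdivrMr// mulrC.
have mono m : cnorm (rect_int g x y h k) / 4 ^+ m <=
    cnorm (rect_int g (q m).1 (q m).2 (H m) (K m)).
  elim: m => [|m IH]; first by rewrite /H /K /= !expr0 !divr1.
  have [_ _ _ _] := nxtP _ _ (ins m); apply: le_trans.
  by rewrite exprSr invfM mulrA ler_pM2r.
have hk0 : 0 <= H n + K n by rewrite addr_ge0.
have [j1 j2 j3 j4] := ins n.
have hq : holo_rect g (q n).1 (q n).2 (H n) (K n).
  by move=> s t ss tt; apply: hg; [exact: sub_itv j1 j2 ss|exact: sub_itv j3 j4 tt].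
have small := @rect_int_small g (q n).1 (q n).2 (H n) (K n) (X +i* Y) l
  (e' * (H n + K n)) (H0 n) (K0 n) (mulr_ge0 (ltW e'0) hk0) hq.
have {}small : cnorm (rect_int g (q n).1 (q n).2 (H n) (K n)) <=
    4 * (e' * (H n + K n)) * (H n + K n).
  apply: small => s t ss tt.
  have st : cnorm ((s +i* t) - (X +i* Y)) <= H n + K n.
    rewrite (le_trans (cnorm_rect_dist _ _ _ _))//.
    by rewrite lerD// (ler_dist_itv ss (XP n), ler_dist_itv tt (YP n)).
  rewrite (le_trans (gd _ (le_lt_trans st nd)))//.
  by rewrite ler_pM2l.
move: small => /(le_trans (mono n)).
rewrite ler_pdivrMr ?exprn_gt0// => /le_trans; apply.
have -> : 4 * (e' * (H n + K n)) * (H n + K n) * 4 ^+ n = 4 * e' * (h + k) ^+ 2.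
  rewrite /H /K; have -> : 4 ^+ n = (2 ^+ n) ^+ 2 :> R by rewrite -exprM mulnC exprM; congr (_ ^+ n); rewrite -natrX.
  by field; rewrite gt_eqF.
have -> : 4 * e' * (h + k) ^+ 2 = e * (4 * (h + k) ^+ 2) / (4 * (h + k) ^+ 2 + 1).
  by rewrite /e'; field; rewrite gt_eqF.
by rewrite ler_pdivrMr//; have := sqr_ge0 (h + k); nra.
Qed.

End goursat.

(** * The maximum principle *)

Section real_eps.
Context {R : realType}.

Lemma is_derive_eps (f : R -> R) (a l e : R) : is_derive a 1 f l -> 0 < e ->
  exists2 d : R, 0 < d & forall t, `|t - a| < d -> `|f t - f a - l * (t - a)| <= e * `|t - a|.
Proof.
move=> fl e0.
have : (h^-1 *: ((f \o shift a) (h *: 1) - f a) @[h --> 0^']) --> l.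
  by have := @ex_derive _ _ _ _ _ _ _ fl; rewrite /derivable => /cvg_ex [l' fl'];
    have := @derive_val _ _ _ _ _ _ _ fl; rewrite /derive (cvg_lim _ fl')// => <-.
move/cvgrPdist_le => /(_ _ e0); rewrite near_withinE => /nbhs_ballP[d /= d0 h].
exists d => // t ta.
have [->|ta0] := eqVneq t a; first by rewrite !subrr mulr0 subr0 normr0 mulr0.
have hb : ball (0 : R) d (t - a) by rewrite /ball /= sub0r normrN.
have ta1 : t - a != 0 by rewrite subr_eq0.
have := h _ hb ta1.
rewrite /= scaler1 subrK -(@ler_pM2r _ `|t - a|) ?normr_gt0// -normrM.
apply: le_trans; rewrite -normrN le_eqVlt; apply/orP; left; apply/eqP.
congr (`| _ |); rewrite -[_ *: _]/(_ * _).
by field.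
Qed.

(** By Bernoulli's inequality [(x / y) ^+ n] is unbounded if [y < x]. This is the device by which
    multiplicative constants disappear: a bound that is off by a factor [C] is applied to all powers
    of a function. *)
Lemma le_of_exprn (x y C : R) : 0 <= x -> 0 <= y ->
  (forall n, x ^+ n <= C * y ^+ n) -> x <= y.
Proof.
move=> x0 y0 h; rewrite leNgt; apply/negP => yx.
have [y00|yn0] := eqVneq y 0.
  by have := h 1%N; rewrite y00 !expr1 mulr0; move: yx; rewrite y00; lra.
have yp : 0 < y by rewrite lt_neqAle eq_sym yn0.
pose d := x / y - 1.
have d0 : 0 < d by rewrite subr_gt0 ltr_pdivlMr// mul1r.
have B n : 1 + n%:R * d <= (x / y) ^+ n.
  elim: n => [|n IH]; first by rewrite expr0 mul0r addr0.
  have xE : x / y = 1 + d by rewrite /d addrC subrK.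
  rewrite exprS xE; rewrite xE in IH.
  have n0 : 0 <= n%:R * d by rewrite mulr_ge0 ?ler0n// ltW.
  rewrite -natr1; nra.
have C0 : 0 <= C / d.
  by rewrite divr_ge0 ?(ltW d0)//; have := h 0%N; rewrite !expr0; lra.
have /archi_boundP := C0; set n := Num.bound _.
rewrite ltr_pdivrMr// => Cn.
have := h n; rewrite -ler_pdivrMr ?exprn_gt0// -expr_div_n => hn.
have := B n; lra.
Qed.

End real_eps.

HB.lock Definition cexp {R : realType} (z : R[i]) : R[i] :=
  (expR (complex.Re z) * cos (complex.Im z)) +i* (expR (complex.Re z) * sin (complex.Im z)).

Section complex_exp.
Context {R : realType}.
Implicit Types (z w : R[i]).

Lemma cexpE (x y : R) : cexp (x +i* y) = (expR x * cos y) +i* (expR x * sin y).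
Proof. by rewrite cexp.unlock. Qed.

Lemma cexpD z w : cexp (z + w) = cexp z * cexp w.
Proof.
case: z => a b; case: w => c d.
have -> : (a +i* b) + (c +i* d) = (a + c) +i* (b + d) by [].
rewrite !cexpE expRD cosD sinD.
by apply/eqP; rewrite eq_complex /=; apply/andP; split; apply/eqP; ring.
Qed.

Lemma cnorm_cexp z : cnorm (cexp z) = expR (complex.Re z).
Proof.
apply/eqP; rewrite -(@eqrXn2 _ 2) ?cnorm_ge0 ?expR_ge0//; apply/eqP.
rewrite cnorm_sqr; case: z => a b; rewrite cexpE /= !exprMn -mulrDr.
by rewrite cos2Dsin2 mulr1.
Qed.

Lemma cexp0 : cexp 0 = 1 :> R[i].
Proof. by rewrite cexp.unlock /= expR0 cos0 sin0 !mul1r. Qed.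

Lemma cexp_2pi (x y : R) : cexp (x +i* (y + 2 * pi)) = cexp (x +i* y).
Proof.
by rewrite !cexpE mulr_natl cosD2pi sinD2pi.
Qed.

Lemma cderiv_cexp0 : cderiv (@cexp R) 0 1.
Proof.
move=> e e0.
(* Seven errors of size [e' * n] accumulate below, whence [e / 8]; [e' <= 1 / 2] keeps [expR u] at
   most 2. *)
have [e' [e'0 e'e e'1]] : exists e', [/\ 0 < e', e' <= e / 8 & e' <= 1 / 2].
  exists (Num.min (e / 8) (1 / 2)).
  by rewrite lt_min !divr_gt0//; split=> //; rewrite ge_min lexx ?orbT.
have [d1 d10 h1] := is_derive_eps (is_derive_expR (0 : R)) e'0.
have [d2 d20 h2] := is_derive_eps (is_derive_sin (0 : R)) e'0.
have [d3 d30 h3] := is_derive_eps (is_derive_cos (0 : R)) e'0.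
exists (Num.min (Num.min d1 e') (Num.min d2 d3)); first by rewrite !lt_min d10 e'0 d20.
move=> w; rewrite subr0 cexp0 mul1r; case: w => u t; rewrite !lt_min => /andP[/andP[w1 w2] /andP[w3 w4]].
have ul : `|u| <= cnorm (u +i* t) by exact: (ler_Re_cnorm (u +i* t)).
have tl : `|t| <= cnorm (u +i* t) by exact: (ler_Im_cnorm (u +i* t)).
have := h1 u; have := h2 t; have := h3 t.
rewrite !(subr0, expR0, cos0, sin0, oppr0, mul0r, addr0, mul1r).
move=> /(_ (le_lt_trans tl w4)) ct /(_ (le_lt_trans tl w3)) st /(_ (le_lt_trans ul w1)) eu.
have eu1 : `|expR u - 1| <= 2 * cnorm (u +i* t).
  rewrite -(subrK u (expR u - 1)) (le_trans (ler_normD _ _))//.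
  by have := normr_ge0 u; nra.
have eu2 : expR u <= 2.
  by move: eu1; rewrite ler_norml => /andP[_]; lra.
rewrite cexpE (le_trans (cnorm_le_ReIm _))//=.
have n0 := cnorm_ge0 (u +i* t); set n := cnorm _ in n0 ul tl eu1 *.
have er0 := expR_gt0 u.
have t0 := normr_ge0 t.
have k1 : `|expR u * cos t - 1 - u| <= 3 * e' * n.
  have -> : expR u * cos t - 1 - u = expR u * (cos t - 1) + (expR u - 1 - u) by ring.
  rewrite (le_trans (ler_normD _ _))// normrM gtr0_norm//.
  have : expR u * `|cos t - 1| <= 2 * (e' * n).
    by apply: ler_pM => //; rewrite (le_trans ct)// ler_pM2l.
  have : e' * `|u| <= e' * n by rewrite ler_pM2l.
  lra.
have k2 : `|expR u * sin t - 0 - t| <= 4 * e' * n.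
  have -> : expR u * sin t - 0 - t = expR u * (sin t - t) + (expR u - 1) * t by ring.
  rewrite (le_trans (ler_normD _ _))// !normrM gtr0_norm//.
  have : expR u * `|sin t - t| <= 2 * (e' * n).
    by apply: ler_pM => //; rewrite (le_trans st)// ler_pM2l.
  have : `|expR u - 1| * `|t| <= 2 * n * e'.
    apply: ler_pM => //; rewrite (le_trans tl)// ltW//.
  lra.
have : e' * n <= e / 8 * n by rewrite ler_wpM2r.
move=> k3; have k4 := mulr_ge0 (ltW e0) n0; apply: (le_trans (lerD k1 k2)); lra.
Qed.

Lemma cderiv_cexp z : cderiv cexp z (cexp z).
Proof.
have h : cderiv (fun w => cexp (w - z)) z 1.
  rewrite -[1]mulr1; apply: (@cderiv_comp _ cexp (fun w => w - z)).
    rewrite -[1]addr0 -(subr0 (1 + 0)) -[- 0]/(- 0 : R[i]) oppr0 addr0.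
    by apply: cderivD; [exact: cderiv_id|exact: cderiv_cst].
  by rewrite subrr; exact: cderiv_cexp0.
have := cderivM (cderiv_cst (cexp z) z) h; rewrite mul0r add0r mulr1.
apply: (@cderiv_eq _ _ _ _ _ 1) => // w _.
by rewrite -cexpD addrC subrK.
Qed.

End complex_exp.

Section max_principle.
Context {R : realType}.
Implicit Types (f : R[i] -> R[i]) (z w a : R[i]) (r M : R).

Definition holo_disk f r := forall z, cnorm z <= r -> holo f z.

(* Goursat's theorem for [f (r exp s)] on a long rectangle of height [2 pi], whose
   horizontal sides cancel by periodicity; the factor 2 disappears on passing to
   powers of [f]. *)
Lemma center_bound f r M : 0 < r -> holo_disk f r ->
  (forall z, cnorm z = r -> cnorm (f z) <= M) -> cnorm (f 0) <= 2 * M.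
Proof.
move=> r0 hf fM; apply/ler_addgt0Pr => e e0.
have e2 : 0 < e / 2 by rewrite divr_gt0.
have f0 : holo f 0 by apply: hf; rewrite cnorm0 ltW.
have [d d0 hd] := holo_cont f0 e2.
(* With this left end, the left side of the rectangle is mapped to a circle of radius less than [d],
   where [f] is within [e / 2] of [f 0]. The right side, at abscissa 0, is mapped to the circle of
   radius [r]. *)
pose u : R := Num.min 0 (ln (d / 2 / r)).
have u0 : u <= 0 by rewrite /u ge_min lexx.
have ud : r * expR u < d.
  rewrite mulrC -ltr_pdivlMr//.
  have : expR u <= d / 2 / r.
    by rewrite -[leRHS]lnK ?posrE ?divr_gt0// ler_expR /u ge_min lexx orbT.
  by move/le_lt_trans; apply; rewrite ltr_pM2r ?invr_gt0//; lra.
pose g z := f (r%:C * cexp z).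
have ng z : cnorm (r%:C * cexp z) = r * expR (complex.Re z).
  by rewrite cnormM cnorm_real gtr0_norm// cnorm_cexp.
have hg z : complex.Re z <= 0 -> holo g z.
  move=> z0; apply: (@holo_comp _ f (fun z => r%:C * cexp z)).
    by apply: holoM; [exact: holo_cst|exists (cexp z); exact: cderiv_cexp].
  by apply: hf; rewrite ng ger_pMr// -expR0 ler_expR.
have pi0 := pi_gt0 R.
have hr : holo_rect g u 0 (- u) (2 * pi).
  by move=> s t ss _; apply: hg => /=; lra.
have nu0 : 0 <= - u by lra.
have pi2 : 0 <= 2 * pi :> R by lra.
have := goursat nu0 pi2 hr.
have hH y : rcont_on (fun t => g (t +i* y)) u (u - u).
  by apply: rcont_horizontal => s ss; apply: hg => /=; lra.
have hV x : x <= 0 -> rcont_on (fun t => g (x +i* t)) 0 (0 + 2 * pi).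
  by move=> x0; apply: rcont_vertical => s ss; apply: hg.
have c1 : cnorm (cint (fun t => g (t +i* 0) - g (t +i* (0 + 2 * pi))) u (u - u)
    - (u - u - u)%:C * 0) <= 2 * 0 * (u - u - u).
  apply: cint_near; [lra|by apply: rcont_onB|move=> t _].
  by rewrite /g cexp_2pi !subrr cnorm0.
have c2 : cnorm (cint (fun t => g ((u - u) +i* t) - g (u +i* t)) 0 (0 + 2 * pi)
    - (0 + 2 * pi - 0)%:C * (- f 0)) <= 2 * (M + e / 2) * (0 + 2 * pi - 0).
  apply: cint_near; [lra|by apply: rcont_onB; apply: hV; lra|move=> t _].
  have -> : g ((u - u) +i* t) - g (u +i* t) - - f 0 = g ((u - u) +i* t) - (g (u +i* t) - f 0).
    by ring.
  rewrite (le_trans (cnormB _ _))// lerD//.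
    by apply: fM; rewrite ng /= subrr expR0 mulr1.
  by apply: hd; rewrite subr0 ng /=.
rewrite mulr0 subr0 mulr0 mul0r in c1.
have {}c1 : cint (fun t => g (t +i* 0) - g (t +i* (0 + 2 * pi))) u (u - u) = 0.
  by apply/eqP; rewrite -cnorm_eq0 eq_le c1 cnorm_ge0.
rewrite /rect_int c1 add0r => /eqP; rewrite mulf_eq0 => /orP[|/eqP c3].
  by rewrite -cnorm_eq0 cnorm_i oner_eq0.
move: c2; rewrite c3 sub0r cnormN cnormM cnormN cnorm_real add0r subr0 ger0_norm//.
by rewrite [leRHS]mulrC ler_pM2l; lra.
Qed.

Lemma center_max f r M : 0 < r -> holo_disk f r ->
  (forall z, cnorm z = r -> cnorm (f z) <= M) -> cnorm (f 0) <= M.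
Proof.
move=> r0 hf fM.
have M0 : 0 <= M.
  by apply: le_trans (fM r%:C _); rewrite ?cnorm_ge0// cnorm_real gtr0_norm.
apply: (@le_of_exprn _ _ _ 2) => //; first exact: cnorm_ge0.
move=> n; rewrite -cnormX; apply: (@center_bound (fun z => f z ^+ n) r) => //.
  by move=> z /hf; exact: holoX.
by move=> z /fM fz; rewrite cnormX; apply: lerXn2r fz; rewrite nnegrE ?cnorm_ge0.
Qed.

(** For [a] in the disk, the involutive automorphism of the disk that exchanges 0 and [a]. *)
Definition mobius a z := (a - z) / (1 - conjc a * z).

Lemma cnorm_conjc a : cnorm (conjc a) = cnorm a.
Proof. by case: a => x y; rewrite !cnormE /= sqrrN. Qed.

Lemma mobius_sqr a z :
  cnorm (1 - conjc a * z) ^+ 2 - cnorm (a - z) ^+ 2 =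
  (1 - cnorm a ^+ 2) * (1 - cnorm z ^+ 2).
Proof. by rewrite !cnorm_sqr; case: a => a b; case: z => x y /=; ring. Qed.

Lemma mobius_den_gt a z : cnorm z <= 1 -> 1 - cnorm a <= cnorm (1 - conjc a * z).
Proof.
move=> z1; apply: le_trans (cnormB_ge _ _); rewrite cnorm1 cnormM cnorm_conjc.
by rewrite lerD2l lerN2 ler_piMr ?cnorm_ge0.
Qed.

Lemma mobius_den_neq0 a z : cnorm a < 1 -> cnorm z <= 1 -> 1 - conjc a * z != 0.
Proof.
by move=> a1 /(@mobius_den_gt a) h; rewrite -cnorm_gt0; lra.
Qed.

Lemma mobius_norm a z : cnorm a < 1 -> cnorm z <= 1 ->
  1 - cnorm (mobius a z) ^+ 2 =
  (1 - cnorm a ^+ 2) * (1 - cnorm z ^+ 2) / cnorm (1 - conjc a * z) ^+ 2.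
Proof.
move=> a1 z1; have := mobius_den_neq0 a1 z1; rewrite -cnorm_gt0 => D0.
rewrite -mobius_sqr /mobius cnormM cnormV expr_div_n mulrBl divff//.
by rewrite gt_eqF// exprn_gt0.
Qed.

Lemma mobius_le1 a z : cnorm a < 1 -> cnorm z <= 1 -> cnorm (mobius a z) <= 1.
Proof.
move=> a1 z1; have := mobius_norm a1 z1 => E.
have n0 := cnorm_ge0 a; have n1 := cnorm_ge0 z; have n2 := cnorm_ge0 (mobius a z).
have : 0 <= 1 - cnorm (mobius a z) ^+ 2.
  rewrite E divr_ge0 ?sqr_ge0// mulr_ge0// subr_ge0 expr_le1//; exact: ltW.
by rewrite subr_ge0 expr_le1.
Qed.

Lemma mobius_eq1 a z : cnorm a < 1 -> cnorm z = 1 -> cnorm (mobius a z) = 1.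
Proof.
move=> a1 z1; have z1' : cnorm z <= 1 by rewrite z1.
have := mobius_norm a1 z1'.
rewrite z1 expr1n subrr mulr0 mul0r => /eqP; rewrite subr_eq0 eq_sym.
by rewrite pexpr_eq1 ?cnorm_ge0// => /eqP.
Qed.

Lemma holo_mobius a z : cnorm a < 1 -> cnorm z <= 1 -> holo (mobius a) z.
Proof.
move=> a1 z1; apply: holo_div; last exact: mobius_den_neq0.
  by apply: holoB; [exact: holo_cst|exact: holo_id].
apply: holoB; first exact: holo_cst.
by apply: holoM; [exact: holo_cst|exact: holo_id].
Qed.

Lemma mobius0 a : mobius a 0 = a.
Proof. by rewrite /mobius mulr0 !subr0 divr1. Qed.

(** With [a = z / r], the automorphism [mobius a] scaled by [r] carries the centre to [z], so that
    [center_max] applies at every interior point. *)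
Lemma max_principle f r M : 0 < r -> holo_disk f r ->
  (forall z, cnorm z = r -> cnorm (f z) <= M) ->
  forall z, cnorm z <= r -> cnorm (f z) <= M.
Proof.
move=> r0 hf fM z; rewrite le_eqVlt => /predU1P[/fM//|zr].
have rr : cnorm (r%:C) = r by rewrite cnorm_real gtr0_norm.
have rn0 : r%:C != 0 :> R[i] by rewrite -cnorm_gt0 rr.
pose a := z / r%:C.
have a1 : cnorm a < 1 by rewrite cnormM cnormV rr ltr_pdivrMr// mul1r.
have := @center_max (fun w => f (r%:C * mobius a w)) 1 M ltr01.
rewrite mobius0 /a mulrCA divff// mulr1; apply.
  move=> w w1; apply: (@holo_comp _ f (fun w => r%:C * mobius a w)).
    by apply: holoM; [exact: holo_cst|exact: holo_mobius].
  by apply: hf; rewrite cnormM rr ger_pMr// mobius_le1.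
by move=> w w1; apply: fM; rewrite cnormM rr mobius_eq1// mulr1.
Qed.

Lemma ccont_disk_bounded f r : 0 <= r -> (forall z, cnorm z <= r -> ccont f z) ->
  exists2 M, 0 < M & forall z, cnorm z <= r -> cnorm (f z) <= M.
Proof.
move=> r0 hf.
pose K : set (R * R) := `[- r, r]%classic `*` `[- r, r]%classic.
have cK : compact K by apply: compact_setX; exact: segment_compact.
have := cK => /compact_near_coveringP.
move=> /(_ R (pinfty_nbhs R) (fun (M : R) (w : R * R) => cnorm (w.1 +i* w.2) <= r -> cnorm (f (w.1 +i* w.2)) <= M)).
case.
  move=> [x y] _.
  have [xr|xr] := leP (cnorm (x +i* y)) r.
    have [d d0 hd] := ccont_bound (hf _ xr).
    have d2 : 0 < d / 2 by rewrite divr_gt0.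
    exists (ball ((x, y) : R * R) (d / 2), [set M | cnorm (f (x +i* y)) + 1 <= M]).
      split; first exact: nbhsx_ballx.
      by exists (cnorm (f (x +i* y)) + 1); split; [exact: num_real|move=> ? /ltW].
    move=> [[s t] M] /= [[b1 b2] hM] _.
    apply: le_trans hM; apply: hd; rewrite (le_lt_trans (cnorm_rect_dist _ _ _ _))//.
    by rewrite [ltRHS]splitr distrC ltrD// distrC.
  (* Points of the square outside the disk get a neighbourhood that misses the disk. *)
  have d2 : 0 < (cnorm (x +i* y) - r) / 2 by rewrite divr_gt0// subr_gt0.
  exists (ball ((x, y) : R * R) ((cnorm (x +i* y) - r) / 2), setT).
    by split; [exact: nbhsx_ballx|exact: filterT].
  move=> [[s t] M] /= [[b1 b2] _] st.
  have := cnormB_ge (x +i* y) (s +i* t); have := cnorm_rect_dist x y s t.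
  move: b1 b2; rewrite /ball /= => b1 b2; lra.
move=> M [_ hM]; exists (`|M| + 1); first by have := normr_ge0 M; lra.
move=> [x y] zr; have := hM (`|M| + 1).
have : M < `|M| + 1 by have := ler_norm M; lra.
move=> MM /(_ MM) /(_ (x, y)); apply => //.
have xl := le_trans (ler_Re_cnorm (x +i* y)) zr.
have yl := le_trans (ler_Im_cnorm (x +i* y)) zr.
by split; rewrite /= in_itv /= -ler_norml.
Qed.

Lemma disk_bounded f r : 0 <= r -> holo_disk f r ->
  exists2 M, 0 < M & forall z, cnorm z <= r -> cnorm (f z) <= M.
Proof. by move=> r0 hf; apply: ccont_disk_bounded => // z /hf/holo_cont. Qed.

End max_principle.

(** * Removable singularities and Taylor expansions *)

Definition locally_bounded {R : realType} (f : R[i] -> R[i]) p :=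
  exists B d : R, 0 < d /\ forall z, cnorm (z - p) < d -> z != p -> cnorm (f z) <= B.

(** At [c = b] the value is 0, by the convention on division, and not the derivative; the estimates
    therefore keep the points distinct. *)
Definition divdiff {R : realType} (f : R[i] -> R[i]) b c := (f c - f b) / (c - b).

(** The second divided difference. A local bound on it plays the part of a bound on the second
    derivative. *)
Definition divdiff2 {R : realType} (f : R[i] -> R[i]) b c z :=
  (divdiff f b z - divdiff f b c) / (z - c).

Section removable_singularities.
Context {R : realType}.
Implicit Types (f g F : R[i] -> R[i]) (z w a b c p : R[i]) (r M : R) (P : seq R[i]).

Lemma locally_bounded_holo f p : holo f p -> locally_bounded f p.
Proof.
by move=> /holo_cont/ccont_bound[d d0 h]; exists (cnorm (f p) + 1), d; split=> // z /h.
Qed.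

Lemma locally_boundedB f g p : locally_bounded f p -> locally_bounded g p ->
  locally_bounded (fun z => f z - g z) p.
Proof.
move=> [B [d [d0 h]]] [B' [d' [d'0 h']]]; exists (B + B'), (Num.min d d').
split; first by rewrite lt_min d0.
move=> z; rewrite lt_min => /andP[zd zd'] zp.
by rewrite (le_trans (cnormB _ _))// lerD ?h ?h'.
Qed.

Lemma locally_boundedM f g p : locally_bounded f p -> locally_bounded g p ->
  locally_bounded (fun z => f z * g z) p.
Proof.
move=> [B [d [d0 h]]] [B' [d' [d'0 h']]]; exists (B * B'), (Num.min d d').
split; first by rewrite lt_min d0.
move=> z; rewrite lt_min => /andP[zd zd'] zp.
by rewrite cnormM ler_pM ?cnorm_ge0 ?h ?h'.
Qed.

Lemma locally_bounded_divdiff f p : holo f p -> locally_bounded (divdiff f p) p.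
Proof.
move=> [l fl]; have [d d0 h] := fl _ ltr01.
exists (1 + cnorm l), d; split=> // z /h; rewrite mul1r => hz zp.
have z0 : 0 < cnorm (z - p) by rewrite cnorm_gt0 subr_eq0.
rewrite /divdiff cnormM cnormV ler_pdivrMr// mulrDl mul1r -cnormM.
rewrite -(subrK (l * (z - p)) (f z - f p)) (le_trans (cnormD _ _))//.
by rewrite lerD2r.
Qed.

Lemma holo_inv_sub c z : z != c -> holo (fun w => (w - c)^-1) z.
Proof.
by move=> zc; apply: holoV; [apply: holoB; [exact: holo_id|exact: holo_cst]|rewrite subr_eq0].
Qed.

Lemma holo_divdiff f b z : z != b -> holo f z -> holo (divdiff f b) z.
Proof.
move=> zb hf; apply: holoM; last exact: holo_inv_sub.
by apply: holoB => //; exact: holo_cst.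
Qed.

Lemma cderiv_quadratic F p (C d : R) : 0 < d ->
  (forall z, cnorm (z - p) < d -> cnorm (F z - F p) <= C * cnorm (z - p) ^+ 2) ->
  cderiv F p 0.
Proof.
move=> d0 h e e0; pose C' := `|C| + 1.
have C0 : 0 < C' by rewrite /C'; have := normr_ge0 C; lra.
exists (Num.min d (e / C')); first by rewrite lt_min d0 divr_gt0.
move=> z; rewrite lt_min => /andP[/h hz ze]; rewrite mul0r subr0.
apply: (le_trans hz); rewrite expr2 mulrA ler_wpM2r ?cnorm_ge0//.
have : C * cnorm (z - p) <= C' * cnorm (z - p).
  by rewrite ler_wpM2r ?cnorm_ge0// /C'; have := ler_norm C; lra.
by move: ze; rewrite ltr_pdivlMr// mulrC; lra.
Qed.

(* The factor [w] has a double zero at every exceptional point, so [w f^n] is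
   holomorphic everywhere; its influence on the bound disappears as n grows. *)
Lemma max_principle_except f P r M : 0 < r ->
  (forall z, cnorm z <= r -> z \notin P -> holo f z) ->
  (forall p, p \in P -> cnorm p < r /\ locally_bounded f p) ->
  (forall z, cnorm z = r -> cnorm (f z) <= M) ->
  forall z, cnorm z <= r -> z \notin P -> cnorm (f z) <= M.
Proof.
move=> r0 hf hP fM z0 z0r z0P.
have M0 : 0 <= M.
  by apply: le_trans (fM r%:C _); rewrite ?cnorm_ge0// cnorm_real gtr0_norm.
pose w z := \prod_(p <- P) (z - p) ^+ 2.
have hw z : holo w z.
  apply: holo_prod => p; apply: holoX; apply: holoB; [exact: holo_id|exact: holo_cst].
have wz0 : 0 < cnorm (w z0).
  rewrite cnorm_gt0 /w prodf_seq_neq0; apply/allP => p pP /=.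
  by rewrite expf_neq0// subr_eq0; apply: contraNneq z0P => ->.
have [W W0 wW] := @disk_bounded R w r (ltW r0) (fun z _ => hw z).
have hF n z : cnorm z <= r -> holo (fun z => w z * f z ^+ n) z.
  move=> zr; have [zP|zP] := boolP (z \in P); last first.
    by apply: holoM => //; apply: holoX; exact: hf.
  have wE y : w y = (y - z) ^+ 2 * \prod_(p <- rem z P) (y - p) ^+ 2.
    by rewrite /w (perm_big _ (perm_to_rem zP)) big_cons.
  have [_ [B [d [d0 fB]]]] := hP z zP.
  have hv : holo (fun y => \prod_(p <- rem z P) (y - p) ^+ 2) z.
    by apply: holo_prod => p; apply: holoX; apply: holoB; [exact: holo_id|exact: holo_cst].
  have [d' d'0 vB] := ccont_bound (holo_cont hv).
  set V := cnorm _ + 1 in vB.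
  exists 0; apply: (@cderiv_quadratic _ _ (V * `|B| ^+ n) (Num.min d d')).
    by rewrite lt_min d0.
  move=> y; rewrite lt_min => /andP[yd yd']; rewrite !wE subrr expr0n !mul0r subr0.
  have [->|yz] := eqVneq y z; first by rewrite subrr expr0n !mul0r cnorm0 expr0n mulr0.
  rewrite !cnormM !cnormX -[leLHS]mulrA [leLHS]mulrC.
  rewrite ler_wpM2r ?mulr_ge0 ?exprn_ge0 ?cnorm_ge0//.
  rewrite ler_pM ?cnorm_ge0 ?exprn_ge0 ?cnorm_ge0 ?vB//.
  apply: lerXn2r; rewrite ?nnegrE ?cnorm_ge0//.
  by apply: le_trans (ler_norm B); exact: fB.
apply: (@le_of_exprn _ _ _ (W / cnorm (w z0))) => //; first exact: cnorm_ge0.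
move=> n; rewrite mulrAC ler_pdivlMr// mulrC -cnormX -cnormM.
apply: (max_principle r0 (hF n)) => // z zr.
have zr' : cnorm z <= r by rewrite zr.
rewrite cnormM cnormX ler_pM ?cnorm_ge0 ?exprn_ge0 ?cnorm_ge0 ?wW//.
by apply: lerXn2r; rewrite ?nnegrE ?cnorm_ge0// fM.
Qed.

(** The maximum principle is applied twice. On the circle of radius [r] the quotient [divdiff f b]
    is at most [2 * M / (r - s)], and it is locally bounded at its new exceptional point [b]. The
    same argument with [b] and [c] exceptional yields another factor [2 / (r - s)]. The list [P]
    leaves room for a singularity of [f] itself. *)
Lemma divdiff2_bound f P r s M b c z : 0 < s < r ->
  (forall z, cnorm z <= r -> z \notin P -> holo f z) ->
  (forall p, p \in P -> cnorm p < r /\ locally_bounded f p) ->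
  (forall z, cnorm z = r -> cnorm (f z) <= M) ->
  cnorm b <= s -> cnorm c <= s -> cnorm z <= s ->
  b != c -> z != b -> z != c -> b \notin P -> c \notin P -> z \notin P ->
  cnorm (divdiff2 f b c z) <= 4 * M / (r - s) ^+ 2.
Proof.
move=> /andP[s0 sr] hf hP fM bs cs zs bc zb zc bP cP zP.
have r0 : 0 < r by lra.
have rs0 : 0 < r - s by lra.
have fb : cnorm (f b) <= M by apply: (max_principle_except r0 hf hP fM) => //; lra.
have M0 : 0 <= M by rewrite (le_trans _ fb)// cnorm_ge0.
have hfb : holo f b by apply: hf => //; lra.
have hfc : holo f c by apply: hf => //; lra.
have cb : c != b by rewrite eq_sym.
have lb g p : p != c -> locally_bounded g p -> locally_bounded (fun z => (g z - divdiff f b c) / (z - c)) p.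
  move=> pc lg; apply: locally_boundedM.
    by apply: locally_boundedB => //; apply: locally_bounded_holo; exact: holo_cst.
  by apply: locally_bounded_holo; exact: holo_inv_sub.
have h1 : forall z, cnorm z <= r -> z \notin b :: P -> holo (divdiff f b) z.
  by move=> y yr; rewrite inE negb_or => /andP[yb yP]; apply: holo_divdiff => //; exact: hf.
have hP1 p : p \in P -> locally_bounded (divdiff f b) p.
  move=> pP; apply: locally_boundedM.
    by apply: locally_boundedB; [have [] := hP p pP|apply: locally_bounded_holo; exact: holo_cst].
  by apply: locally_bounded_holo; apply: holo_inv_sub; apply: contraNneq bP => <-.
have h2 : forall p, p \in b :: P -> cnorm p < r /\ locally_bounded (divdiff f b) p.
  move=> p; rewrite inE => /predU1P[->|pP].
    by split; [lra|exact: locally_bounded_divdiff].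
  by split; [have [] := hP p pP|exact: hP1].
have dist y x : cnorm y = r -> cnorm x <= s -> r - s <= cnorm (y - x).
  by move=> yr xs; have := cnormB_ge y x; lra.
have h3 : forall z, cnorm z = r -> cnorm (divdiff f b z) <= 2 * M / (r - s).
  move=> y yr; rewrite /divdiff cnormM cnormV.
  rewrite ler_pM ?cnorm_ge0 ?invr_ge0 ?cnorm_ge0//.
    by rewrite (le_trans (cnormB _ _))//; have := fM y yr; lra.
  rewrite lef_pV2 ?posrE//; first exact: dist.
  by apply: lt_le_trans (dist _ _ yr bs).
have hbc : cnorm (divdiff f b c) <= 2 * M / (r - s).
  by apply: (max_principle_except r0 h1 h2 h3); [lra|rewrite inE negb_or cb].
apply: (@max_principle_except (divdiff2 f b c) [:: b, c & P] r) => //.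
- move=> y yr; rewrite !inE !negb_or => /and3P[yb yc yP].
  apply: holoM; last exact: holo_inv_sub.
  by apply: holoB; [apply: h1 => //; rewrite inE negb_or yb|exact: holo_cst].
- move=> p; rewrite !inE => /or3P[/eqP->|/eqP->|pP].
  + by split; [lra|apply: lb => //; exact: locally_bounded_divdiff].
  + split; first lra.
    exact: (locally_bounded_divdiff (holo_divdiff cb hfc)).
  + split; first by have [] := hP p pP.
    by apply: lb; [apply: contraNneq cP => <-|exact: hP1].
- move=> y yr; rewrite /divdiff2 cnormM cnormV.
  have -> : 4 * M / (r - s) ^+ 2 = (2 * M / (r - s) + 2 * M / (r - s)) / (r - s).
    by field; rewrite gt_eqF.
  rewrite ler_pM ?cnorm_ge0 ?invr_ge0 ?cnorm_ge0//.
    by rewrite (le_trans (cnormB _ _))// lerD// h3.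
  rewrite lef_pV2 ?posrE//; first exact: dist.
  by apply: lt_le_trans (dist _ _ yr cs).
- lra.
- by rewrite !inE !negb_or zb zc.
Qed.

(** The intervals of centre [u n] and radius [e n] meet pairwise, so the supremum of their left ends
    lies in all of them. The rate of convergence thus comes with the limit. *)
Lemma real_limit (u e : nat -> R) : (forall m n, `|u m - u n| <= e m + e n) ->
  exists l, forall n, `|u n - l| <= e n.
Proof.
move=> h; pose E := [set u n - e n | n in [set: nat]].
have ub n : ubound E (u n + e n).
  by move=> _ [m _ <-]; have := h m n; rewrite ler_norml => /andP[]; lra.
exists (sup E) => n.
have h1 : u n - e n <= sup E.
  by apply: ub_le_sup; [exists (u 0%N + e 0%N); exact: ub|exists n].
have h2 : sup E <= u n + e n by apply: ge_sup => //; exists (u 0%N - e 0%N), 0%N.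
by rewrite ler_norml; apply/andP; split; lra.
Qed.

Lemma complex_limit (u : nat -> R[i]) (e : nat -> R) :
  (forall m n, cnorm (u m - u n) <= e m + e n) ->
  exists l, forall n, cnorm (u n - l) <= 2 * e n.
Proof.
move=> h.
have [x hx] := @real_limit (fun n => complex.Re (u n)) e
  (fun m n => le_trans (Re_dist _ _) (h m n)).
have [y hy] := @real_limit (fun n => complex.Im (u n)) e
  (fun m n => le_trans (Im_dist _ _) (h m n)).
exists (x +i* y) => n; rewrite (le_trans (cnorm_le_ReIm _))//.
have := hx n; have := hy n; case: (u n) => s t /=; lra.
Qed.

Lemma divdiffC f b c : divdiff f b c = divdiff f c b.
Proof. by rewrite /divdiff -opprB -(opprB b c) invrN mulrNN. Qed.

End removable_singularities.

Definition cder {R : realType} (f : R[i] -> R[i]) z := xget 0 [set l | cderiv f z l].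

Section holomorphy_criteria.
Context {R : realType}.
Implicit Types (f g F : R[i] -> R[i]) (z w a b c p : R[i]) (r M : R).

Lemma divdiff_lip f (C : R) b c z : 0 <= C -> z != c ->
  cnorm (divdiff2 f b c z) <= C ->
  cnorm (divdiff f b z - divdiff f b c) <= C * cnorm (z - c).
Proof.
move=> C0 zc; rewrite /divdiff2 cnormM cnormV ler_pdivrMr//.
by rewrite cnorm_gt0 subr_eq0.
Qed.

Lemma exists_small_pos (d B e : R) : 0 < d -> 0 <= B -> 0 < e ->
  exists2 t : R, 0 < t < d & B * t <= e.
Proof.
move=> d0 B0 e0; exists (Num.min (d / 2) (e / (B + 1))).
  by rewrite lt_min !divr_gt0 ?gt_min//=; [apply/orP; left|]; lra.
have B1 : 0 < B + 1 by lra.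
apply: (@le_trans _ _ (B * (e / (B + 1)))); first by rewrite ler_wpM2l// ge_min lexx orbT.
by rewrite mulrA ler_pdivrMr//; nra.
Qed.

(** By the bound, first divided differences are Lipschitz in each argument, hence have a limit [l]
    as both arguments tend to [a]. Since the arguments avoid [a], it is continuity at [a] that
    identifies [l] as the derivative. *)
Lemma holo_of_divdiff2 f a (C d : R) : 0 <= C -> 0 < d -> ccont f a ->
  (forall b c z, cnorm (b - a) < d -> cnorm (c - a) < d -> cnorm (z - a) < d ->
    b != a -> c != a -> z != a -> b != c -> z != b -> z != c ->
    cnorm (divdiff2 f b c z) <= C) -> holo f a.
Proof.
move=> C0 d0 ca H.
pose D b c := cnorm (b - a) < d /\ b != a /\ cnorm (c - a) < d /\ c != a /\ b != c.
have h1 b c c' : D b c -> D b c' ->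
    cnorm (divdiff f b c - divdiff f b c') <= C * (cnorm (c - a) + cnorm (c' - a)).
  move=> [bd [ba [cd [ca' bc]]]] [_ [_ [cd' [ca'' bc']]]].
  have [->|cc] := eqVneq c c'.
    by rewrite subrr cnorm0 mulr_ge0// addr_ge0 ?cnorm_ge0.
  have cb : c != b by rewrite eq_sym.
  have := divdiff_lip C0 cc (H b c' c bd cd' cd ba ca'' ca' bc' cb cc).
  move/le_trans; apply; rewrite ler_wpM2l//.
  by rewrite (le_trans (cdist_trans a _ _))// (cdistC a).
have h2 b c b' c' : D b c -> D b' c' -> cnorm (divdiff f b c - divdiff f b' c') <=
    C * (cnorm (b - a) + cnorm (c - a) + (cnorm (b' - a) + cnorm (c' - a))).
  move=> Dbc Dbc'.
  have [bd [ba [cd [ca' bc]]]] := Dbc; have [bd' [ba' [cd' [ca'' bc']]]] := Dbc'.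
  (* The chain from [(b, c)] through [(b, c')] to [(b', c')] breaks down if [b = c']; symmetry then
     makes both divided differences share the argument [b]. *)
  have [bc2|bc2] := eqVneq b c'.
    rewrite (divdiffC f b') -bc2.
    have Db : D b b' by split=> //; split=> //; split=> //; split=> //; rewrite bc2 eq_sym.
    apply: (le_trans (h1 _ _ _ Dbc Db)); rewrite ler_wpM2l//.
    by have := cnorm_ge0 (b - a); lra.
  have D1 : D b c' by [].
  have D2 : D c' b by split=> //; split=> //; split=> //; split=> //; rewrite eq_sym.
  have D3 : D c' b' by split=> //; split=> //; split=> //; split=> //; rewrite eq_sym.
  have k1 := h1 _ _ _ Dbc D1; have k2 := h1 _ _ _ D2 D3.
  rewrite (le_trans (cdist_trans (divdiff f b c') _ _))//.
  rewrite (divdiffC f b') {2}(divdiffC f b c') !mulrDr.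
  by move: k1 k2; rewrite !mulrDr; lra.
(* The symmetric pairs [a + t n], [a - t n] consist of points distinct from [a] and from each
   other. *)
pose t n : R := d / 2 / n.+1%:R.
have t0 n : 0 < t n by rewrite !divr_gt0// ltr0n.
have td n : t n < d.
  rewrite /t ltr_pdivrMr ?ltr0n//; have : 1 <= n.+1%:R :> R by rewrite ler1n.
  nra.
have nt n : cnorm (a + (t n)%:C - a) = t n.
  by rewrite addrC addKr cnorm_real gtr0_norm.
have nt' n : cnorm (a - (t n)%:C - a) = t n.
  by rewrite addrC addKr cnormN cnorm_real gtr0_norm.
have Dn n : D (a + (t n)%:C) (a - (t n)%:C).
  split; first by rewrite nt.
  split; first by rewrite -subr_eq0 -cnorm_gt0 nt.
  split; first by rewrite nt'.
  split; first by rewrite -subr_eq0 -cnorm_gt0 nt'.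
  rewrite -subr_eq0 opprB addrC addrA subrK -cnorm_gt0 -rmorphD cnorm_real.
  by rewrite gtr0_norm ?addr_gt0.
pose u n := divdiff f (a + (t n)%:C) (a - (t n)%:C).
have hu m n : cnorm (u m - u n) <= 2 * C * t m + 2 * C * t n.
  by have := h2 _ _ _ _ (Dn m) (Dn n); rewrite !nt !nt' -/(u m) -/(u n); lra.
have [l hl] := complex_limit hu.
have h3 b c : D b c -> cnorm (divdiff f b c - l) <= C * (cnorm (b - a) + cnorm (c - a)).
  move=> Dbc; apply/ler_addgt0Pr => e e0.
  have [n tn] : exists n, 6 * C * t n <= e.
    have k0 : 0 <= 6 * C * (d / 2) / e by rewrite divr_ge0 ?mulr_ge0 ?divr_ge0// ltW.
    exists (Num.bound (6 * C * (d / 2) / e)).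
    have := archi_boundP k0; set N := Num.bound _.
    rewrite ltr_pdivrMr// => kN; rewrite /t mulrA ler_pdivrMr ?ltr0n//.
    by rewrite -(@natr1 _ N) mulrDr mulr1; lra.
  have := h2 _ _ _ _ Dbc (Dn n); rewrite nt nt' => k1; have k2 := hl n.
  rewrite (le_trans (cdist_trans (u n) _ _))//; rewrite -/(u n) in k1; lra.
have key z : cnorm (z - a) < d -> cnorm (f z - f a - l * (z - a)) <= 3 * C * cnorm (z - a) ^+ 2.
  move=> zd; have [->|za] := eqVneq z a.
    by rewrite !subrr mulr0 subr0 cnorm0 expr0n mulr0.
  have nz : 0 < cnorm (z - a) by rewrite cnorm_gt0 subr_eq0.
  apply/ler_addgt0Pr => e e0; have e2 : 0 < e / 2 by rewrite divr_gt0.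
  have [d' d'0 fd'] := ca _ e2.
  have mn0 : 0 < Num.min d' (cnorm (z - a) / 2) by rewrite lt_min d'0 divr_gt0.
  have [x /andP[x0 xm] xl] := exists_small_pos mn0 (cnorm_ge0 l) e2.
  move: xm; rewrite lt_min => /andP[xd' xz].
  have nx : cnorm (a + x%:C - a) = x by rewrite addrC addKr cnorm_real gtr0_norm.
  have Dz : D z (a + x%:C).
    split=> //; split=> //; split; first by rewrite nx; lra.
    split; first by rewrite -subr_eq0 -cnorm_gt0 nx.
    by apply/eqP => zE; move: xz; rewrite zE nx; lra.
  have [_ [_ [_ [_ zx]]]] := Dz.
  have fx := fd' (a + x%:C); rewrite nx in fx; have {}fx := fx xd'.
  have -> : f z - f a - l * (z - a) =
      (divdiff f z (a + x%:C) - l) * (z - (a + x%:C)) + (f (a + x%:C) - f a) - l * x%:C.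
    rewrite /divdiff; field.
    by rewrite -[a + _ - z]opprB oppr_eq0 subr_eq0.
  have k3 := h3 _ _ Dz; rewrite nx in k3.
  have zl : cnorm (z - (a + x%:C)) <= 3 / 2 * cnorm (z - a).
    rewrite (le_trans (cdist_trans a _ _))// [X in _ + X]cdistC nx; lra.
  have k4 : cnorm ((divdiff f z (a + x%:C) - l) * (z - (a + x%:C))) <=
      C * (cnorm (z - a) + cnorm (z - a)) * (3 / 2 * cnorm (z - a)).
    rewrite cnormM ler_pM ?cnorm_ge0// (le_trans k3)// ler_wpM2l//; lra.
  rewrite (le_trans (cnormB _ _))// cnormM cnorm_real gtr0_norm//.
  rewrite (le_trans (lerD (cnormD _ _) (lexx _)))//.
  by rewrite expr2; lra.
have hF : holo (fun z => f z - l * (z - a)) a.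
  exists 0; apply: (@cderiv_quadratic _ _ _ (3 * C) d) => // z zd.
  by rewrite subrr mulr0 subr0 addrAC; exact: key.
apply: (@holo_eq _ (fun z => (f z - l * (z - a)) + l * (z - a)) _ _ 1) => //.
  by move=> z _; rewrite subrK.
apply: holoD => //; apply: holoM; first exact: holo_cst.
by apply: holoB; [exact: holo_id|exact: holo_cst].
Qed.

(** Here the exceptional set of [divdiff2_bound] is [[:: a]]: second divided differences at points
    other than [a] are bounded, and [holo_of_divdiff2] concludes. *)
Lemma removable_singularity f r a : 0 < r -> cnorm a < r ->
  (forall z, cnorm z <= r -> z != a -> holo f z) -> ccont f a -> holo f a.
Proof.
move=> r0 ar hf ca.
have cf z : cnorm z <= r -> ccont f z.
  by move=> zr; have [->//|za] := eqVneq z a; apply: holo_cont; exact: hf.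
have [M M0 fM] := ccont_disk_bounded (ltW r0) cf.
pose s := (cnorm a + r) / 2.
have a0 := cnorm_ge0 a.
have sr : 0 < s < r by apply/andP; rewrite /s; split; lra.
have [s1 s2] := andP sr.
apply: (@holo_of_divdiff2 f a (4 * M / (r - s) ^+ 2) (s - cnorm a)) => //.
- by rewrite divr_ge0 ?sqr_ge0 ?mulr_ge0// ltW.
- by rewrite /s; lra.
move=> b c z bd cd zd ba ca' za bc zb zc.
have ns y : cnorm (y - a) < s - cnorm a -> cnorm y <= s.
  by move=> h; have := cnormD (y - a) a; rewrite subrK; lra.
apply: (@divdiff2_bound _ f [:: a] r s M) => //; rewrite ?inE//; try exact: ns.
- by move=> y yr; rewrite inE; exact: hf.
- move=> p; rewrite inE => /eqP->; split=> //.
  by have [d d0 h] := ccont_bound ca; exists (cnorm (f a) + 1), d; split=> // y /h.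
- by move=> y yr; apply: fM; rewrite yr.
Qed.

Lemma divdiff2B f g b c z :
  divdiff2 (fun z => f z - g z) b c z = divdiff2 f b c z - divdiff2 g b c z.
Proof. by rewrite /divdiff2 /divdiff; ring. Qed.

Lemma divdiff2_trivial_bound h e b c z : 
  (forall y, y \in [:: b; c; z] -> cnorm (h y) <= e) ->
  cnorm (divdiff2 h b c z) <= e * (2 * (cnorm (z - b))^-1 + 2 * (cnorm (c - b))^-1) / cnorm (z - c).
Proof.
move=> he; have hb := he b; have hc := he c; have hz := he z.
rewrite !inE !eqxx ?orbT /= in hb hc hz.
have {}hb := hb isT; have {}hc := hc isT; have {}hz := hz isT.
rewrite /divdiff2 /divdiff cnormM cnormV ler_wpM2r ?invr_ge0 ?cnorm_ge0//.
rewrite (le_trans (cnormB _ _))// !cnormM !cnormV mulrDr lerD// mulrA.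
  by rewrite ler_wpM2r ?invr_ge0 ?cnorm_ge0// (le_trans (cnormB _ _))//; lra.
by rewrite ler_wpM2r ?invr_ge0 ?cnorm_ge0// (le_trans (cnormB _ _))//; lra.
Qed.

(** For three fixed points the second divided difference depends continuously on the three values,
    so the bound shared by the approximants passes to [F]. *)
Lemma weierstrass F r : 0 < r ->
  (forall e, 0 < e -> exists2 g, holo_disk g r &
    forall z, cnorm z <= r -> cnorm (g z - F z) <= e) ->
  forall z, cnorm z < r -> holo F z.
Proof.
move=> r0 hF a ar.
have cF : ccont F a.
  move=> e e0; have e3 : 0 < e / 3 by rewrite divr_gt0.
  have [g hg gF] := hF _ e3.
  have [d d0 gd] := holo_cont (hg a (ltW ar)) e3.
  exists (Num.min d (r - cnorm a)); first by rewrite lt_min d0 subr_gt0.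
  move=> w; rewrite lt_min => /andP[/gd wd wr].
  have wr' : cnorm w <= r by have := cnormD (w - a) a; rewrite subrK; lra.
  have k1 := gF w wr'; have k2 := gF a (ltW ar).
  have -> : F w - F a = (g w - g a) - (g w - F w) + (g a - F a) by ring.
  by rewrite (le_trans (cnormD _ _))// (le_trans (lerD (cnormB _ _) (lexx _)))//; lra.
(* One approximant bounds [F] by [M + 1], and then every approximant with error at most 1 is bounded
   by [M + 2] on the circle. *)
have [g1 hg1 g1F] := hF 1 ltr01.
have [M M0 g1M] := disk_bounded (ltW r0) hg1.
have FM z : cnorm z <= r -> cnorm (F z) <= M + 1.
  move=> zr; have -> : F z = g1 z - (g1 z - F z) by ring.
  by rewrite (le_trans (cnormB _ _))// lerD ?g1M ?g1F.
pose s := (cnorm a + r) / 2.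
have a0 := cnorm_ge0 a.
have sr : 0 < s < r by apply/andP; rewrite /s; split; lra.
have [s1 s2] := andP sr.
apply: (@holo_of_divdiff2 F a (4 * (M + 2) / (r - s) ^+ 2) (s - cnorm a)) => //.
- by rewrite divr_ge0 ?sqr_ge0 ?mulr_ge0//; lra.
- by rewrite /s; lra.
move=> b c z bd cd zd ba ca' za bc zb zc.
have ns y : cnorm (y - a) < s - cnorm a -> cnorm y <= s.
  by move=> h; have := cnormD (y - a) a; rewrite subrK; lra.
apply/ler_addgt0Pr => e e0.
pose K := (2 * (cnorm (z - b))^-1 + 2 * (cnorm (c - b))^-1) / cnorm (z - c).
have K0 : 0 <= K.
  by rewrite divr_ge0 ?cnorm_ge0// addr_ge0// mulr_ge0// invr_ge0 cnorm_ge0.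
have [x /andP[x0 x1] xe] := exists_small_pos ltr01 K0 e0.
have [g hg gF] := hF _ x0.
have gM y : cnorm y = r -> cnorm (g y) <= M + 2.
  move=> yr; have yr' : cnorm y <= r by rewrite yr.
  have := FM y yr'; have := gF y yr'; have := cnormD (g y - F y) (F y).
  by rewrite subrK; lra.
have k1 : cnorm (divdiff2 g b c z) <= 4 * (M + 2) / (r - s) ^+ 2.
  apply: (@divdiff2_bound _ g [::] r s (M + 2)) => //; try exact: ns.
  by move=> y yr _; exact: hg.
have k2 : cnorm (divdiff2 (fun y => g y - F y) b c z) <= x * K.
  rewrite /K mulrA; apply: divdiff2_trivial_bound => y.
  rewrite !inE => /or3P[]/eqP->; apply: gF.
  - by have := ns b bd; lra.
  - by have := ns c cd; lra.
  - by have := ns z zd; lra.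
have -> : divdiff2 F b c z = divdiff2 g b c z - divdiff2 (fun y => g y - F y) b c z.
  by rewrite divdiff2B; ring.
by rewrite (le_trans (cnormB _ _))// lerD// (le_trans k2)// mulrC.
Qed.

Lemma cderP f z : holo f z -> cderiv f z (cder f z).
Proof. by move=> [l fl]; exact: (@xgetI _ 0 [set l | cderiv f z l] l fl). Qed.

Lemma cder_eq f z l : cderiv f z l -> cder f z = l.
Proof. by move=> fl; apply: (cderiv_uniq _ fl); apply: cderP; exists l. Qed.

(** Difference quotients with a fixed real step [x] are holomorphic and, being Lipschitz in the
    step, uniformly within [C * x] of the derivative, so that [weierstrass] applies. The radii
    [s < s' < r] leave room for the step. *)
Lemma holo_cder f r : 0 < r -> holo_disk f r -> forall z, cnorm z < r -> holo (cder f) z.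
Proof.
move=> r0 hf a ar.
have [M M0 fM] := disk_bounded (ltW r0) hf.
pose s := (cnorm a + r) / 2.
have a0 := cnorm_ge0 a.
have sr : 0 < s < r by apply/andP; rewrite /s; split; lra.
have [s1 s2] := andP sr.
have as_ : cnorm a < s by rewrite /s; lra.
pose s' := (s + r) / 2.
have sr' : 0 < s' < r by apply/andP; rewrite /s'; split; lra.
have ss' : s < s' by rewrite /s'; lra.
apply: (@weierstrass (cder f) s) => // e e0.
pose C := 4 * M / (r - s') ^+ 2.
have C0 : 0 <= C by rewrite divr_ge0 ?sqr_ge0 ?mulr_ge0// ltW.
have d0 : 0 < s' - s by rewrite subr_gt0.
have e2 : 0 < e / 2 by rewrite divr_gt0.
have [x /andP[x0 x1] xe] := exists_small_pos d0 C0 e2.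
have nx w : cnorm (w + x%:C - w) = x by rewrite addrC addKr cnorm_real gtr0_norm.
have nxw w : cnorm w <= s -> cnorm (w + x%:C) <= s'.
  by move=> ws; rewrite (le_trans (cnormD _ _))// cnorm_real gtr0_norm//; lra.
exists (fun w => divdiff f w (w + x%:C)).
  move=> w ws; have ws' := nxw w ws.
  apply: (@holo_eq _ (fun w => (f (w + x%:C) - f w) * (x%:C)^-1) _ _ 1) => //.
    by move=> y _; rewrite /divdiff (addrC y) addrK.
  apply: holoM; last exact: holo_cst.
  apply: holoB; last by apply: hf; lra.
  apply: (@holo_comp _ f (fun w => w + x%:C)).
    by apply: holoD; [exact: holo_id|exact: holo_cst].
  by apply: hf; have := andP sr'; lra.
move=> w ws; have wr : cnorm w <= r by lra.
have fd := cderP (hf w wr).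
apply/ler_addgt0Pr => e' e'0.
have e'2 : 0 < e' by [].
have [d d'0 hd] := fd _ e'2.
have m0 : 0 < Num.min d x by rewrite lt_min d'0.
have [y /andP[y0 ym] _] := exists_small_pos m0 C0 e'0.
move: ym; rewrite lt_min => /andP[yd yx].
have ny : cnorm (w + y%:C - w) = y by rewrite addrC addKr cnorm_real gtr0_norm.
have wy : w + y%:C != w by rewrite -subr_eq0 -cnorm_gt0 ny.
have k1 : cnorm (divdiff f w (w + y%:C) - cder f w) <= e'.
  have := hd (w + y%:C); rewrite ny => /(_ yd).
  have -> : f (w + y%:C) - f w - cder f w * (w + y%:C - w) =
      (divdiff f w (w + y%:C) - cder f w) * (w + y%:C - w).
    by rewrite /divdiff; field; rewrite subr_eq0.
  by rewrite cnormM ny ler_pM2r.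
have xy : w + x%:C - (w + y%:C) = (x - y)%:C by rewrite rmorphB /=; ring.
have nxy : cnorm (w + x%:C - (w + y%:C)) = x - y.
  by rewrite xy cnorm_real ger0_norm// subr_ge0 ltW.
have wxy : w + x%:C != w + y%:C by rewrite -subr_eq0 -cnorm_gt0 nxy subr_gt0.
have wx : w + x%:C != w by rewrite -subr_eq0 -cnorm_gt0 nx.
have := @divdiff_lip f C w (w + y%:C) (w + x%:C) C0 wxy.
rewrite nxy => k2.
have {}k2 : cnorm (divdiff f w (w + x%:C) - divdiff f w (w + y%:C)) <= C * (x - y).
  apply: k2; apply: (@divdiff2_bound _ f [::] r s' M) => //.
  - by move=> u ur _; exact: hf.
  - by move=> u ur; apply: fM; rewrite ur.
  - lra.
  - by rewrite (le_trans (cnormD _ _))// cnorm_real gtr0_norm//; lra.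
  - exact: nxw.
  - by rewrite eq_sym.
rewrite (le_trans (cdist_trans (divdiff f w (w + y%:C)) _ _))//.
have : C * (x - y) <= C * x by rewrite ler_wpM2l//; lra.
lra.
Qed.

End holomorphy_criteria.

Definition holo_unit {R : realType} (f : R[i] -> R[i]) := forall z, cnorm z < 1 -> holo f z.

(** The backward shift of Taylor series. Its iterates define remainders and coefficients without
    higher derivatives. *)
Definition divX {R : realType} (f : R[i] -> R[i]) z :=
  if z == 0 then cder f 0 else (f z - f 0) / z.

Definition taylor_tail {R : realType} (f : R[i] -> R[i]) n := iter n divX f.

Definition taylor_coef {R : realType} (f : R[i] -> R[i]) n := taylor_tail f n 0.

Section real_sequences.
Context {R : realType}.

Lemma exprn_small (x e : R) : 0 <= x < 1 -> 0 < e -> exists N, forall n, (N <= n)%N -> x ^+ n <= e.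
Proof.
move=> /andP[x0 x1] e0.
suff [N xN] : exists N, x ^+ N <= e.
  by exists N => n Nn; rewrite (le_trans _ xN)// ler_wiXn2l// ltW.
apply: contrapT => no.
have h n : e < x ^+ n by rewrite ltNge; apply/negP => k; apply: no; exists n.
suff : 1 <= x by lra.
apply: (@le_of_exprn _ _ _ (1 / e)) => // n.
by rewrite expr1n mulrAC mul1r ler_pdivlMr// mul1r ltW.
Qed.

Lemma mulnX_small (x e : R) : 0 <= x < 1 -> 0 < e ->
  exists N, forall n, (N <= n)%N -> n.+1%:R * x ^+ n <= e.
Proof.
move=> /andP[x0 x1] e0.
(* As [x <= y ^+ 2], one factor [y ^+ n] can absorb [n.+1] while the other tends to 0. *)
pose y := (1 + x) / 2.
have y0 : 0 < y by rewrite /y; lra.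
have y1 : y < 1 by rewrite /y; lra.
have xy : x <= y ^+ 2 by rewrite /y expr2; nra.
pose h := 1 - y.
have h0 : 0 < h by rewrite /h; lra.
have B n : n.+1%:R * h * y ^+ n <= 1.
  suff : n.+1%:R * h * y ^+ n <= 1 - y ^+ n.+1.
    by have := exprn_ge0 n.+1 (ltW y0); lra.
  elim: n => [|n IH]; first by rewrite expr0 expr1 /h; lra.
  have yn := exprn_ge0 n (ltW y0).
  have yn1 : y ^+ n.+1 <= y ^+ n by rewrite exprS ler_piMl// ltW.
  have -> : n.+2%:R = n.+1%:R + 1 :> R by rewrite -(@natr1 _ n.+1).
  have n0 : 0 <= n.+1%:R * h * (y ^+ n - y ^+ n.+1).
    by rewrite mulr_ge0 ?subr_ge0// mulr_ge0// ltW.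
  have e1 : y ^+ n.+2 = (1 - h) * y ^+ n.+1 by rewrite exprS /h; ring.
  rewrite e1; lra.
have [N hN] := @exprn_small y (e * h) (introT andP (conj (ltW y0) y1)) (mulr_gt0 e0 h0).
exists N => n /hN yn.
have k1 : x ^+ n <= y ^+ n * y ^+ n.
  rewrite -expr2 -exprM mulnC exprM.
  by apply: lerXn2r; [rewrite nnegrE|rewrite nnegrE sqr_ge0|].
apply: (@le_trans _ _ (n.+1%:R * (y ^+ n * y ^+ n))); first by rewrite ler_wpM2l.
have k2 := B n.
have : n.+1%:R * h * y ^+ n * y ^+ n <= 1 * (e * h).
  have yn0 := exprn_ge0 n (ltW y0).
  by apply: ler_pM => //; rewrite mulr_ge0// mulr_ge0 ?ler0n// ltW.
rewrite mul1r => k3; rewrite -(@ler_pM2r _ h)//; lra.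
Qed.

End real_sequences.

Section taylor.
Context {R : realType}.
Implicit Types (f g : R[i] -> R[i]) (z w mu nu : R[i]) (r s M : R).

Lemma holo_unit_disk f r : holo_unit f -> r < 1 -> holo_disk f r.
Proof. by move=> hf r1 z zr; apply: hf; exact: le_lt_trans r1. Qed.

Lemma holo_unit_cder f : holo_unit f -> holo_unit (cder f).
Proof.
move=> hf z z1; have z0 := cnorm_ge0 z.
have r1 : (cnorm z + 1) / 2 < 1 by lra.
apply: (@holo_cder _ f ((cnorm z + 1) / 2)); [lra|exact: holo_unit_disk|lra].
Qed.

Lemma divXE f z : f z = f 0 + z * divX f z.
Proof.
rewrite /divX; case: eqVneq => [->|z0]; first by rewrite mul0r addr0.
by rewrite mulrC divfK// addrC subrK.
Qed.

Lemma holo_unit_divX f : holo_unit f -> holo_unit (divX f).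
Proof.
move=> hf z z1.
have off w : cnorm w < 1 -> w != 0 -> holo (divX f) w.
  move=> w1 w0; apply: (@holo_eq _ (fun z => (f z - f 0) / z) _ _ (cnorm w)).
  - by rewrite cnorm_gt0.
  - move=> y yw; rewrite /divX ifN//; apply: contraTneq yw => ->.
    by rewrite sub0r cnormN ltxx.
  - apply: holo_div => //; last exact: holo_id.
    by apply: holoB; [exact: hf|exact: holo_cst].
have [->|z0] := eqVneq z 0; last exact: off.
have half : 0 < 1 / 2 :> R by lra.
apply: (@removable_singularity _ _ (1 / 2)) => //; first by rewrite cnorm0.
  by move=> w w2; apply: off; lra.
have := cderP (hf 0 (ltac:(rewrite cnorm0; lra))) => fd e e0.
have [d d0 h] := fd e e0; exists d => // w wd.
have [->|w0] := eqVneq w 0; first by rewrite subrr cnorm0 ltW.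
have := h w wd; rewrite subr0.
rewrite /divX eqxx (negbTE w0).
have -> : f w - f 0 - cder f 0 * w = ((f w - f 0) / w - cder f 0) * w by field.
by rewrite cnormM ler_pM2r// cnorm_gt0.
Qed.

Lemma holo_taylor_tail f n : holo_unit f -> holo_unit (taylor_tail f n).
Proof. by move=> hf; elim: n => [//|n IH]; exact: holo_unit_divX. Qed.

Lemma taylorE f n z :
  f z = \sum_(k < n) taylor_coef f k * z ^+ k + z ^+ n * taylor_tail f n z.
Proof.
elim: n => [|n IH]; first by rewrite big_ord0 add0r expr0 mul1r.
rewrite {1}IH big_ord_recr /= -addrA; congr (_ + _).
by rewrite {1}(divXE (taylor_tail f n)) mulrDr exprSr mulrA [X in X + _]mulrC.
Qed.

(** The bound does not depend on [n]. Divided by the number of terms it vanishes in the limit, so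
    averages over an orbit isolate a single frequency. *)
Lemma unimodular_sum_le nu n : cnorm nu = 1 -> nu != 1 ->
  cnorm (\sum_(j < n) nu ^+ j) <= 2 / cnorm (1 - nu).
Proof.
move=> nu1 nun; have n0 : 0 < cnorm (1 - nu) by rewrite cnorm_gt0 subr_eq0 eq_sym.
rewrite ler_pdivlMr// mulrC -cnormM -opprB mulNr cnormN -subrX1.
by rewrite (le_trans (cnormB _ _))// cnormX nu1 expr1n cnorm1; lra.
Qed.

Lemma irrational_expf mu i k : (forall n, (0 < n)%N -> mu ^+ n != 1) -> mu != 0 ->
  i != k -> mu ^+ i / mu ^+ k != 1.
Proof.
move=> irr mu0; wlog ik : i k / (i < k)%N => [H|_].
  rewrite neq_ltn => /orP[ik|ki]; first by apply: H => //; rewrite neq_ltn ik.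
  rewrite -invr_eq1 invfM invrK mulrC; apply: H => //; by rewrite neq_ltn ki.
have -> : mu ^+ k = mu ^+ i * mu ^+ (k - i) by rewrite -exprD subnKC// ltnW.
rewrite invfM mulrA divff ?expf_neq0// mul1r invr_eq1.
by apply: irr; rewrite subn_gt0.
Qed.

(** Cauchy's estimate. On the circle, [B z * z ^+ n] is the orbit average of
    [f (mu ^+ j * z) / mu ^+ (j * n)] minus the averages of the [n] lower Taylor terms, which are of
    order [1 / J]. At the centre, [B 0] is the coefficient itself, and [center_max] compares the
    two. *)
Lemma taylor_coef_bound f mu r M n : cnorm mu = 1 -> (forall n, (0 < n)%N -> mu ^+ n != 1) ->
  holo_unit f -> 0 < r < 1 -> (forall z, cnorm z = r -> cnorm (f z) <= M) ->
  cnorm (taylor_coef f n) * r ^+ n <= M.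
Proof.
move=> mu1 irr hf /andP[r0 r1] fM.
have mu0 : mu != 0 by rewrite -cnorm_gt0 mu1.
have rn : 0 < r ^+ n by rewrite exprn_gt0.
pose nu i := mu ^+ i / mu ^+ n.
have nu1 i : cnorm (nu i) = 1 by rewrite cnormM cnormV !cnormX mu1 !expr1n invr1 mulr1.
pose K := \sum_(i < n) cnorm (taylor_coef f i) * r ^+ i * (2 / cnorm (1 - nu i)).
have K0 : 0 <= K.
  by apply: sumr_ge0 => i _; rewrite !mulr_ge0 ?cnorm_ge0 ?invr_ge0 ?cnorm_ge0// exprn_ge0// ltW.
apply/ler_addgt0Pr => e e0.
have /archi_boundP : 0 <= K / e by rewrite divr_ge0// ltW.
set J := Num.bound _; rewrite ltr_pdivrMr// => KJ.
have J0 : 0 < J%:R :> R by rewrite ltr0n lt0n; apply: contraTneq KJ => ->; rewrite mul0r -leNgt.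
have Jc : (J%:R : R[i]) != 0 by rewrite -cnorm_gt0 cnorm_nat.
pose B z := (\sum_(j < J) taylor_tail f n (mu ^+ j * z)) / J%:R.
have muj j z : cnorm (mu ^+ j * z) = cnorm z by rewrite cnormM cnormX mu1 expr1n mul1r.
have B0 : B 0 = taylor_coef f n.
  rewrite /B (eq_bigr (fun=> taylor_coef f n)); last by move=> j _; rewrite mulr0.
  by rewrite sumr_const card_ord -(mulr_natr (taylor_coef f n)) mulfK.
rewrite -ler_pdivlMr// -B0; apply: (center_max r0).
  move=> z zr; apply: holoM; last exact: holo_cst.
  apply: holo_sum => j; apply: (@holo_comp _ (taylor_tail f n) (fun z => mu ^+ j * z)).
    by apply: holoM; [exact: holo_cst|exact: holo_id].
  by apply: holo_taylor_tail => //; rewrite muj (le_lt_trans zr).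
move=> z zr; rewrite ler_pdivlMr// -zr -cnormX -cnormM.
have -> : B z * z ^+ n = (\sum_(j < J) f (mu ^+ j * z) / mu ^+ j ^+ n) / J%:R -
    (\sum_(i < n) taylor_coef f i * z ^+ i * \sum_(j < J) nu i ^+ j) / J%:R.
  rewrite /B -mulrBl mulrAC; congr (_ / _); rewrite mulr_suml.
  under [X in _ = _ - X]eq_bigr do rewrite mulr_sumr.
  rewrite exchange_big /= -sumrB; apply: eq_bigr => j _.
  rewrite (taylorE f n (mu ^+ j * z)) mulrDl mulr_suml.
  rewrite (eq_bigr (fun i : 'I_n => taylor_coef f i * z ^+ i * nu i ^+ j)); last first.
    by move=> i _; rewrite /nu !exprMn exprVn -!exprM ![(_ * j)%N]mulnC; ring.
  rewrite [X in _ = X - _]addrC addrK exprMn.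
  have : mu ^+ j ^+ n != 0 by rewrite !expf_neq0.
  by set x := mu ^+ j ^+ n; set y := z ^+ n => x0; field.
rewrite (le_trans (cnormB _ _))// !cnormM cnormV cnorm_nat lerD//.
  rewrite ler_pdivrMr// (le_trans (cnorm_sum _ _ _))//.
  rewrite -[J in M * J%:R]card_ord mulr_natr -sumr_const; apply: ler_sum => j _.
  rewrite cnormM cnormV !cnormX mu1 !expr1n invr1 mulr1.
  by apply: fM; rewrite muj.
rewrite ler_pdivrMr// (le_trans (cnorm_sum _ _ _))//.
apply: (@le_trans _ _ K); last by rewrite mulrC ltW.
apply: ler_sum => i _; rewrite !cnormM cnormX zr ler_wpM2l ?mulr_ge0 ?cnorm_ge0 ?exprn_ge0 ?(ltW r0)//.
by apply: unimodular_sum_le => //; apply: irrational_expf => //; rewrite neq_ltn ltn_ord.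
Qed.

End taylor.

(** * Products along the orbits of an irrational rotation *)

Definition wprod {R : realType} (w : R[i] -> R[i]) (mu : R[i]) n z :=
  \prod_(j < n) w (mu ^+ j * z).

(** Partial sums of the Neumann series of [(C - lam)^-1], where [wprod w mu m z * f (mu ^+ m * z)]
    is the value of [C^m f] at [z]. *)
Definition resolvent_sum {R : realType} (w f : R[i] -> R[i]) (mu lam : R[i]) n z :=
  - \sum_(m < n) lam^-1 ^+ m.+1 * wprod w mu m z * f (mu ^+ m * z).

Section growth.
Context {R : realType}.
Implicit Types (f g w : R[i] -> R[i]) (z mu lam : R[i]) (r s M : R).

Lemma is_derive_of_eps (f : R -> R) (a l : R) :
  (forall e, 0 < e -> exists2 d, 0 < d & forall t, `|t - a| < d ->
    `|f t - f a - l * (t - a)| <= e * `|t - a|) -> is_derive a 1 f l.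
Proof.
move=> h.
have cv : (x^-1 *: ((f \o shift a) (x *: 1) - f a) @[x --> 0^']) --> l.
  apply/cvgrPdist_le => e e0; have [d d0 hd] := h e e0.
  rewrite near_withinE; apply/nbhs_ballP; exists d => // x; rewrite /ball /= sub0r normrN => xd x0.
  have := hd (x + a); rewrite addrK => /(_ xd).
  have -> : f (x + a) - f a - l * x = (x^-1 *: ((f \o shift a) (x *: 1) - f a) - l) * x.
    by rewrite /= scaler1 -[_ *: _]/(_ * _); field.
  by rewrite normrM ler_pM2r ?normr_gt0// distrC.
by apply: DeriveDef; [exact: cvgP cv|exact: cvg_lim cv].
Qed.

(** Here [p] stands for the real or the imaginary part; this carries complex derivatives over to the
    real mean value theorem. *)
Lemma is_derive_part (p : R[i] -> R) (G : R[i] -> R[i]) t l :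
  (forall z y, `|p z - p y| <= cnorm (z - y)) -> p 0 = 0 ->
  (forall z y, p (z - y) = p z - p y) -> (forall z (x : R), p (z * x%:C) = p z * x) ->
  cderiv G t%:C l -> is_derive t 1 (fun s : R => p (G s%:C)) (p l).
Proof.
move=> pl p0 pB pM hG; apply: is_derive_of_eps => e e0; have [d d0 h] := hG e e0.
exists d => // s st; rewrite -pM -!pB.
have E : s%:C - t%:C = (s - t)%:C :> R[i] by rewrite rmorphB.
have := h s%:C; rewrite E cnorm_real => /(_ st); apply: le_trans.
by have := pl (G s%:C - G t%:C - l * (s - t)%:C) 0; rewrite p0 !subr0.
Qed.

(** Gronwall's inequality on the segment from 0 to [z]: the squared modulus of
    [f (t * z) * exp (- L * t)] has a nonpositive derivative. Squaring keeps the modulus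
    differentiable at zeros of [f]. *)
Lemma growth_bound f z (L : R) :
  (forall t : R, 0 <= t <= 1 -> holo f (t%:C * z)) ->
  (forall t : R, 0 <= t <= 1 -> cnorm (cder f (t%:C * z) * z) <= L * cnorm (f (t%:C * z))) ->
  cnorm (f z) <= cnorm (f 0) * expR L.
Proof.
move=> hf fL.
pose G (s : R[i]) := f (s * z) * cexp (- L%:C * s).
pose l t := (cder f (t%:C * z) * z - L%:C * f (t%:C * z)) * cexp (- L%:C * t%:C).
have hG (t : R) : 0 <= t <= 1 -> cderiv G t%:C (l t).
  move=> t01.
  have h1 : cderiv (fun s : R[i] => f (s * z)) t%:C (cder f (t%:C * z) * z).
    apply: (@cderiv_comp _ f (fun s : R[i] => s * z)); last exact: cderP (hf t t01).
    have := cderivM (cderiv_id t%:C) (cderiv_cst z t%:C).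
    by rewrite mul1r mulr0 addr0.
  have h2 : cderiv (fun s : R[i] => cexp (- L%:C * s)) t%:C (cexp (- L%:C * t%:C) * - L%:C).
    apply: (@cderiv_comp _ cexp (fun s : R[i] => - L%:C * s)); last exact: cderiv_cexp.
    have := cderivM (cderiv_cst (- L%:C) t%:C) (cderiv_id t%:C).
    by rewrite mul0r mulr1 add0r.
  have := cderivM h1 h2; congr (cderiv _ _ _); rewrite /l; ring.
pose u (t : R) := complex.Re (G t%:C); pose v (t : R) := complex.Im (G t%:C).
have du (t : R) : 0 <= t <= 1 -> is_derive t 1 u (complex.Re (l t)).
  move=> t01; apply: (is_derive_part Re_dist _ _ _ (hG t t01)) => //.
  - by move=> [a b] [c d].
  - by move=> [a b] x /=; rewrite mulr0 subr0.
have dv (t : R) : 0 <= t <= 1 -> is_derive t 1 v (complex.Im (l t)).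
  move=> t01; apply: (is_derive_part Im_dist _ _ _ (hG t t01)) => //.
  - by move=> [a b] [c d].
  - by move=> [a b] x /=; rewrite mulr0 add0r.
have dphi (t : R) : 0 <= t <= 1 -> is_derive t 1 (u * u + v * v)
    (u t *: complex.Re (l t) + u t *: complex.Re (l t) +
     (v t *: complex.Im (l t) + v t *: complex.Im (l t))).
  by move=> t01; have := du t t01; have := dv t t01 => ? ?; apply: is_deriveD.
pose phi := u * u + v * v.
pose dph (t : R) := u t *: complex.Re (l t) + u t *: complex.Re (l t) +
     (v t *: complex.Im (l t) + v t *: complex.Im (l t)).
have hd (t : R) : t \in `]0, 1[ -> is_derive t 1 phi (dph t).
  by rewrite in_itv /= => /andP[t0 t1]; apply: dphi; rewrite !ltW.
have hc : {within `[0, 1], continuous phi}.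
  apply: derivable_within_continuous => t; rewrite in_itv /= => t01.
  by have [] := dphi t t01.
have [c c01] := MVT_segment ler01 hd hc.
rewrite subr0 mulr1 /phi /dph => E.
have {}c01 : 0 <= c <= 1 by move: c01; rewrite in_itv.
have phiE (t : R) : (u * u + v * v) t = cnorm (G t%:C) ^+ 2.
  by rewrite cnorm_sqr !expr2.
have le0 : (u * u + v * v) 1 <= (u * u + v * v) 0.
  rewrite -subr_le0 E.
  set F := f (c%:C * z); set H := cder f (c%:C * z) * z.
  pose x := expR (- L * c).
  have xE : cexp (- L%:C * c%:C) = x%:C.
    have -> : - L%:C * c%:C = (- L * c) +i* 0 by rewrite -rmorphN -rmorphM.
    by rewrite cexpE cos0 sin0 mulr1 mulr0.
  have FH : complex.Re (conjc F * H) <= L * cnorm F ^+ 2.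
    apply: (le_trans (ler_norm _)); apply: (le_trans (ler_Re_cnorm _)).
    rewrite cnormM cnorm_conjc expr2 mulrCA ler_wpM2l ?cnorm_ge0//.
    exact: fL.
  have : u c * complex.Re (l c) + v c * complex.Im (l c) =
      x ^+ 2 * (complex.Re (conjc F * H) - L * cnorm F ^+ 2).
    rewrite cnorm_sqr /u /v /l /G xE -/F -/H; clear FH; move: (F) (H) => [a b] [a' b'] /=; ring.
  rewrite -![_ *: _]/(_ * _) => k.
  have : x ^+ 2 * (complex.Re (conjc F * H) - L * cnorm F ^+ 2) <= 0.
    by rewrite mulr_ge0_le0 ?sqr_ge0// subr_le0.
  lra.
move: le0; rewrite !phiE ler_pXn2r ?nnegrE ?cnorm_ge0//.
have -> : (1 : R)%:C = 1 :> R[i] by [].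
have -> : (0 : R)%:C = 0 :> R[i] by [].
rewrite /G mul1r mul0r mulr1 mulr0 cexp0 mulr1 cnormM cnorm_cexp /=.
by rewrite expRN ler_pdivrMr// expR_gt0.
Qed.

(** On the circle of radius [r] the remainder is [f] minus [n] Taylor terms, each of modulus at most
    [B]. The factor [n.+1] is harmless next to a geometric decay, by [mulnX_small]. *)
Lemma taylor_tail_bound f mu r B n z : cnorm mu = 1 -> (forall n, (0 < n)%N -> mu ^+ n != 1) ->
  holo_unit f -> 0 < r < 1 -> (forall z, cnorm z = r -> cnorm (f z) <= B) ->
  cnorm z <= r -> cnorm (taylor_tail f n z) * r ^+ n <= n.+1%:R * B.
Proof.
move=> mu1 irr hf r01 fB zr; have [r0 r1] := andP r01.
have rn : 0 < r ^+ n by rewrite exprn_gt0.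
rewrite -ler_pdivlMr//; apply: (max_principle r0) => //.
  by apply: holo_unit_disk => //; exact: holo_taylor_tail.
move=> y yr; rewrite ler_pdivlMr// -yr -cnormX -cnormM.
have -> : taylor_tail f n y * y ^+ n = f y - \sum_(k < n) taylor_coef f k * y ^+ k.
  by rewrite {1}(taylorE f n y) addrAC subrr add0r mulrC.
rewrite (le_trans (cnormB _ _))// -(@natr1 _ n) mulrDl mul1r addrC lerD ?fB//.
rewrite (le_trans (cnorm_sum _ _ _))//.
rewrite -[n in n%:R * B]card_ord mulr_natl -sumr_const; apply: ler_sum => k _.
by rewrite cnormM cnormX yr; exact: (taylor_coef_bound _ mu1 irr hf r01 fB).
Qed.

Lemma unimodularX mu n : cnorm mu = 1 -> cnorm (mu ^+ n) = 1.
Proof. by move=> mu1; rewrite cnormX mu1 expr1n. Qed.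

Lemma cnorm_rot mu n z : cnorm mu = 1 -> cnorm (mu ^+ n * z) = cnorm z.
Proof. by move=> mu1; rewrite cnormM unimodularX// mul1r. Qed.

Lemma holo_rot f mu z : holo f (mu * z) -> holo (fun z => f (mu * z)) z.
Proof.
by move=> hf; apply: (@holo_comp _ f (fun z => mu * z)) => //;
  apply: holoM; [exact: holo_cst|exact: holo_id].
Qed.

Lemma holo_wprod w mu n : cnorm mu = 1 -> holo_unit w -> holo_unit (wprod w mu n).
Proof.
move=> mu1 hw z z1; apply: holo_prod => j; apply: holo_rot.
by apply: hw; rewrite cnorm_rot.
Qed.

Lemma cderiv_wprod w mu n z : cnorm mu = 1 -> holo_unit w ->
  (forall z, cnorm z < 1 -> w z != 0) -> cnorm z < 1 ->
  cderiv (wprod w mu n) z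
    (wprod w mu n z * \sum_(j < n) mu ^+ j * (cder w (mu ^+ j * z) / w (mu ^+ j * z))).
Proof.
move=> mu1 hw w0 z1; elim: n => [|n IH].
  rewrite big_ord0 mulr0; apply: (cderiv_eq ltr01 _ (cderiv_cst 1 z)) => y _.
  by rewrite /wprod big_ord0.
have hz : cnorm (mu ^+ n * z) < 1 by rewrite cnorm_rot.
have h1 : cderiv (fun z => w (mu ^+ n * z)) z (cder w (mu ^+ n * z) * mu ^+ n).
  apply: (@cderiv_comp _ w (fun z => mu ^+ n * z)); last exact: cderP (hw _ hz).
  by have := cderivM (cderiv_cst (mu ^+ n) z) (cderiv_id z); rewrite mul0r mulr1 add0r.
apply: (@cderiv_eq _ (fun z => wprod w mu n z * w (mu ^+ n * z)) _ _ _ 1) => //.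
  by move=> y _; rewrite /wprod big_ord_recr.
have := cderivM IH h1.
congr (cderiv _ _ _); rewrite /wprod !big_ord_recr /= -/(wprod w mu n z).
have := w0 _ hz; set S := \sum_(_ < _) _; set W := w _; set D := cder _ _.
by move=> W0; field.
Qed.

(** The logarithmic derivative of the product is the sum of [mu ^+ j * q (mu ^+ j * z)] with
    [q = w' / w]. Its part coming from the Taylor term of order [k] stays bounded, as
    [mu ^+ k.+1 != 1]: even the constant term oscillates. The Taylor remainder contributes at most
    [ep] per factor. Starting from the value [w 0 ^+ n] at 0, [growth_bound] gives the growth rate
    [cnorm (w 0) * expR ep = rh]. *)
Lemma uniform_growth w mu s rh : cnorm mu = 1 -> (forall n, (0 < n)%N -> mu ^+ n != 1) ->
  holo_unit w -> (forall z, cnorm z < 1 -> w z != 0) -> 0 < s < 1 -> cnorm (w 0) < rh ->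
  exists2 C : R, 0 < C & forall n z, cnorm z <= s -> cnorm (wprod w mu n z) <= C * rh ^+ n.
Proof.
move=> mu1 irr hw w0 /andP[s0 s1] wr.
have z01 : cnorm (0 : R[i]) < 1 by rewrite cnorm0.
have w00 : 0 < cnorm (w 0) by rewrite cnorm_gt0 w0.
pose q z := cder w z / w z.
have hq : holo_unit q.
  by move=> z z1; apply: holo_div; [exact: holo_unit_cder|exact: hw|exact: w0].
pose r := (1 + s) / 2.
have r01 : 0 < r < 1 by apply/andP; rewrite /r; split; lra.
have sr : s < r by rewrite /r; lra.
have [r0 r1] := andP r01.
have [B B0 qB] := disk_bounded (ltW r0) (holo_unit_disk hq r1).
have qB' z : cnorm z = r -> cnorm (q z) <= B by move=> zr; apply: qB; rewrite zr.
pose ep := ln (rh / cnorm (w 0)).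
have rh0 : 0 < rh by lra.
have ep0 : 0 < ep by rewrite ln_gt0// ltr_pdivlMr// mul1r.
have sr1 : 0 <= s / r < 1.
  by rewrite divr_ge0 ?ltW//= ltr_pdivrMr// mul1r.
have [M hM] := mulnX_small sr1 (divr_gt0 ep0 B0).
have {hM} hM := hM M (leqnn M).
pose K := \sum_(k < M) cnorm (taylor_coef q k) * (2 / cnorm (1 - mu ^+ k.+1)).
have K0 : 0 <= K.
  by apply: sumr_ge0 => i _; rewrite !mulr_ge0 ?cnorm_ge0 ?invr_ge0 ?cnorm_ge0.
have tail z : cnorm z <= s -> cnorm (z ^+ M * taylor_tail q M z) <= ep.
  move=> zs; have zr : cnorm z <= r by lra.
  have := taylor_tail_bound M mu1 irr hq r01 qB' zr.
  have rM : 0 < r ^+ M by rewrite exprn_gt0.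
  rewrite -ler_pdivlMr// => tb; rewrite cnormM cnormX.
  have zM : cnorm z ^+ M <= s ^+ M by apply: lerXn2r; rewrite ?nnegrE ?cnorm_ge0// ltW.
  apply: (le_trans (ler_pM _ _ zM tb)); rewrite ?exprn_ge0 ?cnorm_ge0//.
  have -> : s ^+ M * (M.+1%:R * B / r ^+ M) = M.+1%:R * (s / r) ^+ M * B.
    by rewrite [(s / r) ^+ M]exprMn exprVn mulrA [s ^+ M * _]mulrCA; ring.
  by rewrite -ler_pdivlMr.
have Qb n z : cnorm z <= s -> cnorm (\sum_(j < n) mu ^+ j * q (mu ^+ j * z)) <= K + n%:R * ep.
  move=> zs.
  have -> : \sum_(j < n) mu ^+ j * q (mu ^+ j * z) =
      \sum_(k < M) taylor_coef q k * z ^+ k * (\sum_(j < n) (mu ^+ k.+1) ^+ j) +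
      \sum_(j < n) mu ^+ j * ((mu ^+ j * z) ^+ M * taylor_tail q M (mu ^+ j * z)).
    under [X in _ = X + _]eq_bigr do rewrite mulr_sumr.
    rewrite exchange_big /= -big_split /=; apply: eq_bigr => j _.
    rewrite {1}(taylorE q M (mu ^+ j * z)) mulrDr; congr (_ + _).
    rewrite mulr_sumr; apply: eq_bigr => k _.
    rewrite exprMn -!exprM [(k.+1 * j)%N]mulnC mulnS exprD.
    have gen (a b c d : R[i]) : a * (c * (b * d)) = c * d * (a * b) by ring.
    exact: gen.
  rewrite (le_trans (cnormD _ _))// lerD//.
    rewrite (le_trans (cnorm_sum _ _ _))//; apply: ler_sum => k _.
    rewrite !cnormM cnormX ler_pM ?mulr_ge0 ?exprn_ge0 ?cnorm_ge0//.
      by rewrite ler_piMr ?cnorm_ge0// exprn_ile1 ?cnorm_ge0//; lra.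
    by apply: unimodular_sum_le; [exact: unimodularX|exact: irr].
  rewrite (le_trans (cnorm_sum _ _ _))//.
  rewrite -[n in n%:R * ep]card_ord mulr_natl -sumr_const; apply: ler_sum => j _.
  by rewrite cnorm_rot//; apply: tail; rewrite cnorm_rot.
exists (expR K); first exact: expR_gt0.
move=> n z zs.
have z1 : cnorm z < 1 by lra.
have tz (t : R) : 0 <= t <= 1 -> cnorm (t%:C * z) <= s.
  move=> /andP[t0 t1]; rewrite cnormM cnorm_real ger0_norm//.
  by rewrite (le_trans _ zs)// ler_piMl// cnorm_ge0.
have := @growth_bound (wprod w mu n) z (K + n%:R * ep).
have -> : wprod w mu n 0 = w 0 ^+ n.
  by rewrite /wprod (eq_bigr (fun=> w 0)) ?prodr_const ?card_ord// => j _; rewrite mulr0.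
have -> : cnorm (w 0 ^+ n) * expR (K + n%:R * ep) = expR K * rh ^+ n.
  rewrite cnormX expRD mulrCA expRM_natl lnK ?posrE ?divr_gt0// -exprMn.
  by rewrite [cnorm _ * _]mulrC divfK ?gt_eqF.
apply.
  by move=> t /tz tzs; apply: holo_wprod => //; lra.
move=> t /tz tzs.
have tz1 : cnorm (t%:C * z) < 1 by lra.
rewrite (cder_eq (cderiv_wprod n mu1 hw w0 tz1)) -mulrA cnormM [leRHS]mulrC.
rewrite ler_wpM2l ?cnorm_ge0// cnormM.
by rewrite (le_trans _ (Qb n _ tzs))// ler_piMr ?cnorm_ge0//; lra.
Qed.

End growth.

(** * Density of orbits, eigenvectors, and the telescoping resolvent sums *)

Section rotation_orbits.
Context {R : realType}.
Implicit Types (f g w : R[i] -> R[i]) (z mu nu lam : R[i]) (r s M : R).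

(* The average of the Fejer kernel over the orbit tends to m, while the kernel
   is at most (2/d)^2 at distance d from 1. *)
Lemma orbit_dense mu (d : R) : cnorm mu = 1 -> (forall n, (0 < n)%N -> mu ^+ n != 1) ->
  0 < d -> exists J, forall nu, cnorm nu = 1 -> exists2 j, (j < J)%N & cnorm (mu ^+ j * nu - 1) < d.
Proof.
move=> mu1 irr d0.
have mu0 : mu != 0 by rewrite -cnorm_gt0 mu1.
have dd0 : 0 <= (2 / d) ^+ 2 by exact: sqr_ge0.
have := archi_boundP dd0; set m := Num.bound _ => hm.
pose K := \sum_(k < m) \sum_(l < m | l != k) 2 / cnorm (1 - mu ^+ k / mu ^+ l).
have K0 : 0 <= K.
  by do 2 apply: sumr_ge0 => ? _; rewrite mulr_ge0 ?invr_ge0 ?cnorm_ge0.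
have gap : 0 < m%:R - (2 / d) ^+ 2 by lra.
have /archi_boundP := divr_ge0 K0 (ltW gap); set J := Num.bound _.
rewrite ltr_pdivrMr// => hJ.
exists J => nu nu1; apply: contrapT => no.
have far j : (j < J)%N -> d <= cnorm (1 - mu ^+ j * nu).
  by move=> jJ; rewrite cdistC leNgt; apply/negP => h; apply: no; exists j.
have nu0 : nu != 0 by rewrite -cnorm_gt0 nu1.
have zn j : cnorm (mu ^+ j * nu) = 1 by rewrite cnorm_rot.
(* The argument being unimodular, this is the squared modulus of a sum of [m] powers, with inverses
   instead of conjugates so that it expands into powers. In the off-diagonal terms [nu] enters
   through unimodular factors alone, which makes [J] uniform in [nu]. *)
pose S j := (\sum_(k < m) (mu ^+ j * nu) ^+ k) * (\sum_(l < m) ((mu ^+ j * nu)^-1) ^+ l).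
have Sb j : (j < J)%N -> cnorm (S j) <= (2 / d) ^+ 2.
  move=> jJ; have dj := far j jJ.
  have z0 : mu ^+ j * nu != 0 by rewrite mulf_neq0 ?expf_neq0.
  have z1 : mu ^+ j * nu != 1.
    by rewrite eq_sym -subr_eq0 -cnorm_gt0 (lt_le_trans d0).
  have b1 : cnorm (\sum_(k < m) (mu ^+ j * nu) ^+ k) <= 2 / d.
    rewrite (le_trans (unimodular_sum_le _ (zn j) z1))// ler_wpM2l//.
    by rewrite lef_pV2 ?posrE// (lt_le_trans d0).
  have b2 : cnorm (\sum_(k < m) ((mu ^+ j * nu)^-1) ^+ k) <= 2 / d.
    have zn' : cnorm (mu ^+ j * nu)^-1 = 1 by rewrite cnormV zn invr1.
    have z1' : (mu ^+ j * nu)^-1 != 1 by rewrite invr_eq1.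
    rewrite (le_trans (unimodular_sum_le _ zn' z1'))// ler_wpM2l//.
    have -> : cnorm (1 - (mu ^+ j * nu)^-1) = cnorm (1 - mu ^+ j * nu).
      have -> : 1 - (mu ^+ j * nu)^-1 = - ((1 - mu ^+ j * nu) / (mu ^+ j * nu)).
        by rewrite mulrBl divff// mul1r opprB.
      by rewrite cnormN cnormM cnormV zn invr1 mulr1.
    by rewrite lef_pV2 ?posrE// (lt_le_trans d0).
  by rewrite cnormM expr2 ler_pM ?cnorm_ge0.
have SE : \sum_(j < J) S j = (J * m)%:R +
    \sum_(k < m) \sum_(l < m | l != k) nu ^+ k / nu ^+ l * \sum_(j < J) (mu ^+ k / mu ^+ l) ^+ j.
  have -> : (J * m)%:R = \sum_(k < m) J%:R :> R[i].
    by rewrite sumr_const card_ord natrM mulr_natr.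
  rewrite -big_split /= /S.
  under eq_bigr do rewrite mulr_suml.
  rewrite exchange_big /=; apply: eq_bigr => k _.
  under eq_bigr do rewrite mulr_sumr.
  rewrite exchange_big /= (bigD1 k)//=; congr (_ + _).
    transitivity (\sum_(j < J) (1 : R[i])); last by rewrite sumr_const card_ord.
    apply: eq_bigr => j _.
    by rewrite exprVn divff// !expf_neq0// mulf_neq0 ?expf_neq0.
  apply: eq_bigr => l _; rewrite mulr_sumr; apply: eq_bigr => j _.
  rewrite exprVn !exprMn exprVn invfM -!exprM ![(_ * j)%N]mulnC.
  have gen (x y x' y' : R[i]) : x * y * (x' * y') = y * y' * (x * x') by ring.
  exact: gen.
have : m%:R * J%:R - K <= J%:R * (2 / d) ^+ 2.
  have h1 : cnorm (\sum_(j < J) S j) <= J%:R * (2 / d) ^+ 2.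
    rewrite (le_trans (cnorm_sum _ _ _))// -[J in J%:R * _]card_ord mulr_natl -sumr_const.
    by apply: ler_sum => j _; exact: Sb.
  apply: le_trans h1; rewrite SE; apply: (le_trans _ (cnormD_ge _ _)).
  rewrite cnorm_nat natrM mulrC lerD2l lerN2.
  rewrite (le_trans (cnorm_sum _ _ _))//; apply: ler_sum => k _.
  rewrite (le_trans (cnorm_sum _ _ _))//; apply: ler_sum => l lk.
  rewrite cnormM cnormM cnormV !cnormX nu1 !expr1n invr1 !mul1r.
  apply: unimodular_sum_le; first by rewrite cnormM cnormV !cnormX mu1 !expr1n invr1 mulr1.
  by apply: irrational_expf => //; rewrite eq_sym.
rewrite mulrBr in hJ; lra.
Qed.

(** The identity theorem: [g z] equals each of its Taylor remainders, and these tend to 0. *)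
Lemma taylor_coef_eq0 g mu : cnorm mu = 1 -> (forall n, (0 < n)%N -> mu ^+ n != 1) ->
  holo_unit g -> (forall n, taylor_coef g n = 0) -> forall z, cnorm z < 1 -> g z = 0.
Proof.
move=> mu1 irr hg g0 z z1; have zn := cnorm_ge0 z.
pose r := (1 + cnorm z) / 2.
have r01 : 0 < r < 1 by apply/andP; rewrite /r; split; lra.
have [r0 r1] := andP r01; have zr : cnorm z < r by rewrite /r; lra.
have [B B0 gB] := disk_bounded (ltW r0) (holo_unit_disk hg r1).
have gB' y : cnorm y = r -> cnorm (g y) <= B by move=> yr; apply: gB; rewrite yr.
apply: cnorm_inj_eq => e e0; rewrite subr0.
have q1 : 0 <= cnorm z / r < 1 by rewrite divr_ge0 ?(ltW r0)//= ltr_pdivrMr// mul1r.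
have [n hn] := mulnX_small q1 (divr_gt0 e0 B0).
have := hn n (leqnn n); rewrite ler_pdivlMr//; apply: le_trans.
rewrite (taylorE g n z) big1 ?add0r; last by move=> k _; rewrite g0 mul0r.
have := taylor_tail_bound n mu1 irr hg r01 gB' (ltW zr).
have rn : 0 < r ^+ n by rewrite exprn_gt0.
rewrite -ler_pdivlMr// => tb; rewrite cnormM cnormX.
have -> : n.+1%:R * (cnorm z / r) ^+ n * B = cnorm z ^+ n * (n.+1%:R * B / r ^+ n).
  by rewrite [(cnorm z / r) ^+ n]exprMn exprVn; ring.
by rewrite ler_wpM2l// exprn_ge0.
Qed.

Lemma ccont_eq0 f g : ccont f 0 -> ccont g 0 ->
  (forall z, z != 0 -> cnorm z < 1 -> f z = g z) -> f 0 = g 0.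
Proof.
move=> cf cg fg; apply: cnorm_inj_eq => e e0; have e2 : 0 < e / 2 by rewrite divr_gt0.
have [d d0 hd] := cf _ e2; have [d' d'0 hd'] := cg _ e2.
have m0 : 0 < Num.min (Num.min d d') 1 by rewrite !lt_min d0 d'0 ltr01.
have [t /andP[t0 tm] _] := exists_small_pos m0 (lexx 0) e0.
move: tm; rewrite !lt_min => /andP[/andP[td td'] t1].
have nt : cnorm (t%:C : R[i]) = t by rewrite cnorm_real gtr0_norm.
have := hd t%:C; have := hd' t%:C; rewrite !subr0 nt => /(_ td') k' /(_ td) k.
have ft : f t%:C = g t%:C by apply: fg; rewrite -?cnorm_gt0 nt.
have -> : f 0 - g 0 = (g t%:C - g 0) - (f t%:C - f 0) by rewrite ft; ring.
by rewrite (le_trans (cnormB _ _))//; lra.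
Qed.

(** Divided by [z ^+ n], the eigenvalue equation extends to 0 by continuity. *)
Lemma eigen_taylor_coef w g mu lam n : mu != 0 -> holo_unit w -> holo_unit g -> cnorm mu = 1 ->
  (forall z, cnorm z < 1 -> w z * g (mu * z) = lam * g z) ->
  (forall k, (k < n)%N -> taylor_coef g k = 0) ->
  w 0 * mu ^+ n * taylor_coef g n = lam * taylor_coef g n.
Proof.
move=> mu0 hw hg mu1 eg g0.
have gE z : g z = z ^+ n * taylor_tail g n z.
  by rewrite {1}(taylorE g n z) big1 ?add0r// => k _; rewrite g0 ?ltn_ord// mul0r.
have z01 : cnorm (0 : R[i]) < 1 by rewrite cnorm0.
have ht := holo_taylor_tail n hg.
have := @ccont_eq0 (fun z => w z * mu ^+ n * taylor_tail g n (mu * z))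
  (fun z => lam * taylor_tail g n z); rewrite mulr0; apply.
- apply: holo_cont; apply: holoM.
    by apply: holoM; [exact: hw|exact: holo_cst].
  by apply: holo_rot; apply: ht; rewrite mulr0.
- by apply: holo_cont; apply: holoM; [exact: holo_cst|exact: ht].
move=> z z0 z1; have := eg z z1; rewrite !gE exprMn => E.
apply: (mulfI (expf_neq0 n z0)); rewrite [RHS]mulrCA -E; ring.
Qed.

Lemma eigen_eq0 w g mu lam : cnorm mu = 1 -> (forall n, (0 < n)%N -> mu ^+ n != 1) ->
  holo_unit w -> holo_unit g ->
  (forall z, cnorm z < 1 -> w z * g (mu * z) = lam * g z) ->
  (forall k, lam != w 0 * mu ^+ k) -> forall z, cnorm z < 1 -> g z = 0.
Proof.
move=> mu1 irr hw hg eg lamk; apply: (taylor_coef_eq0 mu1 irr hg) => n.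
have mu0 : mu != 0 by rewrite -cnorm_gt0 mu1.
elim/ltn_ind: n => n IH.
have /eqP := eigen_taylor_coef mu0 hw hg mu1 eg IH.
rewrite -subr_eq0 -mulrBl mulf_eq0 subr_eq0 eq_sym (negbTE (lamk n)) /=.
by move/eqP.
Qed.

Lemma wprodS w mu n z : wprod w mu n.+1 z = w z * wprod w mu n (mu * z).
Proof.
rewrite /wprod big_ord_recl expr0 mul1r; congr (_ * _).
by apply: eq_bigr => j _; rewrite /bump /= ?add1n exprSr mulrA.
Qed.

Lemma wprodSr w mu n z : wprod w mu n.+1 z = wprod w mu n z * w (mu ^+ n * z).
Proof. by rewrite /wprod big_ord_recr. Qed.

(** Taking one more term on one side makes the sums telescope without a remainder. *)
Lemma resolvent_sumS w f mu lam n z : lam != 0 ->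
  w z * resolvent_sum w f mu lam n (mu * z) - lam * resolvent_sum w f mu lam n.+1 z = f z.
Proof.
move=> l0; rewrite /resolvent_sum big_ord_recl /= !mulrN opprK mulrDr mulr_sumr mulr_sumr.
rewrite expr1 expr0 mul1r [wprod _ _ 0 _]big_ord0 mulr1 mulrA divff// mul1r addrCA.
rewrite [X in _ + X](_ : _ = 0) ?addr0// addrC -sumrB big1// => m _.
rewrite (_ : bump 0 m = m.+1)// wprodS.
have -> : mu ^+ m.+1 * z = mu ^+ m * (mu * z) by rewrite exprSr mulrA.
rewrite [lam^-1 ^+ m.+2]exprS.
set x := lam^-1 ^+ _; set y := wprod _ _ _ _; set f' := f _.
by field.
Qed.

End rotation_orbits.

(** * The resolvent and the Schwarz lemma *)

Section resolvent.
Context {R : realType}.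
Implicit Types (f g w : R[i] -> R[i]) (z mu nu lam : R[i]) (r s M : R).

Definition cconverges (u : nat -> R[i]) l := forall e : R, 0 < e ->
  exists N, forall n, (N <= n)%N -> cnorm (u n - l) <= e.

Lemma cconverges_uniq u l l' : cconverges u l -> cconverges u l' -> l = l'.
Proof.
move=> ul ul'; apply: cnorm_inj_eq => e e0; have e2 : 0 < e / 2 by rewrite divr_gt0.
have [N hN] := ul _ e2; have [N' hN'] := ul' _ e2.
have := hN _ (leq_maxl N N'); have := hN' _ (leq_maxr N N').
set n := maxn _ _ => k' k.
have -> : l - l' = (u n - l') - (u n - l) by ring.
by rewrite (le_trans (cnormB _ _))//; lra.
Qed.

Lemma geometric_cauchy (u : nat -> R[i]) (A x : R) : 0 <= x < 1 -> 0 <= A ->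
  (forall n, cnorm (u n.+1 - u n) <= A * x ^+ n) ->
  forall m n, cnorm (u m - u n) <= A / (1 - x) * x ^+ m + A / (1 - x) * x ^+ n.
Proof.
move=> /andP[x0 x1] A0 h m n; have y0 : 0 < 1 - x by lra.
have k i j : cnorm (u (i + j)%N - u i) <= A / (1 - x) * (x ^+ i - x ^+ (i + j)).
  elim: j => [|j IH]; first by rewrite addn0 !subrr cnorm0 mulr0.
  rewrite addnS (le_trans (cdist_trans (u (i + j)%N) _ _))//.
  rewrite (le_trans (lerD (h _) IH))// exprS.
  have -> : A * x ^+ (i + j) = A / (1 - x) * ((1 - x) * x ^+ (i + j)).
    by field; rewrite gt_eqF.
  by rewrite -mulrDr ler_wpM2l ?divr_ge0// ?(ltW y0)//; lra.
have B0 : 0 <= A / (1 - x) by rewrite divr_ge0// ltW.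
have k2 i j : cnorm (u (i + j)%N - u i) <= A / (1 - x) * x ^+ i.
  by rewrite (le_trans (k i j))// ler_wpM2l// gerBl exprn_ge0.
have [mn|nm] := leqP m n.
  rewrite cdistC -(subnKC mn) (le_trans (k2 _ _))// lerDl.
  by rewrite mulr_ge0// exprn_ge0.
rewrite -(subnKC (ltnW nm)) (le_trans (k2 _ _))// lerDr.
by rewrite mulr_ge0// exprn_ge0.
Qed.

(** Growth is controlled on smaller disks, which is what [uniform_growth] provides for
    [|lam| > |w 0|]. Accordingly [G] is holomorphic in the disk but not known to lie in the
    space. *)
Lemma resolvent_exists w f mu lam : cnorm mu = 1 -> holo_unit w -> holo_unit f -> lam != 0 ->
  (forall s, 0 < s < 1 -> exists C q, [/\ 0 <= q, q < cnorm lam &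
    forall n z, cnorm z <= s -> cnorm (wprod w mu n z) <= C * q ^+ n]) ->
  exists G, [/\ holo_unit G,
    forall z, cnorm z < 1 -> w z * G (mu * z) - lam * G z = f z &
    forall z, cnorm z < 1 -> cconverges (resolvent_sum w f mu lam ^~ z) (G z)].
Proof.
move=> mu1 hw hf l0 hq.
have L0 : 0 < cnorm lam by rewrite cnorm_gt0.
pose S n z := resolvent_sum w f mu lam n z.
pose G z := xget 0 [set l | cconverges (S^~ z) l].
have unif s : 0 < s < 1 -> exists A x, [/\ 0 <= A, 0 <= x < 1,
    forall z, cnorm z <= s -> cconverges (S^~ z) (G z) &
    forall n z, cnorm z <= s -> cnorm (S n z - G z) <= A * x ^+ n].
  move=> s01; have [s0 s1] := andP s01.
  have [C [q [q0 ql hC]]] := hq s s01.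
  have [F F0 fF] := disk_bounded (ltW s0) (holo_unit_disk hf s1).
  have C0 : 0 <= C.
    have := hC 0%N 0; rewrite cnorm0 expr0 mulr1 => /(_ (ltW s0)).
    by apply: le_trans; exact: cnorm_ge0.
  pose x := q / cnorm lam; pose A := C * F / cnorm lam.
  have x01 : 0 <= x < 1 by rewrite divr_ge0 ?(ltW L0)//= ltr_pdivrMr// mul1r.
  have A0 : 0 <= A by rewrite divr_ge0 ?(ltW L0)// mulr_ge0// ltW.
  have step z n : cnorm z <= s -> cnorm (S n.+1 z - S n z) <= A * x ^+ n.
    move=> zs; rewrite /S /resolvent_sum big_ord_recr /= opprD addrC addKr.
    rewrite cnormN !cnormM cnormX cnormV exprS.
    have -> : A * x ^+ n = (cnorm lam)^-1 * (cnorm lam)^-1 ^+ n * (C * q ^+ n) * F.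
      by rewrite /A /x [(q / _) ^+ n]exprMn; ring.
    rewrite ler_pM ?mulr_ge0 ?exprn_ge0 ?invr_ge0 ?cnorm_ge0//.
      by rewrite ler_wpM2l ?hC ?mulr_ge0 ?exprn_ge0 ?invr_ge0 ?cnorm_ge0.
    by apply: fF; rewrite cnorm_rot.
  have [x0 x1] := andP x01.
  have D0 : 0 <= A / (1 - x) by rewrite divr_ge0//; lra.
  have cau z m n : cnorm z <= s ->
      cnorm (S m z - S n z) <= A / (1 - x) * x ^+ m + A / (1 - x) * x ^+ n.
    by move=> zs; apply: (@geometric_cauchy (S^~ z)) => // k; exact: step.
  have small e : 0 < e -> exists N, forall n, (N <= n)%N -> A / (1 - x) * x ^+ n <= e.
    move=> e0; have [N hN] := @exprn_small R x (e / (A / (1 - x) + 1)) x01 ltac:(by rewrite divr_gt0//; lra).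
    exists N => n /hN; rewrite ler_pdivlMr; last by lra.
    by have := exprn_ge0 n x0; lra.
  have conv z : cnorm z <= s -> cconverges (S^~ z) (G z).
    move=> zs; have [l hl] := complex_limit (fun m n => cau z m n zs).
    suff ll : cconverges (S^~ z) l by exact: (@xgetI _ 0 [set l | cconverges (S^~ z) l] l ll).
    move=> e e0; have e2 : 0 < e / 2 by rewrite divr_gt0.
    have [N hN] := small _ e2; exists N => n /hN nn.
    by rewrite (le_trans (hl n))//; lra.
  exists (A / (1 - x)), x; split=> // n z zs.
  apply/ler_addgt0Pr => e e0; have e2 : 0 < e / 2 by rewrite divr_gt0.
  have [N hN] := conv z zs _ e2; have [N' hN'] := small _ e2.
  have := hN _ (leq_maxl N N'); have := hN' _ (leq_maxr N N').
  set m := maxn _ _ => k' k; have k2 := cau z n m zs.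
  by rewrite (le_trans (cdist_trans (S m z) _ _))//; lra.
have mid z : cnorm z < 1 -> exists2 s, 0 < s < 1 & cnorm z < s.
  move=> z1; have z0 := cnorm_ge0 z; exists ((1 + cnorm z) / 2); last lra.
  by apply/andP; split; lra.
have conv z : cnorm z < 1 -> cconverges (S^~ z) (G z).
  by move=> /mid[s s01 zs]; have [A [x [_ _ h _]]] := unif s s01; apply: h; exact: ltW.
have hS n : holo_unit (S n).
  move=> z z1; apply: holoN; apply: holo_sum => m; apply: holoM.
    by apply: holoM; [exact: holo_cst|exact: holo_wprod].
  by apply: holo_rot; apply: hf; rewrite cnorm_rot.
exists G; split => // [z z1|z z1].
  have [s s01 zs] := mid z z1; have [s0 s1] := andP s01.
  have [A [x [A0 x01 _ h]]] := unif s s01; have [x0 x1] := andP x01.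
  apply: (@weierstrass _ G s) => // e e0.
  have [N hN] := @exprn_small R x (e / (A + 1)) x01 ltac:(by rewrite divr_gt0//; lra).
  exists (S N); first by apply: holo_unit_disk.
  move=> y ys; rewrite (le_trans (h N y ys))//.
  have := hN N (leqnn N); rewrite ler_pdivlMr; last by lra.
  by have := exprn_ge0 N x0; lra.
have muz : cnorm (mu * z) < 1 by rewrite cnormM mu1 mul1r.
apply: cnorm_inj_eq => e e0.
have W0 : 0 < cnorm (w z) + 1 by have := cnorm_ge0 (w z); lra.
have [N hN] := conv _ muz (e / 2 / (cnorm (w z) + 1)) ltac:(by rewrite !divr_gt0).
have [N' hN'] := conv _ z1 (e / 2 / cnorm lam) ltac:(by rewrite !divr_gt0).
have k := hN _ (leq_maxl N N'); have k' := hN' _ (leq_trans (leq_maxr N N') (leqnSn _)).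
move: k k'; set n := maxn N N'; rewrite !ler_pdivlMr// => k k'.
rewrite -(resolvent_sumS w f mu n z l0) -/(S n (mu * z)) -/(S n.+1 z).
have -> : w z * G (mu * z) - lam * G z - (w z * S n (mu * z) - lam * S n.+1 z) =
    lam * (S n.+1 z - G z) - w z * (S n (mu * z) - G (mu * z)) by ring.
rewrite (le_trans (cnormB _ _))// !cnormM.
have := cnorm_ge0 (S n (mu * z) - G (mu * z)); lra.
Qed.

End resolvent.

Section schwarz.
Context {R : realType}.
Implicit Types (f g h om : R[i] -> R[i]) (z : R[i]).

(** If the derivative [l] were nonzero, a small move in the direction [h z / l] would push [h]
    radially out of the unit circle. *)
Lemma cder_eq0_of_norm1 h z (d : R) : 0 < d -> holo h z ->
  (forall y, cnorm (y - z) < d -> cnorm (h y) = 1) -> cder h z = 0.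
Proof.
move=> d0 /cderP; set l := cder h z => hl h1; apply: contrapT => /eqP l0.
have nl : 0 < cnorm l by rewrite cnorm_gt0.
have e0 : 0 < cnorm l / 2 by rewrite divr_gt0.
have [d' d'0 hd] := hl _ e0.
have c1 : cnorm (h z) = 1 by apply: h1; rewrite subrr cnorm0.
have m0 : 0 < Num.min d d' by rewrite lt_min d0.
(* This size puts [y] at half the admissible distance; the radial gain [t] then exceeds the error,
   which is at most [t / 2]. *)
pose t := Num.min d d' * cnorm l / 2.
have t0 : 0 < t by rewrite !mulr_gt0.
pose y := z + t%:C * h z / l.
have ny : cnorm (y - z) = t / cnorm l.
  by rewrite /y addrC addKr !cnormM cnormV c1 mulr1 cnorm_real gtr0_norm.
have nyd : cnorm (y - z) < Num.min d d'.
  have -> : cnorm (y - z) = Num.min d d' / 2 by rewrite ny /t; field; rewrite gt_eqF.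
  lra.
have [yd yd'] : cnorm (y - z) < d /\ cnorm (y - z) < d' by move: nyd; rewrite lt_min => /andP.
have := hd y yd'; rewrite ny.
have -> : cnorm l / 2 * (t / cnorm l) = t / 2 by field; rewrite gt_eqF.
have -> : h y - h z - l * (y - z) = h y - (1 + t)%:C * h z.
  have -> : l * (y - z) = t%:C * h z by rewrite /y; field.
  by rewrite rmorphD /=; ring.
have := cnormB_ge ((1 + t)%:C * h z) (h y).
rewrite cdistC (h1 y yd) cnormM c1 mulr1 cnorm_real gtr0_norm; lra.
Qed.

Lemma schwarz om : holo_unit om -> om 0 = 0 -> (forall z, cnorm z < 1 -> cnorm (om z) < 1) ->
  forall z, cnorm z < 1 -> cnorm (om z) <= cnorm z.
Proof.
move=> ho o0 o1 z z1; rewrite (divXE om z) o0 add0r cnormM.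
rewrite ler_piMr ?cnorm_ge0//; apply/ler_addgt0Pr => e e0.
have z0 := cnorm_ge0 z.
(* Dividing by the variable costs [1 / r] on the circle of radius [r]; the second entry makes this
   at most [1 + e]. *)
pose r := Num.max ((1 + cnorm z) / 2) (1 / (1 + e)).
have r1 : r < 1.
  by rewrite /r gt_max; apply/andP; split; [lra|rewrite ltr_pdivrMr; lra].
have zr : cnorm z <= r by rewrite /r le_max; apply/orP; left; lra.
have r0 : 0 < r by rewrite /r lt_max; apply/orP; left; lra.
apply: (max_principle r0 (holo_unit_disk (holo_unit_divX ho) r1)) => // y yr.
have yn0 : y != 0 by rewrite -cnorm_gt0 yr.
rewrite /divX (negbTE yn0) o0 subr0 cnormM cnormV yr ler_pdivrMr//.
have : cnorm (om y) < 1 by apply: o1; rewrite yr.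
have : 1 / (1 + e) <= r by rewrite /r le_max lexx orbT.
by rewrite ler_pdivrMr; lra.
Qed.

(** Schwarz's lemma for the map and its inverse gives [|om z| = |z|], so [om z / z] has modulus 1
    and hence zero derivative; [growth_bound] with rate 0 makes it constant. *)
Lemma disk_rotation om om' : holo_unit om -> om 0 = 0 ->
  (forall z, cnorm z < 1 -> cnorm (om z) < 1) -> holo_unit om' ->
  (forall z, cnorm z < 1 -> cnorm (om' z) < 1) ->
  (forall z, cnorm z < 1 -> om' (om z) = z) ->
  exists2 mu, cnorm mu = 1 & forall z, cnorm z < 1 -> om z = mu * z.
Proof.
move=> ho o0 o1 ho' o1' oK.
have z01 : cnorm (0 : R[i]) < 1 by rewrite cnorm0.
have o0' : om' 0 = 0 by rewrite -{1}o0 oK.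
have iso z : cnorm z < 1 -> cnorm (om z) = cnorm z.
  move=> z1; apply/eqP; rewrite eq_le schwarz//=.
  by rewrite -{1}(oK z z1); apply: schwarz => //; exact: o1.
pose h := divX om.
have hh : holo_unit h by exact: holo_unit_divX.
have h1' z : z != 0 -> cnorm z < 1 -> cnorm (h z) = 1.
  move=> z0 z1; rewrite /h /divX (negbTE z0) o0 subr0 cnormM cnormV iso// divff//.
  by rewrite cnorm_eq0.
have cn f z : ccont f z -> ccont (fun y => (cnorm (f y))%:C) z.
  move=> fc e e0; have [d d0 hd] := fc e e0; exists d => // y /hd; apply: le_trans.
  rewrite -rmorphB cnorm_real ler_norml; apply/andP; split.
    by rewrite cdistC; have := cnormB_ge (f z) (f y); lra.
  exact: cnormB_ge.
have h1 z : cnorm z < 1 -> cnorm (h z) = 1.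
  move=> z1; have [->|z0] := eqVneq z 0; last exact: h1'.
  have c1 : ccont (fun y => (cnorm (h y))%:C) 0 by apply/cn/holo_cont/hh.
  have c2 : ccont (fun y : R[i] => (1 : R)%:C) 0 by apply: holo_cont; exact: holo_cst.
  have := ccont_eq0 c1 c2.
  have H : forall z, z != 0 -> cnorm z < 1 -> (cnorm (h z))%:C = (1 : R)%:C.
    by move=> y y0 y1; rewrite h1'.
  by move=> /(_ H)/complexI.
exists (h 0) => [|z z1]; first exact: h1.
rewrite (divXE om) o0 add0r mulrC; congr (_ * _); rewrite -/h.
have hz0 y : cnorm y < 1 -> cder h y = 0.
  move=> y1; apply: (@cder_eq0_of_norm1 h y (1 - cnorm y)); [lra|exact: hh|].
  by move=> x xy; apply: h1; have := cnormD (x - y) y; rewrite subrK; lra.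
have tz (t : R) : 0 <= t <= 1 -> cnorm (t%:C * z) < 1.
  move=> /andP[t0 t1]; rewrite cnormM cnorm_real ger0_norm//.
  by rewrite (le_lt_trans _ z1)// ler_piMl// cnorm_ge0.
have := @growth_bound R (fun y => h y - h 0) z 0.
rewrite subrr cnorm0 mul0r => gb.
apply: cnorm_inj_eq => e e0; apply: le_trans (ltW e0); apply: gb.
  by move=> t /tz t1; apply: holoB; [exact: hh|exact: holo_cst].
move=> t /tz t1; rewrite mul0r.
have := cderP (hh _ t1); rewrite (hz0 _ t1) => h0.
have := cderivD h0 (cderiv_cst (- h 0) (t%:C * z)); rewrite addr0 => /cder_eq ->.
by rewrite mul0r cnorm0.
Qed.

End schwarz.

(** * The open mapping theorem for a complete norm *)

(** A real-valued norm on a bare module, since the norm of a [normedModType R[i]] takes its values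
    in [R[i]]. *)
Record is_norm {R : realType} (X : lmodType R[i]) (N : X -> R) : Prop := IsNorm {
  is_norm_ge0 : forall x, 0 <= N x ;
  is_normD : forall x y, N (x + y) <= N x + N y ;
  is_normZ : forall a x, N (a *: x) = cnorm a * N x ;
  is_norm_eq0 : forall x, N x = 0 -> x = 0 }.

(** Convergence is asked of sequences with geometrically decreasing steps; by passage to
    subsequences this amounts to completeness. *)
Definition norm_complete {R : realType} (X : lmodType R[i]) (N : X -> R) :=
  forall (u : nat -> X) (A : R), (forall n, N (u n.+1 - u n) <= A * 2^-1 ^+ n) ->
  exists l, forall e, 0 < e -> exists n0, forall n, (n0 <= n)%N -> N (u n - l) <= e.

Section norm_theory.
Context {R : realType} (X : lmodType R[i]) (N : X -> R) (nN : is_norm N).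
Implicit Types x y z : X.

Lemma is_norm0 : N 0 = 0.
Proof. by rewrite -[0](scale0r 0) (is_normZ nN) cnorm0 mul0r. Qed.

Lemma is_normN x : N (- x) = N x.
Proof. by rewrite -scaleN1r (is_normZ nN) cnormN cnorm1 mul1r. Qed.

Lemma is_normB x y : N (x - y) <= N x + N y.
Proof. by rewrite -(is_normN y) (is_normD nN). Qed.

Lemma is_norm_distC x y : N (x - y) = N (y - x).
Proof. by rewrite -opprB is_normN. Qed.

Lemma is_norm_trans y x z : N (x - z) <= N (x - y) + N (y - z).
Proof. by rewrite (le_trans _ (is_normD nN _ _))// addrA subrK. Qed.

Lemma is_norm_sum (I : Type) (r : seq I) (P : pred I) (F : I -> X) :
  N (\sum_(i <- r | P i) F i) <= \sum_(i <- r | P i) N (F i).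
Proof.
elim/big_ind2 : _ => [|x u y v xu yv|//]; first by rewrite is_norm0.
by rewrite (le_trans (is_normD nN _ _))// lerD.
Qed.

Lemma is_norm_inj x y : (forall e, 0 < e -> N (x - y) <= e) -> x = y.
Proof.
move=> h; apply/eqP; rewrite -subr_eq0; apply/eqP/(is_norm_eq0 nN)/eqP.
rewrite eq_le (is_norm_ge0 nN) andbT.
by apply/ler_addgt0Pr => e /h; rewrite add0r.
Qed.

Lemma telescope_half_le (u : nat -> X) (A : R) : (forall n, N (u n.+1 - u n) <= A * 2^-1 ^+ n) ->
  forall m k, N (u (m + k)%N - u m) <= 2 * A * 2^-1 ^+ m.
Proof.
move=> h m k.
have A0 : 0 <= A by have := h 0%N; rewrite expr0 mulr1; apply: le_trans; exact: is_norm_ge0.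
suff : N (u (m + k)%N - u m) <= 2 * A * (2^-1 ^+ m - 2^-1 ^+ (m + k)).
  move/le_trans; apply; rewrite ler_wpM2l ?mulr_ge0// gerBl.
  by rewrite exprn_ge0// invr_ge0.
elim: k => [|k IH]; first by rewrite addn0 !subrr is_norm0 mulr0.
rewrite addnS (le_trans (is_norm_trans (u (m + k)%N) _ _))//.
rewrite (le_trans (lerD (h _) IH))// exprS; lra.
Qed.

End norm_theory.

Section open_mapping.
Context {R : realType} (X Y : lmodType R[i]) (NX : X -> R) (NY : Y -> R).
Context (nX : is_norm NX) (nY : is_norm NY) (cX : norm_complete NX) (cY : norm_complete NY).
Context (S : X -> Y) (M : R).
Context (SL : forall a x y, S (a *: x + y) = a *: S x + S y).
Context (SM : forall x, NY (S x) <= M * NX x) (Ssurj : forall y, exists x, S x = y).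

Let S0 : S 0 = 0.
Proof. by have := SL (-1) 0 0; rewrite addr0 scaleN1r oppr0 scaleN1r addNr. Qed.

Let SZ a x : S (a *: x) = a *: S x.
Proof. by have := SL a x 0; rewrite !addr0 S0 addr0. Qed.

Let SD x y : S (x + y) = S x + S y.
Proof. by have := SL 1 x y; rewrite !scale1r. Qed.

Let SB x y : S (x - y) = S x - S y.
Proof. by rewrite SD -scaleN1r SZ scaleN1r. Qed.

Let approx (k : R) y := forall e, 0 < e -> exists2 x, NX x <= k & NY (y - S x) <= e.

(** Baire's argument. Otherwise balls in [Y] can be nested so that each stays away from the image of
    a ball in [X], whose radius runs through the integers. The common point of the balls in [Y] has
    a preimage, and its norm is below some integer. *)
Lemma approx_ball : exists k y0 (d : R), 0 < d /\ forall y, NY (y - y0) <= d -> approx k y.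
Proof.
apply: contrapT => no.
have step (k : nat) (q : Y * R) : exists q' : Y * R, 0 < q.2 ->
    [/\ NY (q'.1 - q.1) <= q.2 / 2, 0 < q'.2, q'.2 <= q.2 / 2 &
        forall x, NX x <= k%:R -> 2 * q'.2 <= NY (q'.1 - S x)].
  have [q0|nq0] := pselect (0 < q.2); last by exists q.
  have q2 : 0 < q.2 / 2 by rewrite divr_gt0.
  have : ~ (forall y, NY (y - q.1) <= q.2 / 2 -> approx k%:R y).
    by move=> h; apply: no; exists k%:R, q.1, (q.2 / 2).
  move/existsNP => [y /not_implyP[yq /existsNP[e /not_implyP[e0 ye]]]].
  exists (y, Num.min (q.2 / 2) (e / 2)) => _ /=.
  have e2 : 0 < e / 2 by rewrite divr_gt0.
  split=> //; [by rewrite lt_min q2|by rewrite ge_min lexx|].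
  move=> x xk; rewrite leNgt; apply/negP => lt.
  apply: ye; exists x => //.
  have : Num.min (q.2 / 2) (e / 2) <= e / 2 by rewrite ge_min lexx orbT.
  by lra.
pose nxt k q := projT1 (cid (step k q)).
pose q := fix q n : Y * R := if n is m.+1 then nxt m (q m) else (0, 1).
have q0 n : 0 < (q n).2.
  by elim: n => [|n IH]; [exact: ltr01|have [] := projT2 (cid (step n (q n))) IH].
have hq n : [/\ NY ((q n.+1).1 - (q n).1) <= (q n).2 / 2, 0 < (q n.+1).2,
    (q n.+1).2 <= (q n).2 / 2 &
    forall x, NX x <= n%:R -> 2 * (q n.+1).2 <= NY ((q n.+1).1 - S x)].
  exact: projT2 (cid (step n (q n))) (q0 n).
have qpow m k : (q (m + k)%N).2 <= (q m).2 * 2^-1 ^+ k.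
  elim: k => [|k IH]; first by rewrite addn0 expr0 mulr1.
  have [_ _ h _] := hq (m + k)%N; rewrite addnS (le_trans h)// exprS; lra.
have qtel m k : NY ((q (m + k)%N).1 - (q m).1) <= (q m).2.
  have := @telescope_half_le _ _ NY nY (fun i => (q (m + i)%N).1) ((q m).2 / 2).
  move=> H; have {}H := H _ 0%N k; rewrite add0n addn0 expr0 mulr1 in H.
  apply: le_trans (H _) _; last by lra.
  move=> n; have [h _ _ _] := hq (m + n)%N; rewrite addnS (le_trans h)//.
  by have := qpow m n; lra.
have [|l hl] := cY (u := fun n => (q n).1) (A := 1).
  move=> n; have [h _ _ _] := hq n; rewrite (le_trans h)//.
  have := qpow 0%N n; rewrite add0n /= mul1r.
  have : 0 <= 2^-1 ^+ n :> R by rewrite exprn_ge0// invr_ge0.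
  lra.
have [x Sx] := Ssurj l.
have /archi_boundP := is_norm_ge0 nX x; set k := Num.bound _ => xk.
have [_ dk _ /(_ x (ltW xk)) hk] := hq k.
have d2 : 0 < (q k.+1).2 / 2 by rewrite divr_gt0.
have [n0 hn0] := hl _ d2.
have h2 := hn0 (k.+1 + n0)%N (leq_addl _ _); have h1 := qtel k.+1 n0.
rewrite Sx in hk; rewrite (is_norm_distC nY) in h1.
have h3 := is_norm_trans nY (q (k.+1 + n0)%N).1 (q k.+1).1 l.
clear Sx; lra.
Qed.

(** The vector [t *: y] is the difference of [y0 + t *: y] and [y0], both in the good ball if
    [t = d / NY y]. Each is approximated up to [d / 4], and division by [t] turns the sum [d / 2]
    into half of [NY y]. *)
Lemma approx_half : exists2 K, 0 <= K & forall y, exists x,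
  NX x <= K * NY y /\ NY (y - S x) <= 2^-1 * NY y.
Proof.
have [k [y0 [d [d0 h]]]] := approx_ball.
have k0 : 0 <= k.
  have := h y0; rewrite subrr (is_norm0 nY) => /(_ (ltW d0) 1 ltr01)[x xk _].
  by apply: le_trans xk; exact: is_norm_ge0.
exists (2 * k / d); first by rewrite divr_ge0 ?mulr_ge0// ltW.
move=> y; have ny := is_norm_ge0 nY y.
have [y00|yn0] := eqVneq (NY y) 0.
  by exists 0; rewrite (is_norm0 nX) S0 subr0 y00 !mulr0.
have yp : 0 < NY y by rewrite lt_neqAle eq_sym yn0.
pose t := d / NY y; have t0 : 0 < t by rewrite divr_gt0.
have nt : cnorm t%:C = t by rewrite cnorm_real gtr0_norm.
have d4 : 0 < d / 4 by rewrite divr_gt0.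
have [|x1 x1k x1e] := h (y0 + t%:C *: y) _ _ d4.
  by rewrite addrC addKr (is_normZ nY) nt /t divfK.
have [|x2 x2k x2e] := h y0 _ _ d4; first by rewrite subrr (is_norm0 nY) ltW.
have tn0 : t%:C != 0 :> R[i] by rewrite -cnorm_gt0 nt.
exists ((t%:C)^-1 *: (x1 - x2)); rewrite (is_normZ nX) cnormV nt; split.
  rewrite (_ : 2 * k / d * NY y = t^-1 * (k + k)).
    by rewrite ler_pM2l ?invr_gt0// (le_trans (is_normB nX _ _))// lerD.
  by rewrite /t invf_div; field; rewrite gt_eqF.
have -> : y - S (t%:C^-1 *: (x1 - x2)) =
    t%:C^-1 *: ((y0 + t%:C *: y - S x1) - (y0 - S x2)).
  rewrite SZ SB; have {1}-> : y = t%:C^-1 *: (t%:C *: y) by rewrite scalerA mulVf// scale1r.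
  rewrite -scalerBr; congr (_ *: _).
  by rewrite !opprB [RHS]addrC -[y0 + _ - _]addrA [RHS]addrA subrK addrCA.
rewrite (is_normZ nY) cnormV nt mulrC ler_pdivrMr//.
rewrite (_ : 2^-1 * NY y * t = d / 2); last by rewrite /t; field.
by rewrite (le_trans (is_normB nY _ _))//; lra.
Qed.

Lemma open_mapping : exists2 K, 0 <= K & forall y, exists2 x, S x = y & NX x <= K * NY y.
Proof.
have [K K0 hK] := approx_half.
(* Here [2 * K] sums the geometric series, and the extra 1 covers the distance from a partial sum to
   the limit. *)
exists (2 * K + 1); first by lra.
move=> y; have ny := is_norm_ge0 nY y.
have [y00|yn0] := eqVneq (NY y) 0.
  by exists 0; rewrite ?(is_norm0 nX) ?y00 ?mulr0// (is_norm_eq0 nY y00).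
have yp : 0 < NY y by rewrite lt_neqAle eq_sym yn0.
pose sol y := projT1 (cid (hK y)).
have solP z : NX (sol z) <= K * NY z /\ NY (z - S (sol z)) <= 2^-1 * NY z.
  exact: projT2 (cid (hK z)).
pose r := fix r n := if n is m.+1 then r m - S (sol (r m)) else y.
have rS n : r n.+1 = r n - S (sol (r n)) by [].
pose u n := \sum_(i < n) sol (r i).
have Su n : S (u n) = y - r n.
  elim: n => [|n IH]; first by rewrite /u big_ord0 S0 subrr.
  by rewrite /u big_ord_recr SD -/(u n) IH rS opprB addrA addrAC.
have rn n : NY (r n) <= NY y * 2^-1 ^+ n.
  elim: n => [|n IH]; first by rewrite expr0 mulr1.
  by rewrite rS exprS; have [_ h] := solP (r n); lra.
have un n : NX (u n.+1 - u n) <= K * NY y * 2^-1 ^+ n.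
  have -> : u n.+1 - u n = sol (r n) by rewrite /u big_ord_recr addrAC subrr add0r.
  have [h _] := solP (r n).
  by rewrite (le_trans h)// -mulrA ler_wpM2l.
have [l hl] := cX un.
have lu (e : R) : 0 < e -> exists n, NX (u n - l) <= e /\ 2^-1 ^+ n <= e.
  move=> e0; have [n0 h0] := hl e e0.
  have h01 : 0 <= (2 : R)^-1 < 1 by rewrite invr_ge0 ler0n /= invf_lt1 ?ltr1n.
  have [n1 h1] := exprn_small h01 e0.
  by exists (maxn n0 n1); split; [apply: h0; exact: leq_maxl|apply: h1; exact: leq_maxr].
have M1 : 0 <= `|M| + NY y + 1 by rewrite !addr_ge0.
exists l.
  apply: (is_norm_inj nY) => e e0; rewrite (is_norm_distC nY).
  have ep : 0 < e / (`|M| + NY y + 1) by rewrite divr_gt0// ltr_wpDl ?addr_ge0.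
  have [n [h1 h2]] := lu _ ep.
  have -> : y - S l = r n + S (u n - l) by rewrite SB Su [RHS]addrA [r n + _]addrC subrK.
  rewrite (le_trans (is_normD nY _ _))//.
  have k1 := SM (u n - l); have k2 := rn n.
  have k3 : M * NX (u n - l) <= `|M| * (e / (`|M| + NY y + 1)).
    rewrite (le_trans (ler_wpM2r (is_norm_ge0 nX _) (ler_norm M)))//.
    by rewrite ler_wpM2l.
  have k4 : NY y * 2^-1 ^+ n <= NY y * (e / (`|M| + NY y + 1)) by rewrite ler_wpM2l.
  have k5 : (`|M| + NY y + 1) * (e / (`|M| + NY y + 1)) = e.
    by rewrite mulrC divfK// gt_eqF// ltr_wpDl ?addr_ge0.
  rewrite !mulrDl mul1r in k5; lra.
have [n [h1 _]] := lu _ yp.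
have := @telescope_half_le _ _ NX nX u (K * NY y) un 0%N n.
rewrite add0n expr0 mulr1 {2}/u big_ord0 subr0 => h2.
have -> : l = u n - (u n - l) by rewrite opprB addrC subrK.
by rewrite (le_trans (is_normB nX _ _))//; lra.
Qed.

End open_mapping.

(** The vectors [s i] may be dependent modulo the range, so [m] is only an upper bound for the
    codimension. *)
Definition finite_corank {R : realType} (X Y : lmodType R[i]) (T : X -> Y) m :=
  exists s : 'I_m -> Y, forall y, exists x (c : 'I_m -> R[i]), y = T x + \sum_i c i *: s i.

Section finite_corank_inverse.
Context {R : realType} (V : lmodType R[i]) (N : V -> R).
Context (nN : is_norm N) (cN : norm_complete N).

Section pairs.
Context (m : nat).
Let X : lmodType R[i] := (V * {ffun 'I_m -> R[i]})%type.

Definition pair_norm (x : X) : R := N x.1 + \sum_(i < m) cnorm (x.2 i).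

Lemma is_norm_pair : is_norm pair_norm.
Proof.
split.
- by move=> x; rewrite addr_ge0 ?(is_norm_ge0 nN)// sumr_ge0// => i _; exact: cnorm_ge0.
- move=> x y; rewrite /pair_norm addrACA lerD ?(is_normD nN)// -big_split /=.
  by apply: ler_sum => i _; rewrite ffunE cnormD.
- move=> a x; rewrite /pair_norm (is_normZ nN) mulrDr mulr_sumr; congr (_ + _).
  by apply: eq_bigr => i _; rewrite ffunE cnormM.
- move=> [x c]; rewrite /pair_norm /= => /eqP; rewrite paddr_eq0 ?(is_norm_ge0 nN)//; last first.
    by rewrite sumr_ge0// => i _; exact: cnorm_ge0.
  move=> /andP[/eqP/(is_norm_eq0 nN)-> /eqP c0]; congr (_, _); apply/ffunP => i.
  rewrite ffunE; apply/eqP; rewrite -cnorm_eq0; apply/eqP.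
  by move/psumr_eq0P : c0; apply => // j _; exact: cnorm_ge0.
Qed.

Lemma half_range : 0 <= (2 : R)^-1 < 1.
Proof. by rewrite invr_ge0 ler0n /= invf_lt1 ?ltr1n. Qed.

Lemma complex_complete (u : nat -> R[i]) (A : R) :
  (forall n, cnorm (u n.+1 - u n) <= A * 2^-1 ^+ n) -> exists l, cconverges u l.
Proof.
move=> h.
have A0 : 0 <= A by have := h 0%N; rewrite expr0 mulr1; apply: le_trans; exact: cnorm_ge0.
have [l hl] := complex_limit (geometric_cauchy half_range A0 h).
have B0 : 0 <= A / (1 - 2^-1) by apply: divr_ge0 => //; have /andP[_] := half_range; lra.
move: (A / _) B0 hl => B B0 hl; exists l => e e0.
have B1 : 0 < 2 * B + 1 by lra.
have [n0 hn0] := exprn_small half_range (divr_gt0 e0 B1); exists n0 => n /hn0.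
rewrite ler_pdivlMr// => hn; rewrite (le_trans (hl n))//.
have : 0 <= 2^-1 ^+ n :> R by rewrite exprn_ge0// invr_ge0.
lra.
Qed.

Lemma pair_complete : norm_complete pair_norm.
Proof.
move=> u A h.
have [l hl] : exists l, forall e, 0 < e -> exists n0, forall n, (n0 <= n)%N -> N ((u n).1 - l) <= e.
  apply: (cN (A := A)) => n; apply: le_trans (h n); rewrite /pair_norm lerDl.
  by rewrite sumr_ge0// => i _; exact: cnorm_ge0.
have lim i : exists l, cconverges (fun n => (u n).2 i) l.
  apply: (@complex_complete _ A) => n; apply: le_trans (h n).
  rewrite /pair_norm (bigD1 i)//= !ffunE addrCA lerDl addr_ge0 ?(is_norm_ge0 nN)//.
  by rewrite sumr_ge0// => j _; exact: cnorm_ge0.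
pose c i := projT1 (cid (lim i)).
have hc i : cconverges (fun n => (u n).2 i) (c i) by exact: projT2 (cid (lim i)).
exists (l, [ffun i => c i]) => e e0.
have em : 0 < e / m.+1%:R by rewrite divr_gt0// ltr0n.
have [n0 hn0] := hl _ em.
pose n1 i := projT1 (cid (hc i _ em)).
have hn1 i : forall n, (n1 i <= n)%N -> cnorm ((u n).2 i - c i) <= e / m.+1%:R.
  exact: projT2 (cid (hc i _ em)).
exists (maxn n0 (\max_i n1 i)) => n; rewrite geq_max => /andP[/hn0 k0 /bigmax_leqP k1].
rewrite /pair_norm /=.
have -> : e = e / m.+1%:R + \sum_(i < m) e / m.+1%:R.
  by rewrite sumr_const card_ord -mulrS -(mulr_natr (e / m.+1%:R)) divfK.
rewrite lerD//; apply: ler_sum => i _; rewrite !ffunE; apply: hn1; exact: k1.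
Qed.

End pairs.

(** For the least [m] the vectors [s i] are independent modulo the range, so that
    [T x + \sum_i c i *: s i] is a bijective function of the pair [(x, c)]. The open mapping theorem
    bounds its inverse; on the pairs [(x, 0)] this is the lower bound for [T]. *)
Lemma finite_corank_inverse (T : V -> V) (M : R) m :
  (forall a x y, T (a *: x + y) = a *: T x + T y) -> (forall x, N (T x) <= M * N x) ->
  (forall x, T x = 0 -> x = 0) -> finite_corank T m ->
  exists2 K, 0 <= K & exists n (s : 'I_n -> V),
    (forall y, exists x (c : 'I_n -> R[i]),
      [/\ y = T x + \sum_i c i *: s i, N x <= K * N y & forall i, cnorm (c i) <= K * N y]) /\
    forall x, N x <= K * N (T x).
Proof.
move=> TL TM Tinj Tm.
have exm : exists m, `[< finite_corank T m >] by exists m; apply/asboolP.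
case: (ex_minnP exm) => n /asboolP[s hs] minn.
have T0 : T 0 = 0.
  by have := TL (-1) 0 0; rewrite addr0 scaleN1r oppr0 scaleN1r addNr.
have TZ a x : T (a *: x) = a *: T x by have := TL a x 0; rewrite !addr0 T0 addr0.
have TD x y : T (x + y) = T x + T y by have := TL 1 x y; rewrite !scale1r.
pose X : lmodType R[i] := (V * {ffun 'I_n -> R[i]})%type.
pose S (x : X) := T x.1 + \sum_i x.2 i *: s i.
have SL a x y : S (a *: x + y) = a *: S x + S y.
  rewrite /S /= TL scalerDr -!addrA; congr (_ + _).
  rewrite addrCA; congr (_ + _); rewrite scaler_sumr -big_split /=.
  by apply: eq_bigr => i _; rewrite !ffunE scalerDl scalerA.
(* A relation with [c i != 0] would express [s i] through the others and an element of the range,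
   against minimality. *)
have indep x (c : 'I_n -> R[i]) : T x + \sum_i c i *: s i = 0 -> forall i, c i = 0.
  move=> xc i; apply/eqP; apply: contrapT => /negP ci0.
  have n0 : (0 < n)%N by apply: leq_ltn_trans (ltn_ord i).
  suff /asboolP/minn : finite_corank T n.-1 by rewrite -(prednK n0) ltnn.
  move: n0 i s hs c xc ci0 {minn S SL X}; case: n => // n _ i s hs c xc ci0.
  have si : s i = T (- (c i)^-1 *: x) + \sum_j (- (c i)^-1 * c (lift i j)) *: s (lift i j).
    rewrite TZ; move/eqP: xc; rewrite (bigD1_ord i)//= addrCA addr_eq0 => /eqP E.
    rewrite -[LHS](scale1r) -(mulVf ci0) -scalerA E scalerN -scaleNr scalerDr; congr (_ + _).
    by rewrite scaler_sumr; apply: eq_bigr => j _; rewrite scalerA.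
  exists (fun j => s (lift i j)) => y; have [x' [c' ->]] := hs y.
  exists (x' + c' i *: (- (c i)^-1 *: x)),
    (fun j => c' (lift i j) + c' i * (- (c i)^-1 * c (lift i j))).
  rewrite TD (TZ (c' i)) -addrA; congr (_ + _).
  rewrite (bigD1_ord i)//= {1}si scalerDr -addrA; congr (_ + _).
  rewrite scaler_sumr -big_split /=; apply: eq_bigr => j _.
  by rewrite addrC scalerDl scalerA.
have Sinj x y : S x = S y -> x = y.
  move=> Sxy; have d0 : S (x - y) = 0.
    by rewrite addrC -scaleN1r SL Sxy scaleN1r addNr.
  have c0 := indep _ _ d0.
  have x0 : (x - y).1 = 0.
    by apply: Tinj; rewrite -d0 /S big1 ?addr0// => i _; rewrite c0 scale0r.
  apply/eqP; rewrite -subr_eq0; apply/eqP; case: (x - y) x0 c0 => a b /= -> c0.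
  by congr (_, _); apply/ffunP => i; rewrite c0 ffunE.
have Ssurj y : exists x, S x = y.
  have [x [c ->]] := hs y; exists (x, [ffun i => c i]); rewrite /S /=; congr (_ + _).
  by apply: eq_bigr => i _; rewrite ffunE.
pose B := \sum_i N (s i).
have B0 : 0 <= B by apply: sumr_ge0 => i _; exact: is_norm_ge0.
have SM x : N (S x) <= (`|M| + B) * @pair_norm n x.
  rewrite (le_trans (is_normD nN _ _))// /pair_norm.
  have nx := is_norm_ge0 nN x.1.
  have sx : 0 <= \sum_(i < n) cnorm (x.2 i) by apply: sumr_ge0 => i _; exact: cnorm_ge0.
  have k1 : N (T x.1) <= `|M| * N x.1.
    by rewrite (le_trans (TM _))// ler_wpM2r// ler_norm.
  have k2 : N (\sum_i x.2 i *: s i) <= (\sum_(i < n) cnorm (x.2 i)) * B.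
    rewrite (le_trans (is_norm_sum nN _ _ _))// mulr_suml; apply: ler_sum => i _.
    rewrite (is_normZ nN) ler_wpM2l ?cnorm_ge0// /B (bigD1 i)//= lerDl.
    by apply: sumr_ge0 => j _; exact: is_norm_ge0.
  have := mulr_ge0 (normr_ge0 M) sx; have := mulr_ge0 B0 nx; lra.
have [K K0 hK] := open_mapping (is_norm_pair n) nN (@pair_complete n) cN SL SM Ssurj.
exists K => //; exists n, s; split.
  move=> y; have [x Sx xK] := hK y; exists x.1, (fun i => x.2 i); split.
  - by rewrite -Sx.
  - by apply: le_trans xK; rewrite lerDl sumr_ge0// => i _; exact: cnorm_ge0.
  - move=> i; apply: le_trans xK; rewrite /pair_norm (bigD1 i)//= addrCA lerDl.
    by rewrite addr_ge0 ?(is_norm_ge0 nN)// sumr_ge0// => j _; exact: cnorm_ge0.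
move=> x; have [x' Sx' xK] := hK (T x).
have xx : x = x'.1.
  have : S x' = S (x, 0).
    by rewrite Sx' /S /= big1 ?addr0// => i _; rewrite ffunE scale0r.
  by move/Sinj => ->.
by rewrite {1}xx; apply: le_trans xK; rewrite lerDl sumr_ge0// => i _; exact: cnorm_ge0.
Qed.

End finite_corank_inverse.

(** * Weighted rotations *)

(* What the spectral argument uses of the Bergman norm; [ev f] is [f] read in the
   chart of the disk that moves the fixed point of the automorphism to 0. *)
Record rotation_space {R : realType} (V : lmodType R[i]) (N : V -> R)
    (ev : V -> R[i] -> R[i]) : Prop := RotationSpace {
  rs_norm : is_norm N ;
  rs_lin : forall a f g z, ev (a *: f + g) z = a * ev f z + ev g z ;
  rs_inj : forall f g, (forall z, cnorm z < 1 -> ev f z = ev g z) -> f = g ;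
  rs_holo : forall f, holo_unit (ev f) ;
  rs_dom : exists2 c, 0 <= c & forall h f (k B : R), holo_unit h -> 0 <= k -> 0 <= B ->
    (forall z, cnorm z < 1 -> cnorm (h z) <= k * cnorm (ev f z) + B) ->
    exists2 g, (forall z, cnorm z < 1 -> ev g z = h z) & N g <= k * N f + B * c ;
  rs_fatou : forall (g : nat -> V) h K, holo_unit h -> (forall n, N (g n) <= K) ->
    (forall z, cnorm z < 1 -> cconverges (fun n => ev (g n) z) (h z)) ->
    exists2 f, (forall z, cnorm z < 1 -> ev f z = h z) & N f <= K ;
  rs_bound : forall s, 0 < s < 1 -> exists2 C, 0 <= C &
    forall f z, cnorm z <= s -> cnorm (ev f z) <= C * N f ;
  rs_rot : exists2 c, 0 <= c & forall mu, cnorm mu = 1 -> forall f,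
    exists2 g, (forall z, cnorm z < 1 -> ev g z = ev f (mu * z)) & N g <= c * N f ;
  rs_shrink : forall f e, 0 < e -> exists k0, forall k g, (k0 <= k)%N ->
    (forall z, cnorm z < 1 -> ev g z = z ^+ k * ev f z) -> N g <= e }.

Section rotation_space_theory.
Context {R : realType} (V : lmodType R[i]) (N : V -> R) (ev : V -> R[i] -> R[i]).
Context (H : rotation_space N ev).
Implicit Types (f g x y : V) (z mu lam : R[i]) (h : R[i] -> R[i]).
Let nN := rs_norm H.

Lemma ev0 z : ev 0 z = 0.
Proof. by have := rs_lin H (-1) 0 0 z; rewrite addr0 scaleN1r oppr0 mulN1r addNr. Qed.

Lemma evZ a f z : ev (a *: f) z = a * ev f z.
Proof. by have := rs_lin H a f 0 z; rewrite addr0 ev0 addr0. Qed.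

Lemma evD f g z : ev (f + g) z = ev f z + ev g z.
Proof. by have := rs_lin H 1 f g z; rewrite scale1r mul1r. Qed.

Lemma evB f g z : ev (f - g) z = ev f z - ev g z.
Proof. by rewrite evD -scaleN1r evZ mulN1r. Qed.

Lemma ev_sum (I : Type) (r : seq I) (F : I -> V) z :
  ev (\sum_(i <- r) F i) z = \sum_(i <- r) ev (F i) z.
Proof.
by elim: r => [|i r IH]; rewrite ?big_nil ?ev0// !big_cons evD IH.
Qed.

Lemma exists_mulX k f : exists g, (forall z, cnorm z < 1 -> ev g z = z ^+ k * ev f z) /\ N g <= N f.
Proof.
have [c c0 dom] := rs_dom H.
have [||||g gE gN] := dom (fun z => z ^+ k * ev f z) f 1 0 => //.
- by move=> z z1; apply: holoM; [apply: holoX; exact: holo_id|exact: (rs_holo H)].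
- move=> z z1; rewrite cnormM cnormX mul1r addr0 ler_piMl ?cnorm_ge0//.
  by rewrite exprn_ile1 ?cnorm_ge0// ltW.
by exists g; split=> //; move: gN; rewrite mul0r addr0 mul1r.
Qed.

Definition mulX k f : V := projT1 (cid (exists_mulX k f)).

Lemma mulXE k f z : cnorm z < 1 -> ev (mulX k f) z = z ^+ k * ev f z.
Proof. by move: z; have [] := projT2 (cid (exists_mulX k f)). Qed.

Lemma mulX_norm k f : N (mulX k f) <= N f.
Proof. by have [] := projT2 (cid (exists_mulX k f)). Qed.

Lemma mulXL k a f g : mulX k (a *: f + g) = a *: mulX k f + mulX k g.
Proof. by apply: (rs_inj H) => z z1; rewrite evD evZ !mulXE// evD evZ; ring. Qed.

Lemma mulXD k f g : mulX k (f + g) = mulX k f + mulX k g.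
Proof. by have := mulXL k 1 f g; rewrite !scale1r. Qed.

Lemma mulX0 k : mulX k 0 = 0.
Proof. by apply: (rs_inj H) => z z1; rewrite mulXE// ev0 mulr0. Qed.

Lemma mulXZ k a f : mulX k (a *: f) = a *: mulX k f.
Proof. by have := mulXL k a f 0; rewrite !addr0 mulX0 addr0. Qed.

Lemma mulX_sum k (I : Type) (r : seq I) (F : I -> V) :
  mulX k (\sum_(i <- r) F i) = \sum_(i <- r) mulX k (F i).
Proof.
by elim: r => [|i r IH]; rewrite ?big_nil ?mulX0// !big_cons mulXD IH.
Qed.

Lemma mulX_mulX j k f : mulX j (mulX k f) = mulX (j + k) f.
Proof. by apply: (rs_inj H) => z z1; rewrite !mulXE// exprD mulrA. Qed.

Lemma exists_bounded h (B : R) : holo_unit h -> 0 <= B -> (forall z, cnorm z < 1 -> cnorm (h z) <= B) ->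
  exists g, forall z, cnorm z < 1 -> ev g z = h z.
Proof.
move=> hh B0 hB; have [c c0 dom] := rs_dom H.
have hB' z : cnorm z < 1 -> cnorm (h z) <= 0 * cnorm (ev 0 z) + B.
  by move=> z1; rewrite mul0r add0r hB.
by have [g gE _] := dom h 0 0 B hh (lexx 0) B0 hB'; exists g.
Qed.

Lemma exists_one : exists g, forall z, cnorm z < 1 -> ev g z = 1.
Proof.
apply: (@exists_bounded (fun=> 1) 1) => //; first by move=> z _; exact: holo_cst.
by move=> z _; rewrite cnorm1.
Qed.

Definition unit_fun := projT1 (cid exists_one).

Lemma unit_funE z : cnorm z < 1 -> ev unit_fun z = 1.
Proof. by move: z; exact: projT2 (cid exists_one). Qed.

Lemma division_bound s : 0 < s < 1 -> exists2 A, 0 <= A & forall k f h, holo_unit h ->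
  (forall z, cnorm z < 1 -> ev f z = z ^+ k * h z) ->
  exists2 g, (forall z, cnorm z < 1 -> ev g z = h z) & N g <= A * s^-1 ^+ k * N f.
Proof.
move=> s01; have [s0 s1] := andP s01; have [C C0 hC] := rs_bound H s01.
have [c c0 dom] := rs_dom H; exists (1 + C * c); first by rewrite addr_ge0// mulr_ge0.
move=> k f h hh fh.
have sk : 0 < s^-1 ^+ k by rewrite exprn_gt0// invr_gt0.
have N0 := is_norm_ge0 nN f.
have [|||g gE gN] := dom h f (s^-1 ^+ k) (s^-1 ^+ k * (C * N f)) hh.
- exact: ltW.
- by rewrite mulr_ge0 ?mulr_ge0// ltW.
- move=> z z1; have nz := cnorm_ge0 (ev f z).
  have big (y : R[i]) : s <= cnorm y -> cnorm y < 1 -> cnorm (h y) <= s^-1 ^+ k * cnorm (ev f y).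
    move=> sy y1; rewrite fh// cnormM cnormX mulrA -exprMn ler_peMl ?cnorm_ge0//.
    by rewrite exprn_ege1// mulrC ler_pdivlMr// mul1r.
  have [sz|zs] := leP s (cnorm z).
    by rewrite (le_trans (big _ sz z1))// lerDl mulr_ge0 ?mulr_ge0// ltW.
  rewrite (le_trans _ (_ : s^-1 ^+ k * (C * N f) <= _))//; last first.
    by rewrite lerDr mulr_ge0// ltW.
  apply: (max_principle s0 (holo_unit_disk hh s1)) => //; last exact: ltW.
  move=> y ys; rewrite (le_trans (big y _ _)) ?ys// ler_pM2l//.
  by apply: hC; rewrite ys.
exists g => //; apply: (le_trans gN); lra.
Qed.

(** Evaluations are bounded, so [u] converges pointwise to a holomorphic [G]. Fatou, applied to the
    differences [u (n + k) - u n], puts the remainder [G - u n] into the space, with a norm of order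
    [2^-n]. *)
Lemma space_complete : norm_complete N.
Proof.
move=> u A hu.
have A0 : 0 <= A by have := hu 0%N; rewrite expr0 mulr1; apply: le_trans; exact: is_norm_ge0.
pose G z := xget 0 [set l | cconverges (fun n => ev (u n) z) l].
have loc s : 0 < s < 1 -> exists2 B, 0 <= B & forall z, cnorm z <= s ->
    cconverges (fun n => ev (u n) z) (G z) /\ forall n, cnorm (ev (u n) z - G z) <= B * 2^-1 ^+ n.
  move=> s01; have [C C0 hC] := rs_bound H s01.
  have hr := @half_range R; have [h0 h1] := andP hr.
  exists (2 * (C * A / (1 - 2^-1))).
    by rewrite mulr_ge0//; apply: divr_ge0; [exact: mulr_ge0|lra].
  move=> z zs.
  have st n : cnorm (ev (u n.+1) z - ev (u n) z) <= C * A * 2^-1 ^+ n.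
    by rewrite -evB (le_trans (hC _ _ zs))// -mulrA ler_wpM2l.
  have cau := geometric_cauchy hr (mulr_ge0 C0 A0) st.
  have [l hl] := complex_limit cau.
  have [l' hl'] := complex_complete st.
  have hG : cconverges (fun n => ev (u n) z) (G z).
    exact: (@xgetI _ 0 [set l | cconverges (fun n => ev (u n) z) l] l' hl').
  split=> // n; suff <- : l = G z by rewrite -mulrA; exact: hl.
  apply: cconverges_uniq hG => e e0.
  have B0 : 0 <= C * A / (1 - 2^-1) by apply: divr_ge0; [exact: mulr_ge0|lra].
  move: (C * A / _) B0 hl => B B0 hl {cau}.
  have B1 : 0 < 2 * B + 1 by lra.
  have [n0 hn0] := exprn_small hr (divr_gt0 e0 B1); exists n0 => m /hn0.
  rewrite ler_pdivlMr// => hm; rewrite (le_trans (hl m))//.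
  have : 0 <= 2^-1 ^+ m :> R by rewrite exprn_ge0.
  lra.
have mid z : cnorm z < 1 -> exists2 s, 0 < s < 1 & cnorm z < s.
  move=> z1; have z0 := cnorm_ge0 z; exists ((1 + cnorm z) / 2); last lra.
  by apply/andP; split; lra.
have conv z : cnorm z < 1 -> cconverges (fun n => ev (u n) z) (G z).
  by move=> /mid[s s01 zs]; have [B _ h] := loc s s01; have [] := h z (ltW zs).
have hG : holo_unit G.
  move=> z /mid[s s01 zs]; have [B B0 h] := loc s s01; have [s0 s1] := andP s01.
  apply: (@weierstrass _ G s) => // e e0.
  have B1 : 0 < B + 1 by lra.
  have [n hn] := exprn_small (@half_range R) (divr_gt0 e0 B1).
  exists (ev (u n)); first by apply: holo_unit_disk => //; exact: (rs_holo H).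
  move=> y ys; have [_ h2] := h y ys; rewrite (le_trans (h2 n))//.
  have := hn n (leqnn n); rewrite ler_pdivlMr//.
  have : 0 <= 2^-1 ^+ n :> R by rewrite exprn_ge0// invr_ge0.
  lra.
have rem n : exists2 f, (forall z, cnorm z < 1 -> ev f z = G z - ev (u n) z) & N f <= 2 * A * 2^-1 ^+ n.
  apply: (rs_fatou H (g := fun k => u (n + k)%N - u n)).
  - by move=> z z1; apply: holoB; [exact: hG|exact: (rs_holo H)].
  - by move=> k; exact: (telescope_half_le nN hu).
  - move=> z z1 e e0; have [k0 h0] := conv z z1 e e0; exists k0 => k kk.
    have -> : ev (u (n + k)%N - u n) z - (G z - ev (u n) z) = ev (u (n + k)%N) z - G z.
      by rewrite evB; ring.
    by apply: h0; rewrite (leq_trans kk)// leq_addl.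
have [f0 f0E _] := rem 0%N; exists (f0 + u 0%N) => e e0.
have A1 : 0 < 2 * A + 1 by lra.
have [n0 hn0] := exprn_small (@half_range R) (divr_gt0 e0 A1); exists n0 => n /hn0.
rewrite ler_pdivlMr// => hn; have [f fE fN] := rem n.
have -> : u n - (f0 + u 0%N) = - f.
  by apply: (rs_inj H) => z z1; rewrite evB evD f0E// -[- f]scaleN1r evZ fE//; ring.
rewrite (is_normN nN) (le_trans fN)//.
have : 0 <= 2^-1 ^+ n :> R by rewrite exprn_ge0// invr_ge0.
lra.
Qed.

Lemma exists_backward f : exists g, forall z, cnorm z < 1 -> ev f z = ev f 0 + z * ev g z.
Proof.
have s01 : 0 < (1 / 2 : R) < 1 by apply/andP; split; lra.
have [A A0 div] := division_bound s01.
have [g gE _] := div 1%N (f - ev f 0 *: unit_fun) (divX (ev f)) (holo_unit_divX (rs_holo H f))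
  ltac:(move=> z z1; rewrite evB evZ unit_funE// mulr1 {1}(divXE (ev f) z) expr1; ring).
by exists g => z z1; rewrite gE// -divXE.
Qed.

Definition backward f := projT1 (cid (exists_backward f)).

Lemma backwardE f z : cnorm z < 1 -> ev f z = ev f 0 + z * ev (backward f) z.
Proof. by move: z; exact: projT2 (cid (exists_backward f)). Qed.

Lemma eq_ev_punctured f g : (forall z, z != 0 -> cnorm z < 1 -> ev f z = ev g z) -> f = g.
Proof.
move=> fg; apply: (rs_inj H) => z z1; have [->|z0] := eqVneq z 0; last exact: fg.
have z01 : cnorm (0 : R[i]) < 1 by rewrite cnorm0.
by apply: ccont_eq0 fg; apply: holo_cont; exact: (rs_holo H).
Qed.

Lemma backwardL a f g : backward (a *: f + g) = a *: backward f + backward g.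
Proof.
apply: eq_ev_punctured => z z0 z1; apply: (mulfI z0).
have e1 := backwardE (a *: f + g) z1; have e2 := backwardE f z1; have e3 := backwardE g z1.
move: e1; rewrite !evD !evZ {1}e2 {1}e3 => /eqP.
rewrite -subr_eq0 => /eqP e4; apply/eqP; rewrite -subr_eq0 -oppr_eq0 -e4; apply/eqP; ring.
Qed.

Lemma backward_mulX f : backward (mulX 1 f) = f.
Proof.
apply: eq_ev_punctured => z z0 z1; apply: (mulfI z0).
have z01 : cnorm (0 : R[i]) < 1 by rewrite cnorm0.
by have := backwardE (mulX 1 f) z1; rewrite !mulXE// expr1 mul0r add0r.
Qed.

Lemma backward_decomp f : f = ev f 0 *: unit_fun + mulX 1 (backward f).
Proof.
by apply: (rs_inj H) => z z1; rewrite evD evZ unit_funE// mulr1 mulXE// expr1 -backwardE.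
Qed.

End rotation_space_theory.

Lemma ler_sum_const {R : realType} n (F : 'I_n -> R) (B : R) : (forall i, F i <= B) ->
  \sum_i F i <= n%:R * B.
Proof.
move=> h; rewrite -[n in n%:R]card_ord mulr_natl -sumr_const.
by apply: ler_sum => i _; exact: h.
Qed.

(** * The operators [C - l] for a weighted rotation [C] *)

Section weighted_rotation.
Context {R : realType} (V : lmodType R[i]) (N : V -> R) (ev : V -> R[i] -> R[i]).
Context (H : rotation_space N ev).
Context (w : R[i] -> R[i]) (mu : R[i]) (C : V -> V).
Context (mu1 : cnorm mu = 1) (irr : forall n, (0 < n)%N -> mu ^+ n != 1).
Context (hw : holo_unit w) (w0 : forall z, cnorm z < 1 -> w z != 0).
Context (wB : exists M, forall z, cnorm z < 1 -> cnorm (w z) <= M).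
Context (CE : forall f z, cnorm z < 1 -> ev (C f) z = w z * ev f (mu * z)).
Implicit Types (f g x y : V) (z lam l : R[i]).
Let nN := rs_norm H.
Local Notation mz := (mulX H).

Definition shifted l g := C g - l *: g.
Local Notation T := shifted.

Lemma rot_lt1 z : cnorm z < 1 -> cnorm (mu * z) < 1.
Proof. by rewrite cnormM mu1 mul1r. Qed.

Lemma mu_neq0 : mu != 0.
Proof. by rewrite -cnorm_gt0 mu1. Qed.

Lemma cnorm_divX l k : cnorm (l / mu ^+ k) = cnorm l.
Proof. by rewrite cnormM cnormV unimodularX// invr1 mulr1. Qed.

Lemma ev_shifted l g z : cnorm z < 1 -> ev (T l g) z = w z * ev g (mu * z) - l * ev g z.
Proof. by move=> z1; rewrite (evB H) (evZ H) CE. Qed.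

Lemma shiftedL l a f g : T l (a *: f + g) = a *: T l f + T l g.
Proof.
apply: (rs_inj H) => z z1; have z2 := rot_lt1 z1.
by rewrite (rs_lin H) !ev_shifted// !(rs_lin H); ring.
Qed.

Lemma shiftedD l f g : T l (f + g) = T l f + T l g.
Proof. by have := shiftedL l 1 f g; rewrite !scale1r. Qed.

Lemma shifted0 l : T l 0 = 0.
Proof. by have := shiftedL l (-1) 0 0; rewrite addr0 scaleN1r oppr0 scaleN1r addNr. Qed.

Lemma shiftedZ l a f : T l (a *: f) = a *: T l f.
Proof. by have := shiftedL l a f 0; rewrite !addr0 shifted0 addr0. Qed.

Lemma shiftedB l f g : T l (f - g) = T l f - T l g.
Proof. by rewrite shiftedD -scaleN1r shiftedZ scaleN1r. Qed.

Lemma shifted_sub l l' g : T l g = T l' g + (l' - l) *: g.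
Proof. by rewrite /shifted scalerBl addrA subrK. Qed.

Lemma C_bounded : exists2 B, 0 <= B & forall g, N (C g) <= B * N g.
Proof.
have [M hM] := wB; have [c c0 rot] := rs_rot H; have [d d0 dom] := rs_dom H.
have M0 : 0 <= M by apply: le_trans (hM 0 _); rewrite ?cnorm_ge0// cnorm0.
exists (M * c) => [|g]; first exact: mulr_ge0.
have [r rE rN] := rot mu mu1 g.
have hh : holo_unit (ev (C g)) by exact: (rs_holo H).
have hd z : cnorm z < 1 -> cnorm (ev (C g) z) <= M * cnorm (ev r z) + 0.
  by move=> z1; rewrite addr0 CE// cnormM rE// ler_wpM2r ?cnorm_ge0 ?hM.
have [k kE kN] := dom _ r M 0 hh M0 (lexx 0) hd.
have -> : C g = k by apply: (rs_inj H) => z z1; rewrite kE.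
by rewrite (le_trans kN)// mul0r addr0 -mulrA ler_wpM2l.
Qed.

Lemma shifted_bounded l : exists2 B, 0 <= B & forall g, N (T l g) <= B * N g.
Proof.
have [B B0 hB] := C_bounded; exists (B + cnorm l) => [|g].
  by rewrite addr_ge0// cnorm_ge0.
by rewrite (le_trans (is_normB nN _ _))// mulrDl lerD// (is_normZ nN).
Qed.

Lemma shifted_mulX l k g : T l (mz k g) = mu ^+ k *: mz k (T (l / mu ^+ k) g).
Proof.
apply: (rs_inj H) => z z1; have z2 := rot_lt1 z1.
rewrite (evZ H) ev_shifted// !(mulXE H)// ev_shifted// exprMn.
have : mu ^+ k != 0 by rewrite expf_neq0// mu_neq0.
by move: (mu ^+ k) (z ^+ k) => a b a0; field.
Qed.

Lemma mulX_shifted l k g :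
  mz k (T (l / mu ^+ k) g) = T l ((mu ^+ k)^-1 *: mz k g).
Proof.
by rewrite shiftedZ shifted_mulX scalerA mulVf ?scale1r// expf_neq0// mu_neq0.
Qed.

(* Multiplication by [z] intertwines [C - l] with [mu (C - l / mu)]. *)
Lemma corank_rotate l m : finite_corank (T l) m -> finite_corank (T (l / mu)) m.+1.
Proof.
move=> [s hs].
pose t (i : 'I_m.+1) := if unlift ord0 i is Some j then backward H (s j)
  else backward H (T l (unit_fun H)).
exists t => y; have [x [c E]] := hs (mz 1 y).
exists (mu *: backward H x), (fun i => if unlift ord0 i is Some j then c j else ev x 0).
have BL := backwardL H; have B0 : backward H 0 = 0.
  by have := BL (-1) 0 0; rewrite addr0 scaleN1r oppr0 scaleN1r addNr.
have Bs : backward H (\sum_i c i *: s i) = \sum_i c i *: backward H (s i).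
  elim: (index_enum _) => [|i r IH]; first by rewrite !big_nil.
  by rewrite !big_cons BL IH.
have E2 : T l x = ev x 0 *: T l (unit_fun H) + mu *: mz 1 (T (l / mu) (backward H x)).
  by rewrite {1}(backward_decomp H x) shiftedL shifted_mulX expr1.
rewrite -{1}(backward_mulX H y) E E2 -addrA !BL Bs (backward_mulX H).
rewrite shiftedZ big_ord_recl /t unlift_none addrCA; do 2 congr (_ + _).
by apply: eq_bigr => i _; rewrite liftK.
Qed.

Lemma corank_rotateX l m k : finite_corank (T l) m -> exists n, finite_corank (T (l / mu ^+ k)) n.
Proof.
move=> lm; elim: k => [|k [n IH]]; first by exists m; rewrite expr0 divr1.
exists n.+1; have := corank_rotate IH.
by rewrite exprSr invfM mulrA mulrAC.
Qed.

Lemma w00 : 0 < cnorm (w 0).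
Proof. by rewrite cnorm_gt0 w0// cnorm0. Qed.

Lemma shifted_inj l : (forall k, l != w 0 * mu ^+ k) -> forall x, T l x = 0 -> x = 0.
Proof.
move=> lk x Tx; apply: (rs_inj H) => z z1; rewrite (ev0 H).
apply: (@eigen_eq0 _ w (ev x) mu l mu1 irr hw (rs_holo H x)) => // y y1.
by have := ev_shifted l x y1; rewrite Tx (ev0 H) => /esym/eqP; rewrite subr_eq0 => /eqP.
Qed.

Lemma polar_form (x : R[i]) : x != 0 -> exists2 u, cnorm u = 1 & x = (cnorm x)%:C * u.
Proof.
move=> x0; have nx : 0 < cnorm x by rewrite cnorm_gt0.
have xC : (cnorm x)%:C != 0 :> R[i] by rewrite -cnorm_gt0 cnorm_real gtr0_norm.
exists (x / (cnorm x)%:C); last by rewrite mulrC divfK.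
by rewrite cnormM cnormV cnorm_real gtr0_norm// divff// gt_eqF.
Qed.

(** The moduli differ by less than [e / 2], and density of the orbit brings the arguments together.
    One [J] serving all such [l] keeps the later constants uniform on the annulus. *)
Lemma near_orbit nu l0 (e : R) : cnorm nu = 1 -> (forall n, (0 < n)%N -> nu ^+ n != 1) ->
  l0 != 0 -> 0 < e -> exists2 d : R, 0 < d & exists J, forall l, `|cnorm l - cnorm l0| < d ->
  exists2 j, (j < J)%N & cnorm (nu ^+ j * l - l0) < e.
Proof.
move=> nu1 nirr l00 e0; set a := cnorm l0.
have a0 : 0 < a by rewrite /a cnorm_gt0.
have dl : 0 < e / 2 / a by rewrite !divr_gt0.
have [J hJ] := orbit_dense nu1 nirr dl.
exists (Num.min (e / 2) a); first by rewrite lt_min divr_gt0.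
exists J => l; rewrite lt_min => /andP[la la'].
have nl : 0 < cnorm l by move: la'; rewrite ltr_norml => /andP[]; lra.
have l0' : l != 0 by rewrite -cnorm_gt0.
have [u u1 lu] := polar_form l0'; have [v v1 lv] := polar_form l00.
have v0 : v != 0 by rewrite -cnorm_gt0 v1.
have [|j jJ hj] := hJ (u / v); first by rewrite cnormM cnormV u1 v1 invr1 mulr1.
exists j => //.
have -> : nu ^+ j * l - l0 = (cnorm l - a)%:C * (nu ^+ j * u) + a%:C * v * (nu ^+ j * (u / v) - 1).
  by rewrite {1}lu {1}lv rmorphB /=; field.
rewrite (le_lt_trans (cnormD _ _))// !cnormM v1 mulr1 u1 unimodularX// !mulr1 !cnorm_real.
rewrite (gtr0_norm a0); move: hj; rewrite ltr_pdivlMr// mulrC.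
by lra.
Qed.

(** For [z ^+ j * x] in place of [x] the parameter becomes [mu ^+ j * l], which some [j < J] brings
    so close to [l0] that the bound at [l0] absorbs the perturbation. Dividing by [z ^+ j] again
    costs at most [A * 2 ^+ J]. *)
Lemma bounded_below_annulus l0 K : l0 != 0 -> 0 <= K -> (forall x, N x <= K * N (T l0 x)) ->
  exists2 d : R, 0 < d & exists2 K', 0 <= K' & forall l, `|cnorm l - cnorm l0| < d ->
    forall x, N x <= K' * N (T l x).
Proof.
move=> l00 K0 hK.
have e0 : 0 < 1 / (2 * (K + 1)) by rewrite divr_gt0//; lra.
have [d d0 [J hJ]] := near_orbit mu1 irr l00 e0.
have s01 : 0 < (1 / 2 : R) < 1 by apply/andP; split; lra.
have [A A0 div] := division_bound H s01.
exists d => //; exists (A * 2 ^+ J * (2 * K)); first by rewrite !mulr_ge0// exprn_ge0.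
move=> l /hJ[j jJ hj] x.
have [g gE gN] := div j (mz j x) (ev x) (rs_holo H x) (mulXE H j x).
have gx : g = x by apply: (rs_inj H).
move: gN; rewrite gx invf_div divr1 => {}gN.
have nm := is_norm_ge0 nN (mz j x).
have k1 : N x <= A * 2 ^+ J * N (mz j x).
  rewrite (le_trans gN)// ler_wpM2r// ler_wpM2l// ler_weXn2l ?ler1n//; exact: ltnW.
have k2 : T (mu ^+ j * l) (mz j x) = mu ^+ j *: mz j (T l x).
  by rewrite shifted_mulX mulrAC divff ?mul1r// expf_neq0// mu_neq0.
have k3 : N (T (mu ^+ j * l) (mz j x)) <= N (T l x).
  by rewrite k2 (is_normZ nN) unimodularX// mul1r mulX_norm.
have k4 : N (mz j x) <= 2 * K * N (T l x).
  have := hK (mz j x); rewrite (shifted_sub l0 (mu ^+ j * l)) => h1.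
  have h2 : N (T (mu ^+ j * l) (mz j x) + (mu ^+ j * l - l0) *: mz j x) <=
      N (T l x) + 1 / (2 * (K + 1)) * N (mz j x).
    rewrite (le_trans (is_normD nN _ _))// lerD// (is_normZ nN) ler_wpM2r//.
    exact: ltW.
  have h3 := le_trans h1 (ler_wpM2l K0 h2).
  have h4 : K * (1 / (2 * (K + 1)) * N (mz j x)) <= 1 / 2 * N (mz j x).
    rewrite mulrA ler_wpM2r// mulrA mulr1 ler_pdivrMr; lra.
  rewrite mulrDr in h3; lra.
rewrite (le_trans k1)// -[leRHS]mulrA ler_wpM2l//.
by rewrite mulr_ge0// exprn_ge0.
Qed.

(** The decomposition of [y] at [l0] is multiplied by [z ^+ k]. This turns the parameter
    [l / mu ^+ k], which is close to [l0], into [l], and it makes the finitely many [s i] small once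
    [k] is beyond [k1]. Each of the two errors is at most a quarter of [N y]. *)
Lemma contraction l0 K n (s : 'I_n -> V) : l0 != 0 -> 0 <= K ->
  (forall y, exists x (c : 'I_n -> R[i]),
    [/\ y = T l0 x + \sum_i c i *: s i, N x <= K * N y & forall i, cnorm (c i) <= K * N y]) ->
  exists2 d : R, 0 < d & exists L, forall l, `|cnorm l - cnorm l0| < d ->
    exists2 k, (k <= L)%N & forall y, exists x y', mz k y = T l x + y' /\ N y' <= 2^-1 * N y.
Proof.
move=> l00 K0 hK.
have nu1 : cnorm mu^-1 = 1 by rewrite cnormV mu1 invr1.
have nirr m : (0 < m)%N -> mu^-1 ^+ m != 1 by move=> m0; rewrite exprVn invr_eq1 irr.
have e0 : 0 < 1 / (4 * (K + 1)) by rewrite divr_gt0//; lra.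
have [d d0 [J hJ]] := near_orbit nu1 nirr l00 e0.
have e'0 : 0 < 1 / (4 * (K + 1) * (n%:R + 1)) by rewrite divr_gt0// !mulr_gt0//; lra.
pose k0 i := projT1 (cid (rs_shrink H (s i) e'0)).
have hk0 i : forall k, (k0 i <= k)%N -> N (mz k (s i)) <= 1 / (4 * (K + 1) * (n%:R + 1)).
  by move=> k kk; apply: (projT2 (cid (rs_shrink H (s i) e'0)) k) => // z; exact: mulXE.
pose k1 := \max_i k0 i.
exists d => //; exists (k1 + J)%N => l ll.
have ll' : `|cnorm (l / mu ^+ k1) - cnorm l0| < d by rewrite cnorm_divX.
have [j jJ hj] := hJ _ ll'.
pose k := (k1 + j)%N.
have lE : mu^-1 ^+ j * (l / mu ^+ k1) = l / mu ^+ k.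
  by rewrite exprVn /k exprD invfM mulrC -mulrA.
exists k => [|y]; first by rewrite /k leq_add2l ltnW.
have [x [c [yE xN cN]]] := hK y.
exists ((mu ^+ k)^-1 *: mz k x),
  ((l / mu ^+ k - l0) *: mz k x + \sum_i c i *: mz k (s i)); split.
  rewrite {1}yE mulXD mulX_sum (shifted_sub l0 (l / mu ^+ k)) mulXD mulXZ.
  rewrite mulX_shifted -addrA; do 2 congr (_ + _).
  by apply: eq_bigr => i _; rewrite mulXZ.
have ny := is_norm_ge0 nN y.
rewrite (le_trans (is_normD nN _ _))//.
have b1 : N ((l / mu ^+ k - l0) *: mz k x) <= 1 / 4 * N y.
  rewrite (is_normZ nN) -lE.
  have : cnorm (mu^-1 ^+ j * (l / mu ^+ k1) - l0) * N (mz k x) <=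
      1 / (4 * (K + 1)) * (K * N y).
    apply: ler_pM; rewrite ?cnorm_ge0 ?(is_norm_ge0 nN)//; first exact: ltW.
    by rewrite (le_trans (mulX_norm H _ _)).
  move/le_trans; apply; rewrite mulrA ler_wpM2r// mulrAC mul1r ler_pdivrMr; lra.
have b2 : N (\sum_i c i *: mz k (s i)) <= 1 / 4 * N y.
  rewrite (le_trans (is_norm_sum nN _ _ _))//.
  apply: (@le_trans _ _ (\sum_(i < n) K * N y * (1 / (4 * (K + 1) * (n%:R + 1))))).
    apply: ler_sum => i _; rewrite (is_normZ nN).
    apply: ler_pM; rewrite ?cnorm_ge0 ?(is_norm_ge0 nN)//.
    by apply: hk0; rewrite (leq_trans (leq_bigmax i))// leq_addr.
  rewrite sumr_const card_ord -(mulr_natr (K * N y * _)).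
  have n0 : 0 <= n%:R :> R by rewrite ler0n.
  have -> : K * N y * (1 / (4 * (K + 1) * (n%:R + 1))) * n%:R =
      1 / 4 * N y * (K / (K + 1)) * (n%:R / (n%:R + 1)).
    by field; rewrite !gt_eqF//; lra.
  have q1 : K / (K + 1) <= 1 by rewrite ler_pdivrMr; lra.
  have q2 : n%:R / (n%:R + 1) <= 1 :> R by rewrite ler_pdivrMr; lra.
  have q0 : 0 <= K / (K + 1) by rewrite divr_ge0//; lra.
  have q3 : 0 <= n%:R / (n%:R + 1) :> R by rewrite divr_ge0//; lra.
  have q4 : 0 <= 1 / 4 * N y by lra.
  have q5 : 1 / 4 * N y * (K / (K + 1)) <= 1 / 4 * N y by rewrite ler_piMr.
  apply: le_trans q5; rewrite ler_piMr// mulr_ge0//.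
lra.
Qed.

(** Each step replaces [l] by [l / mu ^+ k], of the same modulus, so the hypothesis applies again.
    The steps have varying lengths [k <= L]; surplus powers of [z] do no harm, because [mulX] does
    not increase the norm. *)
Lemma contraction_iter l0 (d : R) L :
  (forall l, `|cnorm l - cnorm l0| < d -> exists2 k, (k <= L)%N &
    forall y, exists x y', mz k y = T l x + y' /\ N y' <= 2^-1 * N y) ->
  forall q n l, `|cnorm l - cnorm l0| < d -> (q * L <= n)%N -> forall y,
    exists x y', mz n y = T l x + y' /\ N y' <= 2^-1 ^+ q * N y.
Proof.
move=> hc; elim=> [|q IH] n l ll qn y.
  by exists 0, (mz n y); rewrite shifted0 add0r expr0 mul1r mulX_norm.
have [k kL hk] := hc l ll.
have kn : (k <= n)%N by rewrite (leq_trans kL)// (leq_trans _ qn)// mulSn leq_addr.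
have ll' : `|cnorm (l / mu ^+ k) - cnorm l0| < d by rewrite cnorm_divX.
have qn' : (q * L <= n - k)%N.
  by rewrite leq_subRL// (leq_trans _ qn)// mulSn leq_add2r.
have [x [y1 [E y1N]]] := IH _ _ ll' qn' y.
have [x' [y' [E' y'N]]] := hk y1.
exists ((mu ^+ k)^-1 *: mz k x + x'), y'; split.
  rewrite -{1}(subnKC kn) -mulX_mulX E mulXD.
  by rewrite mulX_shifted E' shiftedD addrA.
by rewrite (le_trans y'N)// exprS -mulrA ler_wpM2l.
Qed.

Lemma bernoulli_le n (t : R) : 0 <= t <= 1 -> 1 - n%:R * t <= (1 - t) ^+ n.
Proof.
move=> /andP[t0 t1]; elim: n => [|n IH]; first by rewrite mul0r subr0 expr0.
have q1 : (1 - t) ^+ n <= 1 by rewrite exprn_ile1//; lra.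
have q0 : 0 <= (1 - t) ^+ n by rewrite exprn_ge0//; lra.
rewrite exprS -(@natr1 _ n); nra.
Qed.

Lemma resolvent_data l : cnorm (w 0) < cnorm l ->
  forall s, 0 < s < 1 -> exists c q, [/\ 0 <= q, q < cnorm l &
    forall n z, cnorm z <= s -> cnorm (wprod w mu n z) <= c * q ^+ n].
Proof.
move=> wl s s01; have nw := w00.
have [c c0 hc] := @uniform_growth _ w mu s ((cnorm (w 0) + cnorm l) / 2) mu1 irr hw w0 s01 ltac:(lra).
by exists c, ((cnorm (w 0) + cnorm l) / 2); split=> //; lra.
Qed.

(* The Taylor polynomials of the formal resolvent solve the equation up to a
   remainder divisible by [z^M], which [contraction_iter] then solves. *)
Lemma dense_range l0 (d : R) L l : l0 != 0 ->
  (forall q n l, `|cnorm l - cnorm l0| < d -> (q * L <= n)%N -> forall y,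
    exists x y', mz n y = T l x + y' /\ N y' <= 2^-1 ^+ q * N y) ->
  `|cnorm l - cnorm l0| < d -> cnorm (w 0) < cnorm l ->
  forall f e, 0 < e -> exists g, N (f - T l g) <= e.
Proof.
move=> l00 hit ll wl f e e0.
have nw := w00; have l0' : l != 0 by rewrite -cnorm_gt0; lra.
have [G [hG GE _]] := resolvent_exists mu1 hw (rs_holo H f) l0' (resolvent_data wl).
(* For [M = q * L] the Taylor coefficients and the division by [z ^+ M] each lose [s^-1 ^+ M],
   whereas the contraction gains [2^-1 ^+ q]. This [t] makes [s ^+ (2 * L)] at least 3/4, so that
   the net ratio [X] per round is below 1. *)
pose t : R := 1 / (8 * (L%:R + 1)).
have L0 : 0 <= L%:R :> R by rewrite ler0n.
have L1 : 0 < 8 * (L%:R + 1) :> R by lra.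
have t0 : 0 < t by rewrite divr_gt0.
have tL : t * (8 * (L%:R + 1)) = 1 by rewrite /t mul1r mulVf ?gt_eqF.
have t1 : t <= 1 / 8 by nra.
pose s := 1 - t.
have s01 : 0 < s < 1 by apply/andP; rewrite /s; split; lra.
have [s0 s1] := andP s01.
have sL : 3 / 4 <= s ^+ (2 * L).
  have := @bernoulli_le (2 * L)%N t ltac:(apply/andP; split; lra).
  by rewrite -/s natrM; nra.
pose X := 2^-1 * s^-1 ^+ (2 * L).
have sp : 0 < s ^+ (2 * L) by lra.
have X01 : 0 <= X < 1.
  apply/andP; split; first by rewrite mulr_ge0// exprn_ge0// invr_ge0 ltW.
  rewrite /X exprVn ltr_pdivrMr//; lra.
have [Cs Cs0 GC] := disk_bounded (ltW s0) (holo_unit_disk hG s1).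
have GC' z : cnorm z = s -> cnorm (G z) <= Cs by move=> zs; apply: GC; rewrite zs.
have [A A0 div] := division_bound H s01.
have [B B0 TB] := shifted_bounded l.
pose c1 := N (unit_fun H).
have c10 : 0 <= c1 by exact: is_norm_ge0.
pose gM M : V := \sum_(k < M) taylor_coef G k *: mz k (unit_fun H).
have gME M z : cnorm z < 1 -> ev (gM M) z = \sum_(k < M) taylor_coef G k * z ^+ k.
  move=> z1; rewrite (ev_sum H); apply: eq_bigr => k _.
  by rewrite (evZ H) (mulXE H)// (unit_funE H)// mulr1.
have s1' : 1 <= s^-1 by rewrite -invr1 lef_pV2 ?posrE ?ltr01// ltW.
have gMN M : N (gM M) <= M%:R * (Cs * s^-1 ^+ M * c1).
  rewrite (le_trans (is_norm_sum nN _ _ _))// -[M in M%:R * _]card_ord mulr_natl -sumr_const.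
  apply: ler_sum => k _; rewrite (is_normZ nN) ler_pM ?cnorm_ge0 ?(is_norm_ge0 nN)//; last first.
    exact: mulX_norm.
  have := taylor_coef_bound k mu1 irr hG s01 GC'.
  rewrite -ler_pdivlMr ?exprn_gt0// -exprVn => /le_trans; apply.
  rewrite ler_wpM2l ?(ltW Cs0)// ler_weXn2l//; exact: ltnW.
have xM M : exists2 x, f - T l (gM M) = mz M x &
    N x <= A * s^-1 ^+ M * (N f + B * (M%:R * (Cs * s^-1 ^+ M * c1))).
  pose h z := w z * mu ^+ M * taylor_tail G M (mu * z) - l * taylor_tail G M z.
  have ht := holo_taylor_tail M hG.
  have hh : holo_unit h.
    move=> z z1; apply: holoB.
      apply: holoM; first by apply: holoM; [exact: hw|exact: holo_cst].
      by apply: holo_rot; apply: ht; exact: rot_lt1.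
    by apply: holoM; [exact: holo_cst|exact: ht].
  have E z : cnorm z < 1 -> ev (f - T l (gM M)) z = z ^+ M * h z.
    move=> z1; have z2 := rot_lt1 z1.
    rewrite (evB H) ev_shifted// !gME// -(GE z z1).
    rewrite {1}(taylorE G M (mu * z)) {1}(taylorE G M z) /h exprMn; ring.
  have [x xE xN] := div M _ h hh E.
  exists x; first by apply: (rs_inj H) => z z1; rewrite E// (mulXE H)// xE.
  rewrite (le_trans xN)// ler_wpM2l ?mulr_ge0 ?exprn_ge0 ?invr_ge0 ?(ltW s0)//.
  by rewrite (le_trans (is_normB nN _ _))// lerD2l (le_trans (TB _))// ler_wpM2l.
pose D := A * (N f + B * (L%:R * (Cs * c1))).
have D0 : 0 <= D.
  by rewrite mulr_ge0// addr_ge0 ?(is_norm_ge0 nN)// !mulr_ge0// ltW.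
have [q hq] := mulnX_small X01 (divr_gt0 e0 (ltr_wpDl D0 ltr01)).
have {hq} hq := hq q (leqnn q).
have [x xE xN] := xM (q * L)%N.
have [x' [y' [E y'N]]] := hit q (q * L)%N l ll (leqnn _) x.
exists (gM (q * L)%N + x').
have -> : f - T l (gM (q * L)%N + x') = y'.
  by rewrite shiftedD opprD addrA xE E [T l x' + _]addrC addrK.
rewrite (le_trans y'N)//.
have sq : 1 <= s^-1 ^+ (q * L) by rewrite exprn_ege1.
have k1 : A * s^-1 ^+ (q * L) * (N f + B * ((q * L)%:R * (Cs * s^-1 ^+ (q * L) * c1))) <=
    q.+1%:R * s^-1 ^+ (2 * L) ^+ q * D.
  have -> : s^-1 ^+ (2 * L) ^+ q = s^-1 ^+ (q * L) * s^-1 ^+ (q * L).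
    by rewrite -exprM -expr2 -exprM; congr (_ ^+ _); rewrite mulnC mulnA [(q * 2)%N]mulnC -mulnA mulnC.
  move: sq; set Y := s^-1 ^+ _ => sq.
  have Y0 : 0 <= Y by lra.
  have nf := is_norm_ge0 nN f.
  have q0 : 0 <= q%:R :> R by rewrite ler0n.
  have h1 : A * Y * N f <= q.+1%:R * (Y * Y) * (A * N f).
    have h2 : 0 <= A * Y * N f by rewrite !mulr_ge0.
    have h3 : A * Y * N f <= Y * (A * Y * N f) by rewrite ler_peMl.
    have h4 : Y * (A * Y * N f) <= q.+1%:R * (Y * (A * Y * N f)).
      by rewrite ler_peMl ?ler1n// mulr_ge0.
    have : q.+1%:R * (Y * (A * Y * N f)) = q.+1%:R * (Y * Y) * (A * N f) by ring.
    by lra.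
  have h5 : 0 <= A * Y * (B * (L%:R * (Cs * Y * c1))).
    by rewrite !mulr_ge0// ltW.
  rewrite natrM -(@natr1 _ q) in h1 *.
  rewrite /D; nra.
have p2 : 0 <= (2 : R)^-1 ^+ q by rewrite exprn_ge0// invr_ge0.
rewrite (le_trans (ler_wpM2l p2 (le_trans xN k1)))//.
have -> : 2^-1 ^+ q * (q.+1%:R * s^-1 ^+ (2 * L) ^+ q * D) = q.+1%:R * X ^+ q * D.
  by rewrite /X [(_ * _) ^+ q]exprMn; ring.
have X0 : 0 <= q.+1%:R * X ^+ q by rewrite mulr_ge0// exprn_ge0//; have /andP[] := X01.
move: hq; rewrite ler_pdivlMr; last by rewrite ltr_wpDl.
lra.
Qed.

(** Bounded below on a complete space, the operator has closed range, so density of the range gives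
    surjectivity. *)
Lemma solve_of_dense l K : 0 <= K -> (forall x, N x <= K * N (T l x)) ->
  (forall f e, 0 < e -> exists g, N (f - T l g) <= e) ->
  forall f, exists2 g, T l g = f & N g <= K * N f.
Proof.
move=> K0 hK dn f.
have p2 n : 0 < (2 : R)^-1 ^+ n by rewrite exprn_gt0// invr_gt0.
pose u n := projT1 (cid (dn f _ (p2 n))).
have hu n : N (f - T l (u n)) <= 2^-1 ^+ n := projT2 (cid (dn f _ (p2 n))).
have st n : N (u n.+1 - u n) <= K * 2 * 2^-1 ^+ n.
  rewrite (le_trans (hK _))// -mulrA ler_wpM2l// shiftedB.
  have -> : T l (u n.+1) - T l (u n) = (f - T l (u n)) - (f - T l (u n.+1)).
    by move: (T l _) (T l _) => a b; rewrite opprB [RHS]addrC addrA subrK.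
  rewrite (le_trans (is_normB nN _ _))//.
  have := hu n; have := hu n.+1; rewrite exprS; have := p2 n; lra.
have [g hg] := space_complete H st.
have [B B0 TB] := shifted_bounded l.
have Tg : T l g = f.
  apply: (is_norm_inj nN) => e e0; rewrite (is_norm_distC nN).
  have e2 : 0 < e / 2 by rewrite divr_gt0.
  have B1 : 0 < B + 1 by lra.
  have [n0 h0] := hg _ (divr_gt0 e2 B1).
  have [n1 h1] := exprn_small (@half_range R) e2.
  have := h0 _ (leq_maxl n0 n1); have := h1 _ (leq_maxr n0 n1).
  set n := maxn n0 n1 => k1; rewrite ler_pdivlMr// => k2.
  have -> : f - T l g = (f - T l (u n)) + T l (u n - g) by rewrite shiftedB addrA subrK.
  rewrite (le_trans (is_normD nN _ _))//.
  have := TB (u n - g); have := hu n; have := is_norm_ge0 nN (u n - g); lra.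
by exists g => //; have := hK g; rewrite Tg.
Qed.

Lemma iterated_resolvent l (f G : R[i] -> R[i]) : l != 0 ->
  (forall z, cnorm z < 1 -> w z * G (mu * z) - l * G z = f z) ->
  forall M z, cnorm z < 1 ->
  G z = resolvent_sum w f mu l M z + l^-1 ^+ M * wprod w mu M z * G (mu ^+ M * z).
Proof.
move=> l0 hG; elim=> [|M IH] z z1.
  by rewrite /resolvent_sum /wprod !big_ord0 !expr0 oppr0 add0r !mul1r.
have zM : cnorm (mu ^+ M * z) < 1 by rewrite cnorm_rot.
have E := hG _ zM; rewrite [mu * _]mulrA -exprS in E.
rewrite IH// /resolvent_sum big_ord_recr /= opprD -addrA; congr (_ + _).
rewrite wprodSr -E exprS; move: (l^-1 ^+ M) (wprod _ _ _ _) (G _) (G _) (w _) => a b c d e.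
by field.
Qed.

Lemma ev_iter n f z : cnorm z < 1 -> ev (iter n C f) z = wprod w mu n z * ev f (mu ^+ n * z).
Proof.
elim: n z => [|n IH] z z1; first by rewrite /wprod big_ord0 !mul1r.
have z2 := rot_lt1 z1.
by rewrite iterS CE// IH// wprodS mulrA [mu ^+ n * _]mulrA -exprSr.
Qed.

(* Averaging the solutions over the orbit [r mu^j] extracts the coefficient
   [C^n f] of the Neumann series. *)
Lemma power_bound r K : cnorm (w 0) < r -> 0 <= K ->
  (forall l, cnorm l = r -> forall f, exists2 g, T l g = f & N g <= K * N f) ->
  forall n f, N (iter n C f) <= K * r ^+ n.+1 * N f.
Proof.
move=> wr K0 hK n f; have nw := w00.
have r0 : 0 < r by lra.
have nr : cnorm (r%:C : R[i]) = r by rewrite cnorm_real gtr0_norm.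
pose l j : R[i] := r%:C * mu ^+ j.
have nl j : cnorm (l j) = r by rewrite cnormM nr unimodularX// mulr1.
have l0 j : l j != 0 by rewrite -cnorm_gt0 nl.
pose g j := s2val (cid2 (hK (l j) (nl j) f)).
have gT j : T (l j) (g j) = f := s2valP (cid2 (hK (l j) (nl j) f)).
have gN j : N (g j) <= K * N f := s2valP' (cid2 (hK (l j) (nl j) f)).
have gE j z : cnorm z < 1 -> w z * ev (g j) (mu * z) - l j * ev (g j) z = ev f z.
  by move=> z1; rewrite -ev_shifted// gT.
(* The factor [l j ^+ n.+1] makes the Neumann term of index [n] independent of [j]; a term of
   another index [m] carries the [j]-th power of [mu ^+ n / mu ^+ m != 1] and averages out. *)
pose a (J : nat) : V := (J.+1%:R)^-1 *: \sum_(j < J.+1) (l j) ^+ n.+1 *: g j.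
have nJ J : 0 < J.+1%:R :> R by rewrite ltr0n.
have cJ J : J.+1%:R != 0 :> R[i] by rewrite -cnorm_gt0 cnorm_nat.
have aN J : N (a J) <= K * r ^+ n.+1 * N f.
  rewrite (is_normZ nN) cnormV cnorm_nat mulrC ler_pdivrMr//.
  rewrite (le_trans (is_norm_sum nN _ _ _))// mulrC.
  apply: ler_sum_const => j.
  rewrite (is_normZ nN) cnormX nl.
  have rn0 : 0 <= r ^+ n.+1 by rewrite exprn_ge0// ltW.
  by have := ler_wpM2l rn0 (gN j); rewrite mulrCA mulrA.
have key z : cnorm z < 1 -> cconverges (fun J => ev (a J) z) (- ev (iter n C f) z).
  move=> z1 e e0; have z0 := cnorm_ge0 z.
  pose s := (1 + cnorm z) / 2.
  have s01 : 0 < s < 1 by apply/andP; rewrite /s; split; lra.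
  have zs : cnorm z <= s by rewrite /s; lra.
  have [c [q [q0 qr hq]]] := resolvent_data (l := l 0%N) ltac:(by rewrite nl) s01.
  rewrite nl in qr.
  have [D D0 hD] := rs_bound H s01.
  have c0 : 0 <= c.
    by have := hq 0%N z zs; rewrite expr0 mulr1; apply: le_trans; exact: cnorm_ge0.
  have x01 : 0 <= q / r < 1 by rewrite divr_ge0 ?(ltW r0)//= ltr_pdivrMr// mul1r.
  pose E := r ^+ n.+1 * (c * (D * (K * N f))).
  have E0 : 0 <= E.
    by rewrite /E !mulr_ge0 ?exprn_ge0 ?(is_norm_ge0 nN)// ltW.
  have e2 : 0 < e / 2 by rewrite divr_gt0.
  have [M0 hM0] := exprn_small x01 (divr_gt0 e2 (ltr_wpDl E0 ltr01)).
  (* By [M0] the remainder of order [M] is small for all [j] at once, as [q < r]; the other entry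
     ensures that the term of index [n] occurs. *)
  pose M := maxn M0 n.+1.
  have {hM0} hM := hM0 M (leq_maxl _ _).
  have nM : (n < M)%N by exact: leq_maxr.
  pose t m := wprod w mu m z * ev f (mu ^+ m * z).
  pose nu m := mu ^+ n / mu ^+ m.
  pose P := \sum_(m < M | m != Ordinal nM) cnorm (t m) * (r ^+ n / r ^+ m * (2 / cnorm (1 - nu m))).
  have P0 : 0 <= P.
    apply: sumr_ge0 => m _; rewrite !mulr_ge0 ?invr_ge0 ?exprn_ge0 ?cnorm_ge0//; exact: ltW.
  have /archi_boundP := divr_ge0 P0 (ltW e2); set J0 := Num.bound _.
  rewrite ltr_pdivrMr// => hJ0.
  exists J0; move=> J2 JJ; rewrite opprK ev_iter// -/(t n).
  have rX m : r%:C ^+ m != 0 :> R[i] by rewrite expf_neq0// -cnorm_gt0 nr.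
  have muX m : mu ^+ m != 0 by rewrite expf_neq0// mu_neq0.
  have lE j m : l j ^+ n.+1 * (l j)^-1 ^+ m.+1 = r%:C ^+ n / r%:C ^+ m * nu m ^+ j.
    rewrite /l /nu exprVn !exprMn exprVn -![mu ^+ j ^+ _]exprM -![mu ^+ _ ^+ j]exprM.
    rewrite ![(_ * j)%N]mulnC !mulnS !exprD !exprS.
    have := rX m; have := muX j; have := muX (j * m)%N; have := rX 1%N; rewrite expr1.
    by move: (r%:C) (mu ^+ j) (mu ^+ (j * m)) (mu ^+ (j * n)) (r%:C ^+ m) (r%:C ^+ n) => ? ? ? ? ? ? ? ? ? ?; field; do !(apply/andP; split).
  pose tl j := l j ^+ n.+1 * ((l j)^-1 ^+ M * wprod w mu M z * ev (g j) (mu ^+ M * z)).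
  have aE : ev (a J2) z = - (\sum_(m < M) r%:C ^+ n / r%:C ^+ m * t m * \sum_(j < J2.+1) nu m ^+ j) / J2.+1%:R
      + (\sum_(j < J2.+1) tl j) / J2.+1%:R.
    rewrite (evZ H) (ev_sum H) mulrC -mulrDl; congr (_ / _).
    under [X in _ = - X + _]eq_bigr do rewrite mulr_sumr.
    rewrite exchange_big /= -sumrN -big_split /=; apply: eq_bigr => j _.
    rewrite (evZ H) (iterated_resolvent (l0 j) (gE j) M z1) mulrDr; congr (_ + _).
    rewrite /resolvent_sum mulrN mulr_sumr; congr (- _); apply: eq_bigr => m _.
    by rewrite [LHS]mulrA mulrA lE /t; ring.
  have tlb j : cnorm (tl j) <= e / 2.
    rewrite /tl !cnormM !cnormX cnormV nl.
    have b1 : cnorm (wprod w mu M z) <= c * q ^+ M by apply: hq.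
    have b2 : cnorm (ev (g j) (mu ^+ M * z)) <= D * (K * N f).
      by rewrite (le_trans (hD _ _ _)) ?cnorm_rot// ler_wpM2l.
    have rn0 : 0 <= r ^+ n.+1 by rewrite exprn_ge0// ltW.
    have rM0 : 0 <= r^-1 ^+ M by rewrite exprn_ge0// invr_ge0 ltW.
    have b3 : cnorm (wprod w mu M z) * cnorm (ev (g j) (mu ^+ M * z)) <= c * q ^+ M * (D * (K * N f)).
      by rewrite ler_pM ?cnorm_ge0.
    have -> : r ^+ n.+1 * (r^-1 ^+ M * cnorm (wprod w mu M z) * cnorm (ev (g j) (mu ^+ M * z))) =
      r ^+ n.+1 * r^-1 ^+ M * (cnorm (wprod w mu M z) * cnorm (ev (g j) (mu ^+ M * z))) by ring.
    rewrite (le_trans (ler_wpM2l _ b3)) ?mulr_ge0//.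
    have -> : r ^+ n.+1 * r^-1 ^+ M * (c * q ^+ M * (D * (K * N f))) = E * (q / r) ^+ M.
      by rewrite /E [(q / r) ^+ M]exprMn; ring.
    have xM0 : 0 <= (q / r) ^+ M by rewrite exprn_ge0//; have /andP[] := x01.
    move: hM; rewrite ler_pdivlMr; last by rewrite ltr_wpDl.
    lra.
  have tail : cnorm ((\sum_(j < J2.+1) tl j) / J2.+1%:R) <= e / 2.
    rewrite cnormM cnormV cnorm_nat ler_pdivrMr// (le_trans (cnorm_sum _ _ _))//.
    by rewrite mulrC; apply: ler_sum_const => j; exact: tlb.
  rewrite aE (bigD1 (Ordinal nM))//=.
  have -> : r%:C ^+ n / r%:C ^+ n * t n * \sum_(j < J2.+1) nu n ^+ j = t n * J2.+1%:R.
    rewrite divff// mul1r /nu divff//; congr (_ * _).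
    by rewrite (eq_bigr (fun=> 1)) ?sumr_const ?card_ord// => j _; rewrite expr1n.
  rewrite opprD mulrDl mulNr mulfK//.
  set Q := \sum_(m < M | _) _; set Z := (\sum_(j < J2.+1) tl j) / _ in tail *.
  have -> : - t n + - Q / J2.+1%:R + Z + t n = Z - Q / J2.+1%:R by ring.
  rewrite (le_trans (cnormB _ _))// [leRHS]splitr lerD//.
  rewrite cnormM cnormV cnorm_nat ler_pdivrMr//.
  apply: (@le_trans _ _ P); last first.
    have : (J0%:R : R) <= J2.+1%:R by rewrite ler_nat (leq_trans JJ).
    by move=> h; have := ler_wpM2r (ltW e2) h; lra.
  rewrite (le_trans (cnorm_sum _ _ _))//; apply: ler_sum => m mn.
  rewrite (cnormM (_ * t m)) (cnormM _ (t m)) (cnormM (r%:C ^+ n)) cnormV !cnormX nr.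
  rewrite [_ * cnorm (t m)]mulrC -[leLHS]mulrA.
  have rnm : 0 <= r ^+ n / r ^+ m by rewrite mulr_ge0 ?invr_ge0 ?exprn_ge0 ?(ltW r0).
  apply: (ler_wpM2l (cnorm_ge0 (t m))); apply: (ler_wpM2l rnm).
  apply: unimodular_sum_le; first by rewrite /nu cnormM cnormV !unimodularX// invr1 mulr1.
  apply: irrational_expf => //; first exact: mu_neq0.
  by apply: contra mn => /eqP nm; apply/eqP/val_inj => /=.
(* The averages are known to converge pointwise; Fatou converts this into the bound on the norm. *)
have ha : holo_unit (fun z => - ev (iter n C f) z).
  by move=> z z1; apply: holoN; exact: (rs_holo H).
have [f' f'E f'N] := rs_fatou H ha aN key.
have -> : iter n C f = - f'.
  by apply: (rs_inj H) => z z1; rewrite -scaleN1r (evZ H) f'E// mulN1r opprK.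
by rewrite (is_normN nN).
Qed.

(** Rotating back by [mu ^+ n] before applying [C^n] gives multiplication by [wprod w mu n], of norm
    at most [K * c * r ^+ n]. Its powers, applied to the constant 1 and evaluated at [z], bound all
    powers of the value of the product there, and [le_of_exprn] removes the evaluation constant. *)
Lemma weight_bound K r : 0 <= r -> 0 <= K -> (forall n f, N (iter n C f) <= K * r ^+ n * N f) ->
  exists K', forall n z, cnorm z < 1 -> cnorm (wprod w mu n z) <= K' * r ^+ n.
Proof.
move=> r0 K0 hK; have [c c0 rot] := rs_rot H; have [M hM] := wB.
have M0 : 0 <= M by apply: le_trans (hM 0 _); rewrite ?cnorm_ge0// cnorm0.
exists (K * c) => n z z1.
have Wb (y : R[i]) : cnorm y < 1 -> cnorm (wprod w mu n y) <= M ^+ n.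
  move=> y1; rewrite /wprod cnorm_prod -[n in M ^+ n]card_ord -prodr_const.
  by apply: ler_prod => j _; rewrite cnorm_ge0 hM// cnorm_rot.
have hW := holo_wprod n mu1 hw.
have exF k : exists g, forall z, cnorm z < 1 -> ev g z = wprod w mu n z ^+ k.
  apply: (@exists_bounded _ _ _ _ H (fun z => wprod w mu n z ^+ k) ((M ^+ n) ^+ k)).
  - by move=> y y1; apply: holoX; exact: hW.
  - by rewrite !exprn_ge0.
  - by move=> y y1; rewrite cnormX; apply: lerXn2r; rewrite ?nnegrE ?cnorm_ge0 ?exprn_ge0 ?Wb.
pose F k := projT1 (cid (exF k)).
have FE k (y : R[i]) : cnorm y < 1 -> ev (F k) y = wprod w mu n y ^+ k.
  by move: y; exact: projT2 (cid (exF k)).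
have munV : cnorm (mu ^+ n)^-1 = 1 by rewrite cnormV unimodularX// invr1.
have step k : N (F k.+1) <= K * c * r ^+ n * N (F k).
  have [g gE gN] := rot _ munV (F k).
  have -> : F k.+1 = iter n C g.
    apply: (rs_inj H) => y y1; have y2 : cnorm (mu ^+ n * y) < 1 by rewrite cnorm_rot.
    rewrite ev_iter// FE// gE// mulrA mulVf ?expf_neq0 ?mu_neq0// mul1r FE//.
    by rewrite exprS.
  rewrite (le_trans (hK n g))//.
  have := ler_wpM2l (mulr_ge0 K0 (exprn_ge0 n r0)) gN; lra.
have FN k : N (F k) <= (K * c * r ^+ n) ^+ k * N (F 0%N).
  elim: k => [|k IH]; first by rewrite expr0 mul1r.
  rewrite (le_trans (step k))// exprS -[leRHS]mulrA ler_wpM2l//.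
  by rewrite !mulr_ge0// exprn_ge0.
have z0 := cnorm_ge0 z.
have s01 : 0 < (1 + cnorm z) / 2 < 1 by apply/andP; split; lra.
have [D D0 hD] := rs_bound H s01.
apply: (@le_of_exprn _ _ _ (D * N (F 0%N))); first exact: cnorm_ge0.
  by rewrite !mulr_ge0// exprn_ge0.
move=> k; rewrite -cnormX -FE//.
have zs : cnorm z <= (1 + cnorm z) / 2 by lra.
have := hD (F k) z zs; have := ler_wpM2l D0 (FN k).
move: (_ ^+ k) (N _) (N _) (cnorm _) => X Y Z W; lra.
Qed.

Theorem corank_growth l0 m : cnorm (w 0) <= cnorm l0 -> finite_corank (T l0) m ->
  exists K r, [/\ 0 <= r, r < cnorm l0 & forall n z, cnorm z < 1 ->
    cnorm (wprod w mu n z) <= K * r ^+ n].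
Proof.
move=> wl hm; have nw := w00.
(* If [l0] is [w 0 * mu ^+ j0], division by [mu ^+ j0.+1] leaves [w 0 / mu], which is no
   [w 0 * mu ^+ j] because [mu] is not a root of unity. *)
have [k lk] : exists k, forall j, l0 / mu ^+ k != w 0 * mu ^+ j.
  have [[j0 E]|no] := pselect (exists j, l0 = w 0 * mu ^+ j); last first.
    by exists 0%N => j; rewrite expr0 divr1; apply/eqP => E; apply: no; exists j.
  exists j0.+1 => j; rewrite E; apply/eqP => E2.
  have muX i : mu ^+ i != 0 by rewrite expf_neq0// mu_neq0.
  have : mu ^+ j0 = mu ^+ (j + j0.+1).
    have wn0 : w 0 != 0 by rewrite -cnorm_gt0.
    apply: (mulfI wn0); rewrite exprD mulrA -E2 divfK//.
  rewrite addnS -addSn exprD => /eqP; rewrite -{1}[mu ^+ j0]mul1r.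
  rewrite -subr_eq0 -mulrBl mulf_eq0 (negbTE (muX j0)) orbF subr_eq0 eq_sym.
  by rewrite (negbTE (irr (ltn0Sn j))).
have [m' hm'] := corank_rotateX k hm.
have [B B0 TB] := shifted_bounded (l0 / mu ^+ k).
have [K K0 [n [s [hs bb]]]] := finite_corank_inverse nN (space_complete H)
  (shiftedL _) TB (shifted_inj lk) hm'.
have l00 : l0 / mu ^+ k != 0 by rewrite -cnorm_gt0 cnorm_divX; lra.
have [d d0 [K' K'0 hK']] := bounded_below_annulus l00 K0 bb.
have [d' d'0 [L hL]] := contraction l00 K0 hs.
have hit := contraction_iter hL.
rewrite cnorm_divX in hK' hL.
pose a := cnorm l0.
have solve l : `|cnorm l - a| < Num.min d d' -> cnorm (w 0) < cnorm l ->
    forall f, exists2 g, T l g = f & N g <= K' * N f.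
  rewrite lt_min => /andP[ld ld'] wl' f.
  apply: solve_of_dense => //; first exact: hK'.
  by apply: (dense_range l00 hit) => //; rewrite cnorm_divX.
have md0 : 0 < Num.min d d' by rewrite lt_min d0.
have [wl'|wl'] := ltP (cnorm (w 0)) a.
  have gap0 : 0 < a - cnorm (w 0) by rewrite subr_gt0.
  have mm0 : 0 < Num.min (Num.min d d') (a - cnorm (w 0)) by rewrite lt_min md0.
  have [t /andP[t0 tm] _] := exists_small_pos mm0 (lexx 0) ltr01.
  move: tm; rewrite lt_min => /andP[td tw].
  (* This radius is below [a] but within the annulus, and above [cnorm (w 0)], as the Neumann
     expansion in [power_bound] demands. *)
  pose r := a - t.
  have r0 : 0 <= r by rewrite /r; lra.
  have sr l : cnorm l = r -> forall f, exists2 g, T l g = f & N g <= K' * N f.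
    move=> lr; apply: solve; rewrite lr /r; last lra.
    by rewrite [a - t]addrC addrK normrN gtr0_norm.
  have pb := @power_bound r K' ltac:(rewrite /r; lra) K'0 sr.
  have [K2 hK2] := @weight_bound (K' * r) r r0 ltac:(by rewrite mulr_ge0)
    (fun n f => ltac:(by have := pb n f; rewrite exprS mulrA)).
  by exists K2, r; split=> //; rewrite /r /a; lra.
have wa : cnorm (w 0) = a by apply/eqP; rewrite eq_le wl wl'.
(* Equality is impossible: for [l = (1 + t) * w 0] the equation [T l g = 1], evaluated at 0, reads
   [1 = - t * w 0 * ev g 0], while [ev g 0] stays bounded as [t] tends to 0. *)
exfalso.
have s01 : 0 < (1 / 2 : R) < 1 by apply/andP; split; lra.
have [D D0 hD] := rs_bound H s01.
have z01 : cnorm (0 : R[i]) <= 1 / 2 by rewrite cnorm0; lra.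
have z1 : cnorm (0 : R[i]) < 1 by rewrite cnorm0.
have mm0 : 0 < Num.min d d' / a by rewrite divr_gt0// -wa.
have Q0 : 0 <= a * (D * (K' * N (unit_fun H))).
  by rewrite !mulr_ge0 ?(is_norm_ge0 nN)// -wa ltW.
have half0 : 0 < 1 / 2 :> R by lra.
have [t /andP[t0 tm] tQ] := exists_small_pos mm0 Q0 half0.
have nt : cnorm (1 + t%:C : R[i]) = 1 + t.
  by rewrite -[1]/((1 : R)%:C) -rmorphD cnorm_real gtr0_norm//; lra.
have a0 : 0 < a by rewrite -wa.
move: tm; rewrite ltr_pdivlMr// => tm.
have [g gE gN] := solve ((1 + t%:C) * w 0) ltac:(rewrite cnormM nt wa mulrDl mul1r addrC addKr ger0_norm ?mulr_ge0 ?(ltW t0) ?(ltW a0)//)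
   ltac:(rewrite cnormM nt; nra) (unit_fun H).
have := ev_shifted ((1 + t%:C) * w 0) g z1; rewrite gE (unit_funE H)// mulr0 => E.
have : 1 <= t * (a * (D * (K' * N (unit_fun H)))).
  have <- : cnorm (1 : R[i]) = 1 by exact: cnorm1.
  have -> : 1 = - (t%:C * (w 0 * ev g 0)) by rewrite E; ring.
  rewrite cnormN !cnormM cnorm_real gtr0_norm// wa ler_pM2l// ler_pM2l//.
  by rewrite (le_trans (hD _ _ z01))// ler_wpM2l.
lra.
Qed.

(** The Neumann series is summed pointwise and its limit is placed in the space by Fatou, a
    geometric series bounding the partial sums. For any solution the remainder in
    [iterated_resolvent] tends to 0 pointwise, which gives uniqueness. *)
Lemma shifted_solvable l K r : 0 <= r -> r < cnorm l ->
  (forall n z, cnorm z < 1 -> cnorm (wprod w mu n z) <= K * r ^+ n) ->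
  exists2 B, 0 <= B & forall f, exists g, [/\ T l g = f, N g <= B * N f &
    forall g', T l g' = f -> g' = g].
Proof.
move=> r0 rl hK; have nl : 0 < cnorm l by lra.
have l0 : l != 0 by rewrite -cnorm_gt0.
have [c c0 rot] := rs_rot H; have [c1 c10 dom] := rs_dom H.
have K0 : 0 <= K.
  have := hK 0%N 0; rewrite cnorm0 expr0 mulr1 => /(_ ltr01).
  by apply: le_trans; exact: cnorm_ge0.
have res s : 0 < s < 1 -> exists c q, [/\ 0 <= q, q < cnorm l &
    forall n z, cnorm z <= s -> cnorm (wprod w mu n z) <= c * q ^+ n].
  by move=> /andP[s0 s1]; exists K, r; split=> // n z zs; apply: hK; lra.
pose x := r / cnorm l.
have x01 : 0 <= x < 1 by rewrite divr_ge0 ?(ltW nl)//= ltr_pdivrMr// mul1r.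
have [x0 x1] := andP x01.
pose B := K * c / cnorm l / (1 - x).
have B0 : 0 <= B by rewrite /B !mulr_ge0 ?invr_ge0 ?(ltW nl)//; lra.
exists B => // f.
have [G [hG GE Glim]] := resolvent_exists mu1 hw (rs_holo H f) l0 res.
have term m : exists2 g, (forall z, cnorm z < 1 -> ev g z = wprod w mu m z * ev f (mu ^+ m * z)) &
    N g <= K * c * r ^+ m * N f.
  have [g1 g1E g1N] := rot _ (unimodularX m mu1) f.
  have Kr0 : 0 <= K * r ^+ m by rewrite mulr_ge0// exprn_ge0.
  have [|z z1|g gE gN] := dom (fun z => wprod w mu m z * ev f (mu ^+ m * z)) g1 (K * r ^+ m) 0 _ Kr0 (lexx 0).
  - move=> z z1; apply: holoM; first exact: holo_wprod.
    by apply: holo_rot; apply: (rs_holo H); rewrite cnorm_rot.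
  - by rewrite addr0 cnormM g1E// ler_wpM2r ?cnorm_ge0// hK.
  - exists g => //; rewrite (le_trans gN)// mul0r addr0.
    by have := ler_wpM2l Kr0 g1N; lra.
pose h m := s2val (cid2 (term m)).
have hE m z : cnorm z < 1 -> ev (h m) z = wprod w mu m z * ev f (mu ^+ m * z).
  exact: (s2valP (cid2 (term m))).
have hN (m : nat) : N (h m) <= K * c * r ^+ m * N f := s2valP' (cid2 (term m)).
pose S n : V := - \sum_(m < n) l^-1 ^+ m.+1 *: h m.
have SE n z : cnorm z < 1 -> ev (S n) z = resolvent_sum w (ev f) mu l n z.
  move=> z1; rewrite /S -scaleN1r (evZ H) mulN1r (ev_sum H) /resolvent_sum; congr (- _).
  by apply: eq_bigr => m _; rewrite (evZ H) hE// mulrA.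
have SN n : N (S n) <= B * N f.
  rewrite (is_normN nN) (le_trans (is_norm_sum nN _ _ _))//.
  apply: (@le_trans _ _ (\sum_(m < n) K * c / cnorm l * x ^+ m * N f)).
    apply: ler_sum => m _; rewrite (is_normZ nN) cnormX cnormV.
    have -> : K * c / cnorm l * x ^+ m * N f = (cnorm l)^-1 ^+ m.+1 * (K * c * r ^+ m * N f).
      by rewrite /x exprMn exprS; ring.
    by rewrite ler_wpM2l// exprn_ge0// invr_ge0 ltW.
  rewrite -mulr_suml ler_wpM2r ?(is_norm_ge0 nN)// -mulr_sumr /B ler_wpM2l//.
    by rewrite !mulr_ge0// invr_ge0 ltW.
  have y0 : 0 < 1 - x by lra.
  rewrite -[leRHS]mul1r ler_pdivlMr//.
  have := subrX1 x n; have := exprn_ge0 n x0; move: (\sum_(i < n) _) => Q; lra.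
have [g gE gN] := rs_fatou H (g := S) hG SN ltac:(
  move=> z z1 e e0; have [n0 h0] := Glim z z1 e e0; exists n0 => n nn; rewrite SE//; exact: h0).
exists g; split=> //.
  apply: (rs_inj H) => z z1; have z2 := rot_lt1 z1.
  by rewrite ev_shifted// !gE// GE.
move=> g' Tg'; apply: (rs_inj H) => z z1; rewrite gE//.
have gE' (y : R[i]) : cnorm y < 1 -> w y * ev g' (mu * y) - l * ev g' y = ev f y.
  by move=> y1; rewrite -ev_shifted// Tg'.
apply: cconverges_uniq (Glim z z1) => e e0.
have n0 := cnorm_ge0 z.
have s01 : 0 < (1 + cnorm z) / 2 < 1 by apply/andP; split; lra.
have [D D0 hD] := rs_bound H s01.
have zs : cnorm z <= (1 + cnorm z) / 2 by lra.
have ng := is_norm_ge0 nN g'.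
have E0 : 0 <= K * (D * N g') by rewrite !mulr_ge0.
have [M hM] := exprn_small x01 (divr_gt0 e0 (ltr_wpDl E0 ltr01)); exists M => n /hM.
rewrite ler_pdivlMr; last by rewrite ltr_wpDl.
rewrite (iterated_resolvent l0 gE' n z1) opprD addrA subrr sub0r cnormN !cnormM cnormX cnormV => k.
have b1 := hK n z z1.
have b2 : cnorm (ev g' (mu ^+ n * z)) <= D * N g' by rewrite hD// cnorm_rot.
have ln0 : 0 <= (cnorm l)^-1 ^+ n by rewrite exprn_ge0// invr_ge0 ltW.
have b3 := ler_pM (cnorm_ge0 _) (cnorm_ge0 _) b1 b2.
rewrite -mulrA (le_trans (ler_wpM2l ln0 b3))//.
have -> : (cnorm l)^-1 ^+ n * (K * r ^+ n * (D * N g')) = K * (D * N g') * x ^+ n.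
  by rewrite /x exprMn; ring.
have := exprn_ge0 n x0; lra.
Qed.


End weighted_rotation.

(** * Area estimates *)

Section layer_cake.
Context d (T : measurableType d) (R : realType).
Variable m : {sigma_finite_measure set T -> \bar R}.
Implicit Types F G : T -> R.

Let hypograph F : set (T * measurableTypeR R) := [set q | 0 <= q.2 < F q.1].

Lemma measurable_hypograph F : measurable_fun [set: T] F ->
  measurable (hypograph F).
Proof.
move=> mF.
have -> : hypograph F = [set q | (0 <= q.2)%R] `&` [set q | q.2 < F q.1].
  apply/seteqP; split => q; rewrite /hypograph /=; first by move=> /andP.
  by move=> [-> ->].
apply: measurableI.
  have h : measurable_fun [set: T * measurableTypeR R] (fun q => (0 <= q.2)%R).
    by apply: measurable_fun_ler => //; exact: measurable_snd.
  by have := h measurableT [set true] Logic.I; rewrite setTI.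
have h : measurable_fun [set: T * measurableTypeR R] (fun q => q.2 < F q.1).
  apply: measurable_fun_ltr; first exact: measurable_snd.
  by apply: measurableT_comp => //; exact: measurable_fst.
by have := h measurableT [set true] Logic.I; rewrite setTI.
Qed.

Lemma integral_hypograph F : measurable_fun [set: T] F -> (forall w, 0 <= F w) ->
  (\int[m]_w (F w)%:E = (m \x lebesgue_measure) (hypograph F))%E.
Proof.
move=> mF F0; apply: eq_integral => w _ /=.
have -> : xsection (hypograph F) w = [set` `[0, F w[].
  apply/seteqP; split => t.
    by rewrite /xsection /= inE /hypograph /= in_itv.
  by rewrite /xsection /= inE /hypograph /= in_itv.
rewrite lebesgue_measure_itv /= lte_fin.
case: ifPn => [_|]; first by rewrite -EFinB subr0.
by rewrite -leNgt => Fw; congr EFin; apply/eqP; rewrite eq_le Fw F0.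
Qed.

(** Both sides measure the region under the graph, by sections in the two directions. *)
Lemma layer_cake F : measurable_fun [set: T] F -> (forall w, 0 <= F w) ->
  (\int[m]_w (F w)%:E =
   \int[lebesgue_measure]_t m (ysection (hypograph F) t))%E.
Proof.
move=> mF F0; rewrite integral_hypograph//.
apply: (@product_measure_unique _ _ _ _ _ m lebesgue_measure
  (m \x^ lebesgue_measure)%E); last exact: measurable_hypograph.
by move=> A B mA mB; exact: product_measure2E.
Qed.

(** This stands in for a change of variables: only the measures of superlevel sets have to be
    compared. *)
Lemma le_integral_superlevel F G K : 0 <= K ->
  measurable_fun [set: T] F -> measurable_fun [set: T] G ->
  (forall w, 0 <= F w) -> (forall w, 0 <= G w) ->
  (forall t, 0 <= t -> (m [set w | (t < F w)%R] <= K%:E * m [set w | (t < G w)%R])%E) ->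
  (\int[m]_w (F w)%:E <= K%:E * \int[m]_w (G w)%:E)%E.
Proof.
move=> K0 mF mG F0 G0 FG; rewrite !layer_cake//.
have ms H : measurable_fun [set: T] H -> measurable_fun setT
    (fun t : measurableTypeR R => m (ysection (hypograph H) t)).
  by move=> mH; apply: measurable_fun_ysection; exact: measurable_hypograph.
rewrite -ge0_integralZl_EFin//; last exact: ms.
apply: ge0_le_integral => //; first exact: ms.
  apply: measurable_funeM; exact: ms.
move=> t _; have [t0|t0] := leP 0 t.
  have E H : ysection (hypograph H) t = [set w | (t < H w)%R].
    by apply/seteqP; split => w;
       rewrite /ysection /= inE /hypograph /= t0.
  by rewrite !E FG.
have E H : ysection (hypograph H) t = set0.
  by apply/seteqP; split => w //;
     rewrite /ysection /= inE /hypograph /= leNgt t0.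
by rewrite !E measure0 mule0.
Qed.

End layer_cake.

(** * Area of preimages under expansive maps *)

Section expansive.
Context {R : realType}.
Local Notation T := (measurableTypeR R * measurableTypeR R)%type.
Implicit Types (w v x y : T) (A D U : set T).

Definition plane_open A := forall w, A w -> exists2 e : R, 0 < e & forall v : R * R,
    `|w.1 - v.1| < e -> `|w.2 - v.2| < e -> A v.

Lemma area_square (a b s : R) : 0 <= s ->
  area ([set` `[a, a + s[] `*` [set` `[b, b + s[] : set T) = (s * s)%:E.
Proof.
move=> s0; rewrite /area /= product_measure1E; [|exact: measurable_itv..].
have len (t : R) : lebesgue_measure [set` `[t, t + s[] = s%:E.
  rewrite lebesgue_measure_itv /= lte_fin ltrDl.
  case: ltP => [_|s0']; first by rewrite -EFinB; congr EFin; lra.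
  by congr EFin; apply/eqP; rewrite eq_le s0 s0'.
by have := (len a, len b) => /= -[-> ->].
Qed.

(** This makes the dyadic grids nested. *)
Let floor_half (u : R) : Num.floor u = (Num.floor (2 * u) %/ 2)%Z.
Proof.
apply: floor_def; set i := Num.floor (2 * u).
have /andP[h1 h2] := floor_itv (2 * u).
have e := divz_eq i 2; have m0 := modz_ge0 i (isT : 2 != 0 :> int).
have m1 := @ltz_pmod i 2 isT.
have h3 : ((i %/ 2)%Z * 2)%:~R <= i%:~R :> R by rewrite ler_int; lia.
have h4 : (i + 1)%:~R <= ((i %/ 2)%Z * 2 + 2)%:~R :> R by rewrite ler_int; lia.
rewrite !intrD !intrM /= in h2 h3 h4 *.
by rewrite -/i in h1 h2; apply/andP; split; lra.
Qed.

Let grid n w : int * int :=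
  (Num.floor (2 ^+ n * w.1), Num.floor (2 ^+ n * w.2)).

Let gridS n w v : grid n.+1 w = grid n.+1 v -> grid n w = grid n v.
Proof.
rewrite /grid !exprS -!mulrA => -[h1 h2].
by rewrite (floor_half (2 ^+ n * w.1)) (floor_half (2 ^+ n * w.2)) h1 h2 -!floor_half.
Qed.

Let cell n q : set T := [set w | grid n w = q].

Let cellE n q : cell n q =
  [set` `[q.1%:~R / 2 ^+ n, q.1%:~R / 2 ^+ n + (2 ^+ n)^-1[] `*`
  [set` `[q.2%:~R / 2 ^+ n, q.2%:~R / 2 ^+ n + (2 ^+ n)^-1[].
Proof.
have n0 : 0 < 2 ^+ n :> R by rewrite exprn_gt0.
have E (i : int) (t : R) : Num.floor (2 ^+ n * t) = i <->
    i%:~R / 2 ^+ n <= t < i%:~R / 2 ^+ n + (2 ^+ n)^-1.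
  have -> : i%:~R / 2 ^+ n + (2 ^+ n)^-1 = (i + 1)%:~R / 2 ^+ n :> R.
    by rewrite intrD mulrDl mul1r.
  rewrite ler_pdivrMr// ltr_pdivlMr// mulrC.
  split => [<-|/floor_def//]; exact: floor_itv.
apply/seteqP; split => w; rewrite /cell /grid /=.
  by move=> <- /=; rewrite !in_itv /=; split; apply/E.
by case: q => i j /=; rewrite !in_itv /= => -[/E -> /E ->].
Qed.

Let measurable_cell n q : measurable (cell n q).
Proof. by rewrite cellE; apply: measurableX; exact: measurable_itv. Qed.

Let area_cell n q : area (cell n q) = ((2 ^+ n)^-1 * (2 ^+ n)^-1)%:E.
Proof. by rewrite cellE area_square// invr_ge0 exprn_ge0. Qed.

Variables (D : set T) (Q : T -> T) (c : R).
Hypotheses (c0 : 0 < c) (mD : measurable D) (mQ : measurable_fun D Q).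
Hypothesis expand : forall x y, D x -> D y -> forall e,
  `|(Q x).1 - (Q y).1| <= e -> `|(Q x).2 - (Q y).2| <= e ->
  c * `|x.1 - y.1| <= e /\ c * `|x.2 - y.2| <= e.

Let area_preimage_cell n q :
  (area (D `&` Q @^-1` cell n q) <= (16 / c ^+ 2)%:E * area (cell n q))%E.
Proof.
have [h|/set0P[x [Dx Qx]]] := eqVneq (D `&` Q @^-1` cell n q) set0.
  by rewrite h measure0 mule_ge0// lee_fin divr_ge0// exprn_ge0// ltW.
have n0 : 0 < (2 ^+ n)^-1 :> R by rewrite invr_gt0 exprn_gt0.
have Q1 y : cell n q (Q y) ->
    `|(Q x).1 - (Q y).1| <= (2 ^+ n)^-1 /\ `|(Q x).2 - (Q y).2| <= (2 ^+ n)^-1.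
  move: Qx n0; rewrite /= cellE /= !in_itv /=.
  move=> [/andP[a1 a2] /andP[a3 a4]] n0 [/andP[b1 b2] /andP[b3 b4]].
  by split; rewrite ler_norml; apply/andP; split; lra.
rewrite area_cell; move: (2 ^+ n)^-1 n0 Q1 => s n0 Q1.
have [r r0 sE] : exists2 r, 0 < r & s = c * r.
  by exists (s / c); [rewrite divr_gt0|rewrite mulrC divfK// gt_eqF].
pose S : set T := [set` `[x.1 - 2 * r, x.1 - 2 * r + 4 * r[] `*`
  [set` `[x.2 - 2 * r, x.2 - 2 * r + 4 * r[].
have -> : ((16 / c ^+ 2)%:E * (s * s)%:E = area S)%E.
  rewrite area_square; last by rewrite mulr_ge0// ltW.
  by rewrite -EFinM; congr EFin; rewrite sE; field; rewrite gt_eqF.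
apply: le_measure; rewrite ?inE.
- exact: mQ.
- by apply: measurableX; exact: measurable_itv.
move=> y [Dy Qy]; have [Q2 Q3] := Q1 _ Qy; have := expand Dx Dy Q2 Q3.
rewrite sE !ler_pM2l// !ler_norml => -[/andP[h1 h2] /andP[h3 h4]].
by split; rewrite /= in_itv /=; apply/andP; split; lra.
Qed.

(* An open set is an increasing union of dyadic squares, and the preimage of a
   square of side [s] lies in a square of side [4 s / c]. *)
Lemma area_expansive U : plane_open U ->
  (area (D `&` Q @^-1` U) <= (16 / c ^+ 2)%:E * area U)%E.
Proof.
move=> oU; have mU : measurable U by exact: measurable_plane_open.
have K0 : 0 <= 16 / c ^+ 2 by rewrite divr_ge0// exprn_ge0// ltW.
(* The cells of level [n] contained in [U], enumerated by their codes; an index that is not a code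
   contributes the empty set. *)
pose F n k := if pickle_inv k is Some q then
  if `[< cell n q `<=` U >] then cell n q else set0 else set0.
have mF n k : measurable (F n k).
  by rewrite /F; case: pickle_inv => // q; case: ifP.
have dF n i j : i != j -> F n i `&` F n j = set0.
  move=> ij; apply/seteqP; split => // w [].
  have := @pickle_invK (int * int)%type i; have := @pickle_invK (int * int)%type j.
  rewrite /F; case: pickle_inv => [q|//] /= qj; case: pickle_inv => [q'|//] /= qi.
  case: ifP => // _; case: ifP => // _; rewrite /cell /= => e1 e2.
  by move: ij; rewrite -qi -qj -e1 -e2 eqxx.
have tF n : trivIset setT (F n) by apply/trivIsetP => i j _ _; exact: dF.
pose V n := [set w | cell n (grid n w) `<=` U].
have VE n : V n = \bigcup_k F n k.
  apply/seteqP; split => w.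
    move=> Vw; have Fw : F n (pickle (grid n w)) w.
      by rewrite /F pickleK_inv; case: asboolP.
    by move: (pickle _) Fw => k Fw; exists k.
  move=> [k _]; rewrite /F; case: pickle_inv => // q; case: asboolP => // qU.
  by rewrite /cell /= => e; rewrite /V /= e.
have mV n : measurable (V n) by rewrite VE; exact: bigcup_measurable.
have VU n : V n `<=` U by move=> w; apply.
have bV : \bigcup_n V n = U.
  apply/seteqP; split => [w [n _ /VU//]|w Uw].
  have [e e0 eU] := oU _ Uw.
  have [n ne] : exists n, (2 ^+ n)^-1 < e.
    have [n hn] := @exprn_small R 2^-1 (e / 2) ltac:(apply/andP; split; lra) ltac:(lra).
    exists n; have := hn n (leqnn n); rewrite exprVn => h; apply: (le_lt_trans h); lra.
  exists n => // v; rewrite cellE => hv.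
  have : cell n (grid n w) w by [].
  rewrite cellE; move: hv => /=; rewrite !in_itv /=.
  move=> [/andP[a1 a2] /andP[a3 a4]] [/andP[b1 b2] /andP[b3 b4]].
  by case: v a1 a2 a3 a4 => v1 v2 /= *; apply: eU => /=; rewrite ltr_norml; apply/andP; split; lra.
have ndV : {homo V : n k / (n <= k)%N >-> (n <= k)%O}.
  apply/nondecreasing_seqP => n; apply/subsetPset => w Vw v; rewrite /cell /= => e.
  by apply: Vw; apply: gridS.
have le n : (area (D `&` Q @^-1` V n) <= (16 / c ^+ 2)%:E * area U)%E.
  apply: (@le_trans _ _ ((16 / c ^+ 2)%:E * area (V n)))%E; last first.
    by apply: lee_wpmul2l => //; apply: le_measure; rewrite ?inE.
  rewrite VE preimage_bigcup setI_bigcupr !measure_bigcup//; last 2 first.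
  - by move=> k _; exact: mQ.
  - apply/trivIsetP => i j _ _ /(dF n) e.
    by apply/seteqP; split => // w [[_ Fi] [_ Fj]]; have : set0 (Q w) by rewrite -e.
  rewrite -nneseriesZl//; apply: lee_nneseries => // k _.
  rewrite /F; case: pickle_inv => [q|]; last first.
    by rewrite preimage_set0 setI0 measure0 mule0.
  case: ifP => _; first exact: area_preimage_cell.
  by rewrite preimage_set0 setI0 measure0 mule0.
have mDV n : measurable (D `&` Q @^-1` V n) by exact: mQ.
have cv : area (D `&` Q @^-1` V n) @[n --> \oo] --> area (D `&` Q @^-1` U).
  rewrite -bV preimage_bigcup setI_bigcupr.
  apply: nondecreasing_cvg_mu => //; first exact: bigcup_measurable.
  move=> n k nk; apply/subsetPset => w [Dw Vw]; split => //.
  by move/subsetPset : (ndV _ _ nk); apply.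
rewrite -(cvg_lim _ cv)//; apply: lime_le; first by apply/cvg_ex; eexists; exact: cv.
by apply: nearW.
Qed.

End expansive.

(** * The Bergman norm *)

Section holomorphic_functions.
Context {R : realType}.
Implicit Types (f g : R[i] -> R[i]) (z w : R[i]).

Lemma holoP f z : holo f z <-> derivable f z 1.
Proof.
have posC (e : R[i]) : 0 < e -> exists2 r : R, 0 < r & e = r%:C.
  move=> e0; have eE : e = (complex.Re e)%:C by rewrite RRe_real// gtr0_real.
  by exists (complex.Re e) => //; rewrite -ltcR -eE.
have eqle (x y : R) : x = y -> x <= y by move=> ->.
split=> [[l fl]|].
  apply/cvg_ex; exists l; apply/cvgrPdist_le => _ /posC[e e0 ->].
  have [d d0 h] := fl e e0.
  have d0' : 0 < d%:C :> R[i] by rewrite ltcR.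
  rewrite near_withinE; apply/nbhs_ballP; exists d%:C => //= y.
  rewrite -ball_normE /= sub0r normrN normrC ltcR -cnormE => yd yn0.
  have := h (y * 1 + z) ltac:(by rewrite mulr1 addrK).
  rewrite mulr1 addrK => H.
  have y0 : 0 < cnorm y by rewrite cnorm_gt0.
  rewrite normrC -cnormE lecR -(ler_pM2r y0) -cnormM (le_trans _ H)//.
  rewrite -cnormN; apply: eqle; congr cnorm.
  rewrite /GRing.scale /= mulr1.
  by field.
move=> /cvg_ex[l]; rewrite /cvg_to => /cvgrPdist_le h; exists l => e e0.
have e0' : 0 < e%:C :> R[i] by rewrite ltcR.
have := h _ e0'; rewrite near_withinE => /nbhs_ballP[_ /posC[d d0 ->] hd].
exists d => // w wd; have [->|wz] := eqVneq w z.
  by rewrite !subrr mulr0 subrr cnorm0 mulr0.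
have y0 : 0 < cnorm (w - z) by rewrite cnorm_gt0 subr_eq0.
have := hd (w - z); rewrite -ball_normE /= sub0r normrN normrC ltcR -cnormE.
move=> /(_ wd); rewrite subr_eq0 => /(_ wz).
rewrite normrC -cnormE lecR -(ler_pM2r y0) -cnormM => H; apply: (le_trans _ H).
rewrite -cnormN; apply: eqle; congr cnorm.
rewrite /GRing.scale /= mulr1 subrK.
by field; rewrite subr_eq0.
Qed.

Lemma holomorphic_diskP f : holomorphic_on disk f <-> holo_unit f.
Proof.
split=> h z; last by rewrite /disk /= -cnormE => /h/holoP.
by rewrite cnormE => /h/holoP.
Qed.

End holomorphic_functions.

Section power_estimates.
Context {R : realType}.
Implicit Types (x y u v a t : R).

Lemma powR_cont a t : 0 < t -> x `^ a @[x --> t] --> t `^ a.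
Proof.
move=> t0; have : derivable (fun x => x `^ a) t 1.
  by apply: derivable_powR; rewrite in_itv /= t0.
by move=> /derivable1_diffP/differentiable_continuous.
Qed.

Lemma powR_exprn x a n : 0 <= x -> (x ^+ n) `^ a = (x `^ a) ^+ n.
Proof.
by move=> x0; rewrite -powR_mulrn// -powRrM mulrC powRrM powR_mulrn ?powR_ge0.
Qed.

(** The exponent may be negative, whence the comparison of [u] and [v] in both directions and the
    absolute value in the constant. *)
Lemma powR_comparable (a k u v : R) : 1 <= k -> 0 < u -> 0 < v -> u <= k * v ->
  v <= k * u -> u `^ a <= k `^ `|a| * v `^ a.
Proof.
move=> k1 u0 v0 uv vu; have k0 : 0 < k by lra.
have [a0|a0] := leP 0 a.
  rewrite ger0_norm// -powRM ?(ltW k0) ?(ltW v0)// ge0_ler_powR// ?nnegrE ?(ltW u0)//.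
  by rewrite mulr_ge0 ?ltW.
have b0 : 0 < - a by rewrite oppr_gt0.
have [b aE] : exists b, a = - b by exists (- a); rewrite opprK.
rewrite ltr0_norm// in b0 *; rewrite aE opprK !powRN in b0 *.
rewrite ler_pdivlMr ?powR_gt0// mulrC ler_pdivrMr ?powR_gt0//.
rewrite -powRM ?(ltW k0) ?(ltW u0)//.
by rewrite ge0_ler_powR// ?nnegrE ?mulr_ge0 ?(ltW v0) ?(ltW b0) ?(ltW k0) ?(ltW u0).
Qed.

End power_estimates.

(** The integrand of the Bergman integral, extended by 0, so that integrals run over the whole plane
    and superlevel sets at levels [t >= 0] stay inside the disk. *)
Definition bergman_mass {R : realType} (alpha p : R) f
    (w : measurableTypeR R * measurableTypeR R) : R :=
  bergman_root alpha p f w `^ p.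

Section bergman_mass.
Context {R : realType} {alpha p : R} (alpha_gtN1 : -1 < alpha) (p_ge1 : 1 <= p).
Local Notation T := (measurableTypeR R * measurableTypeR R)%type.
Local Notation D := (@cplx R @^-1` disk).
Local Notation mass := (bergman_mass alpha p).
Local Notation bint := (bergman_integral alpha p).
Local Notation dens := (bergman_density alpha).
Local Notation V := (bergman alpha_gtN1 p_ge1).
Implicit Types (f g h : R[i] -> R[i]) (w v : T) (z : R[i]).

Let p0 : 0 < p. Proof. by apply: lt_le_trans p_ge1. Qed.

Lemma disk_cnorm z : disk z = (cnorm z < 1) :> Prop.
Proof. by rewrite cnormE. Qed.

Lemma massE f w : D w -> mass f w = cnorm (f (cplx w)) `^ p * dens w.
Proof.
move=> Dw; rewrite /bergman_mass /bergman_root patchE mem_set// -cnormE.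
rewrite powRM ?cnorm_ge0 ?powR_ge0// -powRrM mulVf ?gt_eqF// powRr1//.
exact: bergman_density_ge0.
Qed.

Lemma mass_out f w : ~ D w -> mass f w = 0.
Proof.
move=> Dw; rewrite /bergman_mass /bergman_root patchE memNset//.
by rewrite powR0 ?gt_eqF.
Qed.

Lemma mass_ge0 f w : 0 <= mass f w.
Proof. exact: powR_ge0. Qed.

Lemma measurable_mass f : holo_unit f -> measurable_fun [set: T] (mass f).
Proof.
move=> /holomorphic_diskP hf; apply: (measurableT_comp (measurable_powR _)).
exact: measurable_bergman_root.
Qed.

Lemma measurable_EFin_mass f : holo_unit f ->
  measurable_fun [set: T] (fun w => (mass f w)%:E).
Proof. by move=> hf; apply/measurable_EFinP; exact: measurable_mass. Qed.

Lemma bintE f : bint f = (\int[area]_w (mass f w)%:E)%E.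
Proof. exact: bergman_integralE. Qed.

Lemma bint_ge0 f : (0 <= bint f)%E.
Proof. exact: bergman_integral_ge0. Qed.

Lemma mass_eq f g w : (forall z, cnorm z < 1 -> f z = g z) -> mass f w = mass g w.
Proof.
move=> fg; have [Dw|Dw] := pselect (D w); last by rewrite !mass_out.
by rewrite !massE// fg// -disk_cnorm.
Qed.

Lemma bint_eq f g : (forall z, cnorm z < 1 -> f z = g z) -> bint f = bint g.
Proof. by move=> fg; rewrite !bintE; apply: eq_integral => w _; rewrite (mass_eq _ fg). Qed.

(** Minkowski's inequality combined with monotonicity; domination in place of a sum is the form that
    [bergman_dom] uses. *)
Lemma bint_triangle f g h : holo_unit f -> holo_unit g -> holo_unit h ->
  (forall z, cnorm z < 1 -> cnorm (h z) <= cnorm (f z) + cnorm (g z)) ->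
  (bint h `^ p^-1 <= bint f `^ p^-1 + bint g `^ p^-1)%E.
Proof.
move=> hf hg hh hfg; rewrite -!Lnorm_bergman_root//.
have mr f' : holo_unit f' -> measurable_fun [set: T] (bergman_root alpha p f').
  by move=> /holomorphic_diskP; exact: measurable_bergman_root.
apply: (le_trans _ (minkowski_EFin area (mr _ hf) (mr _ hg) p_ge1)).
have mP (F : T -> R) : measurable_fun [set: T] F ->
    measurable_fun [set: T] (fun w => (`|(EFin \o F) w| `^ p)%E).
  move=> mF; apply/measurable_EFinP => /=.
  by apply: (measurableT_comp (measurable_powR _)); exact: measurableT_comp.
rewrite Lnorm.unlock; apply: gt0_ler_poweR.
- by rewrite invr_ge0 ltW.
- by rewrite in_itv /= leey andbT integral_ge0// => w _; rewrite poweR_ge0.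
- by rewrite in_itv /= leey andbT integral_ge0// => w _; rewrite poweR_ge0.
apply: ge0_le_integral => //.
- by move=> w _; rewrite poweR_ge0.
- exact: (mP _ (mr _ hh)).
- exact: (mP _ (measurable_funD (mr _ hf) (mr _ hg))).
move=> w _ /=; rewrite lee_fin ge0_ler_powR ?nnegrE ?normr_ge0 ?(ltW p0)//.
rewrite !ger0_norm ?addr_ge0 ?bergman_root_ge0// /bergman_root !patchE.
case: ifP => [/set_mem Dw|_]; last first.
  by rewrite (_ : point = 0 :> R) // addr0.
by rewrite -mulrDl ler_wpM2r ?powR_ge0// -!cnormE hfg// -disk_cnorm.
Qed.

Lemma bergman_ext h : holo_unit h -> (bint h < +oo)%E ->
  exists2 g : V, (forall z, cnorm z < 1 -> g z = h z) &
    (bergman_norm g)%:E = (bint h `^ p^-1)%E.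
Proof.
move=> hh Ih; pose h0 := patch (fun=> 0) disk h.
have h0E z : cnorm z < 1 -> h0 z = h z.
  by rewrite -disk_cnorm => dz; rewrite /h0 patchE mem_set.
have I0 : bint h0 = bint h by exact: bint_eq.
have hP : h0 \in bergman_pred alpha_gtN1 p_ge1.
  apply/asboolP; split; last by rewrite I0.
    apply/holomorphic_diskP => z z1; have d0 : 0 < 1 - cnorm z by lra.
    apply: (holo_eq d0 _ (hh z z1)) => w wz; rewrite h0E//.
    by rewrite -(subrK z w) (le_lt_trans (cnormD _ _))//; lra.
  by move=> z dz; rewrite /h0 patchE memNset.
by exists (Bergman hP) => //; rewrite bergman_normE /= I0.
Qed.

Lemma bergman_holo (f : V) : holo_unit f.
Proof. by have [/holomorphic_diskP] := bergmanP f. Qed.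

Lemma bergman_eq (f g : V) : (forall z, cnorm z < 1 -> f z = g z) -> f = g.
Proof.
move=> fg; apply/val_inj/funext => z /=.
have [_ f0 _] := bergmanP f; have [_ g0 _] := bergmanP g.
have [dz|dz] := pselect (disk z); last by rewrite f0// g0.
by apply: fg; rewrite -disk_cnorm.
Qed.

Lemma bergman_norm_ge0 (f : V) : 0 <= bergman_norm f.
Proof. exact: powR_ge0. Qed.

Lemma normr_bergman (f : V) : `|f| = (bergman_norm f)%:C.
Proof. by []. Qed.

Lemma bergman_is_norm : is_norm (@bergman_norm R alpha p alpha_gtN1 p_ge1).
Proof.
split; first exact: bergman_norm_ge0.
- by move=> f g; rewrite -lecR rmorphD /= -!normr_bergman ler_normD.
- by move=> a f; apply: complexI; rewrite rmorphM /= -!normr_bergman normrZ cnormE.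
- by move=> f f0; apply/eqP; rewrite -normr_eq0 normr_bergman f0.
Qed.

Lemma bergman_norm_bint (f : V) : (bint f = (bergman_norm f `^ p)%:E)%E.
Proof.
have [_ _ If] := bergmanP f.
by rewrite /bergman_norm -powRrM mulVf ?gt_eqF// powRr1 ?fineK// fine_ge0 ?bint_ge0.
Qed.

Hypothesis finite_mass : (bint (fun=> 1%R) < +oo)%E.

Lemma bergman_dom : exists2 c : R, 0 <= c & forall h (f : V) (k B : R),
  holo_unit h -> 0 <= k -> 0 <= B ->
  (forall z, cnorm z < 1 -> cnorm (h z) <= k * cnorm (f z) + B) ->
  exists2 g : V, (forall z, cnorm z < 1 -> g z = h z) &
    bergman_norm g <= k * bergman_norm f + B * c.
Proof.
have h1 : holo_unit (fun=> 1 : R[i]) by move=> z _; exact: holo_cst.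
have [u uE uN] := bergman_ext h1 finite_mass.
exists (bergman_norm u); first exact: bergman_norm_ge0.
move=> h f k B hh k0 B0 hle.
have [n0 _ nZ _] := bergman_is_norm.
have root (x : V) : (bint x `^ p^-1 = (bergman_norm x)%:E)%E by rewrite bergman_normE.
have le : (bint h `^ p^-1 <= (k * bergman_norm f + B * bergman_norm u)%:E)%E.
  have := @bint_triangle (k%:C *: f : V) (B%:C *: u : V) h (bergman_holo _) (bergman_holo _) hh.
  rewrite !root !nZ !cnorm_real !ger0_norm// -EFinD; apply => z z1.
  have -> : (k%:C *: f : V) z = k%:C * f z by [].
  have -> : (B%:C *: u : V) z = B%:C * u z by [].
  by rewrite !cnormM !cnorm_real !ger0_norm// uE// cnorm1 mulr1 hle.
have Ih : (bint h < +oo)%E.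
  rewrite ltey; apply/eqP => Ih; move: le.
  by rewrite Ih poweRyr ?invr_eq0 ?gt_eqF.
have [g gE gN] := bergman_ext hh Ih.
by exists g => //; rewrite -lee_fin gN.
Qed.

(** Dominated convergence: on the disk the powers of [th] tend to 0 pointwise and have modulus at
    most 1. *)
Lemma bergman_shrink (th : R[i] -> R[i]) (f : V) (e : R) : 0 < e -> holo_unit th ->
  (forall z, cnorm z < 1 -> cnorm (th z) < 1) ->
  exists k0, forall k (g : V), (k0 <= k)%N ->
    (forall z, cnorm z < 1 -> g z = th z ^+ k * f z) -> bergman_norm g <= e.
Proof.
move=> e0 hth th1; have hf := bergman_holo f.
pose F k : R[i] -> R[i] := fun z => th z ^+ k * f z.
have hF k : holo_unit (F k) by move=> z z1; apply: holoM (holoX _ (hth _ z1)) (hf _ z1).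
have FE k w : D w -> mass (F k) w = (cnorm (th (cplx w)) ^+ k) `^ p * mass f w.
  by move=> Dw; rewrite !massE// cnormM cnormX powRM ?exprn_ge0 ?cnorm_ge0// mulrA.
have Fle k w : mass (F k) w <= mass f w.
  have [Dw|Dw] := pselect (D w); last by rewrite !mass_out.
  rewrite FE// ler_piMl ?mass_ge0//.
  have <- : 1 `^ p = 1 :> R by rewrite powR1.
  rewrite ge0_ler_powR// ?nnegrE ?exprn_ge0 ?cnorm_ge0 ?(ltW p0)//.
  by rewrite exprn_ile1 ?cnorm_ge0// ltW// th1// -disk_cnorm.
have F0 w : (mass (F k) w)%:E @[k --> \oo] --> 0%E.
  apply/cvg_EFin; first exact: nearW.
  have [Dw|Dw] := pselect (D w); last first.
    rewrite (_ : (fun k => _) = cst 0); first exact: cvg_cst.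
    by apply/funext => k /=; rewrite mass_out.
  apply/cvgrPdist_le => d d0; set m := mass f w.
  have m1 : 0 < m + 1 by have := mass_ge0 f w; rewrite -/m; lra.
  have d1 : 0 < (d / (m + 1)) `^ p^-1 by rewrite powR_gt0// divr_gt0.
  have thw : 0 <= cnorm (th (cplx w)) < 1 by rewrite cnorm_ge0 th1// -disk_cnorm.
  have [k0 hk] := exprn_small thw d1; near=> k.
  rewrite /= sub0r normrN ger0_norm ?mass_ge0// FE// -/m.
  have le : (cnorm (th (cplx w)) ^+ k) `^ p <= d / (m + 1).
    apply: (@le_trans _ _ (((d / (m + 1)) `^ p^-1) `^ p)).
      rewrite ge0_ler_powR ?nnegrE ?exprn_ge0 ?cnorm_ge0 ?(ltW p0) ?(ltW d1)//.
      by apply: hk; near: k; exists k0.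
    by rewrite -powRrM mulVf ?gt_eqF// powRr1// ltW// divr_gt0.
  have m0 : 0 <= m by exact: mass_ge0.
  rewrite (le_trans (ler_wpM2r m0 le))// mulrAC ler_pdivrMr// ler_pM2l//; lra.
have Fb k w : (`|(mass (F k) w)%:E| <= (mass f w)%:E)%E.
  by rewrite gee0_abs ?lee_fin ?Fle ?mass_ge0.
have ifin : area.-integrable setT (fun w => (mass f w)%:E).
  apply/integrableP; split; first exact: measurable_EFin_mass.
  have [_ _ If] := bergmanP f.
  rewrite (eq_integral (fun w => (mass f w)%:E)) -?bintE ?ltey_eq ?If// => w _.
  by rewrite gee0_abs// lee_fin mass_ge0.
have [_ _] := @dominated_convergence _ _ _ (@area R) setT measurableT
  (fun k w => (mass (F k) w)%:E) (cst 0%E) (fun w => (mass f w)%:E)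
  (fun k => measurable_EFin_mass (hF k)) (measurable_cst _)
  (aeW _ (fun w _ => F0 w)) ifin
  (aeW _ (fun w k _ => Fb k w)).
rewrite integral0 => /fine_cvgP[_ /cvgrPdist_le].
have ep : 0 < e `^ p by rewrite powR_gt0.
move=> /(_ _ ep)[k0 _ hk]; exists k0 => k g kk gE.
have := hk k kk; rewrite /= -bintE sub0r normrN.
have -> : bint (F k) = bint g by apply: bint_eq => z z1; rewrite gE.
rewrite bergman_norm_bint /= ger0_norm ?powR_ge0// => le.
rewrite leNgt; apply/negP => lt; move: le; apply/negP; rewrite -ltNge.
by rewrite gt0_ltr_powR ?nnegrE ?bergman_norm_ge0 ?(ltW e0).
Unshelve. all: by end_near. Qed.

Lemma bergman_fatou (g : nat -> V) h K : holo_unit h ->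
  (forall n, bergman_norm (g n) <= K) ->
  (forall z, cnorm z < 1 -> cconverges (fun n => g n z) (h z)) ->
  exists2 f : V, (forall z, cnorm z < 1 -> f z = h z) & bergman_norm f <= K.
Proof.
move=> hh gK gh; have K0 : 0 <= K by apply: le_trans (gK 0%N); exact: bergman_norm_ge0.
have liminf_le (u : nat -> \bar R) b : (forall n, u n <= b)%E -> (limn_einf u <= b)%E.
  move=> ub; rewrite limn_einf_lim; apply: lime_le; first exact: is_cvg_einfs.
  apply: nearW => n; apply: (le_trans _ (ub n)); apply: ereal_inf_lbound.
  by exists n => /=.
have liminf_ge0 (u : nat -> \bar R) : (forall n, 0 <= u n)%E -> (0 <= limn_einf u)%E.
  move=> u0; rewrite limn_einf_lim; apply: lime_ge; first exact: is_cvg_einfs.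
  by apply: nearW => n; apply: le_ereal_inf_tmp => _ [k _ <-].
have le : (bint h <= (K `^ p)%:E)%E.
  rewrite bintE; apply: (@le_trans _ _ (limn_einf (fun n => bint (g n)))); last first.
    apply: liminf_le => n; rewrite bergman_norm_bint lee_fin.
    by rewrite ge0_ler_powR ?nnegrE ?bergman_norm_ge0// ltW.
  under [X in limn_einf X]eq_fun do rewrite bintE.
  have mg n := measurable_EFin_mass (bergman_holo (g n)).
  have := @fatou _ _ _ (@area R) setT measurableT (fun n w => (mass (g n) w)%:E) mg
    (fun n w _ => ltac:(by rewrite lee_fin mass_ge0)).
  apply: le_trans; apply: ge0_le_integral => //.
  - by move=> w _; rewrite lee_fin mass_ge0.
  - exact: measurable_EFin_mass.
  - apply: (emeasurable_fun_cvg (fun n w => einfs (fun k => (mass (g k) w)%:E) n)) => [n|w _].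
      by apply: measurable_fun_einfs => k; exact: mg.
    by rewrite limn_einf_lim; exact: is_cvg_einfs.
  move=> w _.
  have [Dw|Dw] := pselect (D w); last first.
    by rewrite mass_out//; apply: liminf_ge0 => n; rewrite lee_fin mass_ge0.
  (* At a zero of [h] the inequality is trivial; elsewhere the modulus is positive and [powR_cont]
     applies. *)
  have [h0|hn0] := eqVneq (h (cplx w)) 0.
    rewrite massE// h0 cnorm0 powR0 ?gt_eqF// mul0r.
    by apply: liminf_ge0 => n; rewrite lee_fin mass_ge0.
  have cv : mass (g n) w @[n --> \oo] --> mass h w.
    rewrite massE//; under eq_fun do rewrite massE//.
    apply: cvgMl.
    apply: (@cvg_comp _ _ _ (fun n => cnorm (g n (cplx w))) (fun x => x `^ p) _
      (nbhs (cnorm (h (cplx w))))).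
      apply/cvgrPdist_le => e e0.
      have [N hN] := gh (cplx w) ltac:(by rewrite -disk_cnorm) e e0.
      near=> n; rewrite distrC (le_trans _ (hN n _)) ?cnormE ?ler_dist_normc//.
      by near: n; exists N.
    by apply: powR_cont; rewrite cnorm_gt0.
  have cvE : (mass (g n) w)%:E @[n --> \oo] --> (mass h w)%:E by apply/cvg_EFin => //; exact: nearW.
  rewrite is_cvg_limn_einfE; last by apply/cvg_ex; eexists; exact: cvE.
  by rewrite (cvg_lim _ cvE).
have [|f fE fN] := bergman_ext hh; first by rewrite (le_lt_trans le)// ltry.
exists f => //; rewrite -lee_fin fN.
rewrite -[K in leRHS](powRr1 K0) -(@mulfV _ p) ?gt_eqF// powRrM -poweR_EFin.
apply: gt0_ler_poweR => //.
- by rewrite invr_ge0 ltW.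
- by rewrite in_itv /= leey bint_ge0.
- by rewrite in_itv /= leey lee_fin powR_ge0.
Unshelve. all: by end_near. Qed.

End bergman_mass.

(** * Area near the unit circle and finiteness of the total mass *)

Section collar.
Context {R : realType}.
Local Notation T := (measurableTypeR R * measurableTypeR R)%type.
Local Notation D := (@cplx R @^-1` disk).
Implicit Types (w v : T).

Definition defect w : R := 1 - (w.1 ^+ 2 + w.2 ^+ 2).

Lemma defectE w : defect w = 1 - cnorm (cplx w) ^+ 2.
Proof. by rewrite cnormE sqr_normc_cplx. Qed.

Lemma disk_defect w : D w -> 0 < defect w <= 1.
Proof.
rewrite /= disk_cnorm defectE => w1; have w0 := cnorm_ge0 (cplx w).
by rewrite subr_gt0 expr_lt1// w1 gerBl sqr_ge0.
Qed.

Lemma measurable_defect : measurable_fun [set: T] defect.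
Proof.
apply: measurable_funB => //.
by apply: measurable_funD; apply: measurable_funX;
  [exact: measurable_fst|exact: measurable_snd].
Qed.

Lemma measurable_superlevel (F : T -> R) t : measurable_fun [set: T] F ->
  measurable [set w | t < F w].
Proof.
move=> mF; have := measurable_fun_ltr (measurable_cst t) mF.
by move=> /(_ measurableT [set true] Logic.I); rewrite setTI.
Qed.

Lemma measurable_sublevel (F : T -> R) t : measurable_fun [set: T] F ->
  measurable [set w | F w <= t].
Proof.
move=> mF; have := measurable_fun_ler mF (measurable_cst t).
by move=> /(_ measurableT [set true] Logic.I); rewrite setTI.
Qed.

Lemma area_open_rect (a b c d : R) : a < b -> c < d ->
  area ([set` `]a, b[] `*` [set` `]c, d[] : set T) = ((b - a) * (d - c))%:E.
Proof.
move=> ab cd; rewrite /area /= product_measure1E; [|exact: measurable_itv..].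
have len (s t : R) : s < t -> lebesgue_measure [set` `]s, t[] = (t - s)%:E.
  by move=> st; rewrite lebesgue_measure_itv /= lte_fin st EFinB.
by have := (len a b ab, len c d cd) => /= -[-> ->].
Qed.

Lemma plane_open_rect (a b c d : R) :
  plane_open ([set` `]a, b[] `*` [set` `]c, d[] : set T).
Proof.
move=> [x y] [] /=; rewrite !in_itv /= => /andP[ax xb] /andP[cy yd].
exists (Num.min (Num.min (x - a) (b - x)) (Num.min (y - c) (d - y))).
  by rewrite !lt_min !subr_gt0 ax xb cy yd.
move=> [x' y']; rewrite !lt_min !ltr_norml /= => /andP[/andP[h1 h2] _] /andP[_ /andP[h3 h4]].
by split; rewrite /= in_itv /=; apply/andP; split; lra.
Qed.

(* With the defect as one coordinate the collar becomes a rectangle of area [12 t],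
   and the change of coordinates is expansive with constant 1/5. *)
Lemma area_collar_piece (a b : T -> R) (t : R) : 0 < t ->
  measurable_fun [set: T] a -> measurable_fun [set: T] b ->
  (forall w, a w ^+ 2 + b w ^+ 2 = w.1 ^+ 2 + w.2 ^+ 2) ->
  (forall w v e, `|a w - a v| <= e -> `|b w - b v| <= e ->
     `|w.1 - v.1| <= e /\ `|w.2 - v.2| <= e) ->
  (area (D `&` [set w | (3^-1 < a w)%R] `&` [set w | (defect w <= t)%R]) <= ((16 * 25 * 12) * t)%:E)%E.
Proof.
move=> t0 ma mb ab coord; pose E : set T := D `&` [set w | 3^-1 < a w].
have mE : measurable E.
  by apply: measurableI; [exact: measurable_disk|exact: measurable_superlevel].
pose Q w : T := (defect w, b w).
have mQ : measurable_fun setT Q.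
  by apply/measurable_fun_pair => //; exact: measurable_defect.
have bE w : E w -> -1 <= b w <= 1 /\ 3^-1 < a w.
  move=> [/disk_defect/andP[d0 _] a2]; split => //; rewrite -ler_norml.
  rewrite -(@ler_pXn2r _ 2)// ?nnegrE// real_normK ?num_real// expr1n.
  by have := ab w; have := sqr_ge0 (a w); rewrite /defect in d0; lra.
have := @area_expansive _ E Q 5^-1 ltac:(lra) mE (measurable_funTS mQ).
have ex v w : E v -> E w -> forall e, `|(Q v).1 - (Q w).1| <= e -> `|(Q v).2 - (Q w).2| <= e ->
    5^-1 * `|v.1 - w.1| <= e /\ 5^-1 * `|v.2 - w.2| <= e.
  move=> /bE[bv av] /bE[bw aw] e /= h1 h2.
  (* An error [e] in the defect and in [b], with [|b| <= 1], becomes [3 * e] in [a ^+ 2]; as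
     [a v + a w > 2 / 3], this is at most [9 / 2 * e] in [a]. *)
  have [] := coord v w (5 * e).
  - have := ab v; have := ab w; move: h1 h2 bv bw; rewrite /defect => h1 h2 bv bw eq1 eq2.
    have e0 : 0 <= e by apply: le_trans h2.
    have h3 : `|b v ^+ 2 - b w ^+ 2| <= 2 * e.
      rewrite subr_sqr normrM mulrC ler_pM//.
      by move: bv bw => /andP[? ?] /andP[? ?]; rewrite ler_norml; apply/andP; split; lra.
    have h4 : `|a v ^+ 2 - a w ^+ 2| <= 3 * e.
      rewrite (_ : a v ^+ 2 - a w ^+ 2 =
        - (1 - (v.1 ^+ 2 + v.2 ^+ 2) - (1 - (w.1 ^+ 2 + w.2 ^+ 2))) - (b v ^+ 2 - b w ^+ 2)).
        by rewrite (le_trans (ler_normB _ _))// normrN; lra.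
      by lra.
    move: h4; rewrite subr_sqr normrM [`|a v + a w|]ger0_norm; last by lra.
    have := normr_ge0 (a v - a w); move: (`|_|) => n n0 h4.
    have : n * (2 / 3) <= n * (a v + a w) by apply: ler_wpM2l => //; lra.
    by lra.
  - by apply: (le_trans h2); have := le_trans (normr_ge0 _) h2; lra.
  by move=> ? ?; split; lra.
move=> /(_ ex) h; pose U : set T := [set` `](- t), 2 * t[] `*` [set` `](-2), 2[].
have := h U (@plane_open_rect _ _ _ _).
rewrite area_open_rect; [|lra|lra].
rewrite -EFinM => h1.
have -> : (16 * 25 * 12) * t = 16 / 5^-1 ^+ 2 * ((2 * t - - t) * (2 - - 2)) by field.
apply: le_trans h1; apply: le_measure; rewrite ?inE.
- by apply: measurableI => //; apply: measurable_sublevel; exact: measurable_defect.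
- apply: (measurable_funTS mQ) => //; apply: measurable_plane_open.
  exact: plane_open_rect.
move=> w [Ew /= wt]; have [/andP[b1 b2] _] := bE _ Ew.
have /andP[d0 _] := disk_defect Ew.1.
by split => //; split; rewrite /= in_itv /=; apply/andP; split; lra.
Qed.

Lemma area_collar : exists2 K : R, 0 <= K & forall t, 0 < t <= 2^-1 ->
  (area (D `&` [set w | (defect w <= t)%R]) <= (K * t)%:E)%E.
Proof.
exists (4 * (16 * 25 * 12)) => [|t /andP[t0 t2]]; first by rewrite !mulr_ge0.
have m1 : measurable_fun [set: T] (fun w : T => w.1) by exact: measurable_fst.
have m2 : measurable_fun [set: T] (fun w : T => w.2) by exact: measurable_snd.
have md := measurable_defect.
pose P (a : T -> R) : set T := D `&` [set w | (3^-1 < a w)%R] `&` [set w | (defect w <= t)%R].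
have mP a : measurable_fun [set: T] a -> measurable (P a).
  move=> ma; apply: measurableI; last exact: measurable_sublevel.
  by apply: measurableI; [exact: measurable_disk|exact: measurable_superlevel].
have nrm (x y e : R) : `|- x - - y| <= e -> `|x - y| <= e.
  by rewrite -opprD normrN.
have A1 : (area (P (fun w => w.1)) <= ((16 * 25 * 12) * t)%:E)%E.
  exact: (@area_collar_piece _ (fun w : T => w.2)).
have A2 : (area (P (fun w => (- w.1)%R)) <= ((16 * 25 * 12) * t)%:E)%E.
  apply: (@area_collar_piece _ (fun w : T => w.2)) => //.
  - exact: measurableT_comp.
  - by move=> w; rewrite sqrrN.
  - by move=> w v e /nrm.
have A3 : (area (P (fun w => w.2)) <= ((16 * 25 * 12) * t)%:E)%E.
  apply: (@area_collar_piece _ (fun w : T => w.1)) => //.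
  by move=> w; rewrite addrC.
have A4 : (area (P (fun w => (- w.2)%R)) <= ((16 * 25 * 12) * t)%:E)%E.
  apply: (@area_collar_piece _ (fun w : T => w.1)) => //.
  - exact: measurableT_comp.
  - by move=> w; rewrite sqrrN addrC.
  - by move=> w v e /nrm.
have n1 : measurable_fun [set: T] (fun w : T => - w.1) by exact: measurableT_comp.
have n2 : measurable_fun [set: T] (fun w : T => - w.2) by exact: measurableT_comp.
(* If no coordinate exceeds 1/3 in absolute value, the defect is at least 7/9; this is where
   [t <= 2^-1] enters. *)
have sub : D `&` [set w | (defect w <= t)%R] `<=`
    P (fun w => w.1) `|` P (fun w => (- w.1)%R) `|` (P (fun w => w.2) `|` P (fun w => (- w.2)%R)).
  move=> w [Dw dt]; rewrite /P /=.
  have [|h1] := ltP 3^-1 w.1; first by move=> ?; do 2 left.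
  have [|h2] := ltP 3^-1 (- w.1); first by move=> ?; left; right.
  have [|h3] := ltP 3^-1 w.2; first by move=> ?; right; left.
  have [|h4] := ltP 3^-1 (- w.2); first by move=> ?; right; right.
  exfalso; move: dt; rewrite /defect /= => dt.
  have : w.1 ^+ 2 <= 3^-1 * 3^-1.
    rewrite -expr2 -(real_normK (num_real w.1)) lerXn2r ?nnegrE// ler_norml; lra.
  have : w.2 ^+ 2 <= 3^-1 * 3^-1.
    rewrite -expr2 -(real_normK (num_real w.2)) lerXn2r ?nnegrE// ler_norml; lra.
  by move: t2 dt; move: (w.1 ^+ 2) (w.2 ^+ 2) => x y; lra.
apply: (@le_trans _ _ (area (P (fun w => w.1) `|` P (fun w => (- w.1)%R) `|` (P (fun w => w.2) `|` P (fun w => (- w.2)%R))))).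
  apply: le_measure => //; rewrite inE; first by apply: measurableI;
    [exact: measurable_disk|exact: measurable_sublevel].
  by apply: measurableU; apply: measurableU; exact: mP.
have mU (A B : set T) : measurable A -> measurable B -> (area (A `|` B) <= area A + area B)%E.
  exact: measureU2.
apply: (le_trans (mU _ _ _ _)); [by apply: measurableU; exact: mP..|].
have -> : 4 * (16 * 25 * 12) * t = (16 * 25 * 12 * t + 16 * 25 * 12 * t) +
  (16 * 25 * 12 * t + 16 * 25 * 12 * t) by ring.
move: (16 * 25 * 12 * t) A1 A2 A3 A4 => k A1 A2 A3 A4.
rewrite !EFinD; apply: leeD.
  by apply: (le_trans (mU _ _ (mP _ m1) (mP _ n1))); exact: (leeD A1 A2).
by apply: (le_trans (mU _ _ (mP _ m2) (mP _ n2))); exact: (leeD A3 A4).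
Qed.

End collar.

Section total_mass.
Context {R : realType} {alpha p : R} (alpha_gtN1 : -1 < alpha) (p_ge1 : 1 <= p).
Local Notation T := (measurableTypeR R * measurableTypeR R)%type.
Local Notation D := (@cplx R @^-1` disk).
Local Notation mass := (bergman_mass alpha p).
Local Notation bint := (bergman_integral alpha p).
Local Notation dens := (bergman_density alpha).
Implicit Types (w v : T).

Lemma densE w : dens w = (1 + alpha) / pi * defect w `^ alpha.
Proof. by []. Qed.

Let c0 : 0 < (1 + alpha) / pi.
Proof. by rewrite divr_gt0 ?pi_gt0//; have := alpha_gtN1; lra. Qed.

Let mdens (A : set T) : measurable_fun A (fun w => (dens w)%:E).
Proof.
apply/measurable_EFinP/(measurable_funS measurableT (@subsetT _ _)).
exact: measurable_bergman_density.
Qed.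

(** On the ring where the defect lies between [h n.+1] and [h n], the density is at most a constant
    times the power [alpha] of [h n = 2^-n], and the area is of order [h n]. The rings thus form a
    geometric series, whose ratio [q = 2^-(alpha + 1)] is less than 1 because [alpha > -1]. *)
Lemma bint_cst1_finite : (bint (fun=> 1%R) < +oo)%E.
Proof.
have [K K0 hK] := @area_collar R.
have md := @measurable_defect R.
pose h n : R := 2^-1 ^+ n.
have h0 n : 0 < h n by rewrite exprn_gt0.
have hS n : h n.+1 = h n / 2 by rewrite /h exprSr.
have h1 n : h n <= 1 by rewrite exprn_ile1//; lra.
pose S n : set T := D `&` [set w | h n.+1 < defect w].
pose ring n : set T := (D `&` [set w | defect w <= h n]) `&` [set w | h n.+1 < defect w].
have mD := @measurable_disk R.
have mS n : measurable (S n) by apply: measurableI => //; exact: measurable_superlevel.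
have mring n : measurable (ring n).
  apply: measurableI; last exact: measurable_superlevel.
  by apply: measurableI => //; exact: measurable_sublevel.
have d0 (A : set T) w : A w -> (0 <= (dens w)%:E)%E.
  by move=> _; rewrite lee_fin bergman_density_ge0.
pose c := (1 + alpha) / pi * 2 `^ `|alpha|.
have cp : 0 <= c by rewrite mulr_ge0 ?powR_ge0// ltW.
have le_ring n w : ring n w -> dens w <= c * h n `^ alpha.
  move=> [[Dw /= dw1] /= dw2]; rewrite densE /c -[leRHS]mulrA ler_pM2l//.
  have /andP[dw0 _] := disk_defect Dw; have := h0 n; rewrite hS in dw2 => hn.
  by apply: powR_comparable => //; lra.
have int_ring n : (0 < n)%N -> (\int[area]_(w in ring n) (dens w)%:E <=
    (c * K * ((2^-1) `^ (alpha + 1)) ^+ n)%:E)%E.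
  move=> n0; apply: (@le_trans _ _ (\int[area]_(w in ring n) (c * h n `^ alpha)%:E)%E).
    apply: ge0_le_integral => //.
    - exact: d0.
    - by move=> w /le_ring; rewrite lee_fin.
  rewrite integral_cst//; apply: (@le_trans _ _ ((c * h n `^ alpha)%:E * (K * h n)%:E)%E).
    apply: lee_wpmul2l; first by rewrite lee_fin mulr_ge0 ?powR_ge0.
    apply: le_trans (hK (h n) _).
      apply: le_measure; rewrite ?inE//.
        by apply: measurableI => //; exact: measurable_sublevel.
      by move=> w [].
    rewrite h0 /= /h; case: n n0 => // n _.
    by rewrite exprS ler_piMr// exprn_ile1//; lra.
  have E : h n `^ alpha * h n = ((2^-1) `^ (alpha + 1)) ^+ n.
    rewrite -{2}(powRr1 (ltW (h0 n))) -powRD; last by rewrite (gt_eqF (h0 n)) implybT.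
    exact: powR_exprn.
  by rewrite -EFinM lee_fin -E le_eqVlt; apply/orP; left; apply/eqP; ring.
set q := 2^-1 `^ (alpha + 1) in int_ring.
have q0 : 0 <= q by exact: powR_ge0.
have q1 : q < 1.
  have -> : 1 = 1 `^ (alpha + 1) :> R by rewrite powR1.
  by have := alpha_gtN1 => a1; rewrite gt0_ltr_powR ?nnegrE//; lra.
pose E n : \bar R := (\int[area]_(w in S n) (dens w)%:E)%E.
have [A A0 EA] : exists2 A : R, 0 <= A & (E 0%N <= A%:E)%E.
  exists (c * 4); first by rewrite mulr_ge0.
  apply: (@le_trans _ _ (\int[area]_(w in S 0%N) c%:E)%E).
    apply: ge0_le_integral => //; first exact: d0.
    move=> w [Dw /= dw]; have {}dw : 2^-1 < defect w by move: dw; rewrite /h expr1.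
    rewrite lee_fin densE /c -[leRHS]mulr1 -[leRHS]mulrA.
    rewrite ler_pM2l// -[X in _ <= _ * X](_ : 1 `^ alpha = 1); last by rewrite powR1.
    by have /andP[dw0 dw1] := disk_defect Dw; apply: powR_comparable => //; lra.
  rewrite integral_cst// (EFinM c 4); apply: lee_wpmul2l; first by rewrite lee_fin.
  have -> : 4%:E = area ([set` `](-1), 1[] `*` [set` `](-1), 1[] : set T).
    by rewrite area_open_rect; [congr EFin; ring|lra|lra].
  apply: le_measure; rewrite ?inE//; first by apply: measurableX; exact: measurable_itv.
  move=> w [Dw _]; have := Dw; rewrite /= disk_cnorm => w1.
  have := le_lt_trans (ler_Re_cnorm _) w1; have := le_lt_trans (ler_Im_cnorm _) w1.
  by rewrite !ltr_norml /= => a1 a2; split; rewrite /= in_itv.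
have EB n : (E n <= (A + c * K * ((1 - q ^+ n.+1) / (1 - q)))%:E)%E.
  elim: n => [|n IH].
    apply: (le_trans EA); rewrite lee_fin lerDl mulr_ge0 ?(mulr_ge0 cp K0)//.
    by rewrite divr_ge0//; lra.
  have SE : S n.+1 = S n `|` ring n.+1.
    apply/seteqP; split => w.
      move=> [Dw /= w2]; have [w3|w3] := ltP (h n.+1) (defect w); first by left.
      by right.
    move=> [[Dw /= w2]|[[Dw /= _] //]]; split => //=; apply: lt_trans w2.
    by rewrite hS; have := h0 n.+1; lra.
  rewrite /E SE ge0_integral_setU//.
  - apply: (@le_trans _ _ ((A + c * K * ((1 - q ^+ n.+1) / (1 - q)))%:E + (c * K * q ^+ n.+1)%:E)%E); first by apply: leeD; [exact: IH|exact: int_ring].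
    rewrite -EFinD lee_fin.
    have -> : q ^+ n.+2 = q * q ^+ n.+1 by rewrite -exprS.
    rewrite -addrA lerD2l -mulrDr ler_wpM2l ?(mulr_ge0 cp K0)//.
    have q2 : 0 < 1 - q by lra.
    rewrite ler_pdivlMr// mulrDl divfK ?gt_eqF//.
    by move: (q ^+ n.+1) => x; lra.
  - exact: d0.
  - by apply/disj_setPLR => w [_ /= w2] [[_ /= w3] _]; move: w2; rewrite ltNge w3.
have bS : \bigcup_n S n = D.
  apply/seteqP; split => [w [n _ []]//|w Dw].
  have /andP[dw _] := disk_defect Dw.
  have [n hn] := @exprn_small R 2^-1 (defect w / 2) ltac:(apply/andP; split; lra) ltac:(lra).
  by exists n => //; split => //=; rewrite /h; have := hn n.+1 (leqnSn n); lra.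
have ndS : {homo S : n k / (n <= k)%N >-> (n <= k)%O}.
  apply/nondecreasing_seqP => n; apply/subsetPset => w [Dw /= w2]; split => //=.
  by apply: lt_trans w2; rewrite hS; have := h0 n.+1; lra.
have := @ge0_nondecreasing_set_cvg_integral _ _ _ S (fun w => (dens w)%:E) area ndS mS
  (fun n => @mdens (S n)) (fun n => @d0 (S n)).
rewrite bS => cv.
have : (bint (fun=> 1%R) <= (A + c * K / (1 - q))%:E)%E.
  have -> : bint (fun=> 1%R) = (\int[area]_(w in D) (dens w)%:E)%E.
    rewrite bergman_integral.unlock; apply: eq_integral => w _.
    by rewrite normc1 powR1 mul1r.
  rewrite -(cvg_lim _ cv)//; apply: lime_le; first by apply/cvg_ex; eexists; exact: cv.
  apply: nearW => n; apply: (le_trans (EB n)); rewrite lee_fin lerD2l.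
  rewrite [leLHS]mulrA ler_pM2r ?invr_gt0 ?subr_gt0// ler_piMr ?(mulr_ge0 cp K0)//.
  by rewrite gerBl exprn_ge0.
by move=> /le_lt_trans; apply; exact: ltry.
Qed.

End total_mass.

(** * Boundedness of point evaluations *)

Section point_evaluation.
Context {R : realType} {alpha p : R} (alpha_gtN1 : -1 < alpha) (p_ge1 : 1 <= p).
Local Notation T := (measurableTypeR R * measurableTypeR R)%type.
Local Notation D := (@cplx R @^-1` disk).
Local Notation mass := (bergman_mass alpha p).
Local Notation bint := (bergman_integral alpha p).
Local Notation dens := (bergman_density alpha).
Local Notation V := (bergman alpha_gtN1 p_ge1).
Implicit Types (f : R[i] -> R[i]) (w v : T) (z : R[i]).

Lemma density_lower_bound (r : R) : 0 <= r < 1 ->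
  exists2 d : R, 0 < d & forall w, cnorm (cplx w) <= r -> d <= dens w.
Proof.
move=> /andP[r0 r1]; have a1 := alpha_gtN1.
have u0 : 0 < 1 - r ^+ 2 by rewrite subr_gt0 expr_lt1.
have c0 : 0 < (1 + alpha) / pi by rewrite divr_gt0 ?pi_gt0//; lra.
have k0 : 0 < (1 - r ^+ 2)^-1 `^ `|alpha| by rewrite powR_gt0// invr_gt0.
exists ((1 + alpha) / pi / (1 - r ^+ 2)^-1 `^ `|alpha|); first by rewrite divr_gt0.
move=> w wr; have w0 := cnorm_ge0 (cplx w).
have Dw : D w by rewrite /= disk_cnorm; lra.
have /andP[d0 d1] := disk_defect Dw.
have d2 : 1 - r ^+ 2 <= defect w by rewrite defectE lerD2l lerN2 lerXn2r// nnegrE.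
have k1 : 1 <= (1 - r ^+ 2)^-1 by rewrite invf_ge1// gerBl sqr_ge0.
rewrite densE; apply: ler_wpM2l; first exact: ltW.
rewrite -[leLHS]mul1r ler_pdivrMr// mulrC -[leLHS](_ : 1 `^ alpha = 1); last by rewrite powR1.
apply: powR_comparable => //.
  by rewrite mulrC ler_pdivlMr// mul1r.
by rewrite mulr1 (le_trans d1).
Qed.

Lemma mass_square_le f z (eta m r : R) : holo_unit f -> 0 < eta -> 0 <= m ->
  r < 1 -> cnorm z + 2 * eta <= r ->
  (forall y, cnorm (y - z) <= 2 * eta -> m <= cnorm (f y)) ->
  forall d : R, 0 <= d -> (forall w, cnorm (cplx w) <= r -> d <= dens w) ->
  ((m `^ p * d * (4 * eta ^+ 2))%:E <= bint f)%E.
Proof.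
move=> hf eta0 m0 r1 zr hm d d0 hd.
pose S : set T := [set` `](complex.Re z - eta), (complex.Re z + eta)[] `*`
  [set` `](complex.Im z - eta), (complex.Im z + eta)[].
have SE w : S w -> cnorm (cplx w - z) <= 2 * eta.
  move=> [] /=; rewrite !in_itv /= => /andP[a1 a2] /andP[a3 a4].
  apply: (le_trans (cnorm_le_ReIm _)); case: z a1 a2 a3 a4 {zr hm S} => x y /= *.
  have h1 : `|w.1 - x| <= eta by rewrite ler_norml; apply/andP; split; lra.
  have h2 : `|w.2 - y| <= eta by rewrite ler_norml; apply/andP; split; lra.
  by lra.
have Sr w : S w -> cnorm (cplx w) <= r.
  move=> /SE h; rewrite -(subrK z (cplx w)) (le_trans (cnormD _ _))//; lra.
have mS : measurable S by apply: measurableX; exact: measurable_itv.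
rewrite bintE//; apply: (@le_trans _ _ (\int[area]_(w in S) (m `^ p * d)%:E)%E).
  rewrite integral_cst// area_open_rect; [|lra|lra].
  rewrite -EFinM lee_fin le_eqVlt; apply/orP; left; apply/eqP; ring.
have mm := @measurable_EFin_mass _ alpha p f hf.
apply: (@le_trans _ _ (\int[area]_(w in S) (mass f w)%:E)%E).
  apply: ge0_le_integral => //.
  - by move=> w _; rewrite lee_fin mulr_ge0 ?powR_ge0.
  - exact: measurable_funTS.
  move=> w Sw; have wr := Sr _ Sw; rewrite lee_fin massE//; last first.
    by rewrite /= disk_cnorm; lra.
  rewrite ler_pM ?powR_ge0 ?hd// ge0_ler_powR ?nnegrE ?cnorm_ge0//.
    by have := p_ge1; lra.
  by apply: hm; exact: SE.
apply: ge0_subset_integral => //.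
by move=> w _; rewrite lee_fin mass_ge0.
Qed.

(** Schwarz's lemma for the rescaled difference [(f - f z) / (3 * M)]; the factor 3, where 2 bounds
    the difference, gives the strict bound by 1. *)
Lemma holo_lipschitz f z (delta M : R) : holo_unit f -> 0 < delta -> 0 < M ->
  cnorm z + delta <= 1 ->
  (forall y, cnorm (y - z) < delta -> cnorm (f y) <= M) ->
  forall y, cnorm (y - z) < delta ->
    cnorm (f y - f z) <= 3 * M * (cnorm (y - z) / delta).
Proof.
move=> hf d0 M0 zd hM y yd.
have M3 : 0 < 3 * M by lra.
pose g : R[i] -> R[i] := fun u => (3 * M)^-1%:C * (f (z + delta%:C * u) - f z).
have gd u : cnorm u < 1 -> cnorm (z + delta%:C * u - z) < delta.
  move=> u1; rewrite addrC addKr cnormM cnorm_real gtr0_norm//.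
  by rewrite -[ltRHS]mulr1 ltr_pM2l.
have gl u : cnorm u < 1 -> cnorm (z + delta%:C * u) < 1.
  by move=> /gd h; rewrite -(subrK z (z + _)) (le_lt_trans (cnormD _ _))//; lra.
have hg : holo_unit g.
  move=> u u1; apply: holoM (holo_cst _ _) _; apply: holoB (holo_cst _ _).
  apply: (holo_comp (f := f)); last exact/hf/gl.
  apply: holoD (holo_cst _ _) _; exact: holoM (holo_cst _ _) (holo_id _).
have g1 u : cnorm u < 1 -> cnorm (g u) < 1.
  move=> u1; rewrite cnormM cnorm_real gtr0_norm ?invr_gt0// mulrC ltr_pdivrMr// mul1r.
  have := cnormB (f (z + delta%:C * u)) (f z).
  have := hM _ (gd _ u1); have := hM z; rewrite subrr cnorm0 => /(_ d0); lra.
have g0 : g 0 = 0 by rewrite /g mulr0 addr0 subrr mulr0.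
have yE : z + delta%:C * ((y - z) / delta%:C) = y.
  have d1 : delta%:C != 0 by rewrite -cnorm_gt0 cnorm_real gtr0_norm.
  by rewrite [delta%:C * _]mulrC divfK// addrC subrK.
have uE : cnorm ((y - z) / delta%:C) = cnorm (y - z) / delta.
  by rewrite cnormM cnormV cnorm_real gtr0_norm.
have u1 : cnorm ((y - z) / delta%:C) < 1 by rewrite uE ltr_pdivrMr// mul1r.
have := schwarz hg g0 g1 u1; rewrite /g yE uE cnormM cnorm_real gtr0_norm ?invr_gt0//.
by rewrite mulrC ler_pdivrMr// mulrC.
Qed.

(* If [f] is large at a point but not four times larger nearby, it is large on a
   whole square, which costs mass; so a value too large for the norm propagates
   to ever larger values inside a fixed disk, against boundedness. *)
Lemma bergman_eval s : 0 < s < 1 -> exists2 C : R, 0 <= C &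
  forall (f : V) z, cnorm z <= s -> cnorm (f z) <= C * bergman_norm f.
Proof.
move=> /andP[s0 s1]; have p0 : 0 < p by apply: lt_le_trans p_ge1.
have [sg [sg0 sg1]] : exists sg, 0 < sg /\ s + sg < 1 by exists ((1 - s) / 2); split; lra.
have [d d0 hd] := @density_lower_bound (s + sg) ltac:(apply/andP; split; lra).
pose c1 := d * (4 * (sg / 96) ^+ 2).
have c10 : 0 < c1 by rewrite !mulr_gt0// exprn_gt0// divr_gt0.
exists (2 * c1^-1 `^ p^-1); first by rewrite mulr_ge0 ?powR_ge0.
move=> f z0 z0s; rewrite leNgt; apply/negP => lt.
have hf := bergman_holo f; have N0 := bergman_norm_ge0 f.
set A := cnorm (f z0) in lt.
have A0 : 0 < A by apply: le_lt_trans lt; rewrite mulr_ge0// mulr_ge0// powR_ge0.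
have big : bergman_norm f `^ p < (A / 2) `^ p * c1.
  have c1V : 0 <= c1^-1 by rewrite invr_ge0 ltW.
  have cE : c1^-1 = (c1^-1 `^ p^-1) `^ p.
    by rewrite -powRrM mulVf ?gt_eqF// powRr1.
  rewrite mulrC -ltr_pdivrMl// cE -powRM ?powR_ge0//.
  rewrite gt0_ltr_powR// ?nnegrE ?mulr_ge0 ?powR_ge0 ?divr_ge0 ?(ltW A0)//.
  by move: lt; rewrite -mulrA; move: (_ `^ _ * _) => x; lra.
(* Radii increasing from [s] towards [s + sg]. The squares used at stage [k] have area of order
   [4^-k]; growth of the values by [4 ^+ k] compensates this, since the [p]-th power of [4 ^+ k] is
   at least [4 ^+ k]. *)
pose sk k := s + sg * (1 - 2^-1 ^+ k).
have hk k : 0 < (2^-1 : R) ^+ k <= 1 by rewrite exprn_gt0//= exprn_ile1//; lra.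
have skE k : sk k + sg * 2^-1 ^+ k.+1 = sk k.+1.
  by rewrite /sk exprS; lra.
have sk1 k : sk k <= s + sg.
  by rewrite lerD2l ler_piMr ?(ltW sg0)//; have /andP[] := hk k; lra.
have step k z : cnorm z <= sk k -> 4 ^+ k * A <= cnorm (f z) ->
    exists2 z', cnorm z' <= sk k.+1 & 4 * cnorm (f z) <= cnorm (f z').
  move=> zk fz; apply: contrapT => no.
  have small y : cnorm y <= sk k.+1 -> cnorm (f y) <= 4 * cnorm (f z).
    by move=> ys; rewrite leNgt; apply/negP => h; apply: no; exists y => //; exact: ltW.
  set m := cnorm (f z) in fz small.
  have m0 : 0 < m by apply: lt_le_trans fz; rewrite mulr_gt0// exprn_gt0.
  pose dl := sg * 2^-1 ^+ k.+1.
  have dl0 : 0 < dl by rewrite mulr_gt0//; have /andP[] := hk k.+1.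
  have zdl : cnorm z + dl <= sk k.+1 by rewrite -skE lerD2r.
  have lip := @holo_lipschitz f z dl (4 * m) hf dl0 ltac:(lra).
  (* Within [dl / 24] the Lipschitz constant [3 * (4 * m) / dl] allows a change of at most
     [m / 2]. *)
  have near y : cnorm (y - z) <= 2 * (dl / 48) -> m / 2 <= cnorm (f y).
    move=> yz; have yd : cnorm (y - z) < dl by lra.
    have := lip _ _ y yd; move=> h.
    have {}h : cnorm (f y - f z) <= 3 * (4 * m) * (cnorm (y - z) / dl).
      apply: h; first by have := sk1 k.+1; lra.
      move=> x xd; apply: small; rewrite -(subrK z x) (le_trans (cnormD _ _))//; lra.
    have h2 : cnorm (y - z) / dl <= 24^-1 by rewrite ler_pdivrMr//; lra.
    have h3 : cnorm (f y - f z) <= m / 2.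
      by apply: (le_trans h); have := ler_wpM2l (_ : 0 <= 3 * (4 * m)) h2 => /(_ ltac:(lra)); lra.
    have := cnormB_ge (f z) (f z - f y); rewrite subKr (cdistC (f z)) -/m; lra.
  have := @mass_square_le f z (dl / 48) (m / 2) (s + sg) hf ltac:(lra) ltac:(lra) sg1
    ltac:(have := sk1 k.+1; lra) near d (ltW d0) hd.
  rewrite bergman_norm_bint lee_fin leNgt => /negP; apply; apply: (lt_le_trans big).
  have -> : c1 = 4 ^+ k * (d * (4 * (dl / 48) ^+ 2)).
    rewrite /c1 /dl [2^-1 ^+ k.+1]exprS.
    have e : 4 ^+ k * (2^-1 ^+ k) ^+ 2 = 1 :> R.
      by rewrite -exprM mulnC exprM -exprMn (_ : 4 * _ = 1) ?expr1n//; lra.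
    transitivity ((4 ^+ k * (2^-1 ^+ k) ^+ 2) * (d * (4 * (sg / 96) ^+ 2))).
      by rewrite e mul1r.
    by move: (4 ^+ k) (2^-1 ^+ k) => a b; field.
  rewrite mulrA -[leRHS]mulrA ler_wpM2r//.
    by rewrite mulr_ge0 ?(ltW d0)// mulr_ge0// sqr_ge0.
  have q1 : 1 <= 4 ^+ k :> R by rewrite exprn_ege1//; lra.
  have A2 : 0 <= A / 2 by lra.
  apply: (@le_trans _ _ ((4 ^+ k) `^ p * (A / 2) `^ p)).
    by rewrite mulrC ler_wpM2r ?powR_ge0// le1r_powR.
  have q0 : 0 <= 4 ^+ k :> R by lra.
  rewrite -powRM// ge0_ler_powR ?nnegrE ?(ltW p0) ?mulr_ge0 ?divr_ge0 ?cnorm_ge0 ?(ltW A0)//.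
  by rewrite mulrA ler_pM2r//; lra.
have all k : exists2 z, cnorm z <= sk k & 4 ^+ k * A <= cnorm (f z).
  elim: k => [|k [z zk fz]].
    by exists z0; [rewrite /sk expr0 subrr mulr0 addr0|rewrite expr0 mul1r].
  have [z' z'k fz'] := step k z zk fz; exists z' => //.
  by apply: le_trans fz'; rewrite exprS -mulrA ler_pM2l.
have [M M0 hM] := @disk_bounded _ f (s + sg) ltac:(lra) (holo_unit_disk hf sg1).
have [k kh] := @exprn_small R 4^-1 (A / (2 * M)) ltac:(apply/andP; split; lra)
  ltac:(apply: divr_gt0; lra).
have [z zk fz] := all k; have := hM z (le_trans zk (sk1 k)).
have := kh k (leqnn k); rewrite exprVn ler_pdivlMr; last by lra.
have q0 : 0 < 4 ^+ k :> R by rewrite exprn_gt0.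
rewrite mulrC ler_pdivrMr//; lra.
Qed.

End point_evaluation.

(** * Composition with disk automorphisms *)

Section mobius_involution.
Context {R : realType}.
Implicit Types (a z w : R[i]).

Lemma mobius_lt1 a z : cnorm a < 1 -> cnorm z < 1 -> cnorm (mobius a z) < 1.
Proof.
move=> a1 z1; have h := mobius_norm a1 (ltW z1).
have n0 := cnorm_ge0 a; have n1 := cnorm_ge0 z; have n2 := cnorm_ge0 (mobius a z).
have : 0 < 1 - cnorm (mobius a z) ^+ 2.
  rewrite h divr_gt0//; first by rewrite mulr_gt0 ?subr_gt0 ?expr_lt1.
  by rewrite exprn_gt0// cnorm_gt0 mobius_den_neq0// ltW.
by rewrite subr_gt0 expr_lt1.
Qed.

Lemma mobius_diff a z w : cnorm a < 1 -> cnorm z < 1 -> cnorm w < 1 ->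
  mobius a z - mobius a w = (conjc a * a - 1) * (z - w) / (1 - conjc a * z) / (1 - conjc a * w).
Proof.
move=> a1 z1 w1; have dz := mobius_den_neq0 a1 (ltW z1); have dw := mobius_den_neq0 a1 (ltW w1).
by rewrite /mobius; field; rewrite dz dw.
Qed.

Lemma mobiusK a z : cnorm a < 1 -> cnorm z < 1 -> mobius a (mobius a z) = z.
Proof.
move=> a1 z1; have dz := mobius_den_neq0 a1 (ltW z1).
have da := mobius_den_neq0 a1 (ltW a1).
have e1 : a - mobius a z = z * (1 - conjc a * a) / (1 - conjc a * z).
  by rewrite /mobius; field.
have e2 : 1 - conjc a * mobius a z = (1 - conjc a * a) / (1 - conjc a * z).
  by rewrite /mobius; field.
rewrite {1}/mobius e1 e2; move: da dz; move: (1 - conjc a * a) (1 - conjc a * z) => x y x0 y0.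
by field; rewrite x0 y0.
Qed.

Lemma mobius_lipschitz a z w : cnorm a < 1 -> cnorm z < 1 -> cnorm w < 1 ->
  cnorm (mobius a z - mobius a w) <= 2 / (1 - cnorm a) ^+ 2 * cnorm (z - w).
Proof.
move=> a1 z1 w1; rewrite mobius_diff// !cnormM !cnormV.
have hz := mobius_den_gt a (ltW z1); have hw := mobius_den_gt a (ltW w1).
have h2 : cnorm (conjc a * a - 1) <= 2.
  rewrite (le_trans (cnormB _ _))// cnormM cnorm_conjc cnorm1.
  have a0 := cnorm_ge0 a; have : cnorm a * cnorm a <= 1 by rewrite mulr_ile1// ltW.
  lra.
have a2 : 0 < 1 - cnorm a by lra.
rewrite -!mulrA; apply: ler_pM => //; rewrite ?mulr_ge0 ?invr_ge0 ?cnorm_ge0//.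
rewrite mulrC ler_wpM2r ?cnorm_ge0// expr2 invfM.
by apply: ler_pM; rewrite ?invr_ge0 ?cnorm_ge0// lef_pV2// posrE; lra.
Qed.

End mobius_involution.

Section disk_continuity.
Context {R : realType}.
Local Notation T := (measurableTypeR R * measurableTypeR R)%type.
Local Notation D := (@cplx R @^-1` disk).
Implicit Types (f : R[i] -> R[i]) (g : R[i] -> R) (z w : R[i]).

Let ccont_near f z e : ccont f z -> 0 < e ->
  nbhs z [set y | cnorm (f y - f z) <= e].
Proof.
move=> /(_ e) fz /fz[d d0 h]; have d0' : 0 < d%:C :> R[i] by rewrite ltcR.
apply/nbhs_ballP; exists d%:C => //= y.
rewrite -ball_normE /= normrC ltcR -cnormE => yz.
by apply: h; rewrite cdistC.
Qed.

Lemma ccont_cvg f z : ccont f z -> cnorm (f y) @[y --> z] --> cnorm (f z).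
Proof.
move=> fz; have F := @nbhs_filter R[i] z.
apply/(@cvgrPdist_le _ _ _ (nbhs z) F) => e e0.
apply: filterS (ccont_near fz e0) => y /= hy.
by rewrite distrC (le_trans _ hy)// !cnormE ler_dist_normc.
Qed.

Lemma ccont_ReIm_cvg f z : ccont f z ->
  complex.Re (f y) @[y --> z] --> complex.Re (f z) /\
  complex.Im (f y) @[y --> z] --> complex.Im (f z).
Proof.
move=> fz; have F := @nbhs_filter R[i] z.
split; apply/(@cvgrPdist_le _ _ _ (nbhs z) F) => e e0;
  apply: filterS (ccont_near fz e0) => y /= hy; rewrite distrC (le_trans _ hy)//.
  have -> : complex.Re (f y) - complex.Re (f z) = complex.Re (f y - f z).
    by case: (f y) => ? ?; case: (f z).
  exact: ler_Re_cnorm.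
have -> : complex.Im (f y) - complex.Im (f z) = complex.Im (f y - f z).
  by case: (f y) => ? ?; case: (f z).
exact: ler_Im_cnorm.
Qed.

Lemma plane_open_disk (P : set R[i]) : (forall z, cnorm z < 1 -> P z -> nbhs z P) ->
  plane_open (D `&` @cplx R @^-1` P : set T).
Proof.
move=> hP w [Dw Pw].
have /nbhs_cplx[e e0 eA] : nbhs (cplx w) (disk `&` P).
  by apply: filterI; [exact: nbhs_disk|apply: hP; rewrite -?disk_cnorm].
by exists e => // v h1 h2; have [] := eA v h1 h2.
Qed.

Lemma measurable_disk_cont g : (forall z, cnorm z < 1 -> g y @[y --> z] --> g z) ->
  measurable_fun (D : set T) (g \o @cplx R).
Proof.
move=> hg; apply: (measurability _ (RGenOpens.measurableE R)).
move=> _ [_ [a [b ->] <-]]; apply: measurable_plane_open.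
apply: (plane_open_disk (P := g @^-1` `]a, b[)) => z z1 /=.
rewrite in_itv /= => /andP[ga gb].
have F := @nbhs_filter R[i] z.
have h1 := @cvgr_gt _ _ _ F _ _ (hg z z1) _ ga.
have h2 := @cvgr_lt _ _ _ F _ _ (hg z z1) _ gb.
by apply: filterS2 h1 h2 => y; rewrite /= in_itv /= => -> ->.
Qed.

End disk_continuity.

Section area_superlevel.
Context {R : realType}.
Local Notation T := (measurableTypeR R * measurableTypeR R)%type.

Lemma sigma_finite_area : sigma_finite setT (@area R).
Proof.
exists (fun n => [set` `](- n.+1%:R), n.+1%:R[] `*` [set` `](- n.+1%:R), n.+1%:R[]).
  apply/seteqP; split => // -[x y] _.
  have [n xn] : exists n, `|x| + `|y| < n.+1%:R.
    exists (Num.truncn (`|x| + `|y|)).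
    by rewrite truncnS_gt.
  have x0 := normr_ge0 x; have y0 := normr_ge0 y.
  exists n => //; split; rewrite /= in_itv /= -ltr_norml; lra.
move=> n; split; first by apply: measurableX; exact: measurable_itv.
have n0 : - n.+1%:R < n.+1%:R :> R by rewrite -subr_gt0 opprK addr_gt0.
by rewrite area_open_rect// ltry.
Qed.

Lemma le_area_superlevel (F G : T -> R) K : 0 <= K ->
  measurable_fun [set: T] F -> measurable_fun [set: T] G ->
  (forall w, 0 <= F w) -> (forall w, 0 <= G w) ->
  (forall t, 0 <= t ->
    (area [set w | (t < F w)%R] <= K%:E * area [set w | (t < G w)%R])%E) ->
  (\int[area]_w (F w)%:E <= K%:E * \int[area]_w (G w)%:E)%E.
Proof.
pose mx := Measure_isSigmaFinite.Build _ _ _ (@area R) sigma_finite_area.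
pose m : {sigma_finite_measure set T -> \bar R} := HB.pack (Measure.sort (@area R)) mx.
exact: (@le_integral_superlevel _ _ _ m).
Qed.

End area_superlevel.

Section bergman_composition.
Context {R : realType} {alpha p : R} (alpha_gtN1 : -1 < alpha) (p_ge1 : 1 <= p).
Local Notation T := (measurableTypeR R * measurableTypeR R)%type.
Local Notation D := (@cplx R @^-1` disk).
Local Notation mass := (bergman_mass alpha p).
Local Notation bint := (bergman_integral alpha p).
Local Notation dens := (bergman_density alpha).
Implicit Types (f om : R[i] -> R[i]) (w v : T) (z : R[i]).

(** Openness is what [area_expansive] asks of its sets. Where the mass exceeds a level [t >= 0] the
    function does not vanish, so the real powers are continuous there. *)
Lemma plane_open_mass f (k t : R) : 0 < k -> 0 <= t -> holo_unit f ->
  plane_open [set w : T | t < k * mass f w].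
Proof.
move=> k0 t0 hf; have p0 : 0 < p by apply: lt_le_trans p_ge1.
pose g z : R := k * (cnorm (f z) `^ p * ((1 + alpha) / pi * (1 - cnorm z ^+ 2) `^ alpha)).
have gE w : D w -> k * mass f w = g (cplx w).
  by move=> Dw; rewrite massE// densE defectE.
have -> : [set w : T | t < k * mass f w] = D `&` @cplx R @^-1` [set z | t < g z].
  apply/seteqP; split => w /=; last by move=> [Dw]; rewrite gE.
  have [Dw|Dw] := pselect (D w); first by rewrite gE.
  by rewrite mass_out// mulr0 ltNge t0.
apply: plane_open_disk => z z1 /= tg; have F := @nbhs_filter R[i] z.
have fz0 : 0 < cnorm (f z).
  rewrite lt_neqAle cnorm_ge0 andbT eq_sym; apply/eqP => fz.
  by move: tg; rewrite /g fz powR0 ?gt_eqF// mul0r mulr0 ltNge t0.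
have u0 : 0 < 1 - cnorm z ^+ 2 by rewrite subr_gt0 expr_lt1// cnorm_ge0.
suff cg : g y @[y --> z] --> g z by exact: (@cvgr_gt _ _ _ F _ _ cg).
have cz : cnorm y @[y --> z] --> cnorm z by apply: (@ccont_cvg _ id); exact/holo_cont/holo_id.
have cf := ccont_cvg (holo_cont (hf z z1)).
have cu : 1 - cnorm y ^+ 2 @[y --> z] --> 1 - cnorm z ^+ 2.
  by apply: cvgB; [exact: cvg_cst|rewrite expr2; under eq_fun do rewrite expr2; exact: cvgM].
apply: cvgM; first exact: cvg_cst.
apply: cvgM; first exact: (cvg_comp _ _ cf (@powR_cont R p _ fz0)).
apply: cvgM; first exact: cvg_cst.
exact: (cvg_comp _ _ cu (@powR_cont R alpha _ u0)).
Qed.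

(** A superlevel set for the composition lies in the preimage under [om] of a superlevel set for
    [f], the change of density costing the power [|alpha|] of [k]. The map [om] is expansive because
    [om'] is Lipschitz; passing between modulus and coordinates doubles [L]. *)
Lemma bint_comp f om om' (L k : R) : holo_unit f -> holo_unit om ->
  (forall z, cnorm z < 1 -> cnorm (om z) < 1) ->
  (forall z, cnorm z < 1 -> om' (om z) = z) -> 0 < L ->
  (forall z (y : R[i]), cnorm z < 1 -> cnorm y < 1 -> cnorm (om' z - om' y) <= L * cnorm (z - y)) ->
  1 <= k ->
  (forall z, cnorm z < 1 -> 1 - cnorm (om z) ^+ 2 <= k * (1 - cnorm z ^+ 2)) ->
  (forall z, cnorm z < 1 -> 1 - cnorm z ^+ 2 <= k * (1 - cnorm (om z) ^+ 2)) ->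
  (bint (fun z => f (om z)) <=
   (16 / (2 * L)^-1 ^+ 2 * k `^ `|alpha|)%:E * bint f)%E.
Proof.
move=> hf ho o1 oK L0 lip k1 ok1 ok2.
have hfo : holo_unit (fun z => f (om z)).
  by move=> z z1; apply: holo_comp (ho z z1) _; exact/hf/o1.
have [Q mQ QE] : exists2 Q : T -> T, measurable_fun setT Q &
    forall w, D w -> cplx (Q w) = om (cplx w).
  pose q1 := (fun w => complex.Re (om (cplx w))) \_ D.
  pose q2 := (fun w => complex.Im (om (cplx w))) \_ D.
  exists (fun w => (q1 w, q2 w)); last first.
    by move=> w Dw; rewrite /q1 /q2 !patchE mem_set// /cplx /=; case: (om _).
  apply: measurable_fun_pair; apply: (iffLR (measurable_restrictT _ (@measurable_disk R))).
    apply: (@measurable_disk_cont _ (fun z => complex.Re (om z))) => z z1.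
    by have [] := ccont_ReIm_cvg (holo_cont (ho z z1)).
  apply: (@measurable_disk_cont _ (fun z => complex.Im (om z))) => z z1.
  by have [] := ccont_ReIm_cvg (holo_cont (ho z z1)).
pose K := k `^ `|alpha|; have K0 : 0 < K by rewrite powR_gt0; lra.
have fin : 0 <= 16 / (2 * L)^-1 ^+ 2 by rewrite divr_ge0// sqr_ge0.
have mle w : D w -> mass (fun z => f (om z)) w <= K * mass f (Q w).
  move=> Dw; have w1 : cnorm (cplx w) < 1 by rewrite -disk_cnorm.
  have DQ : D (Q w) by rewrite /= QE// disk_cnorm o1.
  rewrite !massE// QE// [leRHS]mulrCA ler_wpM2l ?powR_ge0// !densE [leRHS]mulrCA.
  apply: ler_wpM2l; first by rewrite divr_ge0 ?pi_ge0//; have := alpha_gtN1; lra.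
  have /andP[dw _] := disk_defect Dw; have /andP[dQ _] := disk_defect DQ.
  apply: powR_comparable => //; rewrite !defectE QE//; [exact: ok2|exact: ok1].
rewrite !bintE// EFinM -muleA -ge0_integralZl_EFin ?(ltW K0)//; last 2 first.
- by move=> w _; rewrite lee_fin mass_ge0.
- exact: measurable_EFin_mass.
apply: (@le_area_superlevel _ (mass (fun z => f (om z))) (fun w => K * mass f w)) => //.
- exact: measurable_mass.
- by apply: measurable_funM => //; exact: measurable_mass.
- by move=> w; exact: mass_ge0.
- by move=> w; rewrite mulr_ge0 ?mass_ge0// ltW.
move=> t t0; have oU := plane_open_mass K0 t0 hf.
have mD := @measurable_disk R.
have := @area_expansive _ D Q (2 * L)^-1 ltac:(rewrite invr_gt0; lra) mD (measurable_funTS mQ).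
have ex v w : D v -> D w -> forall e, `|(Q v).1 - (Q w).1| <= e -> `|(Q v).2 - (Q w).2| <= e ->
    (2 * L)^-1 * `|v.1 - w.1| <= e /\ (2 * L)^-1 * `|v.2 - w.2| <= e.
  move=> Dv Dw e h1 h2; have := Dv; have := Dw; rewrite /= !disk_cnorm => w1 v1.
  have h3 : cnorm (om (cplx v) - om (cplx w)) <= 2 * e.
    by rewrite -!QE// (le_trans (cnorm_le_ReIm _))//=; lra.
  have h4 : cnorm (cplx v - cplx w) <= 2 * L * e.
    have := lip _ _ (o1 _ v1) (o1 _ w1); rewrite !oK// => h.
    by apply: (le_trans h); rewrite [2 * L]mulrC -mulrA ler_pM2l.
  have L2 : 0 < 2 * L by lra.
  rewrite !ler_pdivrMl//; split; apply: le_trans h4.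
    exact: (ler_Re_cnorm (cplx v - cplx w)).
  exact: (ler_Im_cnorm (cplx v - cplx w)).
move=> /(_ ex _ oU); apply: le_trans; apply: le_measure; rewrite ?inE.
- by apply: measurable_superlevel; exact: measurable_mass.
- by apply: (measurable_funTS mQ) => //; exact: measurable_plane_open.
move=> w /= tw; have [Dw|Dw] := pselect (D w).
  by split => //; apply: lt_le_trans tw (mle w Dw).
by move: tw; rewrite mass_out// ltNge t0.
Qed.

End bergman_composition.

(** * The Bergman space, read in the chart, as a rotation space *)

Section bergman_rotation_space.
Context {R : realType} {alpha p : R} (alpha_gtN1 : -1 < alpha) (p_ge1 : 1 <= p).
Local Notation bint := (bergman_integral alpha p).
Local Notation V := (bergman alpha_gtN1 p_ge1).
Implicit Types (f om : R[i] -> R[i]) (z : R[i]).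

Lemma bergman_norm_le (f g : V) (K : R) : 0 <= K ->
  (bint g <= K%:E * bint f)%E -> bergman_norm g <= K `^ p^-1 * bergman_norm f.
Proof.
move=> K0; rewrite !bergman_norm_bint -EFinM lee_fin.
move: (bergman_norm_ge0 f) (bergman_norm_ge0 g).
move: (bergman_norm f) (bergman_norm g) => x y x0 y0 le.
have p0 : 0 < p by apply: lt_le_trans p_ge1.
have root (t : R) : 0 <= t -> (t `^ p) `^ p^-1 = t.
  by move=> t0; rewrite -powRrM mulfV ?gt_eqF// powRr1.
rewrite -(root y y0) -(root x x0) -powRM ?powR_ge0//.
by rewrite ge0_ler_powR ?nnegrE ?mulr_ge0 ?powR_ge0// invr_ge0 ltW.
Qed.

Context (a : R[i]) (a1 : cnorm a < 1).
Local Notation tau := (mobius a).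

Let tau1 z : cnorm z < 1 -> cnorm (tau z) < 1. Proof. exact: mobius_lt1. Qed.
Let tauK z : cnorm z < 1 -> tau (tau z) = z. Proof. exact: mobiusK. Qed.

Let holo_tau h : holo_unit h -> holo_unit (fun z => h (tau z)).
Proof.
by move=> hh z z1; apply: holo_comp; [apply: holo_mobius => //; exact: ltW|exact/hh/tau1].
Qed.

Let kap := ((1 - cnorm a) ^+ 2)^-1.

Let kap_ge1 : 1 <= kap.
Proof.
have := a1; have a0 := cnorm_ge0 a => a1'.
by rewrite invf_ge1 ?exprn_gt0 ?subr_gt0// exprn_ile1//; lra.
Qed.

Let tau_defect z : cnorm z < 1 -> 1 - cnorm (tau z) ^+ 2 <= kap * (1 - cnorm z ^+ 2).
Proof.
move=> z1; rewrite mobius_norm//; last exact: ltW.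
have a0 := cnorm_ge0 a; have z0 := cnorm_ge0 z.
have den := mobius_den_gt a (ltW z1).
have u0 : 0 <= 1 - cnorm z ^+ 2 by rewrite subr_ge0 expr_le1// ltW.
have d0 : 0 < 1 - cnorm a by rewrite subr_gt0.
have d1 : 0 < cnorm (1 - conjc a * z) by lra.
rewrite mulrAC ler_wpM2r// -[leRHS]mul1r ler_pM ?invr_ge0 ?exprn_ge0 ?cnorm_ge0//.
- by rewrite subr_ge0 expr_le1// ltW.
- by rewrite gerBl exprn_ge0.
- by rewrite lef_pV2 ?posrE ?exprn_gt0// lerXn2r// nnegrE ?cnorm_ge0 ?ltW.
Qed.

(** The rotation about [a]. The estimates for it depend on [a] alone, which gives [rs_rot] a
    constant uniform in [mu]. *)
Let rotated mu z := tau (mu * tau z).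

Let rotated_lt1 mu z : cnorm mu = 1 -> cnorm z < 1 -> cnorm (rotated mu z) < 1.
Proof. by move=> m1 z1; apply: tau1; rewrite cnormM m1 mul1r tau1. Qed.

Let rotatedK mu z : cnorm mu = 1 -> cnorm z < 1 -> rotated mu^-1 (rotated mu z) = z.
Proof.
move=> m1 z1; rewrite /rotated tauK; last by rewrite cnormM m1 mul1r tau1.
by rewrite mulKf ?tauK// -cnorm_gt0 m1.
Qed.

Let rotated_defect mu z : cnorm mu = 1 -> cnorm z < 1 ->
  1 - cnorm (rotated mu z) ^+ 2 <= kap ^+ 2 * (1 - cnorm z ^+ 2).
Proof.
move=> m1 z1; have z2 : cnorm (mu * tau z) < 1 by rewrite cnormM m1 mul1r tau1.
have k0 : 0 <= kap by have := kap_ge1; lra.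
apply: (le_trans (tau_defect z2)); rewrite expr2 -mulrA ler_wpM2l//.
by rewrite cnormM m1 mul1r; exact: tau_defect.
Qed.

Let L := 2 / (1 - cnorm a) ^+ 2.

Let L_gt0 : 0 < L.
Proof. by rewrite divr_gt0// exprn_gt0// subr_gt0. Qed.

Let rotated_lipschitz mu z (y : R[i]) : cnorm mu = 1 -> cnorm z < 1 -> cnorm y < 1 ->
  cnorm (rotated mu z - rotated mu y) <= L * L * cnorm (z - y).
Proof.
move=> m1 z1 y1.
have r1 x : cnorm x < 1 -> cnorm (mu * tau x) < 1 by move=> x1; rewrite cnormM m1 mul1r tau1.
apply: (le_trans (mobius_lipschitz a1 (r1 _ z1) (r1 _ y1))).
rewrite -/L -[leRHS]mulrA; apply: ler_wpM2l; first exact: ltW L_gt0.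
rewrite -mulrBr cnormM m1 mul1r.
exact: mobius_lipschitz.
Qed.

Lemma bergman_rotation_space :
  rotation_space (@bergman_norm R alpha p alpha_gtN1 p_ge1) (fun (f : V) z => f (tau z)).
Proof.
have fm := @bint_cst1_finite R alpha p alpha_gtN1.
split.
- exact: bergman_is_norm.
- by [].
- by move=> f g fg; apply: bergman_eq => z z1; rewrite -(tauK z1); exact/fg/tau1.
- by move=> f; apply: holo_tau; exact: bergman_holo.
- have [c c0 dom] := bergman_dom alpha_gtN1 p_ge1 fm; exists c => // h f k B hh k0 B0 hle.
  have [|g gE gN] := dom (fun z => h (tau z)) f k B (holo_tau hh) k0 B0.
    by move=> z z1; have := hle _ (tau1 z1); rewrite tauK.
  by exists g => // z z1; rewrite gE ?tauK// tau1.
- move=> g h K hh gK gh.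
  have [|f fE fN] := bergman_fatou (holo_tau hh) gK.
    move=> z z1 e e0; have [N hN] := gh _ (tau1 z1) e e0; exists N => n /hN.
    by rewrite tauK.
  by exists f => // z z1; rewrite fE ?tauK// tau1.
- move=> s /andP[s0 s1]; have a0 := cnorm_ge0 a.
  (* A lower bound for [1 - cnorm (tau z) ^+ 2], with 4 bounding the squared denominator; it implies
     [cnorm (tau z) <= 1 - eta / 2]. *)
  pose eta := (1 - cnorm a ^+ 2) * (1 - s ^+ 2) / 4.
  have e0 : 0 < eta.
    by rewrite divr_gt0// mulr_gt0// subr_gt0 expr_lt1// ltW.
  have e1 : eta <= 1.
    rewrite ler_pdivrMr// mul1r (@le_trans _ _ 1)//; last lra.
    rewrite mulr_ile1 ?gerBl ?exprn_ge0 ?(ltW s0)// subr_ge0 expr_le1// ?ltW//.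
  have [C C0 hC] := @bergman_eval _ _ _ alpha_gtN1 p_ge1 (1 - eta / 2) ltac:(apply/andP; split; lra).
  exists C => // f z zs; apply: hC.
  have z1 : cnorm z < 1 by lra.
  have z0 := cnorm_ge0 z; have := mobius_norm a1 (ltW z1) => E.
  have den : cnorm (1 - conjc a * z) <= 2.
    rewrite (le_trans (cnormB _ _))// cnorm1 cnormM cnorm_conjc.
    have : cnorm a * cnorm z <= 1 by rewrite mulr_ile1// ltW.
    lra.
  have den0 : 0 < cnorm (1 - conjc a * z).
    by rewrite cnorm_gt0 mobius_den_neq0// ltW.
  have : eta <= 1 - cnorm (tau z) ^+ 2.
    rewrite E /eta; apply: ler_pM; rewrite ?mulr_ge0 ?invr_ge0 ?subr_ge0 ?expr_le1 ?(ltW s0) ?(ltW s1) ?(ltW a1)//.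
      rewrite ler_wpM2l ?subr_ge0 ?expr_le1 ?(ltW a1)// lerD2l lerN2.
      by rewrite lerXn2r// nnegrE// ltW.
    rewrite lef_pV2 ?posrE ?exprn_gt0//.
    have -> : 4 = 2 ^+ 2 :> R by rewrite expr2; ring.
    by rewrite lerXn2r// nnegrE ?(ltW den0).
  move=> h; rewrite -(@ler_pXn2r _ 2)// ?nnegrE ?cnorm_ge0//; last lra.
  have := sqr_ge0 (eta / 2); rewrite sqrrB; move: (_ ^+ 2) h => x; lra.
- pose c := 16 / (2 * (L * L))^-1 ^+ 2 * (kap ^+ 2) `^ `|alpha|.
  have c0 : 0 <= c by rewrite mulr_ge0 ?powR_ge0// divr_ge0// sqr_ge0.
  exists (c `^ p^-1); first exact: powR_ge0.
  move=> mu m1 f; have hf := bergman_holo f.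
  have mV1 : cnorm mu^-1 = 1 by rewrite cnormV m1 invr1.
  have hr : holo_unit (rotated mu).
    move=> z z1; apply: holo_comp; last first.
      by apply: holo_mobius => //; rewrite cnormM m1 mul1r ltW// tau1.
    by apply: holoM (holo_cst _ _) _; apply: holo_mobius => //; exact: ltW.
  have le := @bint_comp _ _ _ alpha_gtN1 p_ge1 f (rotated mu) (rotated mu^-1) (L * L) (kap ^+ 2)
    hf hr (fun z => @rotated_lt1 mu z m1) (fun z => @rotatedK mu z m1)
    (mulr_gt0 L_gt0 L_gt0) (fun z y => @rotated_lipschitz mu^-1 z y mV1)
    (exprn_ege1 2 kap_ge1) (fun z => @rotated_defect mu z m1).
  have {}le : (bint (fun z => f (rotated mu z)) <= c%:E * bint f)%E.
    apply: le => z z1; have := rotated_defect mV1 (rotated_lt1 m1 z1).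
    by rewrite rotatedK.
  have hfr : holo_unit (fun z => f (rotated mu z)).
    by move=> z z1; apply: holo_comp (hr z z1) _; exact/hf/rotated_lt1.
  have [|g gE _] := bergman_ext alpha_gtN1 p_ge1 hfr.
    by apply: (le_lt_trans le); rewrite bergman_norm_bint -EFinM ltry.
  exists g; first by move=> z z1; rewrite gE ?tau1// /rotated tauK.
  apply: bergman_norm_le => //; rewrite (_ : bint g = bint (fun z => f (rotated mu z)))//.
  exact: bint_eq.
- move=> f e e0; have ht : holo_unit tau by move=> z z1; apply: holo_mobius => //; exact: ltW.
  have [k0 hk] := @bergman_shrink _ _ _ alpha_gtN1 p_ge1 tau f e e0 ht (@tau1).
  exists k0 => k g kk gE; apply: (hk k) => // z z1.
  by have := gE _ (tau1 z1); rewrite tauK.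
Qed.

End bergman_rotation_space.

(** * Growth rates and the spectrum *)

Section growth_rate.
Context {R : realType} (W : nat -> R).
Hypotheses (W_ge0 : forall n, 0 <= W n) (W_sub : forall m n, W (m + n)%N <= W m * W n).
Implicit Types (r K c x : R) (n : nat).
Local Notation root n := (W n `^ n%:R^-1).
Local Notation rate := (limn (fun n => W n `^ n%:R^-1)).

Let rootX n : (0 < n)%N -> (root n) ^+ n = W n.
Proof.
move=> n0; rewrite -powR_mulrn ?powR_ge0// -powRrM mulVf ?powRr1//.
by rewrite pnatr_eq0 -lt0n.
Qed.

Let root_le n r : (0 < n)%N -> 0 <= r -> (root n <= r) = (W n <= r ^+ n).
Proof. by move=> n0 r0; rewrite -{2}(rootX n0) ler_pXn2r// nnegrE powR_ge0. Qed.

(** Submultiplicativity along the division [n = q * m + s]; the finitely many values at the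
    remainders [s] go into [K]. *)
Lemma growth_of_power m r : (0 < m)%N -> 0 < r -> W m <= r ^+ m ->
  exists K, forall n, W n <= K * r ^+ n.
Proof.
move=> m0 r0 Wm; exists (\sum_(s < m) W s / r ^+ s) => n.
have iterate q s : W (q * m + s)%N <= r ^+ (q * m) * W s.
  elim: q => [|q IH]; first by rewrite mul0n add0n expr0 mul1r.
  rewrite mulSn -addnA (le_trans (W_sub _ _))// exprD -mulrA.
  by apply: ler_pM.
rewrite [in leLHS](divn_eq n m) [in leRHS](divn_eq n m) (le_trans (iterate _ _))//.
rewrite exprD mulrCA ler_wpM2l ?exprn_ge0 ?(ltW r0)// -ler_pdivrMr ?exprn_gt0//.
rewrite (bigD1 (Ordinal (ltn_pmod n m0)))//= lerDl sumr_ge0// => i _.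
by rewrite divr_ge0// exprn_ge0// ltW.
Qed.

Let eventually_root K r r' : 0 <= r -> r < r' -> (forall n, W n <= K * r ^+ n) ->
  exists n0, forall n, (n0 <= n)%N -> (0 < n)%N -> root n <= r'.
Proof.
move=> r0 rr' hK; have r'0 : 0 < r' by lra.
have K0 : 0 <= K by apply: le_trans (W_ge0 0) _; have := hK 0%N; rewrite expr0 mulr1.
have q1 : 0 <= r / r' < 1 by rewrite divr_ge0 ?(ltW r'0)//= ltr_pdivrMr// mul1r.
have [n0 h] := @exprn_small R (r / r') (K + 1)^-1 q1 ltac:(rewrite invr_gt0; lra).
exists n0 => n nn n1; rewrite root_le// ?(ltW r'0)// (le_trans (hK n))//.
have := h n nn; rewrite expr_div_n ler_pdivrMr ?exprn_gt0// => h1.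
apply: (le_trans (ler_wpM2l K0 h1)); rewrite mulrA ler_piMl ?exprn_ge0 ?(ltW r'0)//.
by rewrite ler_pdivrMr; lra.
Qed.

Let roots := [set root n | n in [set n | (0 < n)%N]].

Let roots_inf : has_inf roots.
Proof.
split; first by exists (root 1), 1%N.
by exists 0 => _ [n _ <-]; exact: powR_ge0.
Qed.

Let inf_le n : (0 < n)%N -> inf roots <= root n.
Proof. by move=> n0; apply: ge_inf; [case: roots_inf|exists n]. Qed.

Let inf_lt x : inf roots < x -> exists2 n, (0 < n)%N & root n < x.
Proof. by move=> /(inf_lt roots_inf.1)[_ [n n0 <-] nx]; exists n. Qed.

Let inf_ge0 : 0 <= inf roots.
Proof. by apply: lb_le_inf; [case: roots_inf|move=> _ [n _ <-]; exact: powR_ge0]. Qed.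

Let growth_of_inf x : inf roots < x ->
  exists K r, [/\ 0 <= r, r < x & forall n, W n <= K * r ^+ n].
Proof.
move=> lx; have l0 := inf_ge0; pose r := (inf roots + x) / 2.
have r0 : 0 < r by rewrite /r; lra.
have [|m m0 mr] := @inf_lt r; first by rewrite /r; lra.
have [K hK] := growth_of_power m0 r0 (ltac:(by rewrite -root_le ?ltW)).
by exists K, r; split => //; rewrite /r; lra.
Qed.

(* Fekete's lemma. *)
Let rateE : rate = inf roots.
Proof.
apply: cvg_lim => //; apply/cvgrPdist_le => e e0.
have [|K [r [r0 re hK]]] := @growth_of_inf (inf roots + e); first by rewrite ltrDl.
have [n0 h] := eventually_root r0 re hK.
exists (maxn n0 1) => // n /=; rewrite geq_max => /andP[nn n1].
have := inf_le n1; have := h n nn n1 => h1 h2.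
by rewrite ler_norml; apply/andP; split; lra.
Qed.

Lemma growth_of_rate x : rate < x ->
  exists K r, [/\ 0 <= r, r < x & forall n, W n <= K * r ^+ n].
Proof. by rewrite rateE; exact: growth_of_inf. Qed.

Lemma rate_le K r : 0 <= r -> (forall n, W n <= K * r ^+ n) -> rate <= r.
Proof.
move=> r0 hK; rewrite rateE leNgt; apply/negP => lt.
have [n0 h] := @eventually_root K r ((r + inf roots) / 2) r0 ltac:(lra) hK.
have := h n0.+1 (leqnSn _) isT; have := @inf_le n0.+1 isT; lra.
Qed.

Lemma rate_ge c : 0 <= c -> (forall n, c ^+ n <= W n) -> c <= rate.
Proof.
move=> c0 hc; rewrite rateE; apply: lb_le_inf; first by case: roots_inf.
move=> _ [n n0 <-]; rewrite -(@ler_pXn2r _ n)// ?nnegrE ?powR_ge0//.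
by rewrite rootX.
Qed.

End growth_rate.

(** * Bounded, invertible and Fredholm operators in terms of a real-valued norm *)

Section operators.
Context {R : realType} {V : normedModType R[i]} (N : V -> R).
Hypothesis normE : forall v, `|v| = (N v)%:C.
Implicit Types (T S : V -> V) (f g x y : V).

Lemma bounded_operator_of_le T (B : R) : linear T -> 0 <= B ->
  (forall f, N (T f) <= B * N f) -> bounded_operator T.
Proof.
move=> lT B0 TB; split => // x.
have TD f g : T (f - g) = T f - T g.
  have := lT (-1) g f; rewrite !scaleN1r => h.
  by rewrite addrC h addrC.
apply/cvgrPdist_le => e e0; have eE : e = (complex.Re e)%:C by rewrite RRe_real// gtr0_real.
move: e0; rewrite eE ltcR; move: (complex.Re e) => r r0.
have B1 : 0 < B + 1 by lra.
have d0 : 0 < (r / (B + 1))%:C :> R[i] by rewrite ltcR divr_gt0.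
apply/nbhs_ballP; exists (r / (B + 1))%:C => //= y.
rewrite -ball_normE /= !normE ltcR lecR ltr_pdivlMr// => yx.
rewrite -TD (le_trans (TB _))//; apply: le_trans (ltW yx); rewrite mulrC.
by apply: ler_wpM2l; [rewrite -lecR -normE normr_ge0|lra].
Qed.

Lemma invertible_of_solvable T (A B : R) : linear T -> 0 <= A -> 0 <= B ->
  (forall f, N (T f) <= A * N f) ->
  (forall f, exists g, [/\ T g = f, N g <= B * N f & forall g', T g' = f -> g' = g]) ->
  invertible_operator T.
Proof.
move=> lT A0 B0 TA TB; split; first exact: bounded_operator_of_le TA.
have /choice[S hS] := TB; exists S.
have TK : cancel T S by move=> x; have [_ _ h] := hS (T x); exact/esym/h.
have SK : cancel S T by move=> x; have [] := hS x.
split => //; apply: (@bounded_operator_of_le S B) => // [a f g|f]; last by have [] := hS f.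
by have [_ _ u] := hS (a *: f + g); apply/esym/u; rewrite lT !SK.
Qed.

Lemma invertible_fredholm T : invertible_operator T -> fredholm T.
Proof.
move=> [bT [S [_ TK SK]]].
have rT : range T = setT by apply/seteqP; split => // x _; exists (S x).
split => //.
- exists [::] => x /= Tx; exists (fun=> 0); rewrite big_ord0.
  by apply: (can_inj TK); rewrite Tx; have [lT _] := bT; have := lT 0 x x; rewrite !scale0r !add0r => _; have := lT (-1) x x; rewrite !scaleN1r !addNr.
- by rewrite rT; exact: closedT.
- exists [::] => x; exists x; first by rewrite rT.
  by exists (fun=> 0); rewrite big_ord0 subrr.
Qed.

Lemma fredholm_corank T : fredholm T -> exists m, finite_corank T m.
Proof.
move=> [_ _ _ [s hs]]; exists (size s), (fun i : 'I_(size s) => s`_i) => y.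
have [_ [x _ <-] [c hc]] := hs y; exists x, (fun i : 'I_(size s) => c i).
by rewrite -hc addrC subrK.
Qed.

End operators.

(** * The inverse of a weighted rotation *)

Section weighted_rotation_inverse.
Context {R : realType} (V : lmodType R[i]) (N : V -> R) (ev : V -> R[i] -> R[i]).
Context (H : rotation_space N ev).
Implicit Types (w : R[i] -> R[i]) (mu z l : R[i]) (C : V -> V) (f g : V).

Lemma weighted_rotation_exists w mu (M : R) : cnorm mu = 1 -> holo_unit w ->
  (forall z, cnorm z < 1 -> cnorm (w z) <= M) ->
  forall f, exists g, forall z, cnorm z < 1 -> ev g z = w z * ev f (mu * z).
Proof.
move=> m1 hw wM f; have [c _ rot] := rs_rot H; have [d _ dom] := rs_dom H.
have [g gE _] := rot mu m1 f.
have M0 : 0 <= M by apply: le_trans (wM 0 _); rewrite ?cnorm_ge0// cnorm0.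
have hwg : holo_unit (fun z => w z * ev g z).
  by move=> z z1; apply: holoM (hw z z1) _; exact: (rs_holo H).
have [|h hE _] := dom _ g M 0 hwg M0 (lexx _).
  by move=> z z1; rewrite addr0 cnormM ler_wpM2r ?cnorm_ge0 ?wM.
by exists h => z z1; rewrite hE// gE.
Qed.

(* [C^-1] is the weighted rotation with this weight and the multiplier [mu^-1]. *)
Definition inverse_weight w mu z := (w (mu^-1 * z))^-1.

Context (w : R[i] -> R[i]) (mu : R[i]) (C C' : V -> V).
Context (mu1 : cnorm mu = 1) (irr : forall n, (0 < n)%N -> mu ^+ n != 1).
Context (hw : holo_unit w) (w0 : forall z, cnorm z < 1 -> w z != 0).
Context (wB : exists M, forall z, cnorm z < 1 -> cnorm (w z) <= M).
Context (wB' : exists M, forall z, cnorm z < 1 -> cnorm (w z)^-1 <= M).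
Context (CE : forall f z, cnorm z < 1 -> ev (C f) z = w z * ev f (mu * z)).
Context (CE' : forall f z, cnorm z < 1 ->
  ev (C' f) z = inverse_weight w mu z * ev f (mu^-1 * z)).

Let mu0 : mu != 0. Proof. by rewrite -cnorm_gt0 mu1. Qed.

Let muV1 : cnorm mu^-1 = 1. Proof. by rewrite cnormV mu1 invr1. Qed.

Let rot1 z : cnorm z < 1 -> cnorm (mu * z) < 1.
Proof. by rewrite cnormM mu1 mul1r. Qed.

Let rotV1 z : cnorm z < 1 -> cnorm (mu^-1 * z) < 1.
Proof. by rewrite cnormM muV1 mul1r. Qed.

Lemma holo_inverse_weight : holo_unit (inverse_weight w mu).
Proof.
move=> z z1; apply: holoV; last exact/w0/rotV1.
apply: (holo_comp (f := w)); last exact/hw/rotV1.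
by apply: holoM (holo_cst _ _) (holo_id _).
Qed.

Lemma inverse_weight_neq0 z : cnorm z < 1 -> inverse_weight w mu z != 0.
Proof. by move=> z1; rewrite invr_eq0 w0// rotV1. Qed.

Lemma inverse_weight_bounded :
  exists M, forall z, cnorm z < 1 -> cnorm (inverse_weight w mu z) <= M.
Proof.
have [M hM] := wB'; exists M => z z1.
by rewrite hM// rotV1.
Qed.

(** The backward orbit of [mu^-1 * z] is the forward orbit of [mu^-1 ^+ n * z] read in reverse. *)
Lemma wprod_inverse n z : cnorm z < 1 ->
  wprod (inverse_weight w mu) mu^-1 n z = wprod (fun y => (w y)^-1) mu n (mu^-1 ^+ n * z).
Proof.
move=> z1; rewrite /wprod (reindex_inj rev_ord_inj) /=; apply: eq_bigr => j _.
rewrite /inverse_weight; congr (w _)^-1; rewrite !mulrA; congr (_ * z).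
have jn := ltn_ord j.
rewrite -exprS subnSK//; move: (nat_of_ord j) jn => k kn.
rewrite -[in RHS](subnK (ltnW kn)) exprD mulrCA [X in _ * X](_ : _ = 1) ?mulr1//.
by rewrite exprVn mulfV// expf_neq0.
Qed.

Lemma inverse_operatorK f : C' (C f) = f.
Proof.
apply: (rs_inj H) => z z1; rewrite CE'// CE ?rotV1// mulVKf//.
by rewrite /inverse_weight mulKf// w0// rotV1.
Qed.

Lemma operator_inverseK f : C (C' f) = f.
Proof.
apply: (rs_inj H) => z z1; rewrite CE// CE' ?rot1// /inverse_weight.
by rewrite mulKf// mulVKf// w0.
Qed.


Lemma wprod_inverse_le n (B : R) :
  (forall z, cnorm z < 1 -> cnorm (wprod (inverse_weight w mu) mu^-1 n z) <= B) <->
  (forall z, cnorm z < 1 -> cnorm (wprod (fun y => (w y)^-1) mu n z) <= B).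
Proof.
have mun (nu z : R[i]) : cnorm nu = 1 -> cnorm z < 1 -> cnorm (nu ^+ n * z) < 1.
  by move=> n1 z1; rewrite cnormM cnormX n1 expr1n mul1r.
split=> hB z z1; last by rewrite wprod_inverse//; apply: hB; exact: mun.
have := hB (mu ^+ n * z) (mun _ _ mu1 z1); rewrite wprod_inverse ?mun//.
by rewrite mulrA -exprMn mulVf// expr1n mul1r.
Qed.

Let CL' : linear C'.
Proof.
move=> a f g; apply: (rs_inj H) => z z1.
by rewrite (rs_lin H) !CE'// (rs_lin H) mulrDr mulrCA.
Qed.

Let CB' f l x : C' (f - l *: x) = C' f - l *: C' x.
Proof. by rewrite addrC -scaleNr CL' scaleNr addrC. Qed.

(* Both transfers rest on [C' (C - l) = - l (C' - l^-1)]. *)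
Let inverse_shifted l x : l != 0 -> C' (shifted C l x) = - l *: shifted C' l^-1 x.
Proof.
move=> l0; rewrite /shifted CB' inverse_operatorK// scalerBr scalerA mulNr mulfV//.
by rewrite scaleN1r opprK scaleNr addrC.
Qed.

Lemma corank_inverse l m : l != 0 -> finite_corank (shifted C l) m ->
  finite_corank (shifted C' l^-1) m.
Proof.
move=> l0 [s hs]; exists (fun i => C' (s i)) => y.
have [x [c hc]] := hs (C y); exists (- l *: x), c.
have CD f g : C' (f + g) = C' f + C' g by rewrite -[f]scale1r CL' !scale1r.
have C0 : C' 0 = 0 by have := CL' (-1) 0 0; rewrite addr0 scaleN1r oppr0 => {1}->; rewrite scaleN1r addNr.
have Csum (r : seq 'I_m) : C' (\sum_(i <- r) c i *: s i) = \sum_(i <- r) c i *: C' (s i).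
  elim: r => [|i r IH]; first by rewrite !big_nil.
  by rewrite !big_cons CL' IH.
rewrite -[LHS]inverse_operatorK hc CD Csum inverse_shifted//; congr (_ + _).
rewrite /shifted scalerBr; congr (_ - _); last by rewrite !scalerA mulrC.
by have := CL' (- l) x 0; rewrite !addr0 C0 addr0 => ->.
Qed.

Lemma corank_growth_cases l m : finite_corank (shifted C l) m -> l != 0 ->
  exists K r, 0 <= r /\
    (r < cnorm l /\ (forall n z, cnorm z < 1 -> cnorm (wprod w mu n z) <= K * r ^+ n) \/
     r < (cnorm l)^-1 /\ (forall n z, cnorm z < 1 ->
       cnorm (wprod (fun y => (w y)^-1) mu n z) <= K * r ^+ n)).
Proof.
move=> hm l0; have [wl|lw] := leP (cnorm (w 0)) (cnorm l).
  have [K [r [r0 rl hK]]] := corank_growth H mu1 irr hw w0 wB CE wl hm.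
  by exists K, r; split => //; left.
have irr' n : (0 < n)%N -> mu^-1 ^+ n != 1.
  by move=> /irr; rewrite exprVn invr_eq1.
have wl' : cnorm (inverse_weight w mu 0) <= cnorm l^-1.
  rewrite /inverse_weight mulr0 !cnormV lef_pV2 ?posrE ?cnorm_gt0//; first exact: ltW.
  by rewrite w0// cnorm0.
have [K [r [r0 rl hK]]] := corank_growth H muV1 irr' holo_inverse_weight
  inverse_weight_neq0 inverse_weight_bounded CE' wl' (corank_inverse l0 hm).
exists K, r; split => //; right; rewrite -cnormV; split => // n.
by apply/wprod_inverse_le => z z1; exact: hK.
Qed.

Definition solvable (T : V -> V) := exists2 B : R, 0 <= B &
  forall f, exists g, [/\ T g = f, N g <= B * N f & forall g', T g' = f -> g' = g].

Lemma solvable0 : solvable (shifted C 0).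
Proof.
have [B B0 hB] := C_bounded H muV1 inverse_weight_bounded CE'.
exists B => // f; exists (C' f); rewrite /shifted scale0r subr0.
split => //; first exact: operator_inverseK.
by move=> g' <-; rewrite scale0r subr0 inverse_operatorK.
Qed.

Lemma solvable_of_growth l K r : 0 <= r -> r < cnorm l ->
  (forall n z, cnorm z < 1 -> cnorm (wprod w mu n z) <= K * r ^+ n) ->
  solvable (shifted C l).
Proof. by move=> r0 rl hK; exact: (shifted_solvable H mu1 hw CE r0 rl hK). Qed.

Lemma solvable_of_inverse_growth l K r : l != 0 -> 0 <= r -> r < (cnorm l)^-1 ->
  (forall n z, cnorm z < 1 -> cnorm (wprod (fun y => (w y)^-1) mu n z) <= K * r ^+ n) ->
  solvable (shifted C l).
Proof.
move=> l0 r0 rl hK; have [A A0 hA] := C_bounded H muV1 inverse_weight_bounded CE'.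
rewrite -cnormV in rl.
have [|B B0 hB] := shifted_solvable H muV1 holo_inverse_weight CE' r0 rl (K := K).
  by move=> n; apply/wprod_inverse_le => z z1; exact: hK.
exists (B * (cnorm l^-1 * A)); first by rewrite mulr_ge0// mulr_ge0// cnorm_ge0.
move=> f; have [g [gE gN gu]] := hB (- l^-1 *: C' f); exists g; split.
- rewrite -[LHS]operator_inverseK inverse_shifted// gE scalerA mulrNN mulfV// scale1r.
  exact: operator_inverseK.
- apply: (le_trans gN); rewrite -mulrA ler_wpM2l// (is_normZ (rs_norm H)) cnormN -mulrA.
  by rewrite ler_wpM2l ?cnorm_ge0.
- move=> g' g'E; apply: gu; have := inverse_shifted g' l0; rewrite g'E => ->.
  by rewrite scalerA mulrNN mulVf// scale1r.
Qed.

End weighted_rotation_inverse.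

(** * Elliptic automorphisms as rotations, and the rates [rho] *)

Section elliptic.
Context {R : realType}.
Implicit Types (psi phi f : R[i] -> R[i]) (a mu z : R[i]) (M B : R).

Lemma elliptic_rotation phi : elliptic_automorphism phi ->
  exists a mu, [/\ cnorm a < 1, cnorm mu = 1 &
    forall z, cnorm z < 1 -> phi (mobius a z) = mobius a (mu * z)].
Proof.
move=> [[/holomorphic_diskP hphi phi1 [phi' [/holomorphic_diskP hphi' phi'1 phiK _]]] [a [[a1 fixa] _]]].
rewrite disk_cnorm in a1.
have {}phi1 z : cnorm z < 1 -> cnorm (phi z) < 1 by rewrite -!disk_cnorm; exact: phi1.
have {}phi'1 z : cnorm z < 1 -> cnorm (phi' z) < 1 by rewrite -!disk_cnorm; exact: phi'1.
have {}phiK z : cnorm z < 1 -> phi' (phi z) = z by rewrite -disk_cnorm; exact: phiK.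
have t1 z := @mobius_lt1 _ a z a1; have tK z := @mobiusK _ a z a1.
have ht : holo_unit (mobius a) by move=> z z1; apply: holo_mobius => //; exact: ltW.
have conj h : holo_unit h -> (forall z, cnorm z < 1 -> cnorm (h z) < 1) ->
    holo_unit (fun z => mobius a (h (mobius a z))).
  move=> hh h1 z z1; apply: holo_comp; last exact/ht/h1/t1.
  by apply: holo_comp (ht z z1) _; exact/hh/t1.
have [||||||mu mu1 E] := @disk_rotation R (fun z => mobius a (phi (mobius a z)))
    (fun z => mobius a (phi' (mobius a z))).
- exact: conj.
- by rewrite mobius0 fixa /mobius subrr mul0r.
- by move=> z z1; exact/t1/phi1/t1.
- exact: conj.
- by move=> z z1; exact/t1/phi'1/t1.
- by move=> z z1; rewrite tK; [rewrite phiK ?tK ?t1|exact/phi1/t1].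
by exists a, mu; split => // z z1; rewrite -E// tK// phi1// t1.
Qed.

Context (phi : R[i] -> R[i]) (a mu : R[i]).
Context (a1 : cnorm a < 1) (mu1 : cnorm mu = 1).
Context (conj : forall z, cnorm z < 1 -> phi (mobius a z) = mobius a (mu * z)).

Lemma iter_conjugate n z : cnorm z < 1 -> iter n phi (mobius a z) = mobius a (mu ^+ n * z).
Proof.
move=> z1; elim: n => [|n IH]; first by rewrite expr0 mul1r.
by rewrite iterS IH conj ?mulrA ?exprS// cnormM cnormX mu1 expr1n mul1r.
Qed.

Lemma rotation_infinite_order : infinite_order phi ->
  forall n, (0 < n)%N -> mu ^+ n != 1.
Proof.
move=> io n n0; apply/eqP => mun; apply: (io n n0) => z; rewrite disk_cnorm => z1.
by rewrite -{1}(mobiusK a1 z1) iter_conjugate ?mobius_lt1// mun mul1r mobiusK.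
Qed.

Lemma iter_weight_conjugate psi n z : cnorm z < 1 ->
  iter_weight psi phi n (mobius a z) = wprod (fun y => psi (mobius a y)) mu n z.
Proof. by move=> z1; apply: eq_bigr => j _; rewrite iter_conjugate. Qed.

Lemma supnorm_le f B : (forall z, cnorm z < 1 -> cnorm (f z) <= B) -> supnorm f <= B.
Proof.
move=> fB; apply: ge_sup; first by exists (normc (f 0)), 0 => //; rewrite disk_cnorm cnorm0.
by move=> _ [z zd <-]; rewrite -cnormE fB// -disk_cnorm.
Qed.

Lemma le_supnorm f M z : (forall z, cnorm z < 1 -> cnorm (f z) <= M) -> cnorm z < 1 ->
  cnorm (f z) <= supnorm f.
Proof.
move=> fM z1; rewrite [in leLHS]cnormE; apply: ub_le_sup.
  by exists M => _ [y yd <-]; rewrite -cnormE fM// -disk_cnorm.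
by exists z => //; rewrite disk_cnorm.
Qed.

Section sup_growth.
Context (psi : R[i] -> R[i]) (M : R).
Context (psiM : forall z, cnorm z < 1 -> cnorm (psi z) <= M).
Local Notation w := (fun y => psi (mobius a y)).
Local Notation W n := (supnorm (iter_weight psi phi n)).

Let rot1 n z : cnorm z < 1 -> cnorm (mu ^+ n * z) < 1.
Proof. by rewrite cnormM cnormX mu1 expr1n mul1r. Qed.

Let wprod_bounded n z : cnorm z < 1 -> cnorm (wprod w mu n z) <= M ^+ n.
Proof.
move=> z1; rewrite /wprod cnorm_prod -[n in leRHS]card_ord -prodr_const.
apply: ler_prod => j _; rewrite cnorm_ge0/= psiM// mobius_lt1//.
exact: rot1.
Qed.

Lemma wprod_le_supnorm n z : cnorm z < 1 -> cnorm (wprod w mu n z) <= W n.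
Proof.
move=> z1; rewrite -iter_weight_conjugate//; apply: (le_supnorm (M := M ^+ n)); last exact: mobius_lt1.
by move=> y y1; rewrite -(mobiusK a1 y1) iter_weight_conjugate ?mobius_lt1// wprod_bounded// mobius_lt1.
Qed.

Lemma supnorm_wprod_le n B : (forall z, cnorm z < 1 -> cnorm (wprod w mu n z) <= B) -> W n <= B.
Proof.
move=> h; apply: supnorm_le => y y1.
by rewrite -(mobiusK a1 y1) iter_weight_conjugate ?mobius_lt1// h// mobius_lt1.
Qed.

Let W_ge0 n : 0 <= W n.
Proof. by apply: le_trans (@wprod_le_supnorm n 0 _); rewrite ?cnorm_ge0// cnorm0. Qed.

Let W_sub m n : W (m + n)%N <= W m * W n.
Proof.
apply: supnorm_wprod_le => z z1; rewrite /wprod big_split_ord /= cnormM.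
apply: ler_pM; rewrite ?cnorm_ge0//; first exact: wprod_le_supnorm.
have -> : \prod_(i < n) psi (mobius a (mu ^+ (m + i) * z)) = wprod w mu n (mu ^+ m * z).
  by apply: eq_bigr => i _; rewrite mulrA -exprD addnC.
exact/wprod_le_supnorm/rot1.
Qed.

Lemma growth_of_rho (x : R) : rho psi phi < x -> exists K r, [/\ 0 <= r, r < x &
  forall n z, cnorm z < 1 -> cnorm (wprod w mu n z) <= K * r ^+ n].
Proof.
move=> /(growth_of_rate W_ge0 W_sub)[K [r [r0 rx h]]]; exists K, r; split => // n z z1.
exact: le_trans (wprod_le_supnorm n z1) (h n).
Qed.

Lemma rho_le (K r : R) : 0 <= r ->
  (forall n z, cnorm z < 1 -> cnorm (wprod w mu n z) <= K * r ^+ n) -> rho psi phi <= r.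
Proof.
by move=> r0 h; apply: (rate_le W_ge0 W_sub r0 (K := K)) => n; apply: supnorm_wprod_le => z; exact: h.
Qed.

(** At the fixed point [a] the iterated weights are powers of [psi a]. For the reciprocal weight
    this shows that the rate is positive, so that its inverse is a true reciprocal and not the
    default 0. *)
Lemma rho_ge : cnorm (psi a) <= rho psi phi.
Proof.
apply: (rate_ge W_ge0 W_sub); first exact: cnorm_ge0.
move=> n; have z1 : cnorm (0 : R[i]) < 1 by rewrite cnorm0.
apply: le_trans (wprod_le_supnorm n z1); rewrite /wprod.
under eq_bigr do rewrite mulr0 mobius0.
by rewrite prodr_const card_ord cnormX.
Qed.

End sup_growth.

End elliptic.

Theorem corollary5p4 (R : realType) (alpha p : R)
    (alpha_gtN1 : -1 < alpha) (p_ge1 : 1 <= p) (psi phi : R[i] -> R[i]) :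
  Hinfty_unit psi ->
  elliptic_automorphism phi ->
  infinite_order phi ->
  let C := weighted_composition alpha_gtN1 p_ge1 psi phi in
  spectrum C = essential_spectrum C /\
  essential_spectrum C =
    [set lambda : R[i] |
      (rho (fun z => (psi z)^-1) phi)^-1 <= normc lambda <= rho psi phi].
Proof.
move=> [[/holomorphic_diskP hpsi [M0 psiM0]] psi0 [/holomorphic_diskP hpsiV [M1 psiM1]]] ell io C.
have psiM z : cnorm z < 1 -> cnorm (psi z) <= M0.
  by move=> z1; rewrite [in leLHS]cnormE psiM0// disk_cnorm.
have psiVM z : cnorm z < 1 -> cnorm (psi z)^-1 <= M1.
  by move=> z1; rewrite [in leLHS]cnormE psiM1// disk_cnorm.
have {}psi0 z : cnorm z < 1 -> psi z != 0 by rewrite -disk_cnorm; exact: psi0.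
have [a [mu [a1 mu1 conj]]] := elliptic_rotation ell.
have irr := rotation_infinite_order a1 mu1 conj io.
have H := bergman_rotation_space alpha_gtN1 p_ge1 a1.
pose w y := psi (mobius a y).
have t1 y : cnorm y < 1 -> cnorm (mobius a y) < 1 by exact: mobius_lt1.
have hw : holo_unit w.
  by move=> y y1; apply: holo_comp; [apply: holo_mobius => //; exact: ltW|exact/hpsi/t1].
have w0 y : cnorm y < 1 -> w y != 0 by move=> y1; exact/psi0/t1.
have wB : exists M, forall y, cnorm y < 1 -> cnorm (w y) <= M.
  by exists M0 => y y1; exact/psiM/t1.
have wB' : exists M, forall y, cnorm y < 1 -> cnorm (w y)^-1 <= M.
  by exists M1 => y y1; exact/psiVM/t1.
have CE f y : cnorm y < 1 -> C f (mobius a y) = w y * f (mobius a (mu * y)).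
  (* The default 0 of [insubd] never occurs: the patched function is the one underlying [g], an
     element of the space. *)
  have [M hM] := wB; have [g gE] := weighted_rotation_exists H mu1 hw hM f.
  suff -> : C f = g by move=> y1; rewrite gE.
  rewrite /C /weighted_composition -[RHS](valKd 0); congr insubd; apply/funext => z.
  rewrite patchE; case: ifPn => [/set_mem|/negP zd].
    rewrite disk_cnorm => z1; rewrite -[in RHS](mobiusK a1 z1) [RHS]gE ?t1//.
    by rewrite /w -conj ?t1// mobiusK.
  have [_ g0 _] := bergmanP g; apply/esym/g0 => dz.
  by apply: zd; rewrite mem_set.
have hw' := holo_inverse_weight mu1 hw w0.
have [M' hM'] := inverse_weight_bounded mu1 wB'.
have mV1 : cnorm mu^-1 = 1 by rewrite cnormV mu1 invr1.
have /choice[C' CE'] := weighted_rotation_exists H mV1 hw' hM'.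
have lin l : linear (fun x => C x - l *: x) := shiftedL H mu1 CE l.
have solv l : solvable (@bergman_norm R alpha p alpha_gtN1 p_ge1) (shifted C l) ->
    invertible_operator (fun x => C x - l *: x).
  move=> [B B0 hB]; have [A A0 hA] := shifted_bounded H mu1 wB CE l.
  exact: (invertible_of_solvable (@normr_bergman R alpha p alpha_gtN1 p_ge1) (lin l) A0 B0 hA hB).
have inv_le (x y : R) : 0 < x -> 0 < y -> y^-1 <= x -> x^-1 <= y.
  by move=> x0 y0; rewrite invf_ple ?posrE.
have rhoV0 : 0 < rho (fun z => (psi z)^-1) phi.
  apply: lt_le_trans (rho_ge a1 mu1 conj psiVM).
  by rewrite cnormV invr_gt0 cnorm_gt0 psi0.
have rhoVV0 : 0 < (rho (fun z => (psi z)^-1) phi)^-1 by rewrite invr_gt0.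
have outside l : ~ ((rho (fun z => (psi z)^-1) phi)^-1 <= normc l <= rho psi phi) ->
    invertible_operator (fun x => C x - l *: x).
  (* The parameter 0 is treated apart, because the passage to the inverse operator divides by
     [l]. *)
  move=> hl; apply: solv; have [->|l0] := eqVneq l 0.
    exact: (solvable0 H mu1 w0 wB' CE CE').
  have [lt|le] := ltP (rho psi phi) (cnorm l).
    have [K [r [r0 rl hK]]] := growth_of_rho a1 mu1 conj psiM lt.
    exact: (solvable_of_growth H mu1 hw CE r0 rl hK).
  have lt : rho (fun z => (psi z)^-1) phi < (cnorm l)^-1.
    rewrite ltNge; apply/negP => le'; apply: hl; rewrite -cnormE le andbT.
    by apply: inv_le; rewrite ?cnorm_gt0.
  have [K [r [r0 rl hK]]] := growth_of_rho a1 mu1 conj psiVM lt.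
  exact: (solvable_of_inverse_growth H mu1 hw w0 wB' CE CE' l0 r0 rl hK).
have inside l : (rho (fun z => (psi z)^-1) phi)^-1 <= normc l <= rho psi phi ->
    ~ fredholm (fun x => C x - l *: x).
  rewrite -cnormE => /andP[h1 h2] /fredholm_corank[m hm].
  have l0 : l != 0 by rewrite -cnorm_gt0; exact: lt_le_trans rhoVV0 h1.
  (* The rate [r] is strictly below [cnorm l], or below its inverse for the reciprocal weight; by
     this strictness the contradiction also covers the two boundary circles of the annulus. *)
  have [K [r [r0 [[rl hK]|[rl hK]]]]] :=
    corank_growth_cases H mu1 irr hw w0 wB wB' CE CE' hm l0.
    have := le_lt_trans (le_trans h2 (rho_le a1 mu1 conj psiM r0 hK)) rl.
    by rewrite ltxx.
  have := rho_le a1 mu1 conj psiVM r0 hK => le.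
  have := le_lt_trans le rl; rewrite ltNge => /negP; apply.
  by apply: inv_le; rewrite ?cnorm_gt0.
have E1 : essential_spectrum C = [set l | (rho (fun z => (psi z)^-1) phi)^-1 <= normc l <= rho psi phi].
  apply/seteqP; split => l /=; last exact: inside.
  move=> nF; apply: contrapT => /outside/invertible_fredholm; exact: nF.
split => //; rewrite E1; apply/seteqP; split => l /=.
  by move=> nI; apply: contrapT => /outside.
by move=> /inside nF /invertible_fredholm.
Qed.
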